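(* Let $(M,g)$ be a semi-Riemannian manifold of dimension $n$ and index $\nu$, with $g\in L^\infty_{\rm loc}$ and with the Levi-Civita connection $\nabla$ of $g$ in $L^p_{\rm loc}$ for some $p>2$. Assume that a family of second fundamental forms and normal affine connections $\{(\mathrm{II}_\varepsilon,\nabla^\perp_\varepsilon)\}$ is uniformly bounded in $L^p_{\rm loc}$, and that each $(\mathrm{II}_\varepsilon,\nabla_\varepsilon^{\perp})$ satisfies, in the sense of distributions, the Gauss–Codazzi–Ricci (GCR) system $$\langle \mathrm{II}(X,Z_1),\mathrm{II}(Y,Z_2)\rangle-\langle \mathrm{II}(X,Z_2),\mathrm{II}(Y,Z_1)\rangle=R(X,Y,Z_1,Z_2),$$ $$(\nabla^\perp_X\mathrm{II})(Y,Z)=(\nabla^\perp_Y\mathrm{II})(X,Z),$$ $$\langle[S_\xi,S_\eta]X,Y\rangle=-R^\perp(X,Y,\xi,\eta)$$ for all tangential vector fields $X,Y,Z,Z_1,Z_2$ and all normal fields $\xi,\eta$ (with $\mathrm{II}=\mathrm{II}_\varepsilon$, $\nabla^\perp=\nabla^\perp_\varepsilon$ and the corresponding $S$, $R^\perp$). Then, after passing to a subsequence if necessary, $\{(\mathrm{II}_\varepsilon,\nabla^\perp_\varepsilon)\}$ converges weakly in $L^p_{\rm loc}$ to a pair $(\mathrm{II},\nabla^\perp)$ that also satisfies the GCR system in the sense of distributions.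
   Context: A semi-Riemannian metric is a symmetric non-degenerate $2$-tensor on $TM$ of constant index (for $L^\infty_{\rm loc}$ metrics non-degeneracy is understood a.e., with $g,g^{-1}\in L^\infty_{\rm loc}$). A connection is $L^p_{\rm loc}$ if its Christoffel symbols are. All $(\mathrm{II}_\varepsilon,\nabla^\perp_\varepsilon)$ are regarded as data on one fixed vector bundle $E\to M$ (playing the role of the normal bundle) with fibre $\mathbb R^k_\tau$, i.e. $\mathbb R^k$ with a metric of index $\tau$: $\mathrm{II}_\varepsilon$ is a symmetric $E$-valued $2$-tensor on $TM$, and $\nabla^\perp_\varepsilon$ is an affine connection on $E$ compatible with the bundle metric. $\langle\cdot,\cdot\rangle$ denotes the metric on $TM$ or $E$. The shape operator is defined by $\langle S_\xi X,Y\rangle=\langle \mathrm{II}(X,Y),\xi\rangle$. For a connection $\nabla^V$ on a bundle $V$, the curvature is $R^V(X,Y)=\nabla^V_Y\nabla^V_X-\nabla^V_X\nabla^V_Y+\nabla^V_{[X,Y]}$ and $R^V(X,Y,\alpha,\beta)=\langle R^V(X,Y)\alpha,\beta\rangle$; $R$ is the curvature of $\nabla$ on $TM$ and $R^\perp$ that of $\nabla^\perp$. Finally $(\nabla^\perp_X\mathrm{II})(Y,Z)=\nabla^\perp_X(\mathrm{II}(Y,Z))-\mathrm{II}(\nabla_XY,Z)-\mathrm{II}(Y,\nabla_XZ)$. *)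

(* Defs.v *)
From HB Require Import structures.
From mathcomp Require Import all_boot all_order all_algebra.
From mathcomp Require Import all_classical all_reals all_analysis.
Import Order.TTheory GRing.Theory Num.Theory.
Import numFieldNormedType.Exports.
Set Implicit Arguments.
Unset Strict Implicit.
Unset Printing Implicit Defensive.
Local Open Scope classical_set_scope.
Local Open Scope ring_scope.

Definition measure_rV_display : measure_display. Proof. exact: default_measure_display. Qed.

(* the sigma-algebra generated by the coordinates, that is, by the open sets *)
Section measurable_rV.
Context (R : realType) (n : nat).

Let coor (i : 'I_n) (x : 'rV[R]_n) : measurableTypeR R := x 0 i.

Let rV_set0 : g_sigma_preimage coor set0.
Proof. exact: sigma_algebra0. Qed.

Let rV_setC A : g_sigma_preimage coor A -> g_sigma_preimage coor (~` A).
Proof. exact: sigma_algebraC. Qed.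

Let rV_bigcup (F : (set _)^nat) : (forall i, g_sigma_preimage coor (F i)) ->
  g_sigma_preimage coor (\bigcup_i (F i)).
Proof. exact: sigma_algebra_bigcup. Qed.

HB.instance Definition _ := @isMeasurable.Build measure_rV_display
  'rV[R]_n (g_sigma_preimage coor) rV_set0 rV_setC rV_bigcup.

Lemma measurable_coord (i : 'I_n) :
  measurable_fun [set: 'rV[R]_n] (fun x => x 0 i : measurableTypeR R).
Proof.
move=> _ Y mY; rewrite setTI; apply: sub_sigma_algebra => /=.
rewrite -bigcup_seq/=; exists i => /=; first by rewrite mem_index_enum.
by exists Y => //; rewrite setTI.
Qed.

Lemma measurable_fun_rV d (T : measurableType d) (f : T -> 'rV[R]_n) :
  (forall i, measurable_fun [set: T] (fun t => f t 0 i : measurableTypeR R)) ->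
  measurable_fun [set: T] f.
Proof.
move=> mf.
have gs : g_sigma_preimage (fun i => coor i \o f) `<=` measurable.
  apply: smallest_sub; first exact: sigma_algebra_measurable.
  rewrite -bigcup_seq; apply: bigcup_sub => i _ A [B mB <-].
  exact: mf.
move=> _ A mA; rewrite setTI; apply: gs; rewrite g_sigma_preimage_comp.
by exists A => //; rewrite setTI.
Qed.

End measurable_rV.

Section lebesgue_rV.
Context (R : realType).

Definition rV_cons n (p : measurableTypeR R * 'rV[R]_n) : 'rV[R]_n.+1 :=
  row_mx p.1%:M p.2 : 'rV[R]_(1 + n).
Definition rV_uncons n (x : 'rV[R]_n.+1) : measurableTypeR R * 'rV[R]_n :=
  (x 0 0, rsubmx (x : 'rV[R]_(1 + n))).

Lemma rV_cons0 n p : @rV_cons n p 0 0 = p.1.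
Proof.
rewrite /rV_cons mxE; case: splitP => // j _; by rewrite !ord1 mxE eqxx.
Qed.

Lemma rV_consS n p (i : 'I_n) : @rV_cons n p 0 (lift 0 i) = p.2 0 i.
Proof.
rewrite /rV_cons mxE; case: splitP => [[[]]//|j].
by rewrite /= /bump/= !add1n => -[/val_inj ->].
Qed.

Lemma rV_consK n : cancel (@rV_cons n) (@rV_uncons n).
Proof.
move=> [a v]; rewrite /rV_uncons rV_cons0/= /rV_cons.
by rewrite row_mxKr.
Qed.

Lemma measurable_rV_cons n : measurable_fun setT (@rV_cons n).
Proof.
apply: measurable_fun_rV => i.
have [->|[j ->]] : i = 0 \/ exists j, i = lift 0 j.
  by case: (unliftP 0 i) => [j|] ->; [right; exists j|left].
  under eq_fun do rewrite rV_cons0; exact: measurable_fst.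
under eq_fun do rewrite rV_consS.
exact: (measurableT_comp (@measurable_coord R n j) measurable_snd).
Qed.

Lemma measurable_rV_uncons n : measurable_fun setT (@rV_uncons n).
Proof.
apply/measurable_fun_pairP; split; first exact: measurable_coord.
apply: measurable_fun_rV => i; under eq_fun do rewrite /= mxE.
exact: measurable_coord.
Qed.

Section step.
Local Open Scope ereal_scope.
Context (n : nat) (mu : {sigma_finite_measure set 'rV[R]_n -> \bar R}).

Definition lebesgue_rV_step := pushforward (lebesgue_measure \x mu) (@rV_cons n).
Local Notation nu := lebesgue_rV_step.

Let mcons (A : set 'rV[R]_n.+1) :
  measurable A -> measurable (@rV_cons n @^-1` A).
Proof. by move=> mA; rewrite -[X in measurable X]setTI; exact: measurable_rV_cons. Qed.

Let nu0 : nu set0 = 0.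
Proof. by rewrite /nu /pushforward preimage_set0 measure0. Qed.

Let nu_ge0 A : 0 <= nu A.
Proof. by rewrite /nu /pushforward; exact: (measure_ge0 (lebesgue_measure \x mu)). Qed.

Let nu_sigma_additive : semi_sigma_additive nu.
Proof.
move=> F mF tF mUF; rewrite /nu /pushforward preimage_bigcup.
apply: measure_semi_sigma_additive.
- by move=> i; exact: mcons.
- apply/trivIsetP => /= i j _ _ ij; rewrite -preimage_setI.
  by move/trivIsetP : tF => /(_ _ _ _ _ ij) ->//; rewrite preimage_set0.
- by rewrite -preimage_bigcup; exact: mcons.
Qed.

HB.instance Definition _ := isMeasure.Build _ _ _ nu nu0 nu_ge0 nu_sigma_additive.

Let nu_sigma_finite : sigma_finite setT nu.
Proof.
have /sigma_finiteP[F [TF ndF Foo]] := sigma_finiteT (@lebesgue_measure R).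
have /sigma_finiteP[G [TG ndG Goo]] := sigma_finiteT mu.
exists (fun i => @rV_uncons n @^-1` (F i `*` G i)).
  apply/seteqP; split => // x _.
  have [i _ Fi] : (\bigcup_k F k) (rV_uncons x).1 by rewrite -TF.
  have [j _ Gj] : (\bigcup_k G k) (rV_uncons x).2 by rewrite -TG.
  exists (maxn i j) => //; split.
  - by move: Fi; exact/subsetPset/ndF/leq_maxl.
  - by move: Gj; exact/subsetPset/ndG/leq_maxr.
move=> i; have [mF Fi] := Foo i; have [mG Gi] := Goo i; split.
  by rewrite -[X in measurable X]setTI; apply: measurable_rV_uncons => //;
    exact: measurableX.
rewrite /nu /pushforward -comp_preimage.
rewrite (_ : _ \o _ = id) ?preimage_id.
  by rewrite product_measure1E// lte_mul_pinfty// ge0_fin_numE.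
by apply/funext => p; exact: rV_consK.
Qed.

HB.instance Definition _ := Measure_isSigmaFinite.Build _ _ _ nu nu_sigma_finite.

End step.

Definition lebesgue_rV_succ n (mu : {sigma_finite_measure set 'rV[R]_n -> \bar R}) :
  {sigma_finite_measure set 'rV[R]_n.+1 -> \bar R} := lebesgue_rV_step mu.

Fixpoint lebesgue_rV n : {sigma_finite_measure set 'rV[R]_n -> \bar R} :=
  match n return {sigma_finite_measure set 'rV[R]_n -> \bar R} with
  | 0 => \d_(0 : 'rV[R]_0)
  | m.+1 => lebesgue_rV_succ (lebesgue_rV m)
  end.

Lemma lebesgue_rV_prod n (A : 'I_n -> set (measurableTypeR R)) :
  (forall i, measurable (A i)) ->
  lebesgue_rV n [set x : 'rV[R]_n | forall i, A i (x 0 i)] =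
  (\prod_(i < n) lebesgue_measure (A i))%E.
Proof.
elim: n A => [|n IH] A mA.
  by rewrite big_ord0 /= diracE mem_set// => -[].
rewrite big_ord_recl -IH//= /lebesgue_rV_step /pushforward.
rewrite -product_measure1E//; last first.
  rewrite (_ : [set _ | _] = \bigcap_(i in [set: 'I_n])
      ((fun x : 'rV[R]_n => x 0 i : measurableTypeR R) @^-1` A (lift 0 i))).
    apply: fin_bigcap_measurable => // i _; rewrite -[X in measurable X]setTI.
    exact: measurable_coord.
  by apply/seteqP; split=> x /= Ax i //=; exact: Ax.
congr product_measure1; apply/seteqP; split => [p /= Ap|p /= [A0 AS] i].
  split; first by have := Ap 0; rewrite rV_cons0.
  by move=> i; have := Ap (lift 0 i); rewrite rV_consS.
by case: (unliftP 0 i) => [j|] ->; rewrite ?rV_cons0// rV_consS.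
Qed.

End lebesgue_rV.

Section euclidean.
Context {R : realType} {n : nat}.
Local Notation V := 'rV[R]_n.
Local Notation leb := (lebesgue_rV R n).
Implicit Types (U K : set V) (f phi psi : V -> R) (X Y : V -> V) (p q : R).

Fixpoint Ck_on (m : nat) U f : Prop :=
  match m with
  | 0 => forall x, U x -> {for x, continuous f}
  | m'.+1 => (forall x, U x -> differentiable f x) /\
             forall b : 'I_n, Ck_on m' U (fun x => 'D_(delta_mx 0 b) f x)
  end.

Definition smooth_on U f := forall m, Ck_on m U f.

Definition smooth_mx_on U r s (F : V -> 'M[R]_(r, s)) :=
  forall a b, smooth_on U (fun x => F x a b).

(* smooth functions with compact support in U, extended by 0 *)
Definition test_function U phi :=
  smooth_on setT phi /\
  exists K, [/\ compact K, K `<=` U & forall x, ~ K x -> phi x = 0].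

Definition Lp_on p K f :=
  measurable_fun K (f : V -> measurableTypeR R) /\
  (\int[leb]_(x in K) (`|f x| `^ p)%:E < +oo)%E.

Definition Lp_loc p U f :=
  measurable_fun U (f : V -> measurableTypeR R) /\
  forall K, compact K -> K `<=` U -> Lp_on p K f.

Definition Linf_loc U f :=
  measurable_fun U (f : V -> measurableTypeR R) /\
  forall K, compact K -> K `<=` U ->
    exists C : R, {ae leb, forall x, K x -> `|f x| <= C}.

Definition bounded_Lp_loc p U (T : Type) (F : T -> V -> R) :=
  forall K, compact K -> K `<=` U ->
    exists C : R, forall t, (\int[leb]_(x in K) (`|F t x| `^ p)%:E <= C%:E)%E.

Definition weak_cvg_Lp_loc p U (F : nat -> V -> R) f :=
  forall K q psi, compact K -> K `<=` U -> 0 < q -> p^-1 + q^-1 = 1 ->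
    Lp_on q K psi ->
    (fun j => \int[leb]_(x in K) (F j x * psi x)) @ \oo -->
    \int[leb]_(x in K) (f x * psi x).

(* the locally integrable function f, as a distribution on U *)
Definition pairing U f phi : R := \int[leb]_(x in U) (f x * phi x).

(* the distributional derivative X(f), evaluated at the test function phi:
   - \int f div (phi X) *)
Definition dist_deriv U X f phi : R :=
  - pairing U f
      (fun x => \sum_b 'D_(delta_mx 0 b) (fun y => phi y * X y 0 b) x).

Definition lie_bracket X Y : V -> V := fun x => 'D_(X x) Y x - 'D_(Y x) X x.

End euclidean.

Section semi_euclidean.
Context {R : realType} {r : nat}.
Implicit Types (G W : 'M[R]_r) (u v : 'rV[R]_r).

Definition inner G u v : R := (u *m G *m v^T) 0 0.

(* W stands for the subspace of row vectors spanned by its rows *)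
Definition negative_definite_on W G :=
  forall v, (v <= W)%MS -> v != 0 -> inner G v v < 0.

(* the index is the largest dimension of a negative definite subspace *)
Definition has_index nu G :=
  (exists2 W, \rank W = nu & negative_definite_on W G) /\
  forall W, negative_definite_on W G -> (\rank W <= nu)%N.

Definition scalar_product nu G := [/\ G^T = G, G \in unitmx & has_index nu G].

End semi_euclidean.

(* A Hausdorff second countable space with a smooth atlas (not necessarily a
   maximal one). chart_inv i is only relevant on the image of the chart i. *)
Record smooth_manifold (R : realType) (n : nat) := SmoothManifold {
  carrier :> topologicalType;
  carrier_hausdorff : hausdorff_space carrier;
  carrier_second_countable : @second_countable carrier;
  chart : Type;
  chart_dom : chart -> set carrier;
  chart_fun : chart -> carrier -> 'rV[R]_n;
  chart_inv : chart -> 'rV[R]_n -> carrier;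
  chart_dom_open : forall i, open (chart_dom i);
  chart_dom_cover : forall m, exists i, chart_dom i m;
  chart_image_open : forall i, open (chart_fun i @` chart_dom i);
  chart_funK : forall i m, chart_dom i m -> chart_inv i (chart_fun i m) = m;
  chart_fun_continuous : forall i m,
    chart_dom i m -> {for m, continuous (chart_fun i)};
  chart_inv_continuous : forall i x,
    (chart_fun i @` chart_dom i) x -> {for x, continuous (chart_inv i)};
  transition_smooth : forall i j,
    smooth_mx_on (chart_fun i @` (chart_dom i `&` chart_dom j))
      (chart_fun j \o chart_inv i)
}.

Section manifold.
Context {R : realType} {n : nat} {M : smooth_manifold R n}.
Local Notation V := 'rV[R]_n.
Local Notation leb := (lebesgue_rV R n).

Definition chart_image (i : chart M) : set V := chart_fun i @` chart_dom i.
Definition overlap (i j : chart M) : set V :=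
  chart_fun i @` (chart_dom i `&` chart_dom j).
Definition transition (i j : chart M) : V -> V := chart_fun j \o chart_inv i.

(* A bundle of rank r trivialised over the charts is given by its cocycle: if
   u is the row of fibre coordinates, over the chart i, of a vector based at
   the point of coordinates x, then u *m A i j x is the row of its fibre
   coordinates over the chart j. *)
Definition cocycle (r : nat) := chart M -> chart M -> V -> 'M[R]_r.

(* the cocycle of the tangent bundle (jacobian matrices act on row vectors) *)
Definition tangent : cocycle n := fun i j x => 'J (transition i j) x.

(* Fields are given by their components in the charts: field T is the type of
   such families, the rules for changing charts being imposed separately. *)
Definition field (T : Type) := chart M -> V -> T.

Definition smooth_section r (A : cocycle r) (s : field 'rV[R]_r) :=
  (forall i, smooth_mx_on (chart_image i) (s i)) /\
  forall i j x, overlap i j x -> s j (transition i j x) = s i x *m A i j x.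

Definition smooth_vector_field : field V -> Prop := smooth_section tangent.

(* Gram matrices of one bilinear form on the fibres *)
Definition form_change r (A : cocycle r) (m : field 'M[R]_r) i j x :=
  m i x = A i j x *m m j (transition i j x) *m (A i j x)^T.

(* Connection coefficients: the covariant derivative of the s-th frame field
   along the b-th coordinate field has the row s of w i x b as components. *)
Definition connection r := field ('I_n -> 'M[R]_r).

Definition conn_at r (W : 'I_n -> 'M[R]_r) (u : V) : 'M[R]_r :=
  \sum_b u 0 b *: W b.

Definition covd r (W : V -> 'I_n -> 'M[R]_r) (X : V -> V) (s : V -> 'rV[R]_r)
    : V -> 'rV[R]_r :=
  fun x => 'D_(X x) s x + s x *m conn_at (W x) (X x).

Definition connection_change r (A : cocycle r) (w : connection r) i j x :=
  forall u : V, conn_at (w i x) u *m A i j x =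
    'D_u (A i j) x +
    A i j x *m conn_at (w j (transition i j x)) (u *m tangent i j x).

Definition Lp_connection (p : R) r (A : cocycle r) (w : connection r) :=
  (forall i b s t, Lp_loc p (chart_image i) (fun x => w i x b s t)) /\
  forall i j, {ae leb, forall x, overlap i j x -> connection_change A w i j x}.

Definition innerf r (m : V -> 'M[R]_r) (s t : V -> 'rV[R]_r) : V -> R :=
  fun x => inner (m x) (s x) (t x).

(* X<s, t> = <D_X s, t> + <s, D_X t> in the sense of distributions *)
Definition metric_connection r (A : cocycle r) (m : field 'M[R]_r)
    (w : connection r) :=
  forall X s t, smooth_vector_field X ->
    smooth_section A s -> smooth_section A t ->
  forall i phi, test_function (chart_image i) phi ->
    dist_deriv (chart_image i) (X i) (innerf (m i) (s i) (t i)) phi =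
    pairing (chart_image i)
      (innerf (m i) (covd (w i) (X i) (s i)) (t i) \+
       innerf (m i) (s i) (covd (w i) (X i) (t i))) phi.

(* The distribution <R(X, Y) s, t> on U, where
   R(X, Y) = D_Y D_X - D_X D_Y + D_[X, Y]. As D_X s is only locally
   integrable, <D_Y D_X s, t> is understood as Y<D_X s, t> - <D_X s, D_Y t>,
   by compatibility of the connection with the metric m. *)
Definition curvature r (m : V -> 'M[R]_r) (W : V -> 'I_n -> 'M[R]_r)
    (U : set V) (X Y : V -> V) (s t : V -> 'rV[R]_r) (phi : V -> R) : R :=
  let second Z1 Z2 := dist_deriv U Z1 (innerf m (covd W Z2 s) t) phi -
                      pairing U (innerf m (covd W Z2 s) (covd W Z1 t)) phi in
  second Y X - second X Y +
  pairing U (innerf m (covd W (lie_bracket X Y) s) t) phi.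

Definition semi_riemannian_metric (nu : nat) (g : field 'M[R]_n) :=
  [/\ forall i a b, Linf_loc (chart_image i) (fun x => g i x a b),
      forall i a b, Linf_loc (chart_image i) (fun x => invmx (g i x) a b),
      forall i, {ae leb, forall x, chart_image i x -> scalar_product nu (g i x)} &
      forall i j, {ae leb, forall x, overlap i j x -> form_change tangent g i j x}].

Definition torsion_free (Gamma : connection n) :=
  forall X Y, smooth_vector_field X -> smooth_vector_field Y ->
  forall i, {ae leb, forall x, chart_image i x ->
    covd (Gamma i) (X i) (Y i) x - covd (Gamma i) (Y i) (X i) x =
    lie_bracket (X i) (Y i) x}.

Definition levi_civita (g : field 'M[R]_n) (Gamma : connection n) :=
  torsion_free Gamma /\ metric_connection tangent g Gamma.

(* Vector bundles of rank k with a smooth metric of index tau. The atlas of M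
   being arbitrary, trivialising E over its charts is no restriction. *)
Record metric_bundle (k tau : nat) := MetricBundle {
  bundle_cocycle : cocycle k;
  bundle_metric : field 'M[R]_k;
  bundle_cocycle_smooth : forall i j,
    smooth_mx_on (overlap i j) (bundle_cocycle i j);
  bundle_cocycle_id : forall i x,
    chart_image i x -> bundle_cocycle i i x = 1%:M;
  bundle_cocycle_comp : forall i j l m,
    chart_dom i m -> chart_dom j m -> chart_dom l m ->
    bundle_cocycle i l (chart_fun i m) =
    bundle_cocycle i j (chart_fun i m) *m bundle_cocycle j l (chart_fun j m);
  bundle_metric_smooth : forall i,
    smooth_mx_on (chart_image i) (bundle_metric i);
  bundle_metric_index : forall i x,
    chart_image i x -> scalar_product tau (bundle_metric i x);
  bundle_metric_change : forall i j x,
    overlap i j x -> form_change bundle_cocycle bundle_metric i j x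
}.

Section normal_bundle.
Context {k tau : nat} (E : metric_bundle k tau).
Local Notation A := (bundle_cocycle E).
Local Notation h := (bundle_metric E).

(* E-valued 2-tensors: B i x a b is the row of fibre coordinates of the value
   at the a-th and b-th coordinate vectors. *)
Definition tensor2 := field ('I_n -> 'I_n -> 'rV[R]_k).

Definition tensor_at (b : 'I_n -> 'I_n -> 'rV[R]_k) (u v : V) : 'rV[R]_k :=
  \sum_c \sum_d (u 0 c * v 0 d) *: b c d.

Definition tensor_app (B : V -> 'I_n -> 'I_n -> 'rV[R]_k) (X Y : V -> V)
    : V -> 'rV[R]_k := fun x => tensor_at (B x) (X x) (Y x).

Definition tensor_change (B : tensor2) i j x :=
  forall u v : V, tensor_at (B i x) u v *m A i j x =
    tensor_at (B j (transition i j x)) (u *m tangent i j x) (v *m tangent i j x).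

Definition second_fundamental_form (p : R) (B : tensor2) :=
  [/\ forall i a b c, Lp_loc p (chart_image i) (fun x => B i x a b 0 c),
      forall i, {ae leb, forall x, chart_image i x ->
        forall a b, B i x a b = B i x b a} &
      forall i j, {ae leb, forall x, overlap i j x -> tensor_change B i j x}].

Definition normal_connection (p : R) (w : connection k) :=
  Lp_connection p A w /\ metric_connection A h w.

(* the solution S of <S, v>_g = <II(u, v), xi>_h for all v, by raising the
   index with the inverse of g; see shape_atP *)
Definition shape_at (G : 'M[R]_n) (H : 'M[R]_k)
    (b : 'I_n -> 'I_n -> 'rV[R]_k) (xi : 'rV[R]_k) (u : V) : V :=
  (\row_a inner H (tensor_at b u (delta_mx 0 a)) xi) *m invmx G.

Lemma shape_atP (G : 'M[R]_n) H b xi u v : G \in unitmx ->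
  inner G (shape_at G H b xi u) v = inner H (tensor_at b u v) xi.
Proof.
move=> uG; rewrite /inner /shape_at mulmxKV// mxE.
have -> : tensor_at b u v = \sum_a v 0 a *: tensor_at b u (delta_mx 0 a).
  rewrite /tensor_at; under [RHS]eq_bigr do rewrite scaler_sumr.
  rewrite [RHS]exchange_big; apply: eq_bigr => c _ /=.
  apply: eq_bigr => a _; rewrite (bigD1 a)//= big1 ?addr0.
    by rewrite mxE !eqxx mulr1 scalerA mulrC.
  by move=> d da; rewrite mxE (negbTE da) andbF mulr0 scale0r.
rewrite !mulmx_suml summxE; apply: eq_bigr => a _.
by rewrite -!scalemxAl mxE [in RHS]mxE mulrC mxE.
Qed.

Definition shape (G : V -> 'M[R]_n) (H : V -> 'M[R]_k)
    (B : V -> 'I_n -> 'I_n -> 'rV[R]_k) (xi : V -> 'rV[R]_k) (X : V -> V)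
    : V -> V := fun x => shape_at (G x) (H x) (B x) (xi x) (X x).

Definition gauss_equation (g : field 'M[R]_n) (Gamma : connection n)
    (B : tensor2) :=
  forall X Y Z1 Z2, smooth_vector_field X -> smooth_vector_field Y ->
    smooth_vector_field Z1 -> smooth_vector_field Z2 ->
  forall i phi, test_function (chart_image i) phi ->
    let II := tensor_app (B i) in
    pairing (chart_image i)
      (innerf (h i) (II (X i) (Z1 i)) (II (Y i) (Z2 i)) \-
       innerf (h i) (II (X i) (Z2 i)) (II (Y i) (Z1 i))) phi =
    curvature (g i) (Gamma i) (chart_image i) (X i) (Y i) (Z1 i) (Z2 i) phi.

(* the c-th fibre component of the E-valued distribution
   D_X (II(Y, Z)) - II(nabla_X Y, Z) - II(Y, nabla_X Z) on U *)
Definition covd_tensor (Gamma : V -> 'I_n -> 'M[R]_n)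
    (W : V -> 'I_n -> 'M[R]_k) (B : V -> 'I_n -> 'I_n -> 'rV[R]_k)
    (U : set V) (X Y Z : V -> V) (c : 'I_k) (phi : V -> R) : R :=
  let II := tensor_app B in
  dist_deriv U X (fun x => II Y Z x 0 c) phi +
  pairing U (fun x => (II Y Z x *m conn_at (W x) (X x)) 0 c) phi -
  pairing U (fun x => II (covd Gamma X Y) Z x 0 c) phi -
  pairing U (fun x => II Y (covd Gamma X Z) x 0 c) phi.

Definition codazzi_equation (Gamma : connection n) (B : tensor2)
    (w : connection k) :=
  forall X Y Z, smooth_vector_field X -> smooth_vector_field Y ->
    smooth_vector_field Z ->
  forall i phi, test_function (chart_image i) phi -> forall c,
    covd_tensor (Gamma i) (w i) (B i) (chart_image i) (X i) (Y i) (Z i) c phi =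
    covd_tensor (Gamma i) (w i) (B i) (chart_image i) (Y i) (X i) (Z i) c phi.

Definition ricci_equation (g : field 'M[R]_n) (B : tensor2)
    (w : connection k) :=
  forall X Y xi eta, smooth_vector_field X -> smooth_vector_field Y ->
    smooth_section A xi -> smooth_section A eta ->
  forall i phi, test_function (chart_image i) phi ->
    let S := shape (g i) (h i) (B i) in
    pairing (chart_image i)
      (innerf (g i) (fun x => S (xi i) (S (eta i) (X i)) x -
                              S (eta i) (S (xi i) (X i)) x) (Y i)) phi =
    - curvature (h i) (w i) (chart_image i) (X i) (Y i) (xi i) (eta i) phi.

Definition gcr_system (g : field 'M[R]_n) (Gamma : connection n)
    (B : tensor2) (w : connection k) :=
  [/\ gauss_equation g Gamma B, codazzi_equation Gamma B w &
      ricci_equation g B w].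

Definition bounded_family (p : R) (T : Type) (B : T -> tensor2)
    (w : T -> connection k) :=
  (forall i a b c, bounded_Lp_loc p (chart_image i)
    (fun t x => B t i x a b 0 c)) /\
  (forall i b s t, bounded_Lp_loc p (chart_image i)
    (fun t' x => w t' i x b s t)).

Definition weak_cvg (p : R) (Bs : nat -> tensor2) (ws : nat -> connection k)
    (B : tensor2) (w : connection k) :=
  (forall i a b c, weak_cvg_Lp_loc p (chart_image i)
    (fun j x => Bs j i x a b 0 c) (fun x => B i x a b 0 c)) /\
  (forall i b s t, weak_cvg_Lp_loc p (chart_image i)
    (fun j x => ws j i x b s t) (fun x => w i x b s t)).

End normal_bundle.
End manifold.

Arguments field {R n} M T.
Arguments connection {R n} M r.
Arguments tensor2 {R n} M k.
Arguments metric_bundle {R n} M k tau.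

(* Main.v *)
(** Choose a countable family of compact patches exhausting every chart,
extract weak L^p limits there along one ultrafilter, and glue them by the
(linear or affine) transition laws. The linear terms of the GCR system pass to
the weak limit. By Codazzi and Ricci, the scalar 1-forms [II(., e_b)^s] and
the connection forms have exterior derivatives bounded in [L^(p/2)] with
equi-integrable quadratic terms, because [p > 2]; hence their curls are
precompact in [H^-1]. Writing a form through the resolvent of the Laplacian
and using Rellich compactness, the wedge product of two such weakly convergent
sequences converges in the sense of distributions to the wedge product of the
limits. All quadratic terms of Gauss, Codazzi and Ricci are such wedge
products, with fixed bounded coefficients. *)

Require Import Defs.
From HB Require Import structures.
From mathcomp Require Import all_boot all_order all_algebra.
From mathcomp Require Import all_classical all_reals all_analysis.
From mathcomp Require Import measurable_realfun lra ring.
Import Order.TTheory GRing.Theory Num.Theory.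
Import numFieldNormedType.Exports.
Set Implicit Arguments.
Unset Strict Implicit.
Unset Printing Implicit Defensive.
Local Open Scope classical_set_scope.
Local Open Scope ring_scope.

(** Precompactness in H^-1 is never stated: curls are controlled only against test functions bounded
    by 1 and small in L2, which is what equi-integrability gives. An H^1 test function [w] need not
    be bounded, so [sin w] is tested instead, and the defect [(1 - cos w) dw] is absorbed by
    equi-integrability of the squared forms. The resolvent is approximate and stays among test
    functions: it comes from a Neumann series for the lattice Laplacian. Once b is written as v -
    kappa lap v up to a small error, lap v splits into the gradient of a divergence, which meets the
    curl of a, and the divergence of a curl, whose derivatives are moved onto the resolvent of a,
    where they meet the curl of b. Two obstacles shape the rest. The inverse metric is merely
    bounded and measurable, so wedge products must converge against such weights; they are
    approximated by test functions while a sup bound is kept. The atlas may be uncountable: limits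
    are extracted on a countable subatlas and carried to the other charts, composition with a
    transition map being bounded in L2 by counting volumes of small cubes. *)

(** * Integrable and square-integrable real functions *)

Section integrable_real.
Context d (T : measurableType d) (R : realType) (mu : {measure set T -> \bar R}).
Implicit Types f g : T -> R.

Definition ig f := mu.-integrable setT (EFin \o f).

Lemma ig_meas f : ig f -> measurable_fun setT f.
Proof. by move=> /measurable_int /measurable_EFinP. Qed.

Lemma ig_le f g : measurable_fun setT f -> (forall x, `|f x| <= g x) ->
  ig g -> ig f.
Proof.
move=> mf fg; apply: le_integrable => //; first exact/measurable_EFinP.
by move=> x _ /=; rewrite lee_fin (le_trans (fg x))// ler_norm.
Qed.

Lemma igD f g : ig f -> ig g -> ig (fun x => f x + g x).
Proof. by move=> hf hg; have := integrableD measurableT hf hg. Qed.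

Lemma igB f g : ig f -> ig g -> ig (fun x => f x - g x).
Proof. by move=> hf hg; have := integrableB measurableT hf hg. Qed.

Lemma igZ k f : ig f -> ig (fun x => k * f x).
Proof. by move=> hf; have := integrableZl measurableT k hf. Qed.

Lemma igN f : ig f -> ig (fun x => - f x).
Proof. by move=> hf; have := integrableN hf. Qed.

Lemma ig0 : ig (fun=> 0).
Proof. exact: integrable0. Qed.

Lemma ig_norm f : ig f -> ig (fun x => `|f x|).
Proof. by move=> hf; have := integrable_norm hf. Qed.

Lemma ig_sum (I : Type) (s : seq I) (P : pred I) (F : I -> T -> R) :
  (forall i, P i -> ig (F i)) -> ig (fun x => \sum_(i <- s | P i) F i x).
Proof.
move=> h; elim: s => [|a s IH].
  by rewrite (_ : (fun x => _) = fun=> 0); [exact: ig0|apply/funext => x; rewrite big_nil].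
rewrite (_ : (fun x => _) = fun x => if P a then F a x + \sum_(i <- s | P i) F i x
    else \sum_(i <- s | P i) F i x); last by apply/funext => x; rewrite big_cons.
by case Pa: (P a) => //; apply: igD => //; exact: h.
Qed.

Lemma igMb f g C : ig f -> measurable_fun setT g -> (forall x, `|g x| <= C) ->
  ig (fun x => f x * g x).
Proof.
move=> hf mg gC; apply: (@ig_le _ (fun x => C * `|f x|)).
- by apply: measurable_funM => //; exact: ig_meas.
- by move=> x; rewrite normrM mulrC ler_wpM2r.
- exact/igZ/ig_norm.
Qed.

Lemma ig_indic A : measurable A -> (mu A < +oo)%E -> ig (\1_A).
Proof.
move=> mA Afin; apply/integrableP; split; first exact/measurable_EFinP/measurable_indic.
rewrite (eq_integral (fun x => (\1_A x)%:E)) ?integral_indic ?setIT// => x _ /=.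
by rewrite indicE; case: (_ \in _); rewrite ?normr1 ?normr0.
Qed.

Lemma int_indic A : measurable A -> \int[mu]_x \1_A x = fine (mu A).
Proof. by move=> mA; rewrite /Rintegral integral_indic// setIT. Qed.

Lemma intD f g : ig f -> ig g ->
  \int[mu]_x (f x + g x) = \int[mu]_x f x + \int[mu]_x g x.
Proof. exact: RintegralD. Qed.

Lemma intB f g : ig f -> ig g ->
  \int[mu]_x (f x - g x) = \int[mu]_x f x - \int[mu]_x g x.
Proof. exact: RintegralB. Qed.

Lemma intZ k f : ig f -> \int[mu]_x (k * f x) = k * \int[mu]_x f x.
Proof. exact: RintegralZl. Qed.

Lemma int0 : \int[mu]_x 0 = 0 :> R.
Proof. by rewrite /Rintegral integral0. Qed.

Lemma int_sum (I : Type) (s : seq I) (P : pred I) (F : I -> T -> R) :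
  (forall i, P i -> ig (F i)) ->
  \int[mu]_x (\sum_(i <- s | P i) F i x) = \sum_(i <- s | P i) \int[mu]_x F i x.
Proof.
move=> h; elim: s => [|a s IH].
  by rewrite big_nil -[RHS]int0; congr Rintegral; apply/funext => x; rewrite big_nil.
rewrite big_cons -IH; case: ifPn => Pa.
  rewrite -intD; [|exact: h|exact: ig_sum].
  by congr Rintegral; apply/funext => x; rewrite big_cons Pa.
by congr Rintegral; apply/funext => x; rewrite big_cons (negbTE Pa).
Qed.

Lemma le_int f g : ig f -> ig g -> (forall x, f x <= g x) ->
  \int[mu]_x f x <= \int[mu]_x g x.
Proof. by move=> hf hg fg; exact: le_Rintegral. Qed.

Lemma int_ge0 f : (forall x, 0 <= f x) -> 0 <= \int[mu]_x f x.
Proof. by move=> h; exact: Rintegral_ge0. Qed.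

Lemma le_norm_int f : ig f -> `|\int[mu]_x f x| <= \int[mu]_x `|f x|.
Proof. exact: le_normr_Rintegral. Qed.

Definition L2 f := measurable_fun setT f /\ ig (fun x => f x ^+ 2).

Definition N2 f := Num.sqrt (\int[mu]_x (f x ^+ 2)).

Lemma L2M f g : L2 f -> L2 g -> ig (fun x => f x * g x).
Proof.
move=> [mf f2] [mg g2]; apply: (@ig_le _ (fun x => f x ^+ 2 + g x ^+ 2)).
- exact: measurable_funM.
- move=> x; rewrite ler_norml; apply/andP; split; nra.
- exact: igD.
Qed.

Lemma L2D f g : L2 f -> L2 g -> L2 (fun x => f x + g x).
Proof.
move=> Lf Lg; split; first by apply: measurable_funD; [case: Lf|case: Lg].
rewrite (_ : (fun _ => _) = fun x => f x ^+ 2 + g x ^+ 2 + 2 * (f x * g x)).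
  by apply: igD; [apply: igD; [case: Lf|case: Lg]|exact/igZ/L2M].
by apply/funext => x; ring.
Qed.

Lemma L2Z k f : L2 f -> L2 (fun x => k * f x).
Proof.
move=> [mf hf]; split; first by apply: measurable_funM.
rewrite (_ : (fun _ => _) = fun x => k ^+ 2 * f x ^+ 2); first exact: igZ.
by apply/funext => x; rewrite exprMn.
Qed.

Lemma L2N f : L2 f -> L2 (fun x => - f x).
Proof. by move=> /(L2Z (-1)); under eq_fun do rewrite mulN1r. Qed.

Lemma L2B f g : L2 f -> L2 g -> L2 (fun x => f x - g x).
Proof. by move=> hf hg; apply: L2D => //; exact: L2N. Qed.

Lemma L2_0 : L2 (fun=> 0).
Proof. by split => //; under eq_fun do rewrite expr0n; exact: ig0. Qed.

Lemma L2_sum (I : Type) (s : seq I) (P : pred I) (F : I -> T -> R) :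
  (forall i, P i -> L2 (F i)) -> L2 (fun x => \sum_(i <- s | P i) F i x).
Proof.
move=> h; elim: s => [|a s IH].
  by rewrite (_ : (fun x => _) = fun=> 0); [exact: L2_0|apply/funext => x; rewrite big_nil].
rewrite (_ : (fun x => _) = fun x => if P a then F a x + \sum_(i <- s | P i) F i x
    else \sum_(i <- s | P i) F i x); last by apply/funext => x; rewrite big_cons.
by case Pa: (P a) => //; apply: L2D => //; exact: h.
Qed.

Lemma L2_le f g : measurable_fun setT f -> (forall x, `|f x| <= `|g x|) ->
  L2 g -> L2 f.
Proof.
move=> mf fg [mg g2]; split => //; apply: ig_le g2; first exact: measurable_funX.
by move=> x; rewrite normrX -[leRHS]real_normK ?num_real// lerXn2r ?nnegrE.
Qed.

Lemma L2Mb f g C : L2 f -> measurable_fun setT g -> (forall x, `|g x| <= C) ->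
  L2 (fun x => f x * g x).
Proof.
move=> Lf mg gC; apply: (@L2_le _ (fun x => C * f x)); last exact: L2Z.
  by apply: measurable_funM => //; case: Lf.
move=> x; rewrite !normrM mulrC ler_wpM2r//.
by rewrite (le_trans (gC x))// ler_norm.
Qed.

Lemma int_sqr_ge0 f : 0 <= \int[mu]_x (f x ^+ 2).
Proof. by apply: int_ge0 => x; exact: sqr_ge0. Qed.

Lemma N2_ge0 f : 0 <= N2 f. Proof. exact: sqrtr_ge0. Qed.

Lemma N2_sqr f : N2 f ^+ 2 = \int[mu]_x (f x ^+ 2).
Proof. by rewrite sqr_sqrtr// int_sqr_ge0. Qed.

Lemma int_sqrD f g : L2 f -> L2 g ->
  \int[mu]_x ((f x + g x) ^+ 2) =
  \int[mu]_x (f x ^+ 2) + 2 * \int[mu]_x (f x * g x) + \int[mu]_x (g x ^+ 2).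
Proof.
move=> Lf Lg; have fg := L2M Lf Lg; case: Lf Lg => mf f2 [mg g2].
rewrite -intZ// -intD; [|by []|exact: igZ]; rewrite -intD; [|by apply: igD => //; exact: igZ|by []].
by congr Rintegral; apply/funext => x; ring.
Qed.

(** The polynomial t -> int (f + t g)^2 is nonnegative. Its value at -C/B gives C^2 <= A B; when B =
    0, its value at -(A+1)/(2C) would be -1 unless C = 0. *)
Lemma cauchy_schwarz f g : L2 f -> L2 g -> `|\int[mu]_x (f x * g x)| <= N2 f * N2 g.
Proof.
move=> Lf Lg.
set A := \int[mu]_x (f x ^+ 2); set B := \int[mu]_x (g x ^+ 2).
set C := \int[mu]_x (f x * g x).
have A0 : 0 <= A by exact: int_sqr_ge0.
have B0 : 0 <= B by exact: int_sqr_ge0.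
have H t : 0 <= A + 2 * (t * C) + t ^+ 2 * B.
  have := int_sqr_ge0 (fun x => f x + t * g x).
  rewrite int_sqrD//; last exact: L2Z.
  rewrite (_ : (fun x => f x * (t * g x)) = (fun x => t * (f x * g x))); last first.
    by apply/funext => x; ring.
  rewrite (_ : (fun x => (t * g x) ^+ 2) = (fun x => t ^+ 2 * g x ^+ 2)); last first.
    by apply/funext => x; ring.
  by rewrite intZ ?intZ//; [case: Lg|exact: L2M].
rewrite /N2 -sqrtrM// -sqrtr_sqr ler_sqrt ?mulr_ge0// -/A -/B.
have [B00|Bn0] := eqVneq B 0.
  have C0 : C = 0.
    apply/eqP/negPn/negP => Cn0; have := H (- (A + 1) / (2 * C)).
    rewrite B00 mulr0 addr0.
    have -> : 2 * (- (A + 1) / (2 * C) * C) = - (A + 1) by field.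
    lra.
  by rewrite C0 expr0n mulr_ge0.
have := H (- C / B).
have -> : A + 2 * (- C / B * C) + (- C / B) ^+ 2 * B = A - C ^+ 2 / B by field.
by rewrite subr_ge0 ler_pdivrMr// lt_neqAle eq_sym Bn0.
Qed.

Lemma N2D f g : L2 f -> L2 g -> N2 (fun x => f x + g x) <= N2 f + N2 g.
Proof.
move=> Lf Lg; rewrite -ler_sqr ?nnegrE ?addr_ge0 ?N2_ge0//.
have := le_trans (ler_norm _) (cauchy_schwarz Lf Lg).
by rewrite N2_sqr int_sqrD// sqrrD !N2_sqr; lra.
Qed.

Lemma N2Z k f : L2 f -> N2 (fun x => k * f x) = `|k| * N2 f.
Proof.
move=> [mf f2]; rewrite /N2 -sqrtr_sqr -sqrtrM ?sqr_ge0// -intZ//.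
by congr (Num.sqrt (Rintegral _ _ _)); apply/funext => x; ring.
Qed.

Lemma N2N f : N2 (fun x => - f x) = N2 f.
Proof. by rewrite /N2; under eq_Rintegral do rewrite sqrrN. Qed.

Lemma N2B f g : L2 f -> L2 g -> N2 (fun x => f x - g x) <= N2 f + N2 g.
Proof. by move=> Lf Lg; rewrite -(N2N g); apply: N2D => //; exact: L2N. Qed.

Lemma N2_0 : N2 (fun=> 0) = 0.
Proof. by rewrite /N2; under eq_Rintegral do rewrite expr0n; rewrite int0 sqrtr0. Qed.

Lemma N2_sum (I : Type) (s : seq I) (P : pred I) (F : I -> T -> R) :
  (forall i, P i -> L2 (F i)) ->
  N2 (fun x => \sum_(i <- s | P i) F i x) <= \sum_(i <- s | P i) N2 (F i).
Proof.
move=> h; elim: s => [|a s IH].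
  by rewrite big_nil (_ : (fun _ => _) = fun=> 0) ?N2_0//; apply/funext => x; rewrite big_nil.
rewrite big_cons; case: ifPn => Pa; last first.
  rewrite (_ : (fun _ => _) = fun x => \sum_(i <- s | P i) F i x)//.
  by apply/funext => x; rewrite big_cons (negbTE Pa).
rewrite (_ : (fun _ => _) = fun x => F a x + \sum_(i <- s | P i) F i x).
  by apply: (le_trans (N2D _ _)); [exact: h|exact: L2_sum|rewrite lerD2l].
by apply/funext => x; rewrite big_cons Pa.
Qed.

Lemma le_N2 f g : measurable_fun setT f -> (forall x, `|f x| <= `|g x|) ->
  L2 g -> N2 f <= N2 g.
Proof.
move=> mf fg Lg; have [_ f2] := L2_le mf fg Lg.
rewrite ler_sqrt ?int_sqr_ge0//; apply: le_int => //; first by case: Lg.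
move=> x; rewrite -[leLHS]real_normK ?num_real// -[leRHS]real_normK ?num_real//.
by rewrite lerXn2r ?nnegrE.
Qed.

Lemma dct_L1 (F : nat -> T -> R) f g : (forall k, measurable_fun setT (F k)) ->
  (forall x, F ^~ x @ \oo --> f x) -> (forall k x, `|F k x| <= g x) -> ig g ->
  ig f /\ (fun k => \int[mu]_x `|F k x - f x|) @ \oo --> (0 : R).
Proof.
move=> mF Ff Fg igg.
have mf : measurable_fun setT f.
  by apply: (@measurable_fun_cvg _ _ _ _ F) => // x _; exact: Ff.
have fg x : `|f x| <= g x.
  have h : (fun k => `|F k x|) @ \oo --> `|f x| by apply: cvg_norm; exact: Ff.
  rewrite -(cvg_lim _ h)//; apply: limr_le; first by apply/cvg_ex; exists `|f x|.
  by near=> k; exact: Fg.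
have igf := ig_le mf fg igg; split => //.
have [|||||_ + _] := @dominated_convergence _ _ _ mu setT measurableT (fun k => EFin \o F k)
  (EFin \o f) (EFin \o g).
- by move=> k; exact/measurable_EFinP.
- exact/measurable_EFinP.
- apply: aeW => x _; apply: cvg_EFin; first by near=> k.
  exact: Ff.
- exact: igg.
- by apply: aeW => x k _; rewrite /= lee_fin.
- by move=> /fine_cvg.
Unshelve. all: by end_near. Qed.

Lemma dct_int (F : nat -> T -> R) f g : (forall k, measurable_fun setT (F k)) ->
  (forall x, F ^~ x @ \oo --> f x) -> (forall k x, `|F k x| <= g x) -> ig g ->
  (fun k => \int[mu]_x F k x) @ \oo --> \int[mu]_x f x.
Proof.
move=> mF Ff Fg igg; have [igf h] := dct_L1 mF Ff Fg igg.
apply/cvgrPdist_le => e e0; have /cvgrPdist_le /(_ _ e0) := h.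
apply: filterS => k; rewrite sub0r normrN => hk.
have igF : ig (F k) by exact: ig_le (Fg k) igg.
rewrite distrC -intB//; apply: le_trans (le_norm_int (igB igF igf)) _.
exact: le_trans (ler_norm _) hk.
Qed.

(** Dominated convergence for (f - F k)^2, which is at most 4 g^2 since both functions are bounded
    by g. *)
Lemma dct_N2 (F : nat -> T -> R) f g : (forall k, measurable_fun setT (F k)) ->
  (forall x, F ^~ x @ \oo --> f x) -> (forall k x, `|F k x| <= g x) -> L2 g ->
  L2 f /\ (fun k => N2 (fun x => f x - F k x)) @ \oo --> (0 : R).
Proof.
move=> mF Ff Fg Lg.
have mf : measurable_fun setT f.
  by apply: (@measurable_fun_cvg _ _ _ _ F) => // x _; exact: Ff.
have fg x : `|f x| <= g x.
  have h : (fun k => `|F k x|) @ \oo --> `|f x| by apply: cvg_norm; exact: Ff.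
  rewrite -(cvg_lim _ h)//; apply: limr_le; first by apply/cvg_ex; exists `|f x|.
  by near=> k; exact: Fg.
have Lf : L2 f by apply: L2_le Lg => // x; exact: le_trans (fg x) (ler_norm _).
split => //.
have h : (fun k => \int[mu]_x ((f x - F k x) ^+ 2)) @ \oo --> \int[mu]_x (0 : R).
  apply: (@dct_int _ _ (fun x => 4 * g x ^+ 2)).
  - by move=> k; apply: measurable_funX; apply: measurable_funB.
  - move=> x; rewrite -[X in _ --> X](_ : (f x - f x) ^+ 2 = 0); last by rewrite subrr expr0n.
    by apply: cvgM; apply: cvgB; [exact: cvg_cst|exact: Ff|exact: cvg_cst|exact: Ff].
  - move=> k x; rewrite ger0_norm ?sqr_ge0//.
    have := fg x; have := Fg k x; rewrite !ler_norml => /andP[? ?] /andP[? ?]; nra.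
  - by apply: igZ; case: Lg.
rewrite int0 in h; rewrite -(@sqrtr0 R).
exact: (continuous_cvg _ (@sqrt_continuous R 0) h).
Unshelve. all: by end_near. Qed.

End integrable_real.

Section integrable_change.
Context d (T : measurableType d) (R : realType) (mu : {measure set T -> \bar R}).

Lemma meas_restrictP (D : set T) (f : T -> R) : measurable D ->
  measurable_fun D f <-> measurable_fun setT (f \_ D).
Proof. by move=> mD; exact: measurable_restrictT. Qed.

End integrable_change.

Section measurable_typeR.
Context d (T : measurableType d) (R : realType).

(* R and measurableTypeR R carry the same sets but distinct displays *)
Lemma measurable_fun_typeR (D : set T) (f : T -> R) :
  measurable_fun D (f : T -> measurableTypeR R) <-> measurable_fun D f.
Proof. by split=> mf mD Y mY; exact: mf. Qed.

End measurable_typeR.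

(** * Rational boxes, topology and measurability in R^n *)

Section rV_topology.
Context {R : realType} {n : nat}.
Local Notation V := 'rV[R]_n.
Implicit Types (x y : V) (a b : 'rV[rat]_n).

Lemma ball_rVP x (e : R) y : ball x e y <-> 0 < e /\ forall i, `|x 0 i - y 0 i| < e.
Proof.
split=> [[e0 h]|[e0 h]]; split => // i; first exact: (h 0 i).
by move=> j; rewrite !ord1; exact: h.
Qed.

Lemma norm_rV_le x (r : R) : 0 <= r -> (forall i, `|x 0 i| <= r) -> `|x| <= r.
Proof.
move=> r0 h; rewrite /Num.norm /= mx_normrE.
apply/bigmax_leP; split => // -[i j] _ /=; rewrite ord1; exact: h.
Qed.

Lemma norm_coord_le x i : `|x 0 i| <= `|x|.
Proof.
rewrite [leRHS]/Num.norm /= mx_normrE.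
exact: (le_bigmax _ (fun ij : 'I_1 * 'I_n => `|x ij.1 ij.2|) (0, i)).
Qed.

Lemma measurable_coordR i : measurable_fun [set: V] (fun x => x 0 i : R).
Proof. exact: (measurable_fun_typeR _ _).1 (measurable_coord i). Qed.

Lemma measurable_fun_rVR d (T : measurableType d) (f : T -> V) :
  (forall i, measurable_fun [set: T] (fun t => f t 0 i)) -> measurable_fun [set: T] f.
Proof. by move=> h; apply: measurable_fun_rV => i; exact: (measurable_fun_typeR _ _).2 (h i). Qed.

(** Rational corners make the boxes a countable base that is stable under intersection: open sets
    are countable unions of boxes, Dynkin arguments start from them, and weak convergence has to be
    checked on countably many of them only. *)
Definition rbox a b : set V := [set x | forall i, ratr (a 0 i) < x 0 i < ratr (b 0 i)].

Definition rboxes : set (set V) := [set rbox ab.1 ab.2 | ab in [set: 'rV[rat]_n * 'rV[rat]_n]].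

Lemma rboxI a b a' b' : rbox a b `&` rbox a' b' =
  rbox (\row_i Num.max (a 0 i) (a' 0 i)) (\row_i Num.min (b 0 i) (b' 0 i)).
Proof.
have rM (p q : rat) : ratr (Num.max p q) = Num.max (ratr p) (ratr q) :> R.
  by rewrite !maxEle ler_rat; case: ifP.
have rm (p q : rat) : ratr (Num.min p q) = Num.min (ratr p) (ratr q) :> R.
  by rewrite !minEle ler_rat; case: ifP.
apply/seteqP; split => x /=.
  move=> [h h'] i; rewrite !mxE rM rm gt_max lt_min.
  have /andP[h1 h2] := h i; have /andP[h3 h4] := h' i.
  by rewrite h1 h2 h3 h4.
move=> h; split=> i; have := h i; rewrite !mxE rM rm gt_max lt_min;
  by move=> /andP[/andP[h1 h2] /andP[h3 h4]]; apply/andP.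
Qed.

Lemma rboxes_setI : setI_closed rboxes.
Proof. by move=> _ _ [[a b] _ <-] [[a' b'] _ <-]; rewrite rboxI; eexists (_, _). Qed.

Definition cbox a b : set V := [set x | forall i, ratr (a 0 i) <= x 0 i <= ratr (b 0 i)].

Lemma rbox_sub_cbox a b : rbox a b `<=` cbox a b.
Proof. by move=> x h i; have /andP[/ltW -> /ltW ->] := h i. Qed.

Lemma open_cbox_nbhs (U : set V) x : open U -> U x ->
  exists a b, rbox a b x /\ cbox a b `<=` U.
Proof.
rewrite openE => oU /oU; rewrite /interior => /nbhs_ballP[e /= e0 eU].
have h (i : 'I_n) : exists ab : rat * rat, x 0 i - e < ratr ab.1 < x 0 i /\
    x 0 i < ratr ab.2 < x 0 i + e.
  have /rat_in_itvoo[p] : x 0 i - e < x 0 i by rewrite ltrBlDr ltrDl.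
  have /rat_in_itvoo[q] : x 0 i < x 0 i + e by rewrite ltrDl.
  by rewrite !in_itv /= => hq hp; exists (p, q).
pose f i := projT1 (cid (h i)).
exists (\row_i (f i).1), (\row_i (f i).2); split.
  move=> i; rewrite !mxE /f; case: cid => -[p q] /= [/andP[_ ->] /andP[-> _]] //.
move=> y /= yab; apply: eU; apply/ball_rVP; split => // i.
have := yab i; rewrite !mxE /f; case: cid => -[p q] /= [/andP[p1 p2] /andP[q1 q2]] /andP[y1 y2].
by rewrite distrC ltr_norml; apply/andP; split; lra.
Qed.

Lemma open_rbox_nbhs (U : set V) x : open U -> U x ->
  exists a b, rbox a b x /\ rbox a b `<=` U.
Proof.
move=> oU Ux; have [a [b [xab abU]]] := open_cbox_nbhs oU Ux.
by exists a, b; split => //; exact: subset_trans (@rbox_sub_cbox a b) abU.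
Qed.

Lemma open_bigcup_rbox (U : set V) : open U ->
  U = \bigcup_(ab in [set: 'rV[rat]_n * 'rV[rat]_n])
        (if `[< rbox ab.1 ab.2 `<=` U >] then rbox ab.1 ab.2 else set0).
Proof.
move=> oU; apply/seteqP; split => [x Ux|x [[a b] _] /=].
  have [a [b [xab abU]]] := open_rbox_nbhs oU Ux.
  by exists (a, b) => //=; rewrite asboolT.
by case: asboolP => // abU /abU.
Qed.

Lemma rbox_open a b : open (rbox a b).
Proof.
rewrite openE => x xab; have h i : \forall y \near x, ratr (a 0 i) < (y : V) 0 i < ratr (b 0 i).
  have /andP[h1 h2] := xab i.
  have : \forall y \near x, (y : V) 0 i \in `]ratr (a 0 i), ratr (b 0 i)[.
    apply: (@coord_continuous _ 1 n 0 i x (fun z => z \in `]ratr (a 0 i), ratr (b 0 i)[)).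
    by apply: near_in_itvoo; rewrite in_itv /= h1.
  by apply: filterS => y; rewrite in_itv.
by apply: filterS (@filter_forall _ _ _ _ _ h) => y; exact.
Qed.

Lemma rbox_measurable a b : measurable (rbox a b).
Proof.
rewrite (_ : rbox a b = \bigcap_(i in [set: 'I_n])
    ((fun x : V => x 0 i) @^-1` `]ratr (a 0 i), ratr (b 0 i)[)).
  apply: fin_bigcap_measurable => // i _; rewrite -[X in measurable X]setTI.
  by apply: measurable_coordR => //; exact: measurable_itv.
apply/seteqP; split => x /= h i; first by rewrite /= in_itv /= (h i).
by have := h i I; rewrite /= in_itv.
Qed.

Lemma open_rV_measurable (U : set V) : open U -> measurable U.
Proof.
move=> oU; rewrite (open_bigcup_rbox oU); apply: countable_bigcupT_measurable => // -[a b].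
by case: asboolP => // _; exact: rbox_measurable.
Qed.

Lemma closed_rV_measurable (U : set V) : closed U -> measurable U.
Proof.
by move=> cU; rewrite -[U]setCK; apply: measurableC; apply: open_rV_measurable; exact: closed_openC.
Qed.

Lemma rV_hausdorff : hausdorff_space V.
Proof. exact: norm_hausdorff. Qed.

Lemma compact_rV_measurable (K : set V) : compact K -> measurable K.
Proof. by move=> cK; apply: closed_rV_measurable; apply: compact_closed => //; exact: rV_hausdorff. Qed.

(** This ties the coordinate sigma-algebra to the topology: preimages of open half-lines under a
    coordinate are open, hence countable unions of boxes. *)
Lemma rboxes_gen : @measurable _ V = <<s rboxes >>.
Proof.
apply/seteqP; split; last first.
  apply: smallest_sub; first exact: sigma_algebra_measurable.
  by move=> _ [[a b] _ <-]; exact: rbox_measurable.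
have opn (U : set V) : open U -> (<<s rboxes >>) U.
  move=> oU; rewrite (open_bigcup_rbox oU).
  apply: (@countable_bigcupT_measurable _ (g_sigma_algebraType rboxes)) => // -[a b].
  case: asboolP => [_|_]; last exact: measurable0.
  by apply: sub_sigma_algebra; exists (a, b).
apply: smallest_sub; first exact: smallest_sigma_algebra.
rewrite -bigcup_seq; apply: bigcup_sub => i _ _ [B mB <-]; rewrite setTI.
have : measurable_fun setT (fun x : g_sigma_algebraType rboxes => x 0 i).
  apply: (measurability _ (RGenInftyO.measurableE R)) => _ [_ [r ->] <-].
  rewrite setTI; apply: opn; apply: open_comp; last exact: open_lt.
  by move=> ? _; exact: coord_continuous.
by move=> /(_ measurableT _ mB); rewrite setTI.
Qed.

Lemma continuous_rV_measurable (U : set V) (f : V -> R) : open U ->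
  (forall x, U x -> {for x, continuous f}) -> measurable_fun U f.
Proof.
move=> oU cf; apply: (measurability _ (RGenInftyO.measurableE R)) => _ [_ [r ->] <-].
apply: open_rV_measurable; rewrite openE => x [Ux fx] /=.
have : nbhs x (f @^-1` `]-oo, r[%classic).
  by apply: cf => //; apply: open_nbhs_nbhs; split => //; exact: open_lt.
by move=> h; apply: filterI => //; apply: open_nbhs_nbhs.
Qed.

End rV_topology.

Section measure_preserving.
Context d (T : measurableType d) (R : realType) (mu : {measure set T -> \bar R}).
Variable phi : T -> T.
Hypothesis mphi : measurable_fun setT phi.
Hypothesis muphi : forall A, measurable A -> mu (phi @^-1` A) = mu A.

Lemma ig_mpres f : ig mu f -> ig mu (f \o phi).
Proof.
move=> /integrableP[mf foo]; apply/integrableP; split.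
  exact: (measurableT_comp mf mphi).
rewrite -(@eq_measure_integral _ _ _ _ _ (pushforward mu phi)) in foo; last first.
  by move=> A mA _; rewrite -[RHS]muphi.
by rewrite ge0_integral_pushforward// in foo; exact: measurableT_comp.
Qed.

Lemma int_mpres f : ig mu f -> \int[mu]_x f (phi x) = \int[mu]_x f x.
Proof.
move=> igf; congr fine; symmetry.
rewrite -(@eq_measure_integral _ _ _ _ _ (pushforward mu phi)); last first.
  by move=> A mA _; rewrite -[RHS]muphi.
rewrite integral_pushforward//; first by case/integrableP: igf.
exact: ig_mpres.
Qed.

End measure_preserving.

(** * Lebesgue measure of cubes and translation invariance *)

Section lebesgue_rV_facts.
Context {R : realType} {n : nat}.
Local Notation V := 'rV[R]_n.
Local Notation leb := (lebesgue_rV R n).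

Definition cube (N : R) : set V := [set x | forall i, `|x 0 i| <= N].

Lemma lebesgue_cube N : 0 <= N -> leb (cube N) = ((N *+ 2) ^+ n)%:E.
Proof.
move=> N0; pose A := fun i : 'I_n => `[- N, N]%classic : set (measurableTypeR R).
rewrite (_ : cube N = [set x : V | forall i, A i (x 0 i)]); last first.
  by apply/seteqP; split => x /= h i; have := h i; rewrite /A /= in_itv /= -ler_norml.
rewrite lebesgue_rV_prod; last by move=> i; exact: measurable_itv.
rewrite (eq_bigr (fun=> (N *+ 2)%:E)).
  by rewrite prodEFin prodr_const card_ord.
move=> i _; rewrite lebesgue_measure_itv /= lte_fin.
have -> : N *+ 2 = N - (- N) by rewrite opprK mulr2n.
case: ltP => // h; suff -> : N = 0 by rewrite oppr0 subr0.
lra.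
Qed.

Lemma cube_compact N : compact (cube N).
Proof.
apply: bounded_closed_compact.
  exists (Num.max N 0); split; first exact: num_real.
  move=> M; rewrite gt_max => /andP[NM M0] x /= xN; apply: norm_rV_le; first exact: ltW.
  by move=> i; apply: le_trans (xN i) (ltW NM).
rewrite (_ : cube N = \bigcap_(i in [set: 'I_n]) (fun x : V => x 0 i) @^-1` `[- N, N]).
  apply: closed_bigI => i _; apply: closed_comp; last exact: interval_closed.
  by move=> x _; exact: coord_continuous.
apply/seteqP; split => x /= h i; first by rewrite /= in_itv /= -ler_norml.
by have := h i I; rewrite /= in_itv /= -ler_norml.
Qed.

Lemma cbox_compact (a b : 'rV[rat]_n) : compact (cbox a b : set V).
Proof.
pose N : R := \sum_i (`|ratr (a 0 i)| + `|ratr (b 0 i)|).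
apply: (@subclosed_compact _ _ (cube N)); last 2 first.
- exact: cube_compact.
- move=> x h i; have /andP[h1 h2] := h i.
  apply: (@le_trans _ _ (`|ratr (a 0 i)| + `|ratr (b 0 i)|)).
    have := ler_norm (ratr (b 0 i) : R); have := ler_norm (- ratr (a 0 i) : R).
    rewrite normrN => ? ?; have := normr_ge0 (ratr (a 0 i) : R).
    by have := normr_ge0 (ratr (b 0 i) : R) => ? ?; rewrite ler_norml; apply/andP; split; lra.
  by rewrite /N (bigD1 i)//= lerDl sumr_ge0// => j _; rewrite addr_ge0.
rewrite (_ : cbox a b = \bigcap_(i in [set: 'I_n]) (fun x : V => x 0 i) @^-1` `[ratr (a 0 i), ratr (b 0 i)]).
  apply: closed_bigI => i _; apply: closed_comp; last exact: interval_closed.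
  by move=> x _; exact: coord_continuous.
apply/seteqP; split => x /= h i; first by move=> _; rewrite /= in_itv /=; exact: h.
by have := h i I; rewrite /= in_itv /=.
Qed.

Lemma compact_sub_cube (K : set V) : compact K -> exists2 N : R, 0 < N & K `<=` cube N.
Proof.
move=> /compact_bounded[N [_ KN]]; exists (Num.max N 0 + 1); first by rewrite ltr_wpDl// le_max lexx orbT.
move=> x Kx i; apply: le_trans (norm_coord_le x i) _.
by apply: KN Kx; rewrite ltr_pwDr// le_max lexx.
Qed.

Lemma cube_measurable N : measurable (cube N).
Proof. exact: compact_rV_measurable (@cube_compact N). Qed.

Lemma compact_lebesgue_fin (K : set V) : compact K -> (leb K < +oo)%E.
Proof.
move=> cK; have [N N0 KN] := compact_sub_cube cK.
apply: le_lt_trans (_ : leb (cube N) < +oo)%E; last by rewrite lebesgue_cube ?ltry// ltW.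
by apply: le_measure => //; rewrite inE; [exact: compact_rV_measurable|exact: cube_measurable].
Qed.

Lemma measurable_addrV (y : V) : measurable_fun setT (fun x : V => x + y).
Proof.
apply: measurable_fun_rVR => i; under eq_fun do rewrite mxE.
by apply: measurable_funD => //; exact: measurable_coordR.
Qed.

(** Both measures agree on the intersection-stable family of rational boxes, where volume is a
    product of lengths, and they are finite on an exhausting sequence of boxes; uniqueness of
    measures concludes. *)
Lemma lebesgue_rV_translate (y : V) (A : set V) : measurable A ->
  leb ((fun x => x + y) @^-1` A) = leb A.
Proof.
have step (a b : 'rV[rat]_n) : leb ((fun x => x + y) @^-1` rbox a b) = leb (rbox a b).
  (* The factor c treats both boxes at once: c = 1 is the preimage under the translation, c = 0 the
     original box. *)
  pose B (c : R) i := (`](ratr (a 0 i) - c * y 0 i), (ratr (b 0 i) - c * y 0 i)[)%classic : set (measurableTypeR R).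
  rewrite (_ : _ @^-1` _ = [set x : V | forall i, B 1 i (x 0 i)]); last first.
    apply/seteqP; split => x /= h i; have := h i; rewrite /B /= !in_itv /= !mxE; lra.
  rewrite (_ : rbox a b = [set x : V | forall i, B 0 i (x 0 i)]); last first.
    apply/seteqP; split => x /= h i; have := h i; rewrite /B /= !in_itv /= !mul0r !subr0//.
  rewrite !lebesgue_rV_prod; [|by move=> i; exact: measurable_itv..].
  apply: eq_bigr => i _; rewrite !lebesgue_measure_itv /= !lte_fin.
  by rewrite mul1r mul0r !subr0 ltrD2r; case: ifP => // _; congr EFin; ring.
pose g (k : nat) : set V := rbox (\row_i - k%:R) (\row_i k%:R).
have lebg k : (leb (g k) < +oo)%E.
  apply: le_lt_trans (_ : leb (cube k%:R) < +oo)%E; last by rewrite lebesgue_cube ?ltry.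
  apply: le_measure; rewrite ?inE; [exact: rbox_measurable|exact: cube_measurable|].
  move=> x /= h i; have := h i; rewrite !mxE rmorphN /= ratr_nat.
  by rewrite -ltr_norml => /ltW.
move=> mA.
apply: (@measure_unique _ R V rboxes g rboxes_gen rboxes_setI _ _
  (pushforward leb (fun x : V => x + y)) leb) => //.
- by move=> i; exists (\row_i0 - i%:R, \row_i0 i%:R).
- apply/seteqP; split => // x _.
  exists (Num.truncn `|x|).+1 => // i; rewrite !mxE rmorphN /= ratr_nat -ltr_norml.
  by apply: le_lt_trans (norm_coord_le x i) _; exact: truncnS_gt.
- exact: measurable_addrV.
- by move=> ? _ [[a b] _ <-]; exact: step.
- by move=> ? k; rewrite /= /pushforward step; exact: lebg.
Qed.

Lemma ig_translate (y : V) f : ig leb f -> ig leb (fun x => f (x + y)).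
Proof.
exact: (ig_mpres (measurable_addrV y) (lebesgue_rV_translate y)).
Qed.

Lemma int_translate (y : V) f : ig leb f -> \int[leb]_x f (x + y) = \int[leb]_x f x.
Proof.
exact: (int_mpres (measurable_addrV y) (lebesgue_rV_translate y)).
Qed.

End lebesgue_rV_facts.

(** * Calculus of C^k and smooth functions *)

Section differentiable_extra.
Context {R : realType}.

Lemma differentiable_near0 (V W : normedModType R) (h : V -> W) x :
  (\near x, h x = 0) -> differentiable h x.
Proof.
move=> h0.
have hx0 : h x = 0 by exact: nbhs_singleton h0.
have e : h \o shift x = cst (h x) + (\0 : V -> W) +o_ (0 : V) id.
  apply/eqaddoP => _/posnumP[eps].
  move: h0; rewrite (near_shift 0) /= subr0 => h0.
  near=> y; rewrite !fctE /= hx0 !addr0 subr0.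
  rewrite (_ : h (y + x) = 0) ?normr0 ?mulr_ge0//.
  by near: y.
have c0 : continuous (\0 : V -> W) by exact: cst_continuous.
apply/diff_locallyP.
have -> : 'd h x = (\0 : V -> W) :> (V -> W).
  exact: (@diff_unique _ _ _ h \0).
by split.
Unshelve. all: by end_near. Qed.

Lemma near_eq_differentiable (V W : normedModType R) (f g : V -> W) x :
  (\near x, f x = g x) -> differentiable f x -> differentiable g x.
Proof.
move=> fg df; rewrite (_ : g = f + (g - f)); last by rewrite addrC subrK.
apply: differentiableD => //; apply: differentiable_near0.
by near=> y; rewrite !fctE (near fg y)// subrr.
Unshelve. all: by end_near. Qed.

Lemma near_eq_continuous (V W : normedModType R) (f g : V -> W) x :
  (\near x, f x = g x) -> {for x, continuous f} -> {for x, continuous g}.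
Proof.
move=> fg cf; rewrite /prop_for /continuous_at -(nbhs_singleton fg).
exact: cvg_trans (near_eq_cvg fg) cf.
Qed.

Lemma continuous_rV (T : topologicalType) m (f : T -> 'rV[R]_m) x :
  (forall c, {for x, continuous (fun y => f y 0 c)}) -> {for x, continuous f}.
Proof.
move=> h; apply/cvg_ballP => e e0.
have : \forall y \near x, forall c : 'I_m, ball (f x 0 c) e (f y 0 c).
  by apply: filter_forall => c; have /cvg_ballP := h c; exact.
by apply: filterS => y hy; split => // i j; rewrite !ord1; exact: hy.
Qed.

Lemma differentiable_rV (V : normedModType R) m (T : V -> 'rV[R]_m) x :
  (forall c, differentiable (fun y => T y 0 c) x) -> differentiable T x.
Proof.
move=> h; rewrite (_ : T = \sum_(c < m) (fun y => T y 0 c *: (delta_mx 0 c : 'rV[R]_m))).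
  by apply: differentiable_sum => c; exact: differentiableZl.
by apply/funext => y; rewrite fct_sumE {1}[T y]row_sum_delta.
Qed.

End differentiable_extra.

Section Ck.
Context {R : realType} {n : nat}.
Local Notation V := 'rV[R]_n.
Implicit Types (U : set V) (f g : V -> R) (x v : V).

Definition pd (b : 'I_n) f : V -> R := fun x => 'D_(delta_mx 0 b) f x.

Lemma derive_sum_pd f x v : differentiable f x ->
  'D_v f x = \sum_b v 0 b * pd b f x.
Proof.
move=> df; rewrite deriveE// {1}[v]row_sum_delta linear_sum.
by apply: eq_bigr => b _; rewrite linearZ /pd deriveE.
Qed.

Lemma Ck_onS m U f : Ck_on m.+1 U f -> Ck_on m U f.
Proof.
elim: m U f => [|m IH] U f /= [df h].
  by move=> x Ux; apply: differentiable_continuous; exact: df.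
by split => // b; apply: IH; exact: h.
Qed.

Lemma Ck_on0 m U f : Ck_on m U f -> forall x, U x -> {for x, continuous f}.
Proof.
by elim: m => // m IH /Ck_onS.
Qed.

(** The iterated derivatives are functions on the whole space and U only says where they are
    examined, so regularity on U is a conjunction of conditions at single points. Restriction and
    gluing follow. *)
Lemma Ck_on_pt m U f : (forall x, U x -> Ck_on m [set x] f) <-> Ck_on m U f.
Proof.
elim: m f => [|m IH] f /=; first by split=> h x; [move/h; exact|move=> Ux y ->; exact: h].
split.
  move=> h; split=> [x /h[+ _]|b]; first exact.
  by apply/IH => x /h[_]; exact.
move=> [h1 h2] x Ux; split=> [y ->|b]; first exact: h1.
by move: x Ux; apply/IH.
Qed.

Lemma Ck_on_sub m U U' f : U' `<=` U -> Ck_on m U f -> Ck_on m U' f.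
Proof. by move=> UU' /Ck_on_pt h; apply/Ck_on_pt => x /UU'; exact: h. Qed.

Lemma Ck_on_near m U f g : (forall x, U x -> \near x, f x = g x) ->
  Ck_on m U f -> Ck_on m U g.
Proof.
elim: m f g => [|m IH] f g fg /=.
  by move=> h x Ux; apply: near_eq_continuous (fg _ Ux) (h x Ux).
move=> [h1 h2]; split=> [x Ux|b].
  by apply: near_eq_differentiable (fg _ Ux) (h1 x Ux).
apply: IH (h2 b) => x Ux.
have /near_join fg' := fg x Ux.
by near=> y; apply: near_eq_derive; near: y.
Unshelve. all: by end_near. Qed.

Lemma Ck_on_eq m U f g : open U -> (forall x, U x -> f x = g x) ->
  Ck_on m U f -> Ck_on m U g.
Proof.
move=> oU fg; apply: Ck_on_near => x Ux.
by near=> y; apply: fg; near: y; exact: open_nbhs_nbhs.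
Unshelve. all: by end_near. Qed.

Lemma Ck_on_cst m U (c : R) : Ck_on m U (fun=> c).
Proof.
elim: m c => [|m IH] c /=; first by move=> x _; exact: cst_continuous.
split=> [x _|b]; first exact: differentiable_cst.
by have -> : 'D_(delta_mx 0 b) (fun=> c) = (fun=> 0) :> (V -> R)
  by apply/funext => x; rewrite derive_cst.
Qed.

Lemma derive_coord v x (i : 'I_n) : 'D_v (fun y : V => y 0 i) x = v 0 i.
Proof.
have := derive_mx (@derivable_id _ V x v); rewrite derive_id => {2}->.
by rewrite mxE.
Qed.

Lemma Ck_on_coord m U (i : 'I_n) : Ck_on m U (fun x => x 0 i).
Proof.
case: m => [|m] /=; first by move=> x _; exact: coord_continuous.
split=> [x _|b]; first exact: differentiable_coord.
have -> : 'D_(delta_mx 0 b) (fun x : V => x 0 i) = (fun=> (delta_mx 0 b : V) 0 i).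
  by apply/funext => x; rewrite derive_coord.
exact: Ck_on_cst.
Qed.

Section Ck_open.
Variable U : set V.
Hypothesis oU : open U.

Lemma Ck_onSE m f (F : 'I_n -> V -> R) : (forall x, U x -> differentiable f x) ->
  (forall b x, U x -> pd b f x = F b x) -> (forall b, Ck_on m U (F b)) -> Ck_on m.+1 U f.
Proof.
move=> df fF h; split => // b; apply: Ck_on_eq (h b) => // x Ux.
by rewrite -fF.
Qed.

Lemma Ck_onD m f g : Ck_on m U f -> Ck_on m U g -> Ck_on m U (fun x => f x + g x).
Proof.
elim: m f g => [|m IH] f g.
  by move=> hf hg x Ux; apply: continuousD; [exact: hf _ Ux|exact: hg _ Ux].
move=> [df hf] [dg hg].
apply: (@Ck_onSE _ _ (fun b x => pd b f x + pd b g x)) => [x Ux|b x Ux|b].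
- by apply: differentiableD; [exact: df|exact: dg].
- by rewrite /pd deriveD//; apply: diff_derivable; [exact: df|exact: dg].
- by apply: IH; [exact: hf|exact: hg].
Qed.

Lemma Ck_onM m f g : Ck_on m U f -> Ck_on m U g -> Ck_on m U (fun x => f x * g x).
Proof.
elim: m f g => [|m IH] f g.
  by move=> hf hg x Ux; apply: continuousM; [exact: hf _ Ux|exact: hg _ Ux].
move=> /[dup] Cf [df hf] /[dup] Cg [dg hg].
apply: (@Ck_onSE _ _ (fun b x => f x * pd b g x + g x * pd b f x)) => [x Ux|b x Ux|b].
- by apply: differentiableM; [exact: df|exact: dg].
- by rewrite /pd deriveM//; apply: diff_derivable; [exact: df|exact: dg].
- by apply: Ck_onD; (apply: IH; [exact: Ck_onS|]); [exact: hg|exact: hf].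
Qed.

Lemma Ck_onZ m c f : Ck_on m U f -> Ck_on m U (fun x => c * f x).
Proof. by move=> hf; apply: Ck_onM => //; exact: Ck_on_cst. Qed.

Lemma Ck_onN m f : Ck_on m U f -> Ck_on m U (fun x => - f x).
Proof. by move=> /(Ck_onZ (-1)); apply: Ck_on_eq => // x _; rewrite mulN1r. Qed.

Lemma Ck_onB m f g : Ck_on m U f -> Ck_on m U g -> Ck_on m U (fun x => f x - g x).
Proof. by move=> hf hg; apply: Ck_onD => //; exact: Ck_onN. Qed.

Lemma Ck_on_sum m (I : Type) (s : seq I) (P : pred I) (F : I -> V -> R) :
  (forall i, P i -> Ck_on m U (F i)) -> Ck_on m U (fun x => \sum_(i <- s | P i) F i x).
Proof.
move=> h; elim: s => [|a s IH].
  by apply: Ck_on_eq (Ck_on_cst m U 0) => // x _; rewrite big_nil.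
case Pa: (P a).
  by apply: Ck_on_eq (Ck_onD (h _ Pa) IH) => // x _; rewrite big_cons Pa.
by apply: Ck_on_eq IH => // x _; rewrite big_cons Pa.
Qed.

Lemma Ck_on_prod m (I : Type) (s : seq I) (P : pred I) (F : I -> V -> R) :
  (forall i, P i -> Ck_on m U (F i)) -> Ck_on m U (fun x => \prod_(i <- s | P i) F i x).
Proof.
move=> h; elim: s => [|a s IH].
  by apply: Ck_on_eq (Ck_on_cst m U 1) => // x _; rewrite big_nil.
case Pa: (P a).
  by apply: Ck_on_eq (Ck_onM (h _ Pa) IH) => // x _; rewrite big_cons Pa.
by apply: Ck_on_eq IH => // x _; rewrite big_cons Pa.
Qed.

(* [F] enumerates the successive derivatives of [F 0] *)
Lemma Ck_on_comp1 m (F : nat -> R -> R) f :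
  (forall k (t : R), is_derive t 1 (F k) (F k.+1 t)) ->
  Ck_on m U f -> forall k, Ck_on m U (F k \o f).
Proof.
move=> dF; elim: m f => [|m IH] f.
  move=> hf k x Ux; apply: continuous_comp; first exact: hf.
  by apply: differentiable_continuous; apply/derivable1_diffP; exact: ex_derive.
move=> /[dup] Cf [df hf] k.
have dFt t : differentiable (F k) t by apply/derivable1_diffP; exact: ex_derive.
apply: (@Ck_onSE _ _ (fun b x => F k.+1 (f x) * pd b f x)) => [x Ux|b x Ux|b].
- by apply: differentiable_comp => //; exact: df.
- rewrite /pd deriveE; last by apply: differentiable_comp => //; exact: df.
  rewrite diff_comp//; last exact: df.
  rewrite /= -(deriveE _ (df x Ux)) deriv1E; last exact: ex_derive.
  by rewrite derive1E (@derive_val _ _ _ _ _ _ _ (dF k (f x))) mulrC.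
- by apply: Ck_onM; [apply: IH; exact: Ck_onS|exact: hf].
Qed.

End Ck_open.

Lemma Ck_on_comp m U (W : set V) (T : V -> V) f : open U -> open W ->
  (forall x, U x -> W (T x)) -> (forall c, Ck_on m U (fun x => T x 0 c)) ->
  Ck_on m W f -> Ck_on m U (f \o T).
Proof.
move=> oU oW UW; elim: m f => [|m IH] f hT.
  move=> hf x Ux; apply: continuous_comp; last exact: hf _ (UW _ Ux).
  by apply: continuous_rV => c; exact: hT.
move=> [df hf].
have dT x : U x -> differentiable T x.
  by move=> Ux; apply: differentiable_rV => c; have [+ _] := hT c; exact.
apply: (@Ck_onSE _ _ _ _ (fun b x => \sum_c pd b (fun y => T y 0 c) x * pd c f (T x))) => //.
- by move=> x Ux; apply: differentiable_comp; [exact: dT|exact: df _ (UW _ Ux)].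
- move=> b x Ux; have dfT := df _ (UW _ Ux).
  rewrite /pd deriveE; last by apply: differentiable_comp => //; exact: dT.
  rewrite diff_comp//; last exact: dT.
  rewrite /= -!deriveE//; last exact: dT.
  rewrite derive_sum_pd//; apply: eq_bigr => c _; congr (_ * _).
  by rewrite derive_mx ?mxE//; apply: diff_derivable; exact: dT.
- move=> b; apply: Ck_on_sum => // c _; apply: Ck_onM => //.
    by have [_] := hT c; exact.
  by apply: (IH (pd c f)); [move=> c'; exact: Ck_onS|exact: hf].
Qed.

End Ck.

Section smooth_on_facts.
Context {R : realType} {n : nat}.
Local Notation V := 'rV[R]_n.
Variable U : set V.
Hypothesis oU : open U.
Implicit Types (f g : V -> R).

Lemma smooth_onD f g : smooth_on U f -> smooth_on U g -> smooth_on U (fun x => f x + g x).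
Proof. by move=> hf hg m; apply: Ck_onD. Qed.

Lemma smooth_onM f g : smooth_on U f -> smooth_on U g -> smooth_on U (fun x => f x * g x).
Proof. by move=> hf hg m; apply: Ck_onM. Qed.

Lemma smooth_onZ c f : smooth_on U f -> smooth_on U (fun x => c * f x).
Proof. by move=> hf m; apply: Ck_onZ. Qed.

Lemma smooth_onB f g : smooth_on U f -> smooth_on U g -> smooth_on U (fun x => f x - g x).
Proof. by move=> hf hg m; apply: Ck_onB. Qed.

Lemma smooth_on_cst c : smooth_on U (fun=> c).
Proof. by move=> m; exact: Ck_on_cst. Qed.

Lemma smooth_on_coord i : smooth_on U (fun x => x 0 i).
Proof. by move=> m; exact: Ck_on_coord. Qed.

Lemma smooth_on_sum (I : Type) (s : seq I) (P : pred I) (F : I -> V -> R) :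
  (forall i, P i -> smooth_on U (F i)) -> smooth_on U (fun x => \sum_(i <- s | P i) F i x).
Proof. by move=> h m; apply: Ck_on_sum => // i /h. Qed.

Lemma smooth_on_prod (I : Type) (s : seq I) (P : pred I) (F : I -> V -> R) :
  (forall i, P i -> smooth_on U (F i)) -> smooth_on U (fun x => \prod_(i <- s | P i) F i x).
Proof. by move=> h m; apply: Ck_on_prod => // i /h. Qed.

Lemma smooth_on_comp1 (F : nat -> R -> R) f k :
  (forall k (t : R), is_derive t 1 (F k) (F k.+1 t)) ->
  smooth_on U f -> smooth_on U (F k \o f).
Proof. by move=> h hf m; apply: Ck_on_comp1. Qed.

Lemma smooth_on_comp (W : set V) (T : V -> V) f : open W ->
  (forall x, U x -> W (T x)) -> (forall c, smooth_on U (fun x => T x 0 c)) ->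
  smooth_on W f -> smooth_on U (f \o T).
Proof. by move=> oW UW hT hf m; apply: (Ck_on_comp oU oW UW) => // c; exact: hT. Qed.

Lemma smooth_on_pd b f : smooth_on U f -> smooth_on U (pd b f).
Proof. by move=> hf m; have [_] := hf m.+1; exact. Qed.

Lemma smooth_on_continuous f x : smooth_on U f -> U x -> {for x, continuous f}.
Proof. by move=> hf; apply: (Ck_on0 (hf 0%N)). Qed.

Lemma smooth_on_differentiable f x : smooth_on U f -> U x -> differentiable f x.
Proof. by move=> hf Ux; have [+ _] := hf 1%N; exact. Qed.

Lemma smooth_on_measurable f : smooth_on U f -> measurable_fun U f.
Proof. by move=> hf; apply: continuous_rV_measurable => // x; exact: smooth_on_continuous. Qed.

End smooth_on_facts.

Section smooth_on_local.
Context {R : realType} {n : nat}.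
Local Notation V := 'rV[R]_n.

Lemma smooth_on_sub (U U' : set V) (f : V -> R) : U' `<=` U -> smooth_on U f -> smooth_on U' f.
Proof. by move=> UU' hf m; apply: Ck_on_sub UU' (hf m). Qed.

Lemma smooth_on_eq (U : set V) (f g : V -> R) : open U ->
  (forall x, U x -> f x = g x) -> smooth_on U f -> smooth_on U g.
Proof. by move=> oU fg hf m; apply: Ck_on_eq fg (hf m). Qed.

Lemma smooth_on_local (U : set V) (f : V -> R) :
  (forall x, U x -> exists W, W x /\ smooth_on W f) -> smooth_on U f.
Proof.
move=> h m; apply/Ck_on_pt => x /h[W [Wx hW]].
by apply: Ck_on_sub (hW m) => y ->.
Qed.

End smooth_on_local.

(** * A smooth step function on the line, from exp(-1/x) *)

Section bump1.
Context {R : realType}.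

(** Each derivative of sine is a shift of its argument by a further pi/2; this is the enumeration of
    derivatives that [Ck_on_comp1] expects. *)
Lemma sin_derivs k (t : R) :
  is_derive t 1 (fun x : R => sin (x + k%:R * (pi / 2))) (sin (t + k.+1%:R * (pi / 2))).
Proof.
have -> : sin (t + k.+1%:R * (pi / 2)) = cos (t + k%:R * (pi / 2)).
  by rewrite -sinDpihalf -natr1 mulrDl mul1r addrA.
have h : is_derive t 1 (fun x : R => x + k%:R * (pi / 2)) (1 : R).
  by rewrite -[1 in X in is_derive _ _ _ X]addr0; exact: is_deriveD.
by have := @is_derive1_comp _ sin (fun x : R => x + k%:R * (pi / 2)) _ _ _ (is_derive_sin _) h; rewrite mulr1.
Qed.

Lemma lipschitz1 (f df : R -> R) (a b : R) : (forall x : R, is_derive x 1 f (df x)) ->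
  (forall x, `|df x| <= 1) -> `|f a - f b| <= `|a - b|.
Proof.
move=> dfx df1; wlog ab : a b / a <= b.
  move=> h; have [|/ltW] := leP a b; first exact: h.
  by rewrite (distrC (f a)) (distrC a); exact: h.
have [|c _] := MVT_segment ab (fun x _ => dfx x).
  apply: continuous_subspaceT => x; apply: differentiable_continuous.
  by apply/derivable1_diffP; exact: ex_derive.
by rewrite (distrC (f a)) (distrC a) => ->; rewrite normrM ler_piMl.
Qed.

Lemma abs_cos_le1 (x : R) : `|cos x| <= 1.
Proof. by rewrite ler_norml cos_geN1 cos_le1. Qed.

Lemma abs_sin_le1 (x : R) : `|sin x| <= 1.
Proof. by rewrite ler_norml sin_geN1 sin_le1. Qed.

Lemma sin_lipschitz (a b : R) : `|sin a - sin b| <= `|a - b|.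
Proof. by apply: lipschitz1 abs_cos_le1 => x; exact: is_derive_sin. Qed.

Lemma abs_sin_le (a : R) : `|sin a| <= `|a|.
Proof. by have := sin_lipschitz a 0; rewrite sin0 !subr0. Qed.

Lemma abs_1cos_le (a : R) : `|1 - cos a| <= `|a|.
Proof.
have := @lipschitz1 cos (fun x => - sin x) 0 a (fun x => is_derive_cos x).
by rewrite cos0 sub0r normrN; apply => x; rewrite normrN abs_sin_le1.
Qed.

Lemma expR_derivs (k : nat) (t : R) : is_derive t 1 (@expR R) (expR t).
Proof. exact: is_derive_expR. Qed.

(** The polynomial factor in 1/x makes the family stable under differentiation, so that all
    derivatives of exp(-1/x) extended by 0 are treated at once. *)
Definition ebump (P : {poly R}) (x : R) : R :=
  if 0 < x then P.[x^-1] * expR (- x^-1) else 0.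

(** With y = 1/((N+1)x), exp(1/x) = exp(y)^(N+1) >= y^(N+1); one of the N+1 factors x is then
    dropped because x <= 1. *)
Lemma expRN_inv_le (N : nat) (x : R) : 0 < x -> x <= 1 ->
  expR (- x^-1) <= (N.+1%:R) ^+ N.+1 * x ^+ N.
Proof.
move=> x0 x1; have N0 : 0 < N.+1%:R :> R by rewrite ltr0n.
have h : (N.+1%:R * x)^-1 <= expR ((N.+1%:R * x)^-1).
  by apply: le_trans (expR_ge1Dx _); rewrite lerDr.
have -> : - x^-1 = N.+1%:R * - (N.+1%:R * x)^-1.
  by rewrite invfM mulrN mulrA mulfV ?mul1r// gt_eqF.
rewrite expRM_natl expRN exprVn -[leRHS]invrK lef_pV2 ?posrE ?exprn_gt0 ?expR_gt0 ?invr_gt0 ?mulr_gt0 ?exprn_gt0//.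
apply: le_trans (_ : (N.+1%:R * x)^-1 ^+ N.+1 <= _); last first.
  by rewrite lerXn2r// nnegrE ?expR_ge0// invr_ge0 mulr_ge0// ltW.
rewrite exprVn lef_pV2 ?posrE ?mulr_gt0 ?exprn_gt0 ?mulr_gt0//.
rewrite exprMn ler_pM2l ?exprn_gt0// exprS ler_piMl// exprn_ge0//; exact: ltW.
Qed.

(** Multiplying the polynomial by X costs one power of x, which is why the induction hypothesis is
    used at N+1. *)
Lemma ebump_le (P : {poly R}) (N : nat) : exists2 C : R, 0 <= C & forall x, 0 < x -> x <= 1 ->
  `|P.[x^-1] * expR (- x^-1)| <= C * x ^+ N.
Proof.
elim/poly_ind: P N => [|P c IH] N.
  by exists 0 => // x x0 x1; rewrite horner0 !mul0r normr0.
have [C C0 hC] := IH N.+1.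
exists (C + `|c| * (N.+1%:R) ^+ N.+1).
  by rewrite addr_ge0// mulr_ge0// exprn_ge0.
move=> x x0 x1; rewrite hornerMXaddC mulrDl mulrDl.
apply: le_trans (ler_normD _ _) _; apply: lerD.
  rewrite mulrAC normrM [leRHS](_ : _ = (C * x ^+ N.+1) * `|x^-1|).
    by rewrite ler_wpM2r// hC.
  by rewrite gtr0_norm ?invr_gt0// exprSr mulrA mulfK// gt_eqF.
rewrite normrM (ger0_norm (expR_ge0 _)) -mulrA ler_wpM2l//.
exact: expRN_inv_le.
Qed.

(** For x > 0 the derivative of P(1/x) exp(-1/x) is x^-2 (P(1/x) - P'(1/x)) exp(-1/x), which
    explains the new polynomial. *)
Lemma ebump_derive (P : {poly R}) (x : R) :
  is_derive x 1 (ebump P) (ebump ('X^2 * (P - P^`())) x).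
Proof.
have [x0|x0|x0] := ltgtP 0 x; last rewrite -x0.
- rewrite {2}/ebump x0.
  have h : is_derive x 1 (fun y : R => P.[y^-1] * expR (- y^-1))
      (('X^2 * (P - P^`())).[x^-1] * expR (- x^-1)).
    have dinv : is_derive x 1 (fun y : R => y^-1) (- x ^- 2 *: 1).
      by apply: is_deriveV; rewrite gt_eqF.
    have h1 := @is_derive1_comp _ (horner P) GRing.inv _ _ _ (is_derive_poly P _) dinv.
    have h2 := @is_derive1_comp _ expR (- (GRing.inv : R -> R)) _ _ _ (is_derive_expR _) (is_deriveN dinv).
    apply: is_derive_eq (is_deriveM h1 h2) _.
    rewrite /= !hornerE /GRing.scale /= -[x ^- 2]exprVn; ring.
  apply: near_eq_is_derive h; near=> y; rewrite /ebump ifT//.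
  by near: y; exact: lt_nbhsr.
- rewrite {2}/ebump ifF; last by apply/negbTE; rewrite -leNgt ltW.
  apply: near_eq_is_derive (is_derive_cst (0 : R) x 1); near=> y.
  rewrite /ebump ifF//; apply/negbTE; rewrite -leNgt ltW//.
  by near: y; exact: lt_nbhsl.
- rewrite {2}/ebump ltxx.
  (* At 0 the difference quotient is at most C h^2 / h = C h, so the exponent 2 suffices. *)
  have [C C0 hC] := ebump_le P 2.
  have cv : (fun h : R => h^-1 *: ((ebump P \o shift 0) (h *: 1) - ebump P 0)) @ 0^' --> (0 : R).
    apply/cvgr0Pnorm_le => e e0; near=> h.
    rewrite /= addr0 {2}/ebump ltxx subr0 /GRing.scale /= mulr1 /ebump.
    case: ifPn => h0; last by rewrite mulr0 normr0 ltW.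
    have h1 : h <= 1.
      apply: le_trans (ler_norm h) _.
      by near: h; apply: dnbhs0_le; exact: ltr01.
    rewrite normrM gtr0_norm ?invr_gt0// ler_pdivrMl//.
    apply: le_trans (hC _ h0 h1) _.
    have hC1 : h * (C + 1) <= e.
      rewrite -ler_pdivlMr ?ltr_wpDl//.
      apply: le_trans (ler_norm h) _.
      by near: h; apply: dnbhs0_le; rewrite divr_gt0// ltr_wpDl.
    nra.
  split; first by apply/cvg_ex; exists 0.
  exact: cvg_lim cv.
Unshelve. all: by end_near. Qed.

Definition estep := ebump 1.

Lemma estep_derivs : exists2 F : nat -> R -> R, F 0%N = estep &
  forall k (t : R), is_derive t 1 (F k) (F k.+1 t).
Proof.
exists (fun k => ebump (iter k (fun P => 'X^2 * (P - P^`())) 1)) => // k t.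
exact: ebump_derive.
Qed.

Lemma estep_ge0 x : 0 <= estep x.
Proof. by rewrite /estep /ebump; case: ifP => // _; rewrite hornerC mul1r expR_ge0. Qed.

Lemma estep_gt0 x : 0 < x -> 0 < estep x.
Proof. by move=> x0; rewrite /estep /ebump x0 hornerC mul1r expR_gt0. Qed.

Lemma estep_le0 x : x <= 0 -> estep x = 0.
Proof. by move=> x0; rewrite /estep /ebump ltNge x0. Qed.

Lemma estep_le x y : x <= y -> estep x <= estep y.
Proof.
move=> xy; have [x0|x0] := leP x 0; first by rewrite (estep_le0 x0) estep_ge0.
have y0 := lt_le_trans x0 xy.
by rewrite /estep /ebump x0 y0 !hornerC !mul1r ler_expR lerN2 lef_pV2.
Qed.

End bump1.

Lemma compact_cover_seq (T : ptopologicalType) (K : set T) (I : choiceType)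
    (D : set I) (f : I -> set T) : compact K -> (forall i, D i -> open (f i)) ->
  (forall x, K x -> exists2 i, D i & f i x) ->
  exists s : seq I, (forall i, i \in s -> D i) /\
    forall x, K x -> exists2 i, i \in s & f i x.
Proof.
rewrite compact_cover => cK fo Kf.
have [|D' D'D KD'] := cK I D f fo.
  by move=> x /Kf[i Di fx]; exists i.
exists (finmap.enum_fset D'); split=> [i iD'|x /KD'[i /= iD' fx]]; last by exists i.
by have := D'D i iD'; rewrite inE.
Qed.

(** * Smooth cutoff functions on R^n *)

Section bump_rV.
Context {R : realType} {n : nat}.
Local Notation V := 'rV[R]_n.

Definition rbump (a b : 'rV[rat]_n) (x : V) : R :=
  \prod_i (estep (x 0 i - ratr (a 0 i)) * estep (ratr (b 0 i) - x 0 i)).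

Lemma smooth_estep (f : V -> R) U : open U -> smooth_on U f -> smooth_on U (estep \o f).
Proof.
by move=> oU hf; have [F <- dF] := @estep_derivs R; exact: (smooth_on_comp1 oU 0%N dF hf).
Qed.

Lemma smooth_rbump a b : smooth_on setT (rbump a b).
Proof.
have oT : open [set: V] by exact: openT.
apply: smooth_on_prod => // i _; apply: smooth_onM => //; apply: smooth_estep => //.
  by apply: smooth_onB => //; [exact: smooth_on_coord|exact: smooth_on_cst].
by apply: smooth_onB => //; [exact: smooth_on_cst|exact: smooth_on_coord].
Qed.

Lemma rbump_ge0 a b x : 0 <= rbump a b x.
Proof. by apply: prodr_ge0 => i _; rewrite mulr_ge0// estep_ge0. Qed.

Lemma rbump_gt0 a b x : rbox a b x -> 0 < rbump a b x.
Proof.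
move=> h; apply: prodr_gt0 => i _; have /andP[h1 h2] := h i.
by rewrite mulr_gt0// estep_gt0// subr_gt0.
Qed.

Lemma rbump_eq0 a b x : ~ rbox a b x -> rbump a b x = 0.
Proof.
move=> /existsNP[i /negP]; rewrite negb_and -!leNgt => h.
rewrite /rbump (bigD1 i)//=; case/orP: h => h.
  by rewrite (@estep_le0 _ (x 0 i - _)) ?subr_le0// !mul0r.
by rewrite (@estep_le0 _ (_ - x 0 i)) ?subr_le0// mulr0 mul0r.
Qed.

(** A finite sum f of box bumps is at least some c > 0 on K and vanishes outside finitely many
    closed boxes contained in U. A function of f that is 0 at 0 and 1 from c on is then a cutoff. *)
Lemma smooth_cutoff (U K : set V) : open U -> compact K -> K `<=` U ->
  exists chi : V -> R, [/\ test_function U chi, forall x, 0 <= chi x <= 1 &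
    forall x, K x -> chi x = 1].
Proof.
move=> oU cK KU.
have oT : open [set: V] by exact: openT.
have [||D [DU Kcov]] := @compact_cover_seq _ K _
  [set ab : 'rV[rat]_n * 'rV[rat]_n | cbox ab.1 ab.2 `<=` U]
  (fun ab => rbox ab.1 ab.2) cK.
- move=> [a b] /= _; exact: rbox_open.
- move=> x /KU Ux; have [a [b [xab abU]]] := open_cbox_nbhs oU Ux.
  by exists (a, b).
pose f (x : V) := \sum_(ab <- D) rbump ab.1 ab.2 x.
have smf : smooth_on setT f.
  by apply: smooth_on_sum => // ab _; exact: smooth_rbump.
have f0 x : 0 <= f x by apply: sumr_ge0 => ab _; exact: rbump_ge0.
have fK x : K x -> 0 < f x.
  move=> /Kcov[ab /= abD xab].
  rewrite /f (big_rem ab)//= ltr_pwDl ?rbump_gt0// sumr_ge0// => ? _; exact: rbump_ge0.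
have [c c0 hc] : exists2 c : R, 0 < c & forall x, K x -> c <= f x.
  have [K0|/set0P Kn0] := eqVneq K set0.
    by exists 1 => // x; rewrite K0.
  have [x /set_mem Kx hx] : exists2 c : V, c \in K & forall t, t \in K -> f c <= f t.
    apply: EVT_min_rV => //; apply: continuous_subspaceT => x.
    exact: smooth_on_continuous smf _.
  by exists (f x); [exact: fK|move=> y Ky; apply: hx; exact: mem_set].
(* This is 1 - e(c - f)/e(c), with e the smooth step: it is 0 where f = 0, and 1 where f >= c
   because e vanishes on nonpositive numbers. *)
pose chi x := 1 + - (estep c)^-1 * estep (c - f x).
have e0 := estep_gt0 c0.
exists chi; split.
- split.
    apply: smooth_onD => //; first exact: smooth_on_cst.
    apply: smooth_onZ => //; apply: (@smooth_estep (fun x => c - f x)) => //.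
    by apply: smooth_onB => //; exact: smooth_on_cst.
  exists (\big[setU/set0]_(ab <- D | `[< cbox ab.1 ab.2 `<=` U >]) cbox ab.1 ab.2); split.
  + by apply: bigsetU_compact => ab _; exact: cbox_compact.
  + by rewrite -bigcup_seq_cond; apply: bigcup_sub => ab /andP[_ /asboolP].
  + move=> x; rewrite -bigcup_seq_cond => nx.
    rewrite /chi (_ : f x = 0) ?subr0 ?mulNr ?mulVf ?subrr ?gt_eqF//.
    rewrite /f big_seq big1// => ab abD; apply: rbump_eq0 => xab; apply: nx.
    exists ab; last exact: rbox_sub_cbox.
    by rewrite /= abD; apply/asboolP; exact: DU.
- move=> x; rewrite /chi mulNr subr_ge0 gerBl ler_pdivrMl// mulr1.
  by rewrite mulr_ge0 ?estep_ge0 ?invr_ge0 ?estep_ge0// estep_le// gerBl.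
- by move=> x Kx; rewrite /chi (@estep_le0 _ (c - f x)) ?mulr0 ?addr0// subr_le0 hc.
Qed.

End bump_rV.

(** * Test functions: stability, bounds, mean values, symmetry of second derivatives *)

Section test_functions.
Context {R : realType} {n : nat}.
Local Notation V := 'rV[R]_n.
Local Notation leb := (lebesgue_rV R n).
Implicit Types (U : set V) (f g : V -> R) (x y : V).

Let oT : open [set: V]. Proof. exact: openT. Qed.

Lemma test_function_sub U U' f : U `<=` U' -> test_function U f -> test_function U' f.
Proof.
move=> UU' [sf [K [cK KU h]]]; split => //; exists K; split => //.
exact: subset_trans UU'.
Qed.

Lemma test_functionT U f : test_function U f -> test_function setT f.
Proof. exact: test_function_sub. Qed.

Lemma test_functionD U f g : test_function U f -> test_function U g ->
  test_function U (fun x => f x + g x).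
Proof.
move=> [sf [K [cK KU hK]]] [sg [L [cL LU hL]]]; split; first exact: smooth_onD.
exists (K `|` L); split; [exact: compactU|by move=> x [/KU|/LU]|].
by move=> x /not_orP[/hK -> /hL ->]; rewrite addr0.
Qed.

Lemma test_functionM U f g : smooth_on setT f -> test_function U g ->
  test_function U (fun x => f x * g x).
Proof.
move=> sf [sg [K [cK KU hK]]]; split; first exact: smooth_onM.
by exists K; split => // x /hK ->; rewrite mulr0.
Qed.

Lemma test_functionZ U c f : test_function U f -> test_function U (fun x => c * f x).
Proof. by move=> hf; apply: (@test_functionM _ (fun=> c)) => //; exact: smooth_on_cst. Qed.

Lemma test_functionB U f g : test_function U f -> test_function U g ->
  test_function U (fun x => f x - g x).
Proof.
move=> hf /(test_functionZ (-1)) hg; have := test_functionD hf hg.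
by under eq_fun do rewrite mulN1r.
Qed.

Lemma test_function0 U : test_function U (fun=> 0 : R).
Proof.
split; first exact: smooth_on_cst.
by exists set0; split => //; exact: compact0.
Qed.

Lemma test_function_sum U (I : Type) (s : seq I) (P : pred I) (F : I -> V -> R) :
  (forall i, P i -> test_function U (F i)) ->
  test_function U (fun x => \sum_(i <- s | P i) F i x).
Proof.
move=> h; elim: s => [|a s IH].
  rewrite (_ : (fun x => _) = fun=> 0); first exact: test_function0.
  by apply/funext => x; rewrite big_nil.
rewrite (_ : (fun x => _) = fun x => if P a then F a x + \sum_(i <- s | P i) F i x
    else \sum_(i <- s | P i) F i x); last by apply/funext => x; rewrite big_cons.
by case Pa: (P a) => //; apply: test_functionD => //; exact: h.
Qed.

Lemma test_function_sin U f : test_function U f -> test_function U (fun x => sin (f x)).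
Proof.
move=> [sf [K [cK KU hK]]]; split.
  have := smooth_on_comp1 oT 0%N (@sin_derivs R) sf.
  by apply: smooth_on_eq => // x _; rewrite /= mul0r addr0.
by exists K; split => // x /hK ->; rewrite sin0.
Qed.

Lemma pd_eq0 b f K x : compact K -> (forall x, ~ K x -> f x = 0) -> ~ K x -> pd b f x = 0.
Proof.
move=> cK h nKx; rewrite /pd (@near_eq_derive _ _ _ f (fun=> 0)) ?derive_cst//.
have oK : open (~` K) by apply: closed_openC; apply: compact_closed => //; exact: rV_hausdorff.
by apply: filterS (open_nbhs_nbhs (conj oK nKx)) => y; exact: h.
Qed.

Lemma test_function_pd U b f : test_function U f -> test_function U (pd b f).
Proof.
move=> [sf [K [cK KU hK]]]; split; first exact: smooth_on_pd.
by exists K; split => // x; exact: pd_eq0.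
Qed.

Lemma pd_translate b f y x : pd b (fun z => f (z + y)) x = pd b f (x + y).
Proof.
have E : (fun h : R => h^-1 *: (((fun z => f (z + y)) \o shift x) (h *: (delta_mx 0 b : V)) - f (x + y))) =
    (fun h : R => h^-1 *: ((f \o shift (x + y)) (h *: (delta_mx 0 b : V)) - f (x + y))).
  by apply/funext => h /=; rewrite addrA.
by rewrite /pd /derive E.
Qed.

Lemma smooth_translate f y : smooth_on setT f -> smooth_on setT (fun x => f (x + y)).
Proof.
move=> sf; apply: (@smooth_on_comp _ _ _ oT setT (fun x => x + y)) => // c.
apply: smooth_on_eq (smooth_onD oT (smooth_on_coord setT c) (smooth_on_cst setT (y 0 c))) => //.
by move=> x _; rewrite mxE.
Qed.

Lemma test_function_cube f : test_function setT f ->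
  exists2 N : R, 0 < N & forall x, ~ cube N x -> f x = 0.
Proof.
move=> [_ [K [cK _ hK]]]; have [N N0 KN] := compact_sub_cube cK.
by exists N => // x nx; apply: hK => /KN.
Qed.

Lemma cube_shift (N M : R) x y : (forall i, `|y 0 i| <= M) -> ~ cube (N + M) x -> ~ cube N (x + y).
Proof.
move=> yM; apply: contra_not => h i; have := h i; rewrite mxE => hi.
have := ler_normB (x 0 i + y 0 i) (y 0 i); rewrite addrK => /le_trans; apply.
exact: lerD.
Qed.

Lemma test_function_translate f y : test_function setT f ->
  test_function setT (fun x => f (x + y)).
Proof.
move=> /[dup] [[sf _]] /test_function_cube[N N0 hN]; split; first exact: smooth_translate.
exists (cube (N + `|y|)); split => //; first exact: cube_compact.
by move=> x nx; apply/hN/(cube_shift _ nx) => i; exact: norm_coord_le.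
Qed.

Lemma test_function_bounded f : test_function setT f -> exists2 C : R, 0 <= C & forall x, `|f x| <= C.
Proof.
move=> [sf [K [cK _ hK]]].
have : compact (f @` K).
  apply: continuous_compact => //; apply: continuous_subspaceT => x.
  exact: smooth_on_continuous sf _.
move=> /compact_bounded[C [_ hC]]; exists (Num.max C 0 + 1).
  by rewrite addr_ge0// le_max lexx orbT.
move=> x; have [Kx|/hK ->] := pselect (K x).
  by apply: (hC (Num.max C 0 + 1)); [rewrite ltr_pwDr// le_max lexx|exists x].
by rewrite normr0 addr_ge0// le_max lexx orbT.
Qed.

Lemma smooth_measurable f : smooth_on setT f -> measurable_fun setT f.
Proof. by move=> sf; exact: smooth_on_measurable. Qed.

Lemma test_function_measurable f : test_function setT f -> measurable_fun setT f.
Proof. by move=> [sf _]; exact: smooth_measurable. Qed.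

Lemma ig_bounded_cube (N C : R) f : measurable_fun setT f -> (forall x, ~ cube N x -> f x = 0) ->
  (forall x, `|f x| <= C) -> ig leb f.
Proof.
move=> mf f0 fC; apply: (@ig_le _ _ _ _ _ (fun x => C * \1_(cube N) x)) => //.
  move=> x; rewrite indicE; case: (boolP (x \in cube N)) => [_|]; first by rewrite mulr1.
  by rewrite notin_setE => /f0 ->; rewrite mulr0 normr0.
apply: igZ; apply: ig_indic; first exact: cube_measurable.
exact: compact_lebesgue_fin (@cube_compact _ _ _).
Qed.

Lemma test_function_ig f : test_function setT f -> ig leb f.
Proof.
move=> /[dup] tf /test_function_cube[N N0 hN].
have [C C0 hC] := test_function_bounded tf.
exact: ig_bounded_cube (test_function_measurable tf) hN hC.
Qed.

Lemma test_function_L2 f : test_function setT f -> L2 leb f.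
Proof.
move=> tf; split; first exact: test_function_measurable.
by apply: test_function_ig; apply: test_functionM => //; case: tf.
Qed.

Lemma int_cube_bound (N C : R) f : 0 <= N -> 0 <= C -> measurable_fun setT f ->
  (forall x, ~ cube N x -> f x = 0) -> (forall x, `|f x| <= C) ->
  \int[leb]_x `|f x| <= C * (N *+ 2) ^+ n.
Proof.
move=> N0 C0 mf f0 fC; have igf := ig_bounded_cube mf f0 fC.
apply: (@le_trans _ _ (\int[leb]_x (C * \1_(cube N) x))).
  apply: le_int; first exact: ig_norm.
    apply: igZ; apply: ig_indic; first exact: cube_measurable.
    exact: compact_lebesgue_fin (@cube_compact _ _ _).
  move=> x; rewrite indicE; case: (boolP (x \in cube N)) => [_|]; first by rewrite mulr1.
  by rewrite notin_setE => /f0 ->; rewrite mulr0 normr0.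
rewrite intZ; last first.
  apply: ig_indic; first exact: cube_measurable.
  exact: compact_lebesgue_fin (@cube_compact _ _ _).
rewrite ler_wpM2l// le_eqVlt; apply/orP; left; apply/eqP.
transitivity (fine (leb (cube N : set V))); last by rewrite lebesgue_cube.
by apply: int_indic; exact: cube_measurable.
Qed.

Lemma N2_cube_bound (N C : R) f : 0 <= N -> 0 <= C -> measurable_fun setT f ->
  (forall x, ~ cube N x -> f x = 0) -> (forall x, `|f x| <= C) ->
  N2 leb f <= C * Num.sqrt ((N *+ 2) ^+ n).
Proof.
move=> N0 C0 mf f0 fC; rewrite -[C in leRHS](ger0_norm C0).
rewrite -sqrtr_sqr -sqrtrM ?sqr_ge0// ler_sqrt; last first.
  by rewrite mulr_ge0 ?sqr_ge0// exprn_ge0// mulrn_wge0.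
apply: le_trans (int_cube_bound (f := fun x => f x ^+ 2) N0 (sqr_ge0 C) _ _ _).
- rewrite le_eqVlt; apply/orP; left; apply/eqP; congr Rintegral; apply/funext => x.
  by rewrite ger0_norm// sqr_ge0.
- exact: measurable_funX.
- by move=> x /f0 ->; rewrite expr0n.
- by move=> x; rewrite normrX lerXn2r// nnegrE.
Qed.

Lemma mvt_slice f x (b : 'I_n) (t : R) : smooth_on setT f -> 0 < t ->
  exists2 s : R, 0 <= s <= t &
    f (x + t *: delta_mx 0 b) - f x = t * pd b f (x + s *: delta_mx 0 b).
Proof.
move=> sf t0; pose e : V := delta_mx 0 b; pose T (s : R) : V := x + s *: e.
have dT s : is_diff s T (fun z => z *: e).
  have h := is_diffD (is_diff_cst x s) (is_diff_scalel s e).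
  by apply: is_diff_eq h _; apply/funext => z; rewrite fctE add0r.
have dfT (s : R) : is_derive s 1 (f \o T) (pd b f (T s)).
  have dfs : differentiable f (T s) by exact: smooth_on_differentiable sf _.
  have dTs : differentiable T s by exact: (@ex_diff _ _ _ _ _ _ _ (dT s)).
  have dfTs : differentiable (f \o T) s by exact: differentiable_comp.
  split; first exact: diff_derivable.
  rewrite deriveE// diff_comp//.
  by rewrite /= (@diff_val _ _ _ _ _ _ _ (dT s)) scale1r /pd deriveE.
have [|s] := MVT_segment (ltW t0) (fun s _ => dfT s).
  apply: continuous_subspaceT => s; apply: differentiable_continuous.
  by apply/derivable1_diffP; exact: ex_derive.
rewrite in_itv /= => hs h; exists s => //.
by move: h; rewrite /= /T scale0r addr0 subr0 mulrC.
Qed.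

Lemma slice_lipschitz f x (b : 'I_n) (t C : R) : smooth_on setT f ->
  (forall x, `|pd b f x| <= C) -> `|f (x + t *: delta_mx 0 b) - f x| <= C * `|t|.
Proof.
move=> sf hC; have [t0|t0|t0] := ltgtP 0 t; last first.
- by rewrite -t0 scale0r addr0 subrr !normr0 mulr0.
- have nt0 : 0 < - t by rewrite oppr_gt0.
  have [s _] := mvt_slice (x + t *: delta_mx 0 b) b sf nt0.
  rewrite scaleNr addrK distrC => ->.
  by rewrite normrM normrN mulrC ler_wpM2r.
- have [s _ ->] := mvt_slice x b sf t0.
  by rewrite normrM mulrC ler_wpM2r.
Qed.

(** Both mixed derivatives are limits of one symmetric second difference divided by t^2: two mean
    value steps, taken in either order, turn it into a mixed derivative at a point whose coordinates
    are within 2t of those of x. *)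
Lemma pd_comm a b f : smooth_on setT f -> pd a (pd b f) = pd b (pd a f).
Proof.
move=> sf; apply/funext => x.
have half a' b' (t : R) : 0 < t -> exists s s' : R, [/\ 0 <= s <= t, 0 <= s' <= t &
    f (x + t *: delta_mx 0 a' + t *: delta_mx 0 b') - f (x + t *: delta_mx 0 a')
    - (f (x + t *: delta_mx 0 b') - f x) =
    t ^+ 2 * pd b' (pd a' f) (x + (s *: delta_mx 0 a' + s' *: delta_mx 0 b'))].
  move=> t0; pose g z := f (z + t *: delta_mx 0 b') - f z.
  have sg : smooth_on setT g by apply: smooth_onB => //; exact: smooth_translate.
  have [s hs hg] := mvt_slice x a' sg t0.
  have [s' hs' hg'] := mvt_slice (x + s *: delta_mx 0 a') b' (smooth_on_pd a' sf) t0.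
  rewrite -(addrA x (s *: delta_mx 0 a') (s' *: delta_mx 0 b')) in hg'.
  exists s, s'; split => //; rewrite -[LHS]/(g _ - g x) hg expr2 -mulrA -hg'; congr (_ * _).
  rewrite /pd deriveB; last 2 first.
  - by apply: diff_derivable; apply: smooth_on_differentiable (smooth_translate _ sf) _.
  - by apply: diff_derivable; apply: smooth_on_differentiable sf _.
  by rewrite -/(pd a' _ _) pd_translate.
have cv a' b' (u : nat -> V) : (forall k i, `|u k 0 i| <= k.+1%:R^-1 *+ 2) ->
    (fun k => pd b' (pd a' f) (x + u k)) @ \oo --> pd b' (pd a' f) x.
  move=> hu; apply: (@cvg_comp _ _ _ (fun k => x + u k) (pd b' (pd a' f)) _ (nbhs x)).
    apply/cvgrPdist_le => e e0; have e2 : 0 < e / 2 by rewrite divr_gt0.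
    near=> k; rewrite opprD addNKr normrN; apply: norm_rV_le; first exact: ltW.
    move=> i; apply: le_trans (hu k i) _.
    have : k.+1%:R^-1 < e / 2 by near: k; exact: (near_infty_natSinv_lt (PosNum e2)).
    by rewrite ltr_pdivlMr// => /ltW; rewrite mulr_natr.
  exact: smooth_on_continuous (smooth_on_pd b' (smooth_on_pd a' sf)) _.
pose t k : R := k.+1%:R^-1.
have t0 k : 0 < t k by rewrite invr_gt0.
pose S a' b' k := cid (half a' b' _ (t0 k)).
pose s a' b' k := projT1 (S a' b' k).
pose s' a' b' k := projT1 (cid (projT2 (S a' b' k))).
have sP a' b' k : [/\ 0 <= s a' b' k <= t k, 0 <= s' a' b' k <= t k &
    f (x + t k *: delta_mx 0 a' + t k *: delta_mx 0 b') - f (x + t k *: delta_mx 0 a')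
    - (f (x + t k *: delta_mx 0 b') - f x) =
    t k ^+ 2 * pd b' (pd a' f) (x + (s a' b' k *: delta_mx 0 a' + s' a' b' k *: delta_mx 0 b'))].
  exact: projT2 (cid (projT2 (S a' b' k))).
have ub a' b' k i : `|(s a' b' k *: delta_mx 0 a' + s' a' b' k *: delta_mx 0 b' : V) 0 i| <= t k *+ 2.
  have [/andP[s1 s2] /andP[s3 s4] _] := sP a' b' k.
  have aux (u v : R) (c : bool) : 0 <= u <= v -> `|u * c%:R| <= v.
    move=> /andP[u0 uv]; case: c; first by rewrite mulr1 ger0_norm.
    by rewrite mulr0 normr0 (le_trans u0 uv).
  rewrite !mxE !eqxx /= mulr2n; apply: le_trans (ler_normD _ _) _.
  by apply: lerD; apply: aux; apply/andP.
have h1 := cv a b _ (ub a b); have h2 := cv b a _ (ub b a).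
have E k : pd b (pd a f) (x + (s a b k *: delta_mx 0 a + s' a b k *: delta_mx 0 b)) =
           pd a (pd b f) (x + (s b a k *: delta_mx 0 b + s' b a k *: delta_mx 0 a)).
  have [_ _ e1] := sP a b k; have [_ _ e2] := sP b a k.
  have tk : t k ^+ 2 != 0 by rewrite sqrf_eq0 gt_eqF.
  apply: (mulfI tk); apply: (etrans (esym e1)); apply: (etrans _ e2).
  rewrite (addrAC x (t k *: delta_mx 0 a) (t k *: delta_mx 0 b)); ring.
by apply: cvg_unique h2 _; [exact: Rhausdorff|rewrite (eq_cvg _ _ E) in h1].
Unshelve. all: by end_near. Qed.

End test_functions.

Lemma le0_small {R : realType} (a C : R) : (forall t, 0 < t -> t <= 1 -> a <= C * t) -> a <= 0.
Proof.
move=> h; rewrite leNgt; apply/negP => a0.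
have C0 : 0 < C by have := h 1 ltr01 (lexx 1); rewrite mulr1; exact: lt_le_trans.
pose t := Num.min 1 (a / (2 * C)).
have t0 : 0 < t by rewrite /t lt_min ltr01 divr_gt0// mulr_gt0.
have t1 : t <= 1 by rewrite /t ge_min lexx.
have ta : t <= a / (2 * C) by rewrite /t ge_min lexx orbT.
have := h t t0 t1; have : C * t <= C * (a / (2 * C)) by rewrite ler_wpM2l// ltW.
have -> : C * (a / (2 * C)) = a / 2 by field; rewrite gt_eqF.
lra.
Qed.

Lemma ler_sum1 {R : realType} (n : nat) (F : 'I_n -> R) c :
  (forall i, 0 <= F i) -> F c <= \sum_i F i.
Proof. by move=> h; rewrite (bigD1 c)//= lerDl sumr_ge0. Qed.

(** * Integration by parts and the energy identity *)

Section calculus.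
Context {R : realType} {n : nat}.
Local Notation V := 'rV[R]_n.
Local Notation leb := (lebesgue_rV R n).
Implicit Types (U : set V) (f g : V -> R) (x y : V).

Let oT : open [set: V]. Proof. exact: openT. Qed.

Lemma pdD b f g x : smooth_on setT f -> smooth_on setT g ->
  pd b (fun y => f y + g y) x = pd b f x + pd b g x.
Proof.
move=> sf sg; rewrite /pd deriveD//; apply: diff_derivable;
  by apply: (smooth_on_differentiable (U := setT)).
Qed.

Lemma pdZ b c f x : smooth_on setT f -> pd b (fun y => c * f y) x = c * pd b f x.
Proof.
move=> sf; rewrite /pd deriveZ//; apply: diff_derivable.
by apply: (smooth_on_differentiable (U := setT)).
Qed.

Lemma pdB b f g x : smooth_on setT f -> smooth_on setT g ->
  pd b (fun y => f y - g y) x = pd b f x - pd b g x.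
Proof.
move=> sf sg; rewrite /pd deriveB//; apply: diff_derivable;
  by apply: (smooth_on_differentiable (U := setT)).
Qed.

Lemma pdM b f g x : smooth_on setT f -> smooth_on setT g ->
  pd b (fun y => f y * g y) x = f x * pd b g x + g x * pd b f x.
Proof.
move=> sf sg; rewrite /pd deriveM//; apply: diff_derivable;
  by apply: (smooth_on_differentiable (U := setT)).
Qed.

Lemma pd_sum b (I : Type) (s : seq I) (F : I -> V -> R) x :
  (forall i, smooth_on setT (F i)) ->
  pd b (fun y => \sum_(i <- s) F i y) x = \sum_(i <- s) pd b (F i) x.
Proof.
move=> sF; elim: s => [|a s IH].
  rewrite big_nil (_ : (fun y => _) = cst 0); first by rewrite /pd derive_cst.
  by apply/funext => y; rewrite big_nil.
rewrite big_cons -IH -pdD//; last exact: smooth_on_sum.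
by congr (pd b _ x); apply/funext => y; rewrite big_cons.
Qed.

(** By translation invariance the difference quotient of step t has integral 0. It differs from the
    derivative by at most C t, on the cube of half-side N + 1 that contains both supports when t <=
    1. *)
Lemma int_pd b f : test_function setT f -> \int[leb]_x pd b f x = 0.
Proof.
move=> tf; have [sf _] := tf; have [N N0 hN] := test_function_cube tf.
have tpf := test_function_pd b tf.
have [C C0 hC] := test_function_bounded (test_function_pd b tpf).
apply/eqP; rewrite -normr_le0; apply: (@le0_small _ _ (C * ((N + 1) *+ 2) ^+ n)) => t t0 t1.
pose h x := pd b f x - t^-1 * (f (x + t *: delta_mx 0 b) - f x).
have igh : ig leb (fun x => t^-1 * (f (x + t *: delta_mx 0 b) - f x)).
  by apply/igZ/igB; [exact: ig_translate (test_function_ig tf)|exact: test_function_ig].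
have ih : \int[leb]_x h x = \int[leb]_x pd b f x.
  rewrite intB//; last exact: test_function_ig.
  rewrite intZ; last by apply: igB; [exact: ig_translate (test_function_ig tf)|exact: test_function_ig].
  rewrite intB; [|exact: ig_translate (test_function_ig tf)|exact: test_function_ig].
  by rewrite int_translate ?subrr ?mulr0 ?subr0//; exact: test_function_ig.
have igH : ig leb h by apply: igB => //; exact: test_function_ig.
rewrite -ih; apply: le_trans (le_norm_int igH) _.
have -> : C * ((N + 1) *+ 2) ^+ n * t = (C * t) * ((N + 1) *+ 2) ^+ n by ring.
apply: int_cube_bound => //.
- by rewrite addr_ge0// ltW.
- by rewrite mulr_ge0// ltW.
- exact: ig_meas igH.
- move=> x nx; have nx' : ~ cube N x.
    by apply: contra_not nx => hx i; apply: le_trans (hx i) _; rewrite lerDl.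
  rewrite /h (pd_eq0 b (@cube_compact _ _ N) hN nx') (hN _ nx') (hN (x + _)) ?subrr ?mulr0 ?subr0//.
  apply: cube_shift nx => i; rewrite !mxE eqxx /= normrM (gtr0_norm t0).
  by case: (i == b); rewrite ?normr1 ?normr0 ?mulr1 ?mulr0.
- move=> x; have [s /andP[s0 st] hs] := mvt_slice x b sf t0.
  rewrite /h hs mulKf ?gt_eqF// distrC.
  have h9 := slice_lipschitz x s (smooth_on_pd b sf) hC.
  apply: (le_trans h9).
  by rewrite ger0_norm// ler_wpM2l.
Qed.

Lemma int_by_parts b f g : smooth_on setT f -> test_function setT g ->
  \int[leb]_x (f x * pd b g x) = - \int[leb]_x (pd b f x * g x).
Proof.
move=> sf tg; have [sg _] := tg.
have := int_pd b (test_functionM sf tg).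
rewrite (_ : pd b _ = fun x => f x * pd b g x + pd b f x * g x); last first.
  by apply/funext => x; rewrite pdM// (mulrC (g x)).
rewrite intD; last 2 first.
- by apply/test_function_ig/test_functionM => //; exact: test_function_pd.
- by apply/test_function_ig/test_functionM => //; exact: smooth_on_pd.
by move/eqP; rewrite addr_eq0 => /eqP.
Qed.

Definition lap f : V -> R := fun x => \sum_b pd b (pd b f) x.

Lemma test_function_lap U f : test_function U f -> test_function U (lap f).
Proof. by move=> tf; apply: test_function_sum => b _; do 2 apply: test_function_pd. Qed.

(** Integrating by parts, the cross term becomes the squared gradient and the squared Laplacian
    becomes the sum of all squared second derivatives. So v - kappa lap v controls v, its gradient
    and its Hessian together. *)
Lemma energy (kappa : R) v : test_function setT v ->
  \int[leb]_x ((v x - kappa * lap v x) ^+ 2) = \int[leb]_x (v x ^+ 2) +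
    2 * kappa * (\sum_c \int[leb]_x (pd c v x ^+ 2)) +
    kappa ^+ 2 * (\sum_c \sum_d \int[leb]_x (pd c (pd d v) x ^+ 2)).
Proof.
move=> tv; have [sv _] := tv; have tl := test_function_lap tv.
have L2v := test_function_L2 tv; have L2l := test_function_L2 tl.
rewrite (_ : (fun x => _) = fun x => (v x + - kappa * lap v x) ^+ 2); last first.
  by apply/funext => x; rewrite mulNr.
rewrite int_sqrD//; last exact: L2Z.
have h1 : \int[leb]_x (v x * lap v x) = - \sum_c \int[leb]_x (pd c v x ^+ 2).
  rewrite (_ : (fun x => _) = fun x => \sum_c (v x * pd c (pd c v) x)); last first.
    by apply/funext => x; rewrite mulr_sumr.
  rewrite int_sum; last by move=> c _; apply: L2M => //; apply: test_function_L2; do 2 apply: test_function_pd.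
  rewrite -sumrN; apply: eq_bigr => c _.
  by rewrite (int_by_parts c sv (test_function_pd c tv)).
have h2 : \int[leb]_x (lap v x ^+ 2) = \sum_c \sum_d \int[leb]_x (pd c (pd d v) x ^+ 2).
  have tpp c d : test_function setT (pd c (pd d v)) by do 2 apply: test_function_pd.
  have spp c d : smooth_on setT (pd c (pd d v)) by case: (tpp c d).
  rewrite (_ : (fun x => _) = fun x => \sum_c \sum_d (pd c (pd c v) x * pd d (pd d v) x)); last first.
    by apply/funext => x; rewrite expr2 mulr_suml; apply: eq_bigr => c _; rewrite mulr_sumr.
  rewrite int_sum; last by move=> c _; apply: ig_sum => d _; apply: L2M; exact: test_function_L2.
  apply: eq_bigr => c _.
  rewrite int_sum; last by move=> d _; apply: L2M; exact: test_function_L2.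
  apply: eq_bigr => d _.
  apply: (etrans (int_by_parts d (spp c c) (test_function_pd d tv))).
  rewrite (pd_comm d c (smooth_on_pd c sv)).
  have E := int_by_parts c (smooth_on_pd d sv) (tpp d c).
  apply: (@etrans _ _ (- \int[leb]_x (pd d v x * pd c (pd d (pd c v)) x))).
    by apply: (congr1 -%R); apply: eq_Rintegral => x _; rewrite mulrC.
  apply: (etrans (congr1 -%R E)); apply: (etrans (opprK _)).
  apply: eq_Rintegral => x _.
  by rewrite (pd_comm d c sv) expr2.
rewrite (_ : (fun x => v x * (- kappa * lap v x)) = fun x => - kappa * (v x * lap v x)); last first.
  by apply/funext => x; ring.
rewrite intZ ?h1; last exact: L2M.
rewrite (_ : (fun x => (- kappa * lap v x) ^+ 2) = fun x => kappa ^+ 2 * lap v x ^+ 2); last first.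
  by apply/funext => x; ring.
rewrite intZ ?h2; last by case: L2l.
ring.
Qed.

Lemma energy_bounds (kappa : R) v : 0 < kappa -> test_function setT v ->
  let F := N2 leb (fun x => v x - kappa * lap v x) in
  [/\ N2 leb v <= F, forall c, 2 * kappa * N2 leb (pd c v) ^+ 2 <= F ^+ 2 &
      forall c d, kappa * N2 leb (pd c (pd d v)) <= F].
Proof.
move=> k0 tv F; have hF : F ^+ 2 = _ := etrans (N2_sqr _ _) (energy kappa tv).
have s1 : 0 <= \sum_c \int[leb]_x (pd c v x ^+ 2) by apply: sumr_ge0 => c _; exact: int_sqr_ge0.
have s2 : 0 <= \sum_c \sum_d \int[leb]_x (pd c (pd d v) x ^+ 2).
  by apply: sumr_ge0 => c _; apply: sumr_ge0 => d _; exact: int_sqr_ge0.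
have F0 : 0 <= F by exact: N2_ge0.
have v0 := int_sqr_ge0 leb v.
have k1 : 0 <= 2 * kappa * \sum_c \int[leb]_x (pd c v x ^+ 2) by rewrite mulr_ge0// mulr_ge0// ltW.
have k2 : 0 <= kappa ^+ 2 * \sum_c \sum_d \int[leb]_x (pd c (pd d v) x ^+ 2).
  by rewrite mulr_ge0// sqr_ge0.
split.
- rewrite -ler_sqr ?nnegrE ?N2_ge0// N2_sqr hF; lra.
- move=> c; rewrite N2_sqr hF.
  have : 2 * kappa * \int[leb]_x (pd c v x ^+ 2) <= 2 * kappa * \sum_c \int[leb]_x (pd c v x ^+ 2).
    apply: ler_wpM2l; first by rewrite mulr_ge0// ltW.
    by apply: (@ler_sum1 _ _ (fun c => \int[leb]_x (pd c v x ^+ 2))) => i; exact: int_sqr_ge0.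
  lra.
- move=> c d; rewrite -ler_sqr ?nnegrE ?mulr_ge0 ?N2_ge0 ?(ltW k0)// exprMn N2_sqr hF.
  have : kappa ^+ 2 * \int[leb]_x (pd c (pd d v) x ^+ 2) <=
      kappa ^+ 2 * \sum_c \sum_d \int[leb]_x (pd c (pd d v) x ^+ 2).
    apply: ler_wpM2l; first exact: sqr_ge0.
    apply: le_trans (@ler_sum1 _ _ (fun c => \sum_d \int[leb]_x (pd c (pd d v) x ^+ 2)) c _).
      by apply: (@ler_sum1 _ _ (fun d => \int[leb]_x (pd c (pd d v) x ^+ 2))) => i; exact: int_sqr_ge0.
    by move=> i; apply: sumr_ge0 => ? _; exact: int_sqr_ge0.
  lra.
Qed.

Definition sdiff (t : R) b f x : R :=
  t ^- 2 * (f (x + t *: delta_mx 0 b) + f (x + (- t) *: delta_mx 0 b) - 2 * f x).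

(** Two mean value steps make the quotient a second derivative at distance at most t from x, and C
    bounds the third derivative. *)
Lemma sdiff_le b f : test_function setT f -> exists2 C : R, 0 <= C &
  forall t x, 0 < t -> `|sdiff t b f x - pd b (pd b f) x| <= C * t.
Proof.
move=> tf; have [sf _] := tf.
have tpp := test_function_pd b (test_function_pd b tf).
have [C C0 hC] := test_function_bounded (test_function_pd b tpp).
exists C => // t x t0; set e : V := delta_mx 0 b.
pose g z := f (z + t *: e) - f z.
have sg : smooth_on setT g by apply: smooth_onB => //; exact: smooth_translate.
have [s /andP[s0 st] hs] := mvt_slice (x + (- t) *: e) b sg t0.
have [s' /andP[s'0 s't] hs'] := mvt_slice (x + (- t) *: e + s *: e) b (smooth_on_pd b sf) t0.
have E : x + (- t) *: e + s *: e + s' *: e = x + (s + s' - t) *: e.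
  by rewrite -!addrA -!scalerDl; congr (_ + _ *: _); ring.
have K : x + (- t) *: e + t *: e = x by rewrite -addrA -scalerDl addNr scale0r addr0.
have -> : sdiff t b f x = pd b (pd b f) (x + (s + s' - t) *: e).
  rewrite -E; have t2 : t != 0 by rewrite gt_eqF.
  apply: (mulfI (expf_neq0 2 t2)); rewrite /sdiff mulVKf ?expf_neq0//.
  rewrite [in RHS]expr2 -mulrA -hs'.
  move: hs; rewrite /g (_ : pd b _ _ = pd b f (x + - t *: e + s *: e + t *: e) - pd b f (x + - t *: e + s *: e)).
    by move=> <-; rewrite K; ring.
  rewrite (pdB _ _ (smooth_translate _ sf) sf).
  by rewrite pd_translate.
have h9 := slice_lipschitz x (s + s' - t) (smooth_on_pd b (smooth_on_pd b sf)) hC.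
apply: (le_trans h9).
by rewrite ler_wpM2l// ler_norml; apply/andP; split; lra.
Qed.

End calculus.

Lemma neumann_arith {R : realType} (a b d c q : R) : a <= (1 - q) * d ->
  (1 - c) * q * b <= (1 - c) * q * d -> a + (1 - c) * q * b <= (1 - c * q) * d.
Proof. by move=> h1 h2; lra. Qed.

(** * Approximate resolvents of the Laplacian by a lattice random walk *)

Section resolvent.
Context {R : realType} {n : nat}.
Local Notation V := 'rV[R]_n.
Local Notation leb := (lebesgue_rV R n).
Implicit Types (f g u v w : V -> R) (x y : V).

Let oT : open [set: V]. Proof. exact: openT. Qed.

Lemma L2_translate y f : L2 leb f -> L2 leb (fun x => f (x + y)).
Proof.
move=> [mf f2]; split; first exact: (measurableT_comp mf (measurable_addrV y)).
exact: (ig_translate y f2).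
Qed.

Lemma N2_translate y f : L2 leb f -> N2 leb (fun x => f (x + y)) = N2 leb f.
Proof.
by move=> [_ f2]; rewrite /N2; congr (Num.sqrt _); exact: (int_translate y f2).
Qed.

Lemma lapD c f g x : smooth_on setT f -> smooth_on setT g ->
  lap (fun y => f y + c * g y) x = lap f x + c * lap g x.
Proof.
move=> sf sg; have scg : smooth_on setT (fun y => c * g y) by exact: smooth_onZ.
rewrite /lap mulr_sumr -big_split; apply: eq_bigr => b _ /=.
rewrite (_ : pd b (fun y => f y + c * g y) = fun y => pd b f y + c * pd b g y); last first.
  by apply/funext => y; rewrite pdD// pdZ.
rewrite pdD ?pdZ//; try exact: smooth_on_pd.
by apply: smooth_onZ => //; exact: smooth_on_pd.
Qed.

Section lattice.
Variables (t : R).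

(* one step of the simple random walk of mesh [t] *)
Definition walk f x : R :=
  (2 * n%:R)^-1 * \sum_b (f (x + t *: delta_mx 0 b) + f (x + (- t) *: delta_mx 0 b)).

Definition dlap f x : R := \sum_b sdiff t b f x.

Lemma dlap_walk f x : (0 < n)%N -> dlap f x = t ^- 2 * (2 * n%:R) * (walk f x - f x).
Proof.
move=> n0; have nz : (2 * n%:R : R) != 0 by rewrite mulf_neq0// pnatr_eq0 -lt0n.
rewrite /dlap /walk -mulrA mulrBr mulVKf// -mulr_sumr big_split /= big_split /=.
by rewrite sumr_const card_ord -mulr_natl; ring.
Qed.

Lemma dlapD c f g x : dlap (fun y => f y + c * g y) x = dlap f x + c * dlap g x.
Proof.
rewrite /dlap mulr_sumr -big_split; apply: eq_bigr => b _ /=; rewrite /sdiff; ring.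
Qed.

Lemma walk_lin a c f g x :
  walk (fun y => a * f y + c * g y) x = a * walk f x + c * walk g x.
Proof.
rewrite /walk; set k := (_)^-1; set A := \sum_b (f _ + _); set B := \sum_b (g _ + _).
rewrite (_ : \sum_b _ = a * A + c * B); first by ring.
rewrite /A /B !mulr_sumr -big_split; apply: eq_bigr => b _ /=; ring.
Qed.

Lemma test_function_walk f : test_function setT f -> test_function setT (walk f).
Proof.
move=> tf; apply: test_functionZ; apply: test_function_sum => b _.
by apply: test_functionD; exact: test_function_translate.
Qed.

Lemma N2_walk f : (0 < n)%N -> L2 leb f -> N2 leb (walk f) <= N2 leb f.
Proof.
move=> n0 Lf; have n0' : 0 < (n%:R : R) by rewrite ltr0n.
rewrite /walk N2Z; last by apply: L2_sum => b _; apply: L2D; exact: L2_translate.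
rewrite gtr0_norm ?invr_gt0 ?mulr_gt0// ler_pdivrMl ?mulr_gt0//.
apply: le_trans (@N2_sum _ _ _ leb _ _ xpredT (fun b x => f (x + t *: delta_mx 0 b) +
    f (x + (- t) *: delta_mx 0 b)) _) _.
  by move=> b _; apply: L2D; exact: L2_translate.
have -> : 2 * n%:R * N2 leb f = \sum_(b < n) (N2 leb f + N2 leb f).
  by rewrite sumr_const card_ord -mulr_natr; ring.
apply: ler_sum => b _; apply: le_trans (N2D _ _) _; [exact: L2_translate|exact: L2_translate|].
by rewrite !N2_translate.
Qed.

Lemma lap_walk f x : smooth_on setT f -> lap (walk f) x = walk (lap f) x.
Proof.
move=> sf; have str y : smooth_on setT (fun z => f (z + y)) by exact: smooth_translate.
rewrite {1}/lap (eq_bigr (fun a => (2 * n%:R)^-1 * \sum_b (pd a (pd a f) (x + t *: delta_mx 0 b) +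
    pd a (pd a f) (x + (- t) *: delta_mx 0 b)))).
  rewrite -mulr_sumr exchange_big; congr (_ * _); apply: eq_bigr => b _.
  by rewrite big_split.
move=> a _.
have step (g : V -> R) y : smooth_on setT g -> pd a (walk g) y = walk (pd a g) y.
  move=> sg; rewrite /walk pdZ; last first.
    by apply: smooth_on_sum => // b _; apply: smooth_onD => //; exact: smooth_translate.
  congr (_ * _); rewrite pd_sum; last first.
    by move=> b; apply: smooth_onD => //; exact: smooth_translate.
  apply: eq_bigr => b _; rewrite pdD; [|exact: smooth_translate..].
  by rewrite !pd_translate.
rewrite (_ : pd a (walk f) = walk (pd a f)); last by apply/funext => y; exact: step.
by rewrite step//; exact: smooth_on_pd.
Qed.

Lemma dlap_walkC f x : (0 < n)%N -> dlap (walk f) x = walk (dlap f) x.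
Proof.
move=> n0; rewrite dlap_walk//.
rewrite (_ : dlap f = fun y => t ^- 2 * (2 * n%:R) * walk f y + - (t ^- 2 * (2 * n%:R)) * f y).
  by rewrite walk_lin; ring.
by apply/funext => y; rewrite dlap_walk//; ring.
Qed.

Definition lap_err f x := dlap f x - lap f x.

(** Both Laplacians are translation invariant, hence commute with the walk. As the walk contracts
    the L2 norm, the consistency error does not grow along the Neumann series. *)
Lemma lap_err_walk f x : (0 < n)%N -> smooth_on setT f ->
  lap_err (walk f) x = walk (lap_err f) x.
Proof.
move=> n0 sf; rewrite /lap_err dlap_walkC// lap_walk//.
rewrite (_ : (fun y => _) = fun y => 1 * dlap f y + (-1) * lap f y); last first.
  by apply/funext => y; ring.
by rewrite walk_lin; ring.
Qed.

Lemma test_function_dlap f : test_function setT f -> test_function setT (dlap f).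
Proof.
move=> tf; apply: test_function_sum => b _; apply: test_functionZ.
apply: test_functionB; last exact: test_functionZ.
by apply: test_functionD; exact: test_function_translate.
Qed.

Lemma test_function_lap_err f : test_function setT f -> test_function setT (lap_err f).
Proof.
by move=> tf; apply: test_functionB; [exact: test_function_dlap|exact: test_function_lap].
Qed.

Lemma lap_err0 x : lap_err (fun=> 0) x = 0.
Proof.
rewrite /lap_err /dlap /lap !big1 ?subrr//.
  move=> b _; rewrite /pd (_ : 'D_(delta_mx 0 b) _ = fun=> 0) ?derive_cst//.
  by apply/funext => y; rewrite derive_cst.
by move=> b _; rewrite /sdiff mulr0 !addr0 subrr mulr0.
Qed.

Opaque pd N2.

(* partial sums of the Neumann series of (1 - kappa * dlap)^-1 *)
Lemma neumann (kappa : R) f : (0 < n)%N -> 0 < t -> 0 < kappa -> test_function setT f ->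
  exists2 c : R, 0 < c < 1 & forall K : nat, exists v u, [/\ test_function setT v,
    test_function setT u, N2 leb u <= N2 leb f, N2 leb (lap_err v) <= N2 leb (lap_err f) &
    forall x, v x - kappa * dlap v x = f x - c ^+ K * u x].
Proof.
move=> n0 t0 k0 tf; have n0' : 0 < (n%:R : R) by rewrite ltr0n.
(* With this L, (1 - kappa dlap) u = (1 + L) (u - c walk u) for c = L / (1 + L), so the inverse is
   (1 - c) times the sum of the c^k walk^k. The total weight of the first K terms is 1 - c^K. *)
pose L := 2 * n%:R * kappa * t ^- 2; have L0 : 0 < L.
  by rewrite /L mulr_gt0 ?mulr_gt0 ?invr_gt0 ?exprn_gt0.
pose c := L / (1 + L); have c01 : 0 < c < 1.
  by rewrite /c divr_gt0 ?addr_gt0//= ltr_pdivrMr ?addr_gt0// mul1r ltrDr.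
have cL : (1 - c) * (1 + L) = 1 by rewrite /c; field; rewrite gt_eqF// addr_gt0.
have cLc : (1 - c) * L = c by rewrite -[in RHS](mul1r c) -cL /c; field; rewrite gt_eqF// addr_gt0.
exists c => // K.
suff : exists v u, [/\ test_function setT v,
    test_function setT u, N2 leb u <= N2 leb f /\ N2 leb (lap_err u) <= N2 leb (lap_err f),
    N2 leb (lap_err v) <= (1 - c ^+ K) * N2 leb (lap_err f) &
    forall x, v x - kappa * dlap v x = f x - c ^+ K * u x].
  move=> [v [u [h1 h2 [h3 h4] h5 h6]]]; exists v, u; split; [exact: h1|exact: h2|exact: h3| |exact: h6].
  apply: le_trans h5 _; rewrite ler_piMl ?N2_ge0// gerBl exprn_ge0//.
  by case/andP: c01 => /ltW.
have /andP[c0 c1] := c01.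
elim: K => [|K [v [u [tv tu [h1 h2] h3 h4]]]].
  exists (fun=> 0), f; split; [exact: test_function0|exact: tf|by split| |].
    rewrite expr0 subrr mul0r (_ : lap_err _ = fun=> 0) ?N2_0//.
    by apply/funext => x; exact: lap_err0.
  move=> x; rewrite expr0 mul1r subrr /dlap big1 ?mulr0 ?subrr//.
  by move=> b _; rewrite /sdiff mulr0 !addr0 subrr mulr0.
(* Here [u] is the K-th iterate of the walk on f; it enters as the next term of the series, and one
   more walk step gives the new remainder. *)
exists (fun x => v x + ((1 - c) * c ^+ K) * u x), (walk u).
have cK : 0 <= (1 - c) * c ^+ K by rewrite mulr_ge0 ?exprn_ge0 ?subr_ge0// ltW.
have [su _] := tu; have [sv _] := tv.
split.
- by apply: test_functionD => //; exact: test_functionZ.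
- exact: test_function_walk.
- split; first by apply: le_trans (N2_walk n0 (test_function_L2 tu)) h1.
  rewrite (_ : lap_err (walk u) = walk (lap_err u)); last first.
    by apply/funext => x; exact: lap_err_walk.
  exact: le_trans (N2_walk n0 (test_function_L2 (test_function_lap_err tu))) h2.
- rewrite (_ : lap_err _ = fun x => lap_err v x + ((1 - c) * c ^+ K) * lap_err u x); last first.
    apply/funext => x; rewrite /lap_err dlapD (lapD _ x sv su).
    by move: (dlap v x) (dlap u x) (lap v x) (lap u x) => *; ring.
  have Lv := test_function_L2 (test_function_lap_err tv).
  have Lu := test_function_L2 (test_function_lap_err tu).
  apply: le_trans (N2D Lv (L2Z _ Lu)) _; rewrite N2Z// ger0_norm//.
  have : (1 - c) * c ^+ K * N2 leb (lap_err u) <= (1 - c) * c ^+ K * N2 leb (lap_err f).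
    exact: ler_wpM2l.
  by rewrite exprS; apply: neumann_arith; exact: h3.
- move=> x; have hx := h4 x; rewrite dlapD.
  have -> : v x + (1 - c) * c ^+ K * u x - kappa * (dlap v x + (1 - c) * c ^+ K * dlap u x) =
    (v x - kappa * dlap v x) + c ^+ K * ((1 - c) * (u x - kappa * dlap u x)).
    by move: (dlap v x) (dlap u x) => *; ring.
  rewrite hx (dlap_walk u x n0).
  have -> : kappa * (t ^- 2 * (2 * n%:R) * (walk u x - u x)) = L * (walk u x - u x).
    by rewrite /L; move: (walk u x) => *; ring.
  have -> : (1 - c) * (u x - L * (walk u x - u x)) =
     (1 - c) * (1 + L) * u x - (1 - c) * L * walk u x.
    by move: (walk u x) => *; ring.
  by rewrite cL cLc exprS; move: (walk u x) => *; ring.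
Qed.

End lattice.

(** The consistency error of [v] is bounded by that of [f] whatever the number of terms. Hence the
    mesh t can be fixed first and the number K of terms afterwards, although c tends to 1 as t tends
    to 0. *)
Lemma test_resolvent (kappa e : R) f : (0 < n)%N -> 0 < kappa -> 0 < e -> test_function setT f ->
  exists2 v, test_function setT v &
    N2 leb (fun x => v x - kappa * lap v x - f x) <= e.
Proof.
move=> n0 k0 e0 tf.
have [Cb hCb] : exists C : 'I_n -> R, forall b, 0 <= C b /\
    forall t x, 0 < t -> `|sdiff t b f x - pd b (pd b f) x| <= C b * t.
  have h b := sdiff_le b tf.
  exists (fun b => projT1 (cid2 (h b))) => b; case: (cid2 (h b)) => C C0 hC /=.
  by split.
have [N N0 hN] := test_function_cube tf.
pose C := \sum_b Cb b; have C0 : 0 <= C by apply: sumr_ge0 => b _; case: (hCb b).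
pose W : R := Num.sqrt (((N + 1) *+ 2) ^+ n); have W0 : 0 <= W by exact: sqrtr_ge0.
pose t : R := Num.min 1 (e / 2 / (kappa * C * W + 1)).
have D0 : 0 < kappa * C * W + 1 by rewrite ltr_wpDl// !mulr_ge0// ltW.
have t0 : 0 < t by rewrite /t lt_min ltr01 !divr_gt0.
have t1 : t <= 1 by rewrite /t ge_min lexx.
have herr : kappa * N2 leb (lap_err t f) <= e / 2.
  have : N2 leb (lap_err t f) <= (C * t) * W.
    apply: N2_cube_bound => //.
    - by rewrite addr_ge0// ltW.
    - by rewrite mulr_ge0// ltW.
    - exact: test_function_measurable (test_function_lap_err t tf).
    - move=> x nx; have nx' : ~ cube N x.
        by apply: contra_not nx => hx i; apply: le_trans (hx i) _; rewrite lerDl.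
      have pN b : forall x, ~ cube N x -> pd b f x = 0.
        by move=> y; apply: pd_eq0 => //; exact: cube_compact.
      have ty (s : R) b : `|s| <= t -> f (x + s *: delta_mx 0 b) = 0.
        move=> st; apply: hN; apply: cube_shift nx => i; rewrite !mxE eqxx /= normrM.
        apply: le_trans (le_trans st t1); case: (i == b); first by rewrite normr1 mulr1.
        by rewrite normr0 mulr0.
      rewrite /lap_err /dlap /lap !big1 ?subrr// => b _.
        by rewrite (pd_eq0 b (@cube_compact _ _ N) (pN b)).
      by rewrite /sdiff !ty ?normrN ?gtr0_norm// hN// mulr0 !addr0 subrr mulr0.
    - move=> x; rewrite /lap_err /dlap /lap -sumrB mulr_suml.
      apply: le_trans (ler_norm_sum _ _ _) _; apply: ler_sum => b _.
      by have [_] := hCb b; apply.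
  move=> h; apply: (@le_trans _ _ (kappa * (C * t * W))); first by rewrite ler_pM2l.
  have -> : kappa * (C * t * W) = (kappa * C * W) * t by ring.
  apply: (@le_trans _ _ ((kappa * C * W + 1) * t)).
    by rewrite ler_wpM2r ?lerDl// ltW.
  by rewrite mulrC -ler_pdivlMr// /t ge_min lexx orbT.
have [c /andP[c0 c1] hc] := neumann n0 t0 k0 tf.
have [K hK] : exists K : nat, c ^+ K * N2 leb f <= e / 2.
  have cv : (fun k => c ^+ k) @ \oo --> (0 : R) by apply: cvg_expr; rewrite gtr0_norm.
  have e3 : 0 < e / 2 / (N2 leb f + 1) by rewrite !divr_gt0// ltr_wpDl ?N2_ge0.
  have /cvgrPdist_lt /(_ _ e3) [K _ hK] := cv.
  exists K; have := hK K (leqnn K); rewrite /= sub0r normrN ger0_norm ?exprn_ge0 ?(ltW c0)//.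
  rewrite ltr_pdivlMr ?ltr_wpDl ?N2_ge0// => /ltW; apply: le_trans.
  by rewrite ler_wpM2l ?exprn_ge0 ?(ltW c0)// lerDl.
have [v [u [tv tu h1 h2 h3]]] := hc K.
exists v => //.
rewrite (_ : (fun x => _) = fun x => - c ^+ K * u x + kappa * lap_err t v x); last first.
  apply/funext => x; have := h3 x; rewrite /lap_err.
  by move: (dlap t v x) (lap v x) => p q h; clear -h; lra.
have Lu := test_function_L2 tu; have Le := test_function_L2 (test_function_lap_err t tv).
apply: le_trans (N2D (L2Z _ Lu) (L2Z _ Le)) _; rewrite !N2Z// normrN !ger0_norm ?exprn_ge0 ?(ltW c0) ?(ltW k0)//.
rewrite [e]splitr; apply: lerD.
  by apply: le_trans hK; rewrite ler_wpM2l ?exprn_ge0 ?(ltW c0).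
by apply: le_trans herr; rewrite ler_wpM2l ?(ltW k0).
Qed.

Transparent pd N2.

End resolvent.

Import HBNNSimple.

(** * Induction over L2 and density of test functions *)

Section density.
Context {R : realType} {n : nat}.
Local Notation V := 'rV[R]_n.
Local Notation leb := (lebesgue_rV R n).
Implicit Types (f g : V -> R).

Let oT : open [set: V]. Proof. exact: openT. Qed.

Lemma L2_indic (mu : {measure set V -> \bar R}) A :
  measurable A -> (mu A < +oo)%E -> L2 mu (\1_A : V -> R).
Proof.
move=> mA Afin; split; first exact: measurable_indic.
rewrite (_ : (fun x => _) = \1_A); first exact: ig_indic.
by apply/funext => x; rewrite indicE; case: (_ \in _); rewrite ?expr1n ?expr0n.
Qed.

Lemma rbox_fin a b : (leb (rbox a b : set V) < +oo)%E.
Proof.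
apply: le_lt_trans (_ : leb (cbox a b) < +oo)%E.
  apply: le_measure; rewrite ?inE; [exact: rbox_measurable| |exact: rbox_sub_cbox].
  exact: compact_rV_measurable (@cbox_compact _ _ a b).
exact: compact_lebesgue_fin (@cbox_compact _ _ a b).
Qed.

Definition nbox (N : nat) : set V := rbox (\row_i - N%:R) (\row_i N%:R).

Lemma nboxP N x : nbox N x <-> forall i, `|x 0 i| < N%:R.
Proof.
split=> h i; have := h i; rewrite !mxE rmorphN /= ratr_nat -ltr_norml//.
Qed.

Section L2_induction.
Variables (mu : {measure set V -> \bar R}) (P : (V -> R) -> Prop).
Hypothesis mu_fin : forall a b, (mu (rbox a b : set V) < +oo)%E.
Hypothesis P_D : forall f g, L2 mu f -> L2 mu g -> P f -> P g -> P (fun x => f x + g x).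
Hypothesis P_Z : forall c f, L2 mu f -> P f -> P (fun x => c * f x).
Hypothesis P_cvg : forall f (g : nat -> V -> R), L2 mu f -> (forall k, L2 mu (g k)) ->
  (forall k, P (g k)) -> (fun k => N2 mu (fun x => f x - g k x)) @ \oo --> (0 : R) -> P f.
Hypothesis P_rbox : forall a b, P (\1_(rbox a b : set V)).

Let P_0 : P (fun=> 0).
Proof.
have -> : (fun=> 0) = fun x => 0 * \1_(nbox 0) x :> R.
  by apply/funext => x; rewrite mul0r.
by apply: P_Z; [apply: L2_indic; [exact: rbox_measurable|exact: mu_fin]|exact: P_rbox].
Qed.

Let P_sum (I : Type) (s : seq I) (F : I -> V -> R) :
  (forall i, L2 mu (F i)) -> (forall i, P (F i)) -> P (fun x => \sum_(i <- s) F i x).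
Proof.
move=> LF aF; elim: s => [|a s IH].
  rewrite (_ : (fun x => _) = fun=> 0); first exact: P_0.
  by apply/funext => x; rewrite big_nil.
rewrite (_ : (fun x => _) = fun x => F a x + \sum_(i <- s) F i x); last first.
  by apply/funext => x; rewrite big_cons.
by apply: P_D => //; exact: L2_sum.
Qed.

Let P_indic N (A : set V) : measurable A -> P (\1_(A `&` nbox N)).
Proof.
have mB : measurable (nbox N) by exact: rbox_measurable.
have fin A' : measurable A' -> (mu (A' `&` nbox N) < +oo)%E.
  move=> mA; apply: le_lt_trans (mu_fin (\row_i - N%:R) (\row_i N%:R)).
  by apply: le_measure; [rewrite inE; exact: measurableI|rewrite inE|exact: subIsetr].
have LA A' : measurable A' -> L2 mu (\1_(A' `&` nbox N)).
  by move=> mA; apply: L2_indic; [exact: measurableI|exact: fin].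
rewrite {1}rboxes_gen; move: A; apply: (@dynkin_induction _ V rboxes (fun A => P (\1_(A `&` nbox N)))).
- exact: rboxes_gen.
- exact: rboxes_setI.
- by rewrite setTI; exact: P_rbox.
- by move=> _ [[a b] _ <-]; rewrite /nbox rboxI; exact: P_rbox.
- move=> S mS aS.
  have -> : \1_(~` S `&` nbox N) = (fun x => \1_(setT `&` nbox N) x + (-1) * \1_(S `&` nbox N) x) :> (V -> R).
    apply/funext => x; rewrite !indicE !in_setI in_setC in_setT.
    by case: (x \in S); case: (x \in nbox N); rewrite /= ?mulr0 ?mulr1 ?addr0 ?subrr.
  apply: P_D; [exact: LA|exact/L2Z/LA| |apply: P_Z => //; exact: LA].
  by rewrite setTI; exact: P_rbox.
- move=> F mF tF aF.
  pose G k x : R := \sum_(i < k) \1_(F i `&` nbox N) x.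
  have GE k : G k = \1_(\big[setU/set0]_(i < k) F i `&` nbox N).
    elim: k => [|k IH].
      by apply/funext => x; rewrite /G !big_ord0 set0I indic0.
    apply/funext => x; rewrite /G big_ord_recr /= -/(G k x) IH big_ord_recr /= !indicE.
    rewrite setIUl in_setU; case: (boolP (x \in F k `&` nbox N)) => [/set_mem[xF xB]|_].
      rewrite orbT (_ : (x \in _) = false) ?add0r//; apply/negbTE; rewrite notin_setE.
      rewrite -bigcup_mkord => -[[i /= ik xi] _].
      move/trivIsetP: tF => /(_ i k I I).
      by rewrite neq_ltn ik => /(_ isT) /seteqP[+ _] => /(_ x); apply.
    by rewrite orbF addr0.
  have mU : measurable (\bigcup_k F k) by exact: bigcupT_measurable.
  have mUk k : measurable (\big[setU/set0]_(i < k) F i) by exact: bigsetU_measurable.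
  have [|||| Lf cv] := @dct_N2 _ _ _ mu G (\1_(\bigcup_k F k `&` nbox N)) (\1_(nbox N)).
  + by move=> k; rewrite GE; apply: measurable_indic; exact: measurableI.
  + move=> x; rewrite indicE; case: (boolP (x \in _)) => [/set_mem[[j _ xF] xB]|].
      apply: cvg_near_cst; exists j.+1 => // k /= jk; rewrite GE indicE mem_set//.
      by split => //; rewrite -bigcup_mkord; exists j.
    rewrite notin_setE => nx; rewrite (_ : G ^~ x = fun=> 0); first exact: cvg_cst.
    apply/funext => k; rewrite GE indicE memNset// => -[].
    rewrite -bigcup_mkord => -[i _ xi] xB; apply: nx; split => //; by exists i.
  + move=> k x; rewrite GE !indicE in_setI ger0_norm//.
    by case: (_ \in _); case: (_ \in _).
  + by rewrite -(setTI (nbox N)); exact: LA.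
  apply: P_cvg cv => // k.
    by rewrite GE; apply: LA.
  by apply: P_sum => i; [by apply: LA; exact: mF|exact: aF].
Qed.

Let P_sfun N (g : {nnsfun V >-> R}) : P (fun x => g x * \1_(nbox N) x).
Proof.
pose s := finmap.enum_fset (fset_set (range g)).
have E : (fun x => g x * \1_(nbox N) x) =
    (fun x => \sum_(y <- s) (y * \1_((g @^-1` [set y]) `&` nbox N) x)).
  apply/funext => x; rewrite fimfunE fsbig_finite//= mulr_suml; apply: eq_bigr => y _.
  by rewrite indicI /= mulrA.
have mg y : measurable (g @^-1` [set y]) by exact: measurable_sfunP.
have LA y : L2 mu (\1_((g @^-1` [set y]) `&` nbox N)).
  apply: L2_indic; first by apply: measurableI => //; exact: rbox_measurable.
  apply: le_lt_trans (mu_fin (\row_i - N%:R) (\row_i N%:R)).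
  apply: le_measure; rewrite ?inE; [|exact: rbox_measurable|exact: subIsetr].
  by apply: measurableI => //; exact: rbox_measurable.
rewrite E; apply: P_sum => y; first exact: L2Z.
by apply: P_Z => //; exact: P_indic.
Qed.

Let P_nneg f : (forall x, 0 <= f x) -> L2 mu f -> P f.
Proof.
move=> f0 Lf; have [mf _] := Lf.
have mfe : measurable_fun setT (EFin \o f) by exact/measurable_EFinP.
pose g k : {nnsfun V >-> R} := nnsfun_approx measurableT mfe k.
have gf x : (fun k => g k x) @ \oo --> f x.
  have := @cvg_nnsfun_approx _ _ _ _ measurableT _ mfe (fun x _ => f0 x : (0 <= (EFin \o f) x)%E) x I.
  by move=> /fine_cvg.
have g0 k x : 0 <= g k x by [].
have gle k x : g k x <= f x.
  have nd := @nd_nnsfun_approx _ _ _ _ measurableT _ mfe.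
  rewrite -(cvg_lim _ (gf x))//; apply: nondecreasing_cvgn_le.
    by move=> i j ij; have /lefP := nd i j ij; apply.
  by apply/cvg_ex; exists (f x); exact: gf.
pose F k x := g k x * \1_(nbox k) x.
have [|||| _ cv] := @dct_N2 _ _ _ mu F f f.
- by move=> k; apply: measurable_funM => //; apply: measurable_indic; exact: rbox_measurable.
- move=> x; rewrite -[X in _ --> X]mulr1; apply: cvgM; first exact: gf.
  apply: cvg_near_cst; exists (Num.truncn `|x|).+1 => // k /= hk.
  rewrite indicE mem_set//; apply/nboxP => i.
  apply: le_lt_trans (norm_coord_le x i) _; apply: lt_le_trans (truncnS_gt _) _.
  by rewrite ler_nat.
- move=> k x; rewrite /F indicE; case: (_ \in _); rewrite ?mulr1 ?mulr0 ?normr0//.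
  by rewrite ger0_norm.
- exact: Lf.
apply: P_cvg cv => // k; last exact: P_sfun.
apply: (@L2_le _ _ _ mu _ f) => //.
  by apply: measurable_funM => //; apply: measurable_indic; exact: rbox_measurable.
move=> x; rewrite /F indicE; case: (_ \in _); rewrite ?mulr1 ?mulr0 ?normr0//.
by rewrite !ger0_norm.
Qed.

(** A property stable under linear combinations and L2 limits spreads from indicators of boxes to
    bounded measurable sets by Dynkin's argument, then to simple functions, to nonnegative functions
    by truncated simple approximation, and to differences. *)
Lemma L2_ind f : L2 mu f -> P f.
Proof.
move=> Lf; have [mf _] := Lf.
have Lp : L2 mu (fun x => Num.max (f x) 0).
  apply: (L2_le _ _ Lf); first exact: measurable_maxr.
  by move=> x; rewrite /Num.max; case: ifP => _; rewrite ?normr0.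
have Lm : L2 mu (fun x => Num.max (- f x) 0).
  apply: (L2_le _ _ Lf).
    by apply: measurable_maxr => //; exact: measurableT_comp.
  by move=> x; rewrite /Num.max; case: ifP => _; rewrite ?normrN ?normr0.
rewrite (_ : f = fun x => Num.max (f x) 0 + (-1) * Num.max (- f x) 0).
  apply: P_D => //; first exact: L2Z.
    by apply: P_nneg => // x; rewrite le_max lexx orbT.
  by apply: P_Z => //; apply: P_nneg => // x; rewrite le_max lexx orbT.
apply/funext => x; rewrite mulN1r.
by case: (leP (f x) 0) => h; [rewrite max_l ?oppr_ge0// sub0r opprK|rewrite max_r ?oppr_le0 ?ltW// subr0].
Qed.

End L2_induction.

Section approximation.
Variable mu : {measure set V -> \bar R}.
Hypothesis mu_fin : forall a b, (mu (rbox a b : set V) < +oo)%E.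

Lemma test_function_L2_measure psi : test_function setT psi -> L2 mu psi.
Proof.
move=> tp; have [C C0 hC] := test_function_bounded tp.
have [N N0 hN] := test_function_cube tp.
pose k := (Num.truncn N).+1.
have Lk : L2 mu (\1_(nbox k)) by apply: L2_indic; [exact: rbox_measurable|exact: mu_fin].
apply: (L2_le _ _ (L2Z C Lk)); first exact: test_function_measurable.
move=> x; rewrite indicE; case: (boolP (x \in _)) => [_|].
  by rewrite mulr1 (le_trans (hC x))// ler_norm.
rewrite notin_setE => nx; rewrite hN ?normr0// => hx; apply: nx; apply/nboxP => i.
exact: le_lt_trans (hx i) (truncnS_gt _).
Qed.

Definition approx2 f := forall e : R, 0 < e ->
  exists2 psi, test_function setT psi & N2 mu (fun x => f x - psi x) <= e.

Let approx2_cvg f (g : nat -> V -> R) : L2 mu f -> (forall k, L2 mu (g k)) ->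
  (forall k, approx2 (g k)) -> (fun k => N2 mu (fun x => f x - g k x)) @ \oo --> (0 : R) ->
  approx2 f.
Proof.
move=> Lf Lg ag cv e e0; have e2 : 0 < e / 2 by rewrite divr_gt0.
have /cvgrPdist_le /(_ _ e2) [k _ hk] := cv.
have [psi tpsi hpsi] := ag k _ e2; exists psi => //.
rewrite (_ : (fun x => _) = fun x => (f x - g k x) + (g k x - psi x)); last first.
  by apply/funext => x; rewrite addrA subrK.
have Lp := test_function_L2_measure tpsi.
apply: le_trans (N2D (L2B Lf (Lg k)) (L2B (Lg k) Lp)) _.
rewrite [e]splitr; apply: lerD => //.
have := hk k (leqnn k); rewrite /= sub0r normrN; apply: le_trans; exact: ler_norm.
Qed.

Let approx2D f g : L2 mu f -> L2 mu g -> approx2 f -> approx2 g ->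
  approx2 (fun x => f x + g x).
Proof.
move=> Lf Lg af ag e e0; have e2 : 0 < e / 2 by rewrite divr_gt0.
have [p tp hp] := af _ e2; have [q tq hq] := ag _ e2.
exists (fun x => p x + q x); first exact: test_functionD.
rewrite (_ : (fun x => _) = fun x => (f x - p x) + (g x - q x)); last first.
  by apply/funext => x; ring.
have Lp := test_function_L2_measure tp; have Lq := test_function_L2_measure tq.
apply: le_trans (N2D (L2B Lf Lp) (L2B Lg Lq)) _.
by rewrite [e]splitr; apply: lerD.
Qed.

Let approx2Z c f : L2 mu f -> approx2 f -> approx2 (fun x => c * f x).
Proof.
move=> Lf af e e0; have c0 : 0 < `|c| + 1 by rewrite ltr_wpDl.
have [p tp hp] := af (e / (`|c| + 1)) (divr_gt0 e0 c0).
exists (fun x => c * p x); first exact: test_functionZ.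
rewrite (_ : (fun x => _) = fun x => c * (f x - p x)); last by apply/funext => x; ring.
rewrite N2Z; last by apply: L2B => //; exact: test_function_L2_measure.
apply: (@le_trans _ _ ((`|c| + 1) * N2 mu (fun x => f x - p x))).
  by rewrite ler_wpM2r ?N2_ge0// lerDl.
by rewrite mulrC -ler_pdivlMr.
Qed.

(** As [rbump] is positive exactly on the box, 1 - exp(-k rbump) is a test function with values in
    [0,1] that converges pointwise to the indicator. *)
Let approx2_rbox a b : approx2 (\1_(rbox a b : set V)).
Proof.
pose F (k : nat) (x : V) : R := 1 - expR (- (k%:R * rbump a b x)).
have tF k : test_function setT (F k).
  split.
    apply: smooth_onB => //; first exact: smooth_on_cst.
    apply: (@smooth_on_comp1 _ _ _ oT (fun=> expR) (fun x => - (k%:R * rbump a b x)) 0%N (@expR_derivs R)).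
    apply: smooth_on_eq (smooth_onZ oT (- k%:R) (smooth_rbump a b)) => // x _.
    by rewrite mulNr.
  exists (cbox a b); split => //; first exact: cbox_compact.
  move=> x nx; rewrite /F rbump_eq0 ?mulr0 ?oppr0 ?expR0 ?subrr//.
  by move=> /rbox_sub_cbox.
have mF k : measurable_fun setT (F k) by apply: test_function_measurable; exact: tF.
have F01 k x : 0 <= F k x <= 1.
  rewrite /F gerBl expR_ge0 andbT subr_ge0 -[leRHS](@expR0 R) ler_expR oppr_le0.
  by rewrite mulr_ge0// rbump_ge0.
have [||| Lf cv] := @dct_N2 _ _ _ mu F (\1_(rbox a b)) (\1_(rbox a b)) mF.
- move=> x; rewrite indicE; case: (boolP (x \in rbox a b)) => [/set_mem xab|].
    rewrite -[X in _ --> X]subr0; apply: cvgB; first exact: cvg_cst.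
    have c0 : 0 < rbump a b x by exact: rbump_gt0.
    rewrite (_ : (fun k => _) = fun k => (expR (- rbump a b x)) ^+ k).
      apply: cvg_expr; rewrite ger0_norm ?expR_ge0//.
      by rewrite -(@expR0 R) ltr_expR oppr_lt0.
    by apply/funext => k; rewrite -mulrN expRM_natl.
  rewrite notin_setE => nx; rewrite (_ : (fun k => _) = fun=> 0); first exact: cvg_cst.
  by apply/funext => k; rewrite /F rbump_eq0// mulr0 oppr0 expR0 subrr.
- move=> k x; have /andP[F0 F1] := F01 k x; rewrite ger0_norm// indicE.
  case: (boolP (x \in rbox a b)) => //; rewrite notin_setE => nx.
  by rewrite /F rbump_eq0// mulr0 oppr0 expR0 subrr.
- apply: L2_indic; [exact: rbox_measurable|exact: mu_fin].
move=> e e0; have /cvgrPdist_le /(_ _ e0) [k _ hk] := cv.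
exists (F k) => //; have := hk k (leqnn k); rewrite /= sub0r normrN; apply: le_trans.
exact: ler_norm.
Qed.

(** General measures are allowed because density is also applied to the sum of Lebesgue measure and
    a pushforward, where one approximation controls f and f o T simultaneously. *)
Lemma test_function_dense_measure f : L2 mu f -> approx2 f.
Proof. by apply: L2_ind. Qed.

End approximation.

Lemma test_function_dense f : L2 leb f -> approx2 leb f.
Proof. by apply: test_function_dense_measure; exact: rbox_fin. Qed.

(** To keep a sup bound, f is written 2N sin h with h = asin (f / 2N), h is approximated, and sine,
    which is 1-Lipschitz and bounded by 1, is applied again. The factor 2 keeps f / 2N away from the
    endpoints -1 and 1, where asin is not smooth. *)
Lemma test_function_dense_bounded f (N M e : R) : 0 < N -> 0 < e -> (forall x, `|f x| <= N) ->
  measurable_fun setT f -> (forall x, ~ cube M x -> f x = 0) ->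
  exists psi, [/\ test_function setT psi, forall x, `|psi x| <= 2 * N &
    N2 leb (fun x => f x - psi x) <= e].
Proof.
move=> N0 e0 fN mf f0; have N2p : 0 < 2 * N by rewrite mulr_gt0.
pose h x := asin (f x / (2 * N)).
have fh x : -1 < f x / (2 * N) < 1.
  have := fN x; rewrite ltr_pdivlMr// ltr_pdivrMr// ler_norml => /andP[h1 h2].
  by clear -h1 h2 N0; apply/andP; split; lra.
have fhI x : -1 <= f x / (2 * N) <= 1 by have /andP[/ltW -> /ltW ->] := fh x.
have fhE x : f x = 2 * N * sin (h x).
  by rewrite /h asinK ?in_itv//= mulrC divfK// gt_eqF.
have mh : measurable_fun setT h.
  have masin : measurable_fun setT ((@asin R) \_ `]-1, 1[%classic).
    apply/(measurable_restrictT _ _).1; first exact: measurable_itv.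
    apply: open_continuous_measurable_fun; first exact: interval_open.
    by move=> x; rewrite inE /= in_itv /= => /continuous_asin.
  have mq : measurable_fun setT (fun x => f x / (2 * N)) by exact: measurable_funM.
  rewrite (_ : h = ((@asin R) \_ `]-1, 1[%classic) \o (fun x => f x / (2 * N))).
    exact: measurableT_comp masin mq.
  apply/funext => x; rewrite /= patchE mem_set//= in_itv /=; exact: fh.
have h0 x : ~ cube M x -> h x = 0.
  move=> /f0 fx; rewrite /h fx mul0r -[X in asin X]sin0 sinK// in_itv /=.
  by rewrite oppr_le0 andbb divr_ge0// pi_ge0.
have hb x : `|h x| <= pi / 2 by rewrite ler_norml asin_geNpi2 ?asin_lepi2.
have Lh : L2 leb h.
  split => //; apply: (@ig_bounded_cube _ _ M ((pi / 2) ^+ 2)).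
  - exact: measurable_funX.
  - by move=> x /h0 ->; rewrite expr0n.
  - by move=> x; rewrite normrX lerXn2r// nnegrE ?normr_ge0// divr_ge0// pi_ge0.
have [psi tp hp] := test_function_dense Lh (divr_gt0 e0 N2p).
exists (fun x => 2 * N * sin (psi x)); split.
- by apply: test_functionZ; exact: test_function_sin.
- by move=> x; rewrite normrM gtr0_norm// ler_piMr ?(ltW N2p)// abs_sin_le1.
- have Lp := test_function_L2 tp.
  apply: (@le_trans _ _ (N2 leb (fun x => 2 * N * (h x - psi x)))); last first.
    by rewrite N2Z ?gtr0_norm//; [rewrite mulrC -ler_pdivlMr|exact: L2B].
  apply: le_N2.
  - apply: measurable_funB => //.
    by apply: test_function_measurable; apply: test_functionZ; exact: test_function_sin.
  - move=> x; rewrite fhE -mulrBr !normrM; apply: ler_wpM2l => //; exact: sin_lipschitz.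
  - by apply: L2Z; exact: L2B.
Qed.

Lemma resolvent (kappa e : R) f : (0 < n)%N -> 0 < kappa -> 0 < e -> L2 leb f ->
  exists2 v, test_function setT v & N2 leb (fun x => v x - kappa * lap v x - f x) <= e.
Proof.
move=> n0 k0 e0 Lf; have e2 : 0 < e / 2 by rewrite divr_gt0.
have [p tp hp] := test_function_dense Lf e2.
have [v tv hv] := test_resolvent n0 k0 e2 tp; exists v => //.
rewrite (_ : (fun x => _) = fun x => (v x - kappa * lap v x - p x) - (f x - p x)); last first.
  by apply/funext => x; move: (lap v x) => z; ring.
have Lp := test_function_L2 tp; have Lv := test_function_L2 tv.
have Ll := test_function_L2 (test_function_lap tv).
apply: le_trans (N2B _ (L2B Lf Lp)) _; first exact: L2B (L2B Lv (L2Z _ Ll)) Lp.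
by rewrite [e]splitr; apply: lerD.
Qed.

End density.

(** * Fubini's theorem for kernels dominated by a product *)

Section fubini_real.
Context d (T : measurableType d) (R : realType).
Variable mu : {sigma_finite_measure set T -> \bar R}.
Variables (F : T * T -> R) (p q : T -> R).
Hypothesis mF : measurable_fun setT F.
Hypotheses (igp : ig mu p) (igq : ig mu q).
Hypothesis Fpq : forall x y, `|F (x, y)| <= p x * q y.

Let sec1 x : ig mu (fun y => F (x, y)).
Proof.
apply: (ig_le _ (Fpq x)); last exact: igZ.
exact: (measurableT_comp mF (pair1_measurable x)).
Qed.

Let sec2 y : ig mu (fun x => F (x, y)).
Proof.
apply: (@ig_le _ _ _ mu _ (fun x => q y * p x)); last exact: igZ.
  exact: (measurableT_comp mF (pair2_measurable y)).
by move=> x; rewrite mulrC.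
Qed.

Let prod_int : (mu \x mu)%E.-integrable setT (EFin \o F).
Proof.
apply/integrable12ltyP; first exact/measurable_EFinP.
have igpp := ig_norm igp; have igqq := ig_norm igq.
apply: (@le_lt_trans _ _ (\int[mu]_x ((\int[mu]_y `|q y|)%R * `|p x|)%:E)%E); last first.
  exact: integrable_lty (igZ (\int[mu]_y `|q y|) igpp).
have msec x : measurable_fun setT (fun y => `|F (x, y)|%:E).
  by apply/measurable_EFinP; apply: measurableT_comp => //; exact: ig_meas (sec1 x).
apply: ge0_le_integral => //.
- by move=> x _; exact: integral_ge0.
- apply: (measurable_fun_fubini_tonelli_F (fun z => `|(EFin \o F) z|%E)) => //.
  by apply: measurableT_comp => //; exact/measurable_EFinP.
- by apply/measurable_EFinP; exact: ig_meas (igZ _ igpp).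
- move=> x _; have E : ((\int[mu]_y `|q y|)%R * `|p x|)%:E = (\int[mu]_y (`|p x| * `|q y|)%:E)%E.
    rewrite -[RHS]fineK; last exact: integrable_fin_num (igZ `|p x| igqq).
    congr EFin; rewrite -[RHS]/(Rintegral mu setT (fun y => `|p x| * `|q y|)) intZ//.
    by rewrite mulrC.
  rewrite E; apply: ge0_le_integral => //.
  + exact: msec.
  + by apply/measurable_EFinP; exact: ig_meas (igZ _ igqq).
  + move=> y _; rewrite lee_fin; apply: le_trans (Fpq x y) _.
    by rewrite -normrM ler_norm.
Qed.

Lemma fubini_bound : ig mu (fun y => \int[mu]_x F (x, y)) /\
  \int[mu]_x \int[mu]_y F (x, y) = \int[mu]_y \int[mu]_x F (x, y).
Proof.
have E1 x : (\int[mu]_y (F (x, y))%:E)%E = (\int[mu]_y F (x, y))%R%:E.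
  by rewrite fineK//; exact: integrable_fin_num (sec1 x).
have E2 y : (\int[mu]_x (F (x, y))%:E)%E = (\int[mu]_x F (x, y))%R%:E.
  by rewrite fineK//; exact: integrable_fin_num (sec2 y).
split.
  apply: (@ig_le _ _ _ mu _ (fun y => (\int[mu]_x `|p x|) * `|q y|)).
  - apply/measurable_EFinP; have := measurable_fubini_G prod_int.
    apply: eq_measurable_fun => y _.
    by rewrite /fubini_G /= E2.
  - move=> y; apply: le_trans (le_norm_int (sec2 y)) _.
    rewrite mulrC -intZ; last exact: ig_norm.
    apply: le_int; [exact/ig_norm/sec2|by apply: igZ; exact: ig_norm|].
    by move=> x; rewrite mulrC -normrM (le_trans (Fpq x y))// ler_norm.
  - by apply: igZ; exact: ig_norm.
rewrite /Rintegral; congr fine.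
transitivity (\int[mu]_x \int[mu]_y (F (x, y))%:E)%E.
  by apply: eq_integral => x _; rewrite E1.
rewrite (Fubini prod_int).
by apply: eq_integral => y _; rewrite E2.
Qed.

End fubini_real.

(** * Translation estimates and a dual form of Rellich's theorem *)

Section rellich.
Context {R : realType} {n : nat}.
Local Notation V := 'rV[R]_n.
Local Notation leb := (lebesgue_rV R n).
Implicit Types (v w f : V -> R) (x y : V).

Let oT : open [set: V]. Proof. exact: openT. Qed.

(** A step s costs s times the norm of the derivative, up to O(s^2), by the pointwise mean value
    theorem. Cutting t into k equal steps of vanishing size, each of the same cost by translation
    invariance, removes the error term. *)
Lemma N2_slice v (b : 'I_n) (t : R) : test_function setT v ->
  N2 leb (fun x => v (x + t *: delta_mx 0 b) - v x) <= `|t| * N2 leb (pd b v).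
Proof.
move=> tv; have [sv _] := tv; have Lv := test_function_L2 tv.
wlog t0 : t / 0 < t.
  move=> h; have [t0|t0|t0] := ltgtP 0 t; first exact: h.
    have nt0 : 0 < - t by rewrite oppr_gt0.
    have := h _ nt0; rewrite normrN; apply: le_trans.
    rewrite -[leRHS](N2_translate (t *: delta_mx 0 b)); last by apply: L2B => //; exact: L2_translate.
    rewrite le_eqVlt; apply/orP; left; apply/eqP; rewrite -N2N.
    congr (N2 _ _); apply/funext => x.
    by rewrite opprB -addrA -scalerDl subrr scale0r addr0.
  rewrite -t0 normr0 mul0r (_ : (fun x => _) = fun=> 0) ?N2_0//.
  by apply/funext => x; rewrite scale0r addr0 subrr.
have tpv := test_function_pd b tv.
have [C C0 hC] := test_function_bounded (test_function_pd b tpv).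
have [N N0 hN] := test_function_cube tv.
pose W : R := Num.sqrt (((N + 1) *+ 2) ^+ n); have W0 : 0 <= W by exact: sqrtr_ge0.
have Lp := test_function_L2 tpv.
have Ls s : L2 leb (fun x => v (x + s *: delta_mx 0 b) - v x).
  by apply: L2B => //; exact: L2_translate.
have small s : 0 < s -> s <= 1 ->
    N2 leb (fun x => v (x + s *: delta_mx 0 b) - v x) <= s * (N2 leb (pd b v) + C * s * W).
  move=> s0 s1.
  rewrite (_ : (fun x => _) = fun x => s * pd b v x +
      (v (x + s *: delta_mx 0 b) - v x - s * pd b v x)); last by apply/funext => x; rewrite [RHS]addrC subrK.
  have Lr : L2 leb (fun x => v (x + s *: delta_mx 0 b) - v x - s * pd b v x).
    by apply: L2B => //; exact: L2Z.
  apply: le_trans (N2D (L2Z s Lp) Lr) _; rewrite mulrDr; apply: lerD.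
    by rewrite N2Z// gtr0_norm.
  have -> : s * (C * s * W) = (s * (C * s)) * W by ring.
  apply: N2_cube_bound.
  - by rewrite addr_ge0// ltW.
  - by rewrite !mulr_ge0// ltW.
  - by case: Lr.
  - move=> x nx; have nx' : ~ cube N x.
      by apply: contra_not nx => hx i; apply: le_trans (hx i) _; rewrite lerDl.
    rewrite (pd_eq0 b (@cube_compact _ _ N) hN nx') (hN _ nx') (hN (x + _)) ?subrr ?mulr0 ?subr0//.
    apply: cube_shift nx => i; rewrite !mxE eqxx /= normrM (gtr0_norm s0).
    by case: (i == b); rewrite ?normr1 ?normr0 ?mulr1 ?mulr0.
  - move=> x; have [r /andP[r0 rs] hr] := mvt_slice x b sv s0.
    rewrite hr -mulrBr normrM gtr0_norm//; apply: ler_wpM2l; first exact: ltW.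
    apply: le_trans (slice_lipschitz x r (smooth_on_pd b sv) hC) _.
    by rewrite ger0_norm// ler_wpM2l.
have iter_bound (s : R) (k : nat) :
    N2 leb (fun x => v (x + (k%:R * s) *: delta_mx 0 b) - v x) <=
    k%:R * N2 leb (fun x => v (x + s *: delta_mx 0 b) - v x).
  elim: k => [|k IH].
    rewrite !mul0r (_ : (fun x => _) = fun=> 0) ?N2_0//.
    by apply/funext => x; rewrite scale0r addr0 subrr.
  rewrite (_ : (fun x => v (x + (k.+1%:R * s) *: delta_mx 0 b) - v x) = fun x => (v (x + (k%:R * s) *: delta_mx 0 b + s *: delta_mx 0 b) - v (x + (k%:R * s) *: delta_mx 0 b)) +
     (v (x + (k%:R * s) *: delta_mx 0 b) - v x)); last first.
    apply/funext => x; rewrite addrA subrK -(addrA x) -scalerDl -natr1 mulrDl mul1r//.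
  apply: le_trans (N2D _ (Ls _)) _; first exact: (L2_translate ((k%:R * s) *: delta_mx 0 b) (Ls s)).
  rewrite (N2_translate ((k%:R * s) *: delta_mx 0 b) (Ls s)) -natr1 mulrDl mul1r addrC.
  by rewrite lerD2r.
rewrite gtr0_norm//; rewrite -subr_le0.
apply: (@le0_small _ _ (t * (C * W))) => r r0 r1.
pose k := (Num.truncn (Num.max t 1 / r)).+1.
have k0 : 0 < k%:R :> R by rewrite ltr0n.
have tk : Num.max t 1 / r < k%:R by exact: truncnS_gt.
have kr : t / k%:R <= r.
  rewrite ler_pdivrMr// mulrC -ler_pdivrMr//; apply: le_trans (ltW tk).
  by rewrite ler_pM2r ?invr_gt0// le_max lexx.
have sk0 : 0 < t / k%:R by rewrite divr_gt0.
have := iter_bound (t / k%:R) k; rewrite mulrC divfK ?gt_eqF// => h.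
have h2 := small _ sk0 (le_trans kr r1).
rewrite lerBlDr; apply: le_trans h _.
apply: (@le_trans _ _ (k%:R * (t / k%:R * (N2 leb (pd b v) + C * (t / k%:R) * W)))).
  by rewrite ler_pM2l.
rewrite mulrA (mulrC k%:R) divfK ?gt_eqF// mulrDr addrC lerD2r.
have -> : t * (C * (t / k%:R) * W) = t * (C * W) * (t / k%:R) by ring.
by rewrite ler_wpM2l// mulr_ge0 ?mulr_ge0// ltW.
Qed.

Lemma N2_shift v y (C : R) : test_function setT v -> (forall b, N2 leb (pd b v) <= C) ->
  N2 leb (fun x => v (x + y) - v x) <= (\sum_b `|y 0 b|) * C.
Proof.
move=> tv hC; have Lv := test_function_L2 tv.
have Ls z : L2 leb (fun x => v (x + z) - v x) by apply: L2B => //; exact: L2_translate.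
rewrite {1}[y]row_sum_delta mulr_suml; elim: (index_enum _) => [|b s IH].
  rewrite !big_nil (_ : (fun x => _) = fun=> 0) ?N2_0//.
  by apply/funext => x; rewrite addr0 subrr.
rewrite !big_cons; set Y := \sum_(j <- s) _ in IH *.
rewrite (_ : (fun x => _) = fun x => (v (x + Y + y 0 b *: delta_mx 0 b) - v (x + Y)) + (v (x + Y) - v x)); last first.
  by apply/funext => x; rewrite [RHS]addrA subrK (addrC (y 0 b *: _)) addrA.
apply: le_trans (N2D _ (Ls Y)) _; first exact: (L2_translate Y (Ls (y 0 b *: delta_mx 0 b))).
apply: lerD => //; rewrite (N2_translate Y (Ls (y 0 b *: delta_mx 0 b))).
by apply: le_trans (N2_slice b (y 0 b) tv) _; rewrite ler_wpM2l.
Qed.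

(** Averaging the translates of v over a cube amounts to averaging a: the smoothing is moved from
    the test function onto the sequence. *)
Lemma int_shift_swap (a v : V -> R) (M h : R) : L2 leb a -> (forall x, ~ cube M x -> a x = 0) ->
  test_function setT v -> 0 <= h ->
  ig leb (fun y => \1_(cube h) y * \int[leb]_x (a x * v (x + y))) /\
  \int[leb]_y (\1_(cube h) y * \int[leb]_x (a x * v (x + y))) =
  \int[leb]_z (v z * \int[leb]_x (a x * \1_(cube h) (z - x))).
Proof.
move=> La a0 tv h0; have [ma _] := La.
have mcube : measurable (cube h : set V) by exact: cube_measurable.
have mi : measurable_fun setT (\1_(cube h) : V -> R) by exact: measurable_indic.
have igi : ig leb (\1_(cube h)) by apply: ig_indic => //; exact: compact_lebesgue_fin (@cube_compact _ _ h).
have mv := test_function_measurable tv.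
have [C C0 hC] := test_function_bounded tv.
have iga : ig leb a.
  pose i x : R := \1_(cube M) x.
  have Li : L2 leb i.
    by apply: L2_indic; [exact: cube_measurable|exact: compact_lebesgue_fin (@cube_compact _ _ M)].
  have := L2M La Li; congr (ig leb _); apply/funext => x; rewrite /i indicE.
  case: (boolP (x \in cube M)) => [_|]; first by rewrite mulr1.
  by rewrite notin_setE => /a0 ->; rewrite mul0r.
have igna := ig_norm iga.
have igv := test_function_ig tv.
have madd : measurable_fun setT (fun xy : V * V => xy.1 + xy.2).
  apply: measurable_fun_rVR => i; under eq_fun do rewrite mxE.
  by apply: measurable_funD; apply: measurableT_comp (measurable_coordR i) _.
have msub : measurable_fun setT (fun xy : V * V => xy.2 - xy.1).
  apply: measurable_fun_rVR => i; under eq_fun do rewrite !mxE.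
  by apply: measurable_funB; apply: measurableT_comp (measurable_coordR i) _.
pose F (xy : V * V) := a xy.1 * (\1_(cube h) xy.2 * v (xy.1 + xy.2)).
pose G (xz : V * V) := a xz.1 * (\1_(cube h) (xz.2 - xz.1) * v xz.2).
have mF : measurable_fun setT F.
  apply: measurable_funM; first exact: measurableT_comp ma measurable_fst.
  apply: measurable_funM; first exact: measurableT_comp mi measurable_snd.
  exact: measurableT_comp mv madd.
have mG : measurable_fun setT G.
  apply: measurable_funM; first exact: measurableT_comp ma measurable_fst.
  apply: measurable_funM; first exact: measurableT_comp mi msub.
  exact: measurableT_comp mv measurable_snd.
have FB x y : `|F (x, y)| <= `|a x| * (C * \1_(cube h) y).
  rewrite /F /= !normrM ler_wpM2l// mulrC ler_pM//.
  by rewrite ger0_norm.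
have GB x z : `|G (x, z)| <= `|a x| * `|v z|.
  rewrite /G /= !normrM ler_wpM2l// ler_piMl// indicE.
  by case: (_ \in _); rewrite ?normr1 ?normr0.
have [igF SF] := fubini_bound mF igna (igZ C igi) FB.
have [_ SG] := fubini_bound mG igna (ig_norm igv) GB.
have EF y : \1_(cube h) y * \int[leb]_x (a x * v (x + y)) = \int[leb]_x F (x, y).
  rewrite -intZ; last first.
    apply: (igMb iga (C := C)); last by move=> x; exact: hC.
    exact: measurableT_comp mv (measurable_addrV y).
  by apply: eq_Rintegral => x _; rewrite /F /= mulrCA.
split; first by rewrite (funext EF).
transitivity (\int[leb]_y \int[leb]_x F (x, y)); first by apply: eq_Rintegral => y _; exact: EF.
apply: (etrans (esym SF)).
transitivity (\int[leb]_x \int[leb]_z G (x, z)); last first.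
  rewrite SG; apply: eq_Rintegral => z _; rewrite -intZ; last first.
    apply: (igMb iga (C := 1)).
      apply: measurableT_comp mi _; apply: measurable_fun_rVR => i.
      under eq_fun do rewrite !mxE.
      by apply: measurable_funB; [exact: measurable_cst|exact: measurable_coordR].
    by move=> x; rewrite indicE; case: (_ \in _); rewrite ?normr1 ?normr0.
  by apply: eq_Rintegral => x _; rewrite /G /=; ring.
apply: eq_Rintegral => x _; rewrite /F /G /=.
have igx : ig leb (fun y => a x * (\1_(cube h) y * v (x + y))).
  apply: igZ; apply: (igMb igi (C := C)); last by move=> y; exact: hC.
  by under eq_fun do rewrite addrC; exact: measurableT_comp mv (measurable_addrV x).
apply: (etrans (esym (int_translate (- x) igx))).
by apply: eq_Rintegral => z _; rewrite (addrC x) subrK.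
Qed.

(** Replacing v by its average over a cube of half-side h costs at most C n h B. The average is then
    moved onto [a j]; the averaged functions tend to 0 pointwise with a common bound and support,
    hence in L2. Therefore the smallness is uniform over the whole H^1 ball of radius B. *)
Lemma rellich (a : nat -> V -> R) (M C : R) : 0 <= M -> 0 <= C ->
  (forall j, L2 leb (a j)) -> (forall j x, ~ cube M x -> a j x = 0) ->
  (forall j, N2 leb (a j) <= C) ->
  (forall z h, 0 <= h -> (fun j => \int[leb]_x (a j x * \1_(cube h) (z - x))) @ \oo --> (0 : R)) ->
  forall kappa B : R, 0 < kappa -> 0 <= B -> \forall j \near \oo, forall v,
    test_function setT v -> N2 leb v <= B -> (forall b, N2 leb (pd b v) <= B) ->
    `|\int[leb]_x (a j x * v x)| <= kappa.
Proof.
move=> M0 C0 La a0 aC wa kappa B k0 B0.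
(* Chosen so that the averaging cost C n h B is at most kappa / 2; the 1 in the denominator avoids a
   division by 0. *)
pose h := kappa / 2 / (C * (n%:R * B) + 1).
have D0 : 0 < C * (n%:R * B) + 1 by rewrite ltr_wpDl// !mulr_ge0.
have h0 : 0 < h by rewrite /h !divr_gt0.
have hk : C * (n%:R * h * B) <= kappa / 2.
  have -> : C * (n%:R * h * B) = (C * (n%:R * B)) * h by ring.
  apply: (@le_trans _ _ ((C * (n%:R * B) + 1) * h)); first by rewrite ler_wpM2r ?lerDl// ltW.
  by rewrite mulrC /h divfK// gt_eqF.
pose Q : R := (h *+ 2) ^+ n; have Q0 : 0 < Q by rewrite exprn_gt0// mulrn_wgt0.
have mcube : measurable (cube h : set V) by exact: cube_measurable.
have igi : ig leb (\1_(cube h)) by apply: ig_indic => //; exact: compact_lebesgue_fin (@cube_compact _ _ h).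
have iQ : \int[leb]_y \1_(cube h) y = Q.
  transitivity (fine (leb (cube h : set V))); last by rewrite lebesgue_cube// ltW.
  exact: int_indic.
pose m j z := \int[leb]_x (a j x * \1_(cube h) (z - x)).
have mi : measurable_fun setT (\1_(cube h) : V -> R) by exact: measurable_indic.
have mind z : measurable_fun setT (fun x => \1_(cube h) (z - x) : R).
  apply: measurableT_comp mi _; apply: measurable_fun_rVR => i.
  under eq_fun do rewrite !mxE.
  by apply: measurable_funB => //; exact: measurable_coordR.
have Lind z : L2 leb (fun x => \1_(cube h) (z - x)).
  split => //; apply: (@ig_bounded_cube _ _ (h + `|z|) 1).
  - exact: measurable_funX.
  - move=> x nx; rewrite indicE memNset ?expr0n// => hx; apply: nx => i.
    have := hx i; rewrite !mxE => hi.
    have := ler_normB (z 0 i) (z 0 i - x 0 i); rewrite opprB addrC subrK => /le_trans; apply.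
    by rewrite addrC lerD// norm_coord_le.
  - by move=> x; rewrite indicE; case: (_ \in _); rewrite ?expr1n ?expr0n ?normr1 ?normr0.
have Nind z : N2 leb (fun x => \1_(cube h) (z - x)) <= Num.sqrt Q.
  rewrite /N2 ler_sqrt; last exact: ltW.
  rewrite (_ : (fun x => _) = fun x => (fun y => \1_(cube h) y) (x + - z)); last first.
    apply/funext => x; rewrite !indicE.
    have -> : (z - x \in cube h) = (x - z \in cube h).
      rewrite -opprB; apply/idP/idP => /set_mem hx; apply/mem_set => i; have := hx i; rewrite !mxE ?normrN//.
    by case: (_ \in _); rewrite ?expr1n ?expr0n.
  by rewrite int_translate// iQ.
have mb j z : `|m j z| <= (C * Num.sqrt Q) * \1_(cube (M + h)) z.
  rewrite indicE; case: (boolP (z \in cube (M + h))) => [_|].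
    rewrite mulr1; apply: le_trans (cauchy_schwarz (La j) (Lind z)) _.
    by apply: ler_pM => //; exact: N2_ge0.
  rewrite notin_setE mulr0 normr_le0 => nz; apply/eqP.
  rewrite /m (_ : (fun x => _) = fun=> 0) ?int0//; apply/funext => x.
  have [hx|hx] := pselect (cube h (z - x)); last by rewrite indicE memNset ?mulr0.
  rewrite a0 ?mul0r// => Mx; apply: nz => i.
  have := hx i; have := Mx i; rewrite !mxE => h1 h2.
  have := ler_normD (x 0 i) (z 0 i - x 0 i); rewrite addrC subrK => /le_trans; apply.
  exact: lerD.
have mm j : measurable_fun setT (m j).
  suff : ig leb (m j) by exact: ig_meas.
  pose G (xz : V * V) := a j xz.1 * \1_(cube h) (xz.2 - xz.1).
  have msub : measurable_fun setT (fun xy : V * V => xy.2 - xy.1).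
    apply: measurable_fun_rVR => i; under eq_fun do rewrite !mxE.
    by apply: measurable_funB; apply: measurableT_comp (measurable_coordR i) _.
  have mG : measurable_fun setT (fun xz : V * V => G xz).
    apply: measurable_funM; last exact: measurableT_comp mi msub.
    by apply: measurableT_comp measurable_fst; case: (La j).
  have iga : ig leb (a j).
    pose i x : R := \1_(cube M) x.
    have Li : L2 leb i.
      by apply: L2_indic; [exact: cube_measurable|exact: compact_lebesgue_fin (@cube_compact _ _ M)].
    have := L2M (La j) Li; congr (ig leb _); apply/funext => x; rewrite /i indicE.
    case: (boolP (x \in cube M)) => [_|]; first by rewrite mulr1.
    by rewrite notin_setE => /a0 ->; rewrite mul0r.
  have igJ : ig leb (\1_(cube (M + h)) : V -> R).
    by apply: ig_indic; [exact: cube_measurable|exact: compact_lebesgue_fin (@cube_compact _ _ _)].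
  apply: (proj1 (fubini_bound mG (ig_norm iga) igJ _)) => x z.
  rewrite /G /= normrM; have [Mx|/a0 ->] := pselect (cube M x); last by rewrite normr0 !mul0r.
  rewrite ler_wpM2l// !indicE.
  have [hx|hx] := pselect (cube h (z - x)); last by rewrite memNset// normr0.
  rewrite (mem_set hx) mem_set ?normr1// => i.
  have := hx i; have := Mx i; rewrite !mxE => h1 h2.
  have := ler_normD (x 0 i) (z 0 i - x 0 i); rewrite addrC subrK => /le_trans; apply.
  exact: lerD.
have [|||| _ cvm] := @dct_N2 _ _ _ leb m (fun=> 0) (fun z => (C * Num.sqrt Q) * \1_(cube (M + h)) z).
- exact: mm.
- by move=> z; exact: wa (ltW h0).
- exact: mb.
- apply: L2Z; apply: L2_indic; first exact: cube_measurable.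
  exact: compact_lebesgue_fin (@cube_compact _ _ _).
have e0 : 0 < Q * (kappa / 2) / (B + 1) by rewrite !divr_gt0 ?mulr_gt0 ?divr_gt0// ltr_wpDl.
have /cvgrPdist_le /(_ _ e0) := cvm; apply: filterS => j hj v tv vB pvB.
have {}hj : N2 leb (m j) <= Q * (kappa / 2) / (B + 1).
  move: hj; rewrite sub0r normrN ger0_norm ?N2_ge0//; apply: le_trans.
  rewrite (_ : (fun x => 0 - m j x) = fun x => - m j x) ?N2N//.
  by apply/funext => x; rewrite sub0r.
have Lv := test_function_L2 tv.
have Lm : L2 leb (m j).
  apply: (@L2_le _ _ _ leb _ (fun z => (C * Num.sqrt Q) * \1_(cube (M + h)) z)) => //.
    by move=> z; apply: le_trans (mb j z) _; rewrite ler_norm.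
  apply: L2Z; apply: L2_indic; first exact: cube_measurable.
  exact: compact_lebesgue_fin (@cube_compact _ _ _).
pose g y := \int[leb]_x (a j x * v (x + y)).
have gdiff y : cube h y -> `|g 0 - g y| <= kappa / 2.
  move=> hy; have Ly := L2_translate y Lv.
  have E : g 0 - g y = - \int[leb]_x (a j x * (v (x + y) - v x)).
    have -> : g 0 = \int[leb]_x (a j x * v x).
      by apply: eq_Rintegral => x _; rewrite addr0.
    rewrite -opprB; apply: (congr1 -%R); rewrite -intB; [|exact: L2M|exact: L2M].
    by apply: eq_Rintegral => x _; rewrite mulrBr.
  rewrite E normrN; apply: le_trans (cauchy_schwarz (La j) (L2B Ly Lv)) _.
  apply: le_trans hk; apply: ler_pM; rewrite ?N2_ge0//.
  apply: le_trans (N2_shift y tv pvB) _; rewrite ler_wpM2r//.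
  apply: (@le_trans _ _ (\sum_(b < n) h)); first by apply: ler_sum => b _; exact: hy.
  by rewrite sumr_const card_ord mulr_natl.
have [igG SG] := int_shift_swap (La j) (a0 j) tv (ltW h0).
have ig0 : ig leb (fun y => g 0 * \1_(cube h) y) by exact: igZ.
have ig1 : ig leb (fun y => \1_(cube h) y * (g 0 - g y)).
  by under eq_fun do rewrite mulrBr mulrC; exact: igB.
(* With Q the volume of the cube, Q <a, v> is the averaging error plus the pairing of v with the
   averaged sequence [m j]. *)
have E : Q * g 0 = \int[leb]_y (\1_(cube h) y * (g 0 - g y)) + \int[leb]_z (v z * m j z).
  rewrite -iQ mulrC -(intZ (g 0) igi); apply: esym.
  rewrite (_ : \int[leb]_z (v z * m j z) = \int[leb]_y (\1_(cube h) y * g y)); last exact: esym SG.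
  rewrite -(intD ig1 igG).
  by apply: eq_Rintegral => y _; rewrite -mulrDr subrK mulrC.
have b1 : `|\int[leb]_y (\1_(cube h) y * (g 0 - g y))| <= Q * (kappa / 2).
  apply: le_trans (le_norm_int ig1) _; rewrite mulrC -iQ -intZ//.
  apply: le_int; [exact: ig_norm|exact: igZ|].
  move=> y; rewrite indicE; have [hy|hy] := pselect (cube h y).
    by rewrite mem_set// mul1r mulr1; exact: gdiff.
  by rewrite memNset// mul0r mulr0 normr0.
have b2 : `|\int[leb]_z (v z * m j z)| <= Q * (kappa / 2).
  apply: le_trans (cauchy_schwarz Lv Lm) _.
  apply: (@le_trans _ _ (B * (Q * (kappa / 2) / (B + 1)))).
    by apply: ler_pM => //; exact: N2_ge0.
  have B1 : 0 < B + 1 by rewrite ltr_wpDl.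
  rewrite mulrA ler_pdivrMr// mulrC ler_wpM2l ?lerDl//.
  by rewrite mulr_ge0// ?divr_ge0// ltW.
have E0 : \int[leb]_x (a j x * v x) = g 0 by apply: eq_Rintegral => x _; rewrite addr0.
rewrite E0 -(ler_pM2l Q0) -[X in X * `|_|](gtr0_norm Q0) -normrM E.
apply: le_trans (ler_normD _ _) _; rewrite [in leRHS](splitr kappa) mulrDr.
exact: lerD.
Qed.

End rellich.

(** * The div-curl lemma in L2 *)

Section inner_product.
Context {R : realType} {n : nat}.
Local Notation V := 'rV[R]_n.
Local Notation leb := (lebesgue_rV R n).
Implicit Types (f g v w y : V -> R) (x : V).

Definition ip f g : R := \int[leb]_x (f x * g x).

Lemma ip_def f g : ip f g = \int[leb]_x (f x * g x).
Proof. by []. Qed.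

Lemma ipC f g : ip f g = ip g f.
Proof. by apply: eq_Rintegral => x _; rewrite mulrC. Qed.

Lemma ipBl f g h : L2 leb f -> L2 leb g -> L2 leb h ->
  ip (fun x => f x - g x) h = ip f h - ip g h.
Proof.
move=> Lf Lg Lh; rewrite /ip -intB; [|exact: L2M|exact: L2M].
by apply: eq_Rintegral => x _; rewrite mulrBl.
Qed.

Lemma ipDl f g h : L2 leb f -> L2 leb g -> L2 leb h ->
  ip (fun x => f x + g x) h = ip f h + ip g h.
Proof.
move=> Lf Lg Lh; rewrite /ip -intD; [|exact: L2M|exact: L2M].
by apply: eq_Rintegral => x _; rewrite mulrDl.
Qed.

Lemma ipZl c f h : L2 leb f -> L2 leb h -> ip (fun x => c * f x) h = c * ip f h.
Proof.
move=> Lf Lh; rewrite /ip -intZ; last exact: L2M.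
by apply: eq_Rintegral => x _; rewrite mulrA.
Qed.

Lemma ip_suml (F : 'I_n -> V -> R) h : (forall i, L2 leb (F i)) -> L2 leb h ->
  ip (fun x => \sum_i F i x) h = \sum_i ip (F i) h.
Proof.
move=> LF Lh; rewrite /ip -int_sum; last by move=> i _; exact: L2M.
by apply: eq_Rintegral => x _; rewrite mulr_suml.
Qed.

Lemma ip_cs f g a b : L2 leb f -> L2 leb g -> N2 leb f <= a -> N2 leb g <= b ->
  `|ip f g| <= a * b.
Proof.
move=> Lf Lg fa gb; apply: le_trans (cauchy_schwarz Lf Lg) _.
by apply: ler_pM => //; exact: N2_ge0.
Qed.

Lemma ip_pd b f g : test_function setT f -> test_function setT g ->
  ip f (pd b g) = - ip (pd b f) g.
Proof. by move=> [sf _] tg; exact: int_by_parts. Qed.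

Local Notation res kappa v := (fun x => v x - kappa * lap v x).

Lemma test_function_res (kappa : R) v : test_function setT v -> test_function setT (res kappa v).
Proof. by move=> tv; apply: test_functionB => //; apply: test_functionZ; exact: test_function_lap. Qed.

Lemma pd_res p (kappa : R) v : test_function setT v -> pd p (res kappa v) = res kappa (pd p v).
Proof.
move=> tv; have [sv _] := tv; have [sl _] := test_function_lap tv.
have slk : smooth_on setT (fun x => kappa * lap v x) by apply: smooth_onZ => //; exact: openT.
apply/funext => x; rewrite pdB// pdZ//; congr (_ - _ * _).
rewrite pd_sum; last by move=> b; do 2 apply: smooth_on_pd.
apply: eq_bigr => b _; rewrite (pd_comm p b (smooth_on_pd b sv)).
by rewrite (pd_comm p b sv).
Qed.

Lemma lapE v : lap v = fun x => \sum_b pd b (pd b v) x.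
Proof. by []. Qed.

Lemma pd_sin b v x : smooth_on setT v -> pd b (fun z => sin (v z)) x = cos (v x) * pd b v x.
Proof.
move=> sv; have dv : differentiable v x by apply: (smooth_on_differentiable (U := setT)).
have ds : is_derive (v x) 1 sin (cos (v x)) by exact: is_derive_sin.
have dsin : differentiable sin (v x) by apply/derivable1_diffP; exact: ex_derive.
rewrite /pd deriveE; last by apply: differentiable_comp.
rewrite (diff_comp dv dsin) /= -(deriveE _ dv) deriv1E; last exact: ex_derive.
by rewrite derive1E (@derive_val _ _ _ _ _ _ _ ds) mulrC.
Qed.

Opaque ip pd N2 lap.

Let tL f : test_function setT f -> L2 leb f. Proof. exact: test_function_L2. Qed.

Lemma ip_lap y v : test_function setT y -> test_function setT v -> ip (lap y) v = ip (lap v) y.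
Proof.
move=> ty tv.
have tp f b : test_function setT f -> test_function setT (pd b f) by exact: test_function_pd.
have E b f g : test_function setT f -> test_function setT g -> ip (pd b f) g = - ip f (pd b g).
  by move=> tf tg; rewrite ip_pd// opprK.
have S f g : test_function setT f -> test_function setT g ->
    ip (lap f) g = - \sum_b ip (pd b f) (pd b g).
  move=> tf tg; rewrite lapE; apply: (etrans (ip_suml (fun b => tL (tp _ b (tp _ b tf))) (tL tg))).
  by rewrite -sumrN; apply: eq_bigr => b _; exact: E (tp _ b tf) tg.
apply: (etrans (S _ _ ty tv)); apply: esym; apply: (etrans (S _ _ tv ty)).
apply: (congr1 -%R); apply: eq_bigr => b _; exact: ipC.
Qed.

Lemma ip_res (kappa : R) y v : test_function setT y -> test_function setT v ->
  ip (res kappa y) v = ip y v - kappa * ip (lap y) v.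
Proof.
move=> ty tv; have Ll := tL (test_function_lap ty).
apply: (etrans (ipBl (tL ty) (L2Z kappa Ll) (tL tv))).
by congr (_ - _); exact: ipZl Ll (tL tv).
Qed.

Lemma ip_res_sym (kappa : R) y v : test_function setT y -> test_function setT v ->
  ip (res kappa y) v = ip y (res kappa v).
Proof.
move=> ty tv; apply: (etrans (ip_res kappa ty tv)); apply: esym.
apply: (etrans (ipC _ _)); apply: (etrans (ip_res kappa tv ty)).
apply: (congr2 (fun a b => a - kappa * b)); [exact: ipC|exact: esym (ip_lap ty tv)].
Qed.

(** The two derivatives leave v and land on z, while the resolvent operator goes the other way. Then
    b, approximately [res kappa v], meets the gradient of a first derivative of z, where its curl
    can be used. *)
Lemma resolvent_dual (kappa : R) z v p q : test_function setT z -> test_function setT v ->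
  ip (res kappa z) (pd p (pd q v)) = ip (pd q (pd p z)) (res kappa v).
Proof.
move=> tz tv; have tzz := test_function_res kappa tz.
have tp f b : test_function setT f -> test_function setT (pd b f) by exact: test_function_pd.
apply: (etrans (ip_pd p tzz (tp _ q tv))).
rewrite (pd_res p kappa tz).
rewrite (ip_pd q (test_function_res kappa (tp _ p tz)) tv) opprK.
rewrite (pd_res q kappa (tp _ p tz)).
exact: ip_res_sym (tp _ q (tp _ p tz)) tv.
Qed.

(** The Hodge identity in components: the Laplacian of a 1-form is the gradient of its divergence
    plus the divergence of its curl. *)
Lemma lap_decomposition (v : 'I_n -> V -> R) d x : (forall p, smooth_on setT (v p)) ->
  lap (v d) x = pd d (fun z => \sum_p pd p (v p) z) x +
    \sum_p (pd p (pd p (v d)) x - pd p (pd d (v p)) x).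
Proof.
move=> sv; rewrite lapE; rewrite pd_sum; last by move=> p; exact: smooth_on_pd.
rewrite -big_split; apply: eq_bigr => p _ /=.
by rewrite (pd_comm d p (sv p)) addrC subrK.
Qed.

(** With kappa = s^2 each derivative costs a factor 1/s. The bound C + 1 comes from adding the error
    rho <= 1 to the norm of f. *)
Lemma resolvent_bounds (s C rho : R) u f : 0 < s -> rho <= 1 -> test_function setT u -> L2 leb f -> N2 leb f <= C ->
  N2 leb (fun x => res (s ^+ 2) u x - f x) <= rho ->
  [/\ N2 leb u <= C + 1, forall c, s * N2 leb (pd c u) <= C + 1 &
      forall c d, s ^+ 2 * N2 leb (pd c (pd d u)) <= C + 1].
Proof.
move=> s0 r1 tu Lf fC hu; have k0 : 0 < s ^+ 2 by rewrite exprn_gt0.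
have [h1 h2 h3] := energy_bounds k0 tu.
pose F := C + 1; have Lr := tL (test_function_res (s ^+ 2) tu).
have HF : N2 leb (res (s ^+ 2) u) <= C + 1.
  rewrite (_ : res (s ^+ 2) u = fun x => (res (s ^+ 2) u x - f x) + f x); last first.
    by apply/funext => x; rewrite subrK.
  apply: le_trans (N2D (L2B Lr Lf) Lf) _; rewrite addrC; apply: lerD => //.
  exact: le_trans r1.
split; [exact: le_trans HF| |by move=> c d; exact: le_trans (h3 c d) HF].
move=> c; apply: le_trans HF; rewrite -ler_sqr ?nnegrE; last 2 first.
- by rewrite mulr_ge0 ?N2_ge0// ltW.
- exact: N2_ge0.
apply: le_trans (h2 c); rewrite exprMn -mulrA ler_peMl ?ler1n//.
by rewrite mulr_ge0 ?sqr_ge0// ltW.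
Qed.

Let term_arith (t1 t2 t3 t4 t5 f e : R) : `|t5| <= f -> `|t4| <= f -> `|t3| <= f ->
  `|t2| <= f -> `|t1| <= e -> `|t1 + (t5 - t4) - (t3 - t2)| <= e + 4 * f.
Proof. rewrite !ler_norml; lra. Qed.

Let estimate_arith (t1 t2 t3 t4 S1 S2 r1 r2 f m e : R) : `|t1 - t2| <= e -> f <= e -> 1 <= m ->
  `|t4| <= e -> `|t3| <= e -> `|r2| <= f -> `|r1| <= f ->
  `|S2| <= m * (e + 4 * f) -> `|S1| <= m * (e + 4 * f) ->
  `|t3 - (t1 + S1) - r1 - (t4 - (t2 + S2) - r2)| <= (5 + 10 * m) * e.
Proof.
move=> h1 h2 m1 h3 h4 h5 h6 h7 h8.
have h9 : m * (e + 4 * f) <= 5 * (m * e) by nra.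
have -> : (5 + 10 * m) * e = 5 * e + 10 * (m * e) by ring.
move: h1 h3 h4 h5 h6 (le_trans h7 h9) (le_trans h8 h9); rewrite !ler_norml; move: (m * e) => me.
clear -h2 m1; lra.
Qed.

Section estimate.
(* [D], [L] and [J] are [pd], [lap] and [ip]: as variables they do not unfold. *)
Variables (D : 'I_n -> (V -> R) -> V -> R) (L : (V -> R) -> V -> R) (J : (V -> R) -> (V -> R) -> R).
Hypotheses (DE : D = @pd R n) (LE : L = @lap R n) (JE : J = ip).
Local Notation Res kappa v := (fun x => v x - kappa * L v x).
Variables (a b v z : 'I_n -> V -> R) (s C rho e : R).
Let kappa := s ^+ 2.
Let F := C + 1.
Hypotheses (s0 : 0 < s) (C0 : 0 <= C) (r0 : 0 <= rho) (r1 : rho <= 1) (rF : rho * F <= e).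
Hypotheses (La : forall c, L2 leb (a c)) (Lb : forall c, L2 leb (b c)).
Hypotheses (aC : forall c, N2 leb (a c) <= C) (bC : forall c, N2 leb (b c) <= C).
Hypotheses (tv : forall c, test_function setT (v c)) (tz : forall c, test_function setT (z c)).
Hypothesis hv : forall c, N2 leb (fun x => Res kappa (v c) x - b c x) <= rho.
Hypothesis hz : forall c, N2 leb (fun x => Res kappa (z c) x - a c x) <= rho.
Hypothesis hA : forall c d w, test_function setT w -> N2 leb w <= s * (n%:R * F) ->
  (forall q, N2 leb (D q w) <= n%:R * F) -> `|J (a c) (D d w) - J (a d) (D c w)| <= e.
Hypothesis hB : forall c d w, test_function setT w -> N2 leb w <= s * (n%:R * F) ->
  (forall q, N2 leb (D q w) <= n%:R * F) -> `|J (b c) (D d w) - J (b d) (D c w)| <= e.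
Hypothesis hR : forall c d, `|J (a c) (v d)| <= e.

Let F0 : 0 < F. Proof. by rewrite /F ltr_wpDl. Qed.
Let k0 : 0 < kappa. Proof. by rewrite exprn_gt0. Qed.
Let tp p f : test_function setT f -> test_function setT (D p f).
Proof. by rewrite DE; exact: test_function_pd. Qed.
Let JC f g : J f g = J g f. Proof. by rewrite JE; exact: ipC. Qed.
Let JB f g h : L2 leb f -> L2 leb g -> L2 leb h -> J (fun x => f x - g x) h = J f h - J g h.
Proof. by rewrite JE; exact: ipBl. Qed.
Let JD f g h : L2 leb f -> L2 leb g -> L2 leb h -> J (fun x => f x + g x) h = J f h + J g h.
Proof. by rewrite JE; exact: ipDl. Qed.
Let JZ c f h : L2 leb f -> L2 leb h -> J (fun x => c * f x) h = c * J f h.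
Proof. by rewrite JE; exact: ipZl. Qed.
Let JS (G : 'I_n -> V -> R) h : (forall i, L2 leb (G i)) -> L2 leb h ->
  J (fun x => \sum_i G i x) h = \sum_i J (G i) h.
Proof. by rewrite JE; exact: ip_suml. Qed.
Let Jcs f g t t' : L2 leb f -> L2 leb g -> N2 leb f <= t -> N2 leb g <= t' -> `|J f g| <= t * t'.
Proof. by rewrite JE; exact: ip_cs. Qed.
Let DZ p t f x : test_function setT f -> D p (fun z => t * f z) x = t * D p f x.
Proof. by rewrite DE => -[sf _]; exact: pdZ. Qed.
Let DS p (G : 'I_n -> V -> R) x : (forall i, test_function setT (G i)) ->
  D p (fun z => \sum_i G i z) x = \sum_i D p (G i) x.
Proof. by rewrite DE => h; apply: pd_sum => i; case: (h i). Qed.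
Let tLap f : test_function setT f -> test_function setT (L f).
Proof. by rewrite LE; exact: test_function_lap. Qed.
Let tRes f : test_function setT f -> test_function setT (Res kappa f).
Proof. by rewrite LE; exact: test_function_res. Qed.
Let Jdual f g p q : test_function setT f -> test_function setT g ->
  J (Res kappa f) (D p (D q g)) = J (D q (D p f)) (Res kappa g).
Proof. by rewrite JE DE LE; exact: resolvent_dual. Qed.

Let bounds u f : test_function setT u -> L2 leb f -> N2 leb f <= C ->
  N2 leb (fun x => Res kappa u x - f x) <= rho ->
  [/\ N2 leb u <= F, forall c, s * N2 leb (D c u) <= F &
      forall c d, kappa * N2 leb (D c (D d u)) <= F].
Proof. by rewrite DE LE; exact: resolvent_bounds. Qed.

Let n0 (c : 'I_n) : 1 <= n%:R :> R.
Proof. by case: (n) c => [[]//|m] _; rewrite ler1n. Qed.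

(** Replace [a c] by the resolvent expression of [z c], move the derivatives by duality, and replace
    the resolvent expressions of [v d] and [v p] by [b d] and [b p]. What remains is the curl of b
    tested with [w], and each of the four replacements costs at most rho F. *)
Let term c d p :
  `|kappa * (J (a c) (D p (D p (v d))) - J (a c) (D p (D d (v p))))| <= e + 4 * (rho * F).
Proof.
have [_ z1 z2] := bounds (tz c) (La c) (aC c) (hz c).
have vb q := bounds (tv q) (Lb q) (bC q) (hv q).
pose r' := fun x => Res kappa (z c) x - a c x.
pose r q := fun x => Res kappa (v q) x - b q x.
have LZ := tL (tRes (tz c)).
have LV q := tL (tRes (tv q)).
have Lr' : L2 leb r' := L2B LZ (La c).
have Lr q : L2 leb (r q) := L2B (LV q) (Lb q).
have LB q f : L2 leb f -> J f (Res kappa (v q)) = J f (b q) + J f (r q).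
  move=> Lf; rewrite (JC f (b q)) (JC f (r q)) -JD// JC.
  by congr J; apply/funext => x; rewrite /r [RHS]addrC subrK.
have LA f : L2 leb f -> J (a c) f = J (Res kappa (z c)) f - J r' f.
  move=> Lf; rewrite -JB//; congr J; apply/funext => x; rewrite /r'.
  by rewrite opprB [RHS]addrC subrK.
have Lpp q1 q2 u : test_function setT u -> L2 leb (D q1 (D q2 u)).
  by move=> tu; apply: tL; do 2 apply: tp.
(* The factor kappa = s^2 makes w of order s in L2 while its gradient stays bounded, which is the
   regime covered by [hB]. *)
pose w := fun x => kappa * D p (z c) x.
have tw : test_function setT w by apply: test_functionZ; exact: tp.
have pw q : D q w = fun x => kappa * D q (D p (z c)) x.
  by apply/funext => x; apply: DZ; exact: tp.
have E : kappa * (J (a c) (D p (D p (v d))) - J (a c) (D p (D d (v p)))) =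
   (J (b d) (D p w) - J (b p) (D d w)) +
   (kappa * J (D p (D p (z c))) (r d) - kappa * J (D d (D p (z c))) (r p)) -
   (kappa * J r' (D p (D p (v d))) - kappa * J r' (D p (D d (v p)))).
  rewrite (LA (D p (D p (v d))))//; last exact: Lpp.
  rewrite (LA (D p (D d (v p))))//; last exact: Lpp.
  rewrite (Jdual p p (tz c) (tv d)) (Jdual p d (tz c) (tv p)).
  rewrite (LB d); last exact: Lpp.
  rewrite (LB p); last exact: Lpp.
  rewrite !pw (JC (b d)) (JC (b p)) JZ//; last exact: Lpp.
  rewrite JZ//; last exact: Lpp.
  move: (J (D p (D p (z c))) (b d)) (J (D d (D p (z c))) (b p)) => t1 t2.
  move: (J (D p (D p (z c))) (r d)) (J (D d (D p (z c))) (r p)) => t3 t4.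
  move: (J r' _) (J r' _) => t5 t6; ring.
have small f g : L2 leb f -> L2 leb g -> kappa * N2 leb f <= F -> N2 leb g <= rho ->
    `|kappa * J f g| <= rho * F.
  move=> Lf Lg hf hg; rewrite normrM gtr0_norm//.
  apply: (@le_trans _ _ (kappa * (N2 leb f * rho))).
    by rewrite ler_pM2l//; apply: Jcs.
  by rewrite mulrA mulrC ler_wpM2l.
have s1 := small _ _ (Lpp p p _ (tz c)) (Lr d) (z2 p p) (hv d).
have s2 := small _ _ (Lpp d p _ (tz c)) (Lr p) (z2 d p) (hv p).
have [_ _ vd2] := vb d; have [_ _ vp2] := vb p.
have s3 := small _ _ (Lpp p p _ (tv d)) Lr' (vd2 p p) (hz c).
have s4 := small _ _ (Lpp p d _ (tv p)) Lr' (vp2 p d) (hz c).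
rewrite JC in s3; rewrite JC in s4.
have s5 : `|J (b d) (D p w) - J (b p) (D d w)| <= e.
  apply: hB => //.
    rewrite N2Z; last exact: tL (tp p (tz c)).
    rewrite gtr0_norm// /kappa expr2 -mulrA ler_pM2l//.
    by apply: le_trans (z1 p) _; rewrite ler_peMl// ?(ltW F0)// (n0 c).
  move=> q; rewrite pw N2Z; last exact: Lpp.
  rewrite gtr0_norm//; apply: le_trans (z2 q p) _.
  by rewrite ler_peMl// ?(ltW F0)// (n0 c).
by rewrite E; exact: term_arith.
Qed.

Let vector c d : kappa * J (a c) (L (v d)) =
  J (a c) (D d (fun x => kappa * \sum_p D p (v p) x)) +
  \sum_p (kappa * (J (a c) (D p (D p (v d))) - J (a c) (D p (D d (v p))))).
Proof.
have tD : test_function setT (fun x => \sum_p D p (v p) x).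
  by apply: test_function_sum => p _; exact: tp.
have Lpp q1 q2 u : test_function setT u -> L2 leb (D q1 (D q2 u)).
  by move=> tu; apply: tL; do 2 apply: tp.
rewrite (_ : D d (fun x => kappa * _) = fun x => kappa * D d (fun x => \sum_p D p (v p) x) x); last first.
  by apply/funext => x; exact: DZ.
rewrite (JC _ (fun x => kappa * _)) JZ//; last exact: tL (tp d tD).
rewrite -mulr_sumr -mulrDr; congr (_ * _).
rewrite (_ : L (v d) = fun x => D d (fun z => \sum_p D p (v p) z) x +
    \sum_p (D p (D p (v d)) x - D p (D d (v p)) x)); last first.
  by rewrite LE DE; apply/funext => x; apply: lap_decomposition => p; case: (tv p).
rewrite JC JD//; last 2 first.
- exact: tL (tp d tD).
- by apply: L2_sum => p _; apply: L2B; exact: Lpp.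
congr (_ + _); rewrite JS//; last by move=> p; apply: L2B; exact: Lpp.
apply: eq_bigr => p _; rewrite JB//; [|exact: Lpp|exact: Lpp].
by rewrite JC (JC (D p (D d (v p)))).
Qed.

(** Write b as v - kappa lap v minus a remainder and split the Laplacian. The five unit terms are
    two pairings <a, v> controlled by [hR], one curl of a and two remainders; each of the two sums
    of n divergence-of-curl terms costs at most 5 n e. *)
Lemma div_curl_estimate c d :
  `|J (a c) (b d) - J (a d) (b c)| <= (5 + 10 * n%:R) * e.
Proof.
(* The scaled divergence of v: antisymmetrising the gradient terms yields the curl of a tested with
   u, which is of order s in L2 with bounded gradient. *)
pose u := fun x => kappa * \sum_p D p (v p) x.
have vb q := bounds (tv q) (Lb q) (bC q) (hv q).
have tD : test_function setT (fun x => \sum_p D p (v p) x).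
  by apply: test_function_sum => p _; exact: tp.
have tu : test_function setT u by exact: test_functionZ.
have pu q : D q u = fun x => kappa * \sum_p D q (D p (v p)) x.
  apply/funext => x; by rewrite /u DZ// DS// => p; exact: tp.
have sumb (G : 'I_n -> V -> R) : (forall p, L2 leb (G p)) -> (forall p, kappa * N2 leb (G p) <= F) ->
    N2 leb (fun x => kappa * \sum_p G p x) <= n%:R * F.
  move=> LG hG; rewrite N2Z; last exact: L2_sum.
  rewrite gtr0_norm//; apply: (@le_trans _ _ (kappa * \sum_p N2 leb (G p))).
    by rewrite ler_pM2l//; exact: N2_sum.
  rewrite mulr_sumr; apply: (@le_trans _ _ (\sum_(p < n) F)); first by apply: ler_sum.
  by rewrite sumr_const card_ord mulr_natl.
have hu : `|J (a c) (D d u) - J (a d) (D c u)| <= e.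
  apply: hA => //.
    rewrite /u (_ : (fun x => _) = fun x => s * (s * \sum_p D p (v p) x)); last first.
      by apply/funext => x; rewrite mulrA -expr2.
    rewrite N2Z; last by apply: L2Z; exact: tL.
    rewrite gtr0_norm// ler_pM2l// N2Z; last exact: tL.
    rewrite gtr0_norm//; apply: (@le_trans _ _ (s * \sum_p N2 leb (D p (v p)))).
      by rewrite ler_pM2l//; apply: N2_sum => p _; exact/tL/tp.
    rewrite mulr_sumr; apply: (@le_trans _ _ (\sum_(p < n) F)).
      by apply: ler_sum => p _; have [_ + _] := vb p; apply.
    by rewrite sumr_const card_ord mulr_natl.
  move=> q; rewrite pu; apply: sumb => p; first by apply: tL; do 2 apply: tp.
  by have [_ _] := vb p; apply.
pose r q := fun x => Res kappa (v q) x - b q x.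
have LV q := tL (tRes (tv q)).
have Lr q : L2 leb (r q) := L2B (LV q) (Lb q).
have Ll q : L2 leb (L (v q)) := tL (tLap (tv q)).
have EB q q' : J (a q) (b q') = J (a q) (v q') - kappa * J (a q) (L (v q')) - J (a q) (r q').
  rewrite -!(JC _ (a q)) -JZ// -JB//; [|exact: tL|exact: L2Z].
  rewrite -JB//.
  by congr J; apply/funext => x; rewrite /r opprB [RHS]addrC subrK.
have hr q q' : `|J (a q) (r q')| <= rho * F.
  have h := Jcs (La q) (Lr q') (aC q) (hv q').
  apply: le_trans h _; rewrite mulrC ler_wpM2l// /F lerDl//.
have hT q q' : `|\sum_p (kappa * (J (a q) (D p (D p (v q'))) - J (a q) (D p (D q' (v p)))))| <= n%:R * (e + 4 * (rho * F)).
  apply: le_trans (ler_norm_sum _ _ _) _.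
  apply: (@le_trans _ _ (\sum_(p < n) (e + 4 * (rho * F)))); first by apply: ler_sum => p _; exact: term.
  by rewrite sumr_const card_ord [leRHS]mulr_natl.
rewrite !EB !vector.
exact: (estimate_arith hu rF (n0 c) (hR d c) (hR c d) (hr d c) (hr c d) (hT d c) (hT c d)).
Qed.

End estimate.

(** Uniform integrability of the squares, expressed with bounded multipliers that are small in L2.
    The bound 2 accommodates multipliers of the form 1 - cos w. *)
Definition equi2 (a : nat -> 'I_n -> V -> R) := forall e : R, 0 < e -> exists2 eta : R, 0 < eta &
  forall j c psi, measurable_fun setT psi -> L2 leb psi -> (forall x, `|psi x| <= 2) -> N2 leb psi <= eta ->
    \int[leb]_x (a j c x ^+ 2 * `|psi x|) <= e.

(** This is the information that curls equi-integrable in L1 provide. The sup bound on psi is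
    essential there and prevents a direct use on H^1 functions. *)
Definition small_curl (a : nat -> 'I_n -> V -> R) := forall e : R, 0 < e -> exists2 eta : R, 0 < eta &
  forall j c d psi, test_function setT psi -> (forall x, `|psi x| <= 1) -> N2 leb psi <= eta ->
    `|ip (a j c) (pd d psi) - ip (a j d) (pd c psi)| <= e.

(** Test with sin w, which is bounded by 1. The gradient of w exceeds that of sin w by (1 - cos w)
    dw, and 1 - cos w is bounded both by 2 and by |w|, so equi-integrability makes a (1 - cos w)
    small in L2 while dw stays bounded there. *)
Lemma small_curl_trunc (a : nat -> 'I_n -> V -> R) (e C : R) : (forall j c, L2 leb (a j c)) ->
  equi2 a -> small_curl a -> 0 < e -> 0 <= C -> exists2 eta : R, 0 < eta &
  forall j c d w, test_function setT w -> N2 leb w <= eta -> (forall b, N2 leb (pd b w) <= C) ->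
    `|ip (a j c) (pd d w) - ip (a j d) (pd c w)| <= e.
Proof.
move=> La ea ca e0 C0.
have e3 : 0 < e / 3 by rewrite divr_gt0.
have C1 : 0 < C + 1 by rewrite ltr_wpDl.
pose t := e / 3 / (C + 1); have t0 : 0 < t by rewrite divr_gt0.
have tC : t * C <= e / 3.
  by rewrite /t mulrAC ler_pdivrMr// ler_wpM2l ?lerDl// ltW.
have [eta1 h1 H1] := ca _ e3.
have tt0 : 0 < t ^+ 2 / 2 by rewrite divr_gt0// exprn_gt0.
have [eta2 h2 H2] := ea _ tt0.
exists (Num.min eta1 eta2); first by rewrite lt_min h1.
move=> j c d w tw; rewrite le_min => /andP[w1 w2] wC; have [sw _] := tw.
have Lw := tL tw; have mw := test_function_measurable tw.
have ts := test_function_sin tw.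
have ms := test_function_measurable ts.
have Ns : N2 leb (fun x => sin (w x)) <= N2 leb w.
  by apply: le_N2 => // x; exact: abs_sin_le.
have mc : measurable_fun setT (fun x => 1 - cos (w x)).
  apply: measurable_funB; first exact: measurable_cst.
  by apply: measurableT_comp mw; exact: continuous_measurable_fun (@continuous_cos R).
have cb x : `|1 - cos (w x)| <= 2.
  by have := abs_cos_le1 (w x); rewrite !ler_norml; lra.
have Lc : L2 leb (fun x => 1 - cos (w x)).
  by apply: (L2_le mc _ Lw) => x; exact: abs_1cos_le.
have Nc : N2 leb (fun x => 1 - cos (w x)) <= N2 leb w.
  by apply: le_N2 => // x; exact: abs_1cos_le.
have Lac q : L2 leb (fun x => a j q x * (1 - cos (w x))) by exact: (L2Mb (La j q) mc cb).
have Nac q : N2 leb (fun x => a j q x * (1 - cos (w x))) <= t.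
  rewrite -ler_sqr ?nnegrE ?N2_ge0 ?(ltW t0)// N2_sqr.
  have [ma iga] := La j q.
  have igp : ig leb (fun x => a j q x ^+ 2 * `|1 - cos (w x)|).
    apply: (igMb (C := 2) iga); first exact: measurableT_comp.
    by move=> x; rewrite normr_id.
  apply: (@le_trans _ _ (\int[leb]_x (2 * (a j q x ^+ 2 * `|1 - cos (w x)|)))).
    apply: le_int; [by case: (Lac q)|exact: igZ|].
    move=> x; rewrite exprMn [leRHS]mulrCA; apply: ler_wpM2l; first exact: sqr_ge0.
    by rewrite -real_normK ?num_real// expr2 ler_wpM2r.
  rewrite intZ// -ler_pdivlMl// mulrC.
  by apply: H2 => //; exact: le_trans w2.
have Lpw q := tL (test_function_pd q tw).
have ES q q' : ip (a j q) (pd q' w) = ip (a j q) (pd q' (fun x => sin (w x))) +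
    ip (fun x => a j q x * (1 - cos (w x))) (pd q' w).
  have Lps := tL (test_function_pd q' ts).
  rewrite ip_def ip_def ip_def -intD; [|exact: (L2M (La j q) Lps)|exact: (L2M (Lac q) (Lpw q'))].
  apply: eq_Rintegral => x _; rewrite (pd_sin q' x sw).
  by move: (pd q' w x) => y; ring.
have B q q' : `|ip (fun x => a j q x * (1 - cos (w x))) (pd q' w)| <= e / 3.
  exact: le_trans (ip_cs (Lac q) (Lpw q') (Nac q) (wC q')) tC.
have A := H1 j c d _ ts (fun x => abs_sin_le1 (w x)) (le_trans Ns w1).
rewrite (ES c d) (ES d c); move: A (B c d) (B d c).
move: (ip _ _) (ip _ _) (ip _ _) (ip _ _) => t1 t2 t3 t4; rewrite !ler_norml; clear; lra.
Qed.

(** The curl moduli fix s, then rho is chosen, and j comes last. The resolvents v and z depend on j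
    but their H^1 bound B does not, which is why [rellich] has to be uniform over test functions. *)
Lemma div_curl (a b : nat -> 'I_n -> V -> R) (M C : R) : 0 <= M -> 0 <= C ->
  (forall j c, L2 leb (a j c)) -> (forall j c, L2 leb (b j c)) ->
  (forall j c, N2 leb (a j c) <= C) -> (forall j c, N2 leb (b j c) <= C) ->
  (forall j c x, ~ cube M x -> a j c x = 0) ->
  equi2 a -> small_curl a -> equi2 b -> small_curl b ->
  (forall c z h, 0 <= h ->
    (fun j => \int[leb]_x (a j c x * \1_(cube h) (z - x))) @ \oo --> (0 : R)) ->
  forall c d, (fun j => ip (a j c) (b j d) - ip (a j d) (b j c)) @ \oo --> (0 : R).
Proof.
move=> M0 C0 La Lb aC bC a0 ea ca eb cb wa c d.
have n0 : (0 < n)%N by case: (n) c => // -[].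
have nr : 0 < n%:R :> R by rewrite ltr0n.
apply/cvgrPdist_le => e e0.
have D0 : 0 < 5 + 10 * n%:R :> R by rewrite ltr_wpDr// mulr_ge0.
pose e' := e / (5 + 10 * n%:R); have e'0 : 0 < e' by rewrite divr_gt0.
pose F := C + 1; have F0 : 0 < F by rewrite ltr_wpDl.
have nF : 0 < n%:R * F by rewrite mulr_gt0.
have [ea1 a1 Ha] := small_curl_trunc La ea ca e'0 (ltW nF).
have [eb1 b1 Hb] := small_curl_trunc Lb eb cb e'0 (ltW nF).
(* Test functions of L2 size s n F are then below both curl thresholds. *)
pose s := Num.min ea1 eb1 / (n%:R * F).
have s0 : 0 < s by rewrite divr_gt0// lt_min a1.
have sE : s * (n%:R * F) = Num.min ea1 eb1 by rewrite divfK// gt_eqF.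
pose rho := Num.min 1 (e' / F).
have r0 : 0 < rho by rewrite lt_min ltr01 divr_gt0.
have r1 : rho <= 1 by rewrite ge_min lexx.
have rF : rho * F <= e' by rewrite -ler_pdivlMr// ge_min lexx orbT.
have k0 : 0 < s ^+ 2 by rewrite exprn_gt0.
pose B := Num.max F (F / s).
have B0 : 0 <= B by rewrite le_max (ltW F0).
have rel c' := rellich M0 C0 (fun j => La j c') (fun j => a0 j c') (fun j => aC j c') (wa c') e'0 B0.
near=> j.
have /choice[v hv] c' : exists v, test_function setT v /\
    N2 leb (fun x => v x - s ^+ 2 * lap v x - b j c' x) <= rho.
  by have [v tv hv] := resolvent n0 k0 r0 (Lb j c'); exists v.
have /choice[z hz] c' : exists v, test_function setT v /\
    N2 leb (fun x => v x - s ^+ 2 * lap v x - a j c' x) <= rho.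
  by have [z tz hz] := resolvent n0 k0 r0 (La j c'); exists z.
rewrite sub0r normrN.
have -> : e = (5 + 10 * n%:R) * e' by rewrite mulrC divfK// gt_eqF.
apply: (@div_curl_estimate (@pd R n) (@lap R n) ip erefl erefl erefl (a j) (b j) v z s C rho e') => //.
- exact: ltW.
- by move=> q; case: (hv q).
- by move=> q; case: (hz q).
- by move=> q; case: (hv q).
- by move=> q; case: (hz q).
- move=> q q' w tw; rewrite sE le_min => /andP[w1 _]; exact: Ha.
- move=> q q' w tw; rewrite sE le_min => /andP[_ w1]; exact: Hb.
- move=> q q'; have [tv hvq] := hv q'.
  have [v1 v2 _] := resolvent_bounds s0 r1 tv (Lb j q') (bC j q') hvq.
  have H : forall c' v, test_function setT v -> N2 leb v <= B -> (forall b, N2 leb (pd b v) <= B) ->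
    `|\int[leb]_x (a j c' x * v x)| <= e'.
    by near: j; apply: filter_forall => c'; exact: rel.
  rewrite ip_def; apply: H => //.
    by rewrite le_max v1.
  by move=> q''; rewrite le_max ler_pdivlMr// mulrC v2 orbT.
Unshelve. all: by end_near.
Qed.

End inner_product.
Transparent ip pd N2 lap.

(** * Elementary inequalities for powers and limits *)

Lemma sqr_le_powR {R : realType} (p L a : R) : 2 < p -> 0 < L -> L <= a ->
  a ^+ 2 * L `^ (p - 2) <= a `^ p.
Proof.
move=> p2 L0 La; have a0 : 0 <= a by apply: le_trans La; exact: ltW.
have an0 : a != 0 by rewrite gt_eqF// (lt_le_trans L0).
have -> : a `^ p = a `^ 2 * a `^ (p - 2) by rewrite -powRD ?subrKC ?an0 ?implybT.
rewrite -powR_mulrn// ler_wpM2l ?powR_ge0// ge0_ler_powR// ?nnegrE ?(ltW L0)// subr_ge0 ltW//.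
Qed.

Lemma abs_wedge_le {R : realType} (a b c d : R) :
  `|a * b - c * d| <= a ^+ 2 + b ^+ 2 + (c ^+ 2 + d ^+ 2).
Proof.
have h1 := sqr_ge0 (a + b); have h2 := sqr_ge0 (a - b).
have h3 := sqr_ge0 (c + d); have h4 := sqr_ge0 (c - d).
have h5 := sqr_ge0 a; have h6 := sqr_ge0 b; have h7 := sqr_ge0 c; have h8 := sqr_ge0 d.
rewrite ler_norml; apply/andP; split; nra.
Qed.

Lemma lim_norm_le {R : realType} (u : nat -> R) (l e : R) :
  u @ \oo --> l -> (forall j, `|u j| <= e) -> `|l| <= e.
Proof.
move=> ul ue; have h : `|u j| @[j --> \oo] --> `|l| by exact: cvg_norm.
rewrite -(cvg_lim _ h)//; apply: limr_le.
  by apply/cvg_ex; exists `|l|.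
by apply: nearW => j; exact: ue.
Qed.

Lemma powR_le_1D {R : realType} (p q a : R) : 0 < q -> q <= p -> 0 <= a ->
  a `^ q <= 1 + a `^ p.
Proof.
move=> q0 qp a0; have [a1|a1] := leP a 1.
  apply: (@le_trans _ _ 1); last by rewrite lerDl powR_ge0.
  have <- : 1 `^ q = 1 :> R by rewrite powR1.
  by rewrite ge0_ler_powR ?nnegrE// ltW.
apply: (@le_trans _ _ (a `^ p)); last by rewrite lerDr.
by rewrite ler_powR// ltW.
Qed.

Lemma powR_D_le {R : realType} (p a b : R) : 0 < p -> 
  `|a + b| `^ p <= 2 `^ p * (`|a| `^ p + `|b| `^ p).
Proof.
move=> p0; wlog ab : a b / `|a| <= `|b|.
  move=> h; have [|/ltW] := leP `|a| `|b|; first exact: h.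
  by move=> /h; rewrite addrC (addrC (_ `^ p)).
apply: (@le_trans _ _ ((2 * `|b|) `^ p)).
  rewrite ge0_ler_powR ?nnegrE ?mulr_ge0// ?(ltW p0)//.
  by apply: le_trans (ler_normD _ _) _; rewrite mulr_natl mulr2n lerD2r.
by rewrite powRM// ler_wpM2l ?powR_ge0// lerDr powR_ge0.
Qed.

(** * L^p functions on compact sets, extended by zero *)

Section Lp_on_theory.
Context {R : realType} {n : nat}.
Local Notation V := 'rV[R]_n.
Local Notation leb := (lebesgue_rV R n).
Implicit Types (f g phi psi : V -> R) (K U : set V) (p q C : R).

Lemma restrict_eq0 K f x : ~ K x -> (f \_ K) x = 0.
Proof. by move=> nx; rewrite patchE memNset. Qed.

Lemma restrictT_eq K f x : K x -> (f \_ K) x = f x.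
Proof. by move=> Kx; rewrite patchE mem_set. Qed.

Lemma int_mkcondE K f : (\int[leb]_(x in K) (f x)%:E)%E = (\int[leb]_x ((f \_ K) x)%:E)%E.
Proof. by rewrite integral_mkcond; apply: eq_integral => x _; rewrite restrict_EFin. Qed.

Lemma ig_ge0P g : (forall x, 0 <= g x) -> measurable_fun setT g ->
  ig leb g <-> (\int[leb]_x (g x)%:E < +oo)%E.
Proof.
move=> g0 mg; have E : (\int[leb]_x `|(g x)%:E| = \int[leb]_x (g x)%:E)%E.
  by apply: eq_integral => x _ /=; rewrite ger0_norm.
split; first by move=> /integrableP[_]; rewrite E.
by move=> h; apply/integrableP; split; [exact/measurable_EFinP|rewrite E].
Qed.

(** Replaces integrals over K by integrals over the whole space of the extension by zero, the form
    in which translations and the L2 inequalities apply. *)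
Lemma Lp_onP p K f : measurable K -> 0 < p -> Lp_on p K f <->
  measurable_fun setT (f \_ K) /\ ig leb (fun x => `|(f \_ K) x| `^ p).
Proof.
move=> mK p0.
have E : (fun x => `|(f \_ K) x| `^ p) = (fun x => `|f x| `^ p) \_ K.
  apply/funext => x; rewrite !patchE; case: (x \in K) => //.
  by rewrite normr0 powR0// gt_eqF.
have mp : measurable_fun setT (f \_ K) -> measurable_fun setT (fun x => `|(f \_ K) x| `^ p).
  move=> mf; apply: (measurableT_comp (f := fun t => t `^ p)) => //.
  exact: measurableT_comp.
have EI : (\int[leb]_(x in K) (`|f x| `^ p)%:E = \int[leb]_x (`|(f \_ K) x| `^ p)%:E)%E.
  by rewrite int_mkcondE; apply: eq_integral => x _; rewrite -E.
split=> -[mf h].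
  have mf' : measurable_fun setT (f \_ K) by apply/(meas_restrictP f mK)/measurable_fun_typeR.
  split => //; apply/ig_ge0P; [by move=> x; exact: powR_ge0|exact: mp|].
  by rewrite -EI.
split; first by apply/measurable_fun_typeR/(meas_restrictP f mK).
by rewrite EI; apply/(ig_ge0P _ (mp mf)) => // x; exact: powR_ge0.
Qed.

Lemma Lp_on_intE p K f : measurable K -> 0 < p -> Lp_on p K f ->
  (\int[leb]_(x in K) (`|f x| `^ p)%:E)%E = (\int[leb]_x (`|(f \_ K) x| `^ p))%:E.
Proof.
move=> mK p0 /(Lp_onP _ mK p0)[_ h].
have E : (fun x => `|(f \_ K) x| `^ p) = (fun x => `|f x| `^ p) \_ K.
  apply/funext => x; rewrite !patchE; case: (x \in K) => //.
  by rewrite normr0 powR0// gt_eqF.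
rewrite fineK; last exact: integrable_fin_num h.
by rewrite int_mkcondE; apply: eq_integral => x _; rewrite -E.
Qed.

Lemma compact_indic_ig K : compact K -> ig leb (\1_K : V -> R).
Proof.
move=> cK; apply: ig_indic; first exact: compact_rV_measurable.
exact: compact_lebesgue_fin.
Qed.

Lemma compact_indic_L2 K : compact K -> L2 leb (\1_K : V -> R).
Proof.
move=> cK; apply: L2_indic; first exact: compact_rV_measurable.
exact: compact_lebesgue_fin.
Qed.

Lemma Lp_on_bound p K f g : measurable K -> 0 < p -> measurable_fun setT (f \_ K) ->
  (forall x, K x -> `|f x| `^ p <= g x) -> (forall x, 0 <= g x) -> ig leb g -> Lp_on p K f.
Proof.
move=> mK p0 mf fg g0 gi; apply/(Lp_onP _ mK p0); split => //.
apply: (ig_le _ _ gi).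
  apply: (measurableT_comp (f := fun t => t `^ p)) => //; exact: measurableT_comp.
move=> x; rewrite ger0_norm ?powR_ge0//.
have [Kx|nKx] := pselect (K x); first by rewrite restrictT_eq//; exact: fg.
by rewrite restrict_eq0// normr0 powR0 ?gt_eqF.
Qed.

Lemma Lp_on_exp p q K f : compact K -> 0 < q -> q <= p -> Lp_on p K f -> Lp_on q K f.
Proof.
move=> cK q0 qp hf; have mK := compact_rV_measurable cK.
have p0 : 0 < p by exact: lt_le_trans qp.
have [mf fi] := (Lp_onP _ mK p0).1 hf.
apply: (Lp_on_bound mK q0 mf (g := fun x => \1_K x + `|(f \_ K) x| `^ p)).
- move=> x Kx; rewrite indicE mem_set// restrictT_eq//; exact: powR_le_1D.
- by move=> x; rewrite addr_ge0// powR_ge0.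
- by apply: igD => //; exact: compact_indic_ig.
Qed.

Lemma Lp_on_bounded q K f C : compact K -> 0 < q -> measurable_fun setT (f \_ K) ->
  (forall x, K x -> `|f x| <= C) -> Lp_on q K f.
Proof.
move=> cK q0 mf fC; have mK := compact_rV_measurable cK.
apply: (Lp_on_bound mK q0 mf (g := fun x => `|C| `^ q * \1_K x)).
- move=> x Kx; rewrite indicE mem_set// mulr1 ge0_ler_powR ?nnegrE ?(ltW q0)//.
  by apply: le_trans (fC x Kx) _; exact: ler_norm.
- by move=> x; rewrite mulr_ge0// powR_ge0.
- by apply: igZ; exact: compact_indic_ig.
Qed.

Lemma restrictM K f g : (fun x => f x * g x) \_ K = (fun x => (f \_ K) x * g x).
Proof. by apply/funext => x; rewrite !patchE; case: (x \in K) => //; rewrite mul0r. Qed.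

Lemma restrictMM K f g : (fun x => f x * g x) \_ K = (fun x => (f \_ K) x * (g \_ K) x).
Proof. by apply/funext => x; rewrite !patchE; case: (x \in K) => //; rewrite mul0r. Qed.

Lemma Lp_on_M q K f g C : compact K -> 0 < q -> Lp_on q K f -> measurable_fun setT (g \_ K) ->
  (forall x, K x -> `|g x| <= C) -> Lp_on q K (fun x => f x * g x).
Proof.
move=> cK q0 hf mg gC; have mK := compact_rV_measurable cK.
have [mf fi] := (Lp_onP _ mK q0).1 hf.
apply: (Lp_on_bound mK q0 (g := fun x => `|C| `^ q * `|(f \_ K) x| `^ q)).
- by rewrite restrictMM; exact: measurable_funM.
- move=> x Kx; rewrite restrictT_eq// normrM powRM// mulrC ler_wpM2r ?powR_ge0//.
  rewrite ge0_ler_powR ?nnegrE ?(ltW q0)//.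
  by apply: le_trans (gC x Kx) _; exact: ler_norm.
- by move=> x; rewrite mulr_ge0 ?powR_ge0.
- exact: igZ.
Qed.

Lemma restrictD K f g : (fun x => f x + g x) \_ K = (fun x => (f \_ K) x + (g \_ K) x).
Proof. by apply/funext => x; rewrite !patchE; case: (x \in K) => //; rewrite addr0. Qed.

Lemma Lp_on_D q K f g : measurable K -> 0 < q -> Lp_on q K f -> Lp_on q K g ->
  Lp_on q K (fun x => f x + g x).
Proof.
move=> mK q0 hf hg.
have [mf fi] := (Lp_onP _ mK q0).1 hf; have [mg gi] := (Lp_onP _ mK q0).1 hg.
apply: (Lp_on_bound mK q0 (g := fun x => 2 `^ q * (`|(f \_ K) x| `^ q + `|(g \_ K) x| `^ q))).
- by rewrite restrictD; exact: measurable_funD.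
- by move=> x Kx; rewrite !restrictT_eq//; exact: powR_D_le.
- by move=> x; rewrite mulr_ge0 ?addr_ge0 ?powR_ge0.
- by apply: igZ; exact: igD.
Qed.

Lemma Lp_on_L2 p K f : compact K -> 2 < p -> Lp_on p K f ->
  L2 leb (f \_ K) /\
  \int[leb]_x ((f \_ K) x ^+ 2) <= \int[leb]_x \1_K x + \int[leb]_x (`|(f \_ K) x| `^ p).
Proof.
move=> cK p2 hf; have mK := compact_rV_measurable cK.
have p0 : 0 < p by exact: lt_trans p2.
have [mf fi] := (Lp_onP _ mK p0).1 hf.
have K1 := compact_indic_ig cK.
have b x : (f \_ K) x ^+ 2 <= \1_K x + `|(f \_ K) x| `^ p.
  have [Kx|nKx] := pselect (K x).
    rewrite restrictT_eq// indicE mem_set// -real_normK ?num_real// -powR_mulrn//.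
    by apply: powR_le_1D => //; exact: ltW.
  by rewrite restrict_eq0// expr0n addr_ge0// powR_ge0.
have L : L2 leb (f \_ K).
  split => //; apply: (@ig_le _ _ _ leb _ (fun x => \1_K x + `|(f \_ K) x| `^ p)).
  - exact: measurable_funX.
  - by move=> x; rewrite ger0_norm ?sqr_ge0.
  - exact: igD.
split => //; rewrite -intD//; apply: le_int => //; [by case: L|exact: igD].
Qed.

Lemma Lp_on_dual_ig p q K f g : measurable K -> 0 < p -> 0 < q -> p^-1 + q^-1 = 1 ->
  Lp_on p K f -> Lp_on q K g -> ig leb (fun x => (f \_ K) x * (g \_ K) x).
Proof.
move=> mK p0 q0 pq hf hg.
have [mf fi] := (Lp_onP _ mK p0).1 hf; have [mg gi] := (Lp_onP _ mK q0).1 hg.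
apply: (@ig_le _ _ _ leb _ (fun x => p^-1 * (`|(f \_ K) x| `^ p) + q^-1 * (`|(g \_ K) x| `^ q))).
- exact: measurable_funM.
- move=> x; rewrite normrM; apply: le_trans (conjugate_powR _ _ p0 q0 pq) _ => //.
  by rewrite mulrC (mulrC (_ `^ q)).
- by apply: igD; exact: igZ.
Qed.

(** Split at the level L. Below it the integral is at most L^2 times that of |psi| over K, small by
    Cauchy-Schwarz. Above it p > 2 gives F^2 <= |F|^p / L^(p-2), whose integral is small uniformly
    in t once L is large. *)
Lemma equi_Lp (T : Type) (F : T -> V -> R) p K C : compact K -> 2 < p ->
  (forall t, Lp_on p K (F t)) -> (forall t, \int[leb]_x (`|(F t \_ K) x| `^ p) <= C) ->
  forall e : R, 0 < e -> exists2 eta : R, 0 < eta & forall t psi, measurable_fun setT psi ->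
    L2 leb psi -> (forall x, `|psi x| <= 2) -> N2 leb psi <= eta ->
    \int[leb]_x ((F t \_ K) x ^+ 2 * `|psi x|) <= e.
Proof.
move=> cK p2 hF FC e e0; have mK := compact_rV_measurable cK.
have p0 : 0 < p by exact: lt_trans p2.
have C1 : 0 < `|C| + 1 by rewrite ltr_wpDl.
(* D = L^(p-2) is chosen so that the part above the level, at most (2 / D) (|C| + 1), is e / 2. *)
pose D := 4 * (`|C| + 1) / e; have D0 : 0 < D by rewrite divr_gt0// mulr_gt0.
pose L := D `^ (p - 2)^-1; have L0 : 0 < L by rewrite powR_gt0.
have D2 : 0 <= 2 / D by rewrite divr_ge0// ltW.
have LD : L `^ (p - 2) = D.
  by rewrite /L -powRrM mulVf ?powRr1 ?(ltW D0)// subr_eq0 gt_eqF.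
have K2 := compact_indic_L2 cK.
pose A := L ^+ 2 * N2 leb (\1_K); have A0 : 0 <= A by rewrite mulr_ge0 ?sqr_ge0 ?N2_ge0.
have A1 : 0 < A + 1 by rewrite ltr_wpDl.
exists (e / 2 / (A + 1)); first by rewrite !divr_gt0.
move=> t psi mpsi Lpsi psi2 psie.
have [Lf _] := Lp_on_L2 cK p2 (hF t); have [mf fi] := (Lp_onP _ mK p0).1 (hF t).
have Lnpsi : L2 leb (fun x => `|psi x|).
  by apply: (L2_le _ _ Lpsi); [exact: measurableT_comp|move=> x; rewrite normr_id].
have igp := L2M K2 Lnpsi.
apply: (@le_trans _ _ (\int[leb]_x (L ^+ 2 * (\1_K x * `|psi x|) + 2 / D * (`|(F t \_ K) x| `^ p)))).
  apply: le_int.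
  - apply: (igMb (C := 2)); [by case: Lf|exact: measurableT_comp|by move=> x; rewrite normr_id].
  - by apply: igD; exact: igZ.
  move=> x; have [Kx|nKx] := pselect (K x); last first.
    by rewrite restrict_eq0// expr0n mul0r addr_ge0 ?mulr_ge0 ?sqr_ge0 ?powR_ge0// invr_ge0 ltW.
  rewrite indicE mem_set// mul1r restrictT_eq//; have [aL|La] := leP `|F t x| L.
    apply: (@le_trans _ _ (L ^+ 2 * `|psi x|)); last first.
      by rewrite lerDl mulr_ge0// powR_ge0.
    by rewrite ler_wpM2r// -real_normK ?num_real// lerXn2r ?nnegrE// ltW.
  apply: (@le_trans _ _ (2 / D * `|F t x| `^ p)); last by rewrite lerDr mulr_ge0 ?sqr_ge0.
  apply: (@le_trans _ _ (F t x ^+ 2 * 2)); first by rewrite ler_wpM2l ?sqr_ge0.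
  have := sqr_le_powR p2 L0 (ltW La); rewrite real_normK ?num_real// LD => h.
  by rewrite mulrC -mulrA ler_wpM2l// ler_pdivlMl// mulrC.
rewrite intD; [|exact: igZ|exact: igZ].
rewrite intZ// intZ//.
have h1 : L ^+ 2 * \int[leb]_x (\1_K x * `|psi x|) <= e / 2.
  apply: (@le_trans _ _ (L ^+ 2 * (N2 leb (\1_K) * N2 leb psi))).
    rewrite ler_wpM2l ?sqr_ge0//; apply: le_trans (ler_norm _) _.
    apply: le_trans (cauchy_schwarz K2 Lnpsi) _; rewrite ler_wpM2l ?N2_ge0//.
    by apply: le_N2 => //; [exact: measurableT_comp|move=> x; rewrite normr_id].
  rewrite mulrA -/A; apply: (@le_trans _ _ (A * (e / 2 / (A + 1)))); first by rewrite ler_wpM2l.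
  rewrite mulrA ler_pdivrMr// mulrC ler_wpM2l ?lerDl//.
  by rewrite divr_ge0// ltW.
have h2 : 2 / D * \int[leb]_x (`|(F t \_ K) x| `^ p) <= e / 2.
  apply: (@le_trans _ _ (2 / D * (`|C| + 1))).
    apply: ler_wpM2l => //; apply: le_trans (FC t) _.
    by apply: le_trans (ler_norm _) _; rewrite lerDl.
  rewrite le_eqVlt; apply/orP; left; apply/eqP; rewrite /D; field.
  by rewrite !gt_eqF.
by rewrite [e]splitr; exact: lerD.
Qed.

End Lp_on_theory.

(** * Weak continuity of wedge products *)

Section wedge.
Context {R : realType} {n : nat}.
Local Notation V := 'rV[R]_n.
Local Notation leb := (lebesgue_rV R n).
Variables (U : set V) (p : R).
Hypotheses (oU : open U) (p2 : 2 < p).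
Implicit Types (al be : nat -> 'I_n -> V -> R) (K : set V).

Let oT : open [set: V]. Proof. exact: openT. Qed.
Let p0 : 0 < p. Proof. exact: lt_trans p2. Qed.
(** The exponent conjugate to p; since p > 2 it is at most p, so functions in L^p on a compact set
    are admissible for testing weak convergence. *)
Let q : R := (1 - p^-1)^-1.
Let q0 : 0 < q.
Proof. by rewrite invr_gt0 subr_gt0 invf_lt1// (lt_trans _ p2)// ltr1n. Qed.
Let pq : p^-1 + q^-1 = 1. Proof. by rewrite invrK subrKC. Qed.
Let qp : q <= p.
Proof.
rewrite -[p]invrK /q lef_pV2 ?posrE ?invr_gt0//; last first.
  by rewrite subr_gt0 invf_lt1// (lt_trans _ p2)// ltr1n.
have : p^-1 <= 2^-1 by rewrite lef_pV2 ?posrE// ltW.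
by move: (p^-1) => t; lra.
Qed.

(** The distributional curls of the family on U act on psi. As psi is supported in K, extending the
    coefficients by zero does not change the action and gives integrals over the whole space. *)
Definition curl_bound al := forall K, compact K -> K `<=` U -> forall e : R, 0 < e ->
  exists2 eta : R, 0 < eta & forall j c d psi, test_function setT psi ->
    (forall x, ~ K x -> psi x = 0) -> (forall x, `|psi x| <= 1) -> N2 leb psi <= eta ->
    `|\int[leb]_x ((al j c \_ K) x * pd d psi x - (al j d \_ K) x * pd c psi x)| <= e.

Definition curl_family al (la : 'I_n -> V -> R) :=
  [/\ forall j c, Lp_loc p U (al j c), forall c, Lp_loc p U (la c),
     forall c, bounded_Lp_loc p U (fun j => al j c),
     forall c, weak_cvg_Lp_loc p U (fun j => al j c) (la c) & curl_bound al].

Lemma int_restrict K (f g : V -> R) : \int[leb]_(x in K) (f x * g x) = \int[leb]_x ((f \_ K) x * g x).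
Proof. by rewrite Rintegral_mkcond restrictM. Qed.

Lemma weak_bounded al la K c (psi : V -> R) C : curl_family al la -> compact K -> K `<=` U ->
  measurable_fun setT psi -> (forall x, `|psi x| <= C) ->
  (fun j => \int[leb]_x ((al j c \_ K) x * psi x)) @ \oo --> \int[leb]_x ((la c \_ K) x * psi x).
Proof.
move=> [_ _ _ w _] cK KU mpsi psiC; have mK := compact_rV_measurable cK.
rewrite -int_restrict; under eq_fun do rewrite -int_restrict.
apply: (w c K q psi cK KU q0 pq); apply: (Lp_on_bounded cK q0 _ (fun x _ => psiC x)).
by apply/(meas_restrictP psi mK); exact: measurable_funTS.
Qed.

Lemma family_Lp al la K : curl_family al la -> compact K -> K `<=` U ->
  (forall j c, Lp_on p K (al j c)) /\ (forall c, Lp_on p K (la c)).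
Proof.
move=> [h h0 _ _ _] cK KU; split; first by move=> j c; exact: (proj2 (h j c)).
by move=> c; exact: (proj2 (h0 c)).
Qed.

Lemma family_bound al la K : curl_family al la -> compact K -> K `<=` U ->
  exists2 C : R, 0 <= C & (forall j c, \int[leb]_x (`|(al j c \_ K) x| `^ p) <= C) /\
    (forall c, \int[leb]_x (`|(la c \_ K) x| `^ p) <= C).
Proof.
move=> fa cK KU; have [LK L0K] := family_Lp fa cK KU.
have mK := compact_rV_measurable cK.
have [_ _ hb _ _] := fa.
have /choice[C hC] c : exists C : R, forall j, \int[leb]_x (`|(al j c \_ K) x| `^ p) <= C.
  have [C hC] := hb c K cK KU; exists C => j.
  by have := hC j; rewrite (Lp_on_intE mK p0 (LK j c)) lee_fin.
have I0 c : 0 <= \int[leb]_x (`|(la c \_ K) x| `^ p).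
  by apply: int_ge0 => x; exact: powR_ge0.
exists (\sum_c (`|C c| + \int[leb]_x (`|(la c \_ K) x| `^ p))).
  by apply: sumr_ge0 => c _; rewrite addr_ge0.
split=> [j c|c]; rewrite (bigD1 c)//=; apply: ler_wpDr.
- by apply: sumr_ge0 => c' _; rewrite addr_ge0.
- by apply: le_trans (hC c j) _; apply: le_trans (ler_norm _) _; rewrite lerDl.
- by apply: sumr_ge0 => c' _; rewrite addr_ge0.
- by rewrite lerDr.
Qed.

Let Lp_on_B K (f g : V -> R) : compact K -> Lp_on p K f -> Lp_on p K g -> Lp_on p K (fun x => f x - g x).
Proof.
move=> cK hf hg; have mK := compact_rV_measurable cK.
have -> : (fun x => f x - g x) = fun x => f x + g x * (-1) by apply/funext => x; rewrite mulrN1.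
have mc : measurable_fun setT ((fun=> -1 : R) \_ K) by apply/(meas_restrictP _ mK); exact: measurable_cst.
have hc x : K x -> `|-1 : R| <= 1 by rewrite normrN1.
exact: (Lp_on_D mK p0 hf (Lp_on_M cK p0 hg mc hc)).
Qed.

Section localized.
Variables (al : nat -> 'I_n -> V -> R) (la : 'I_n -> V -> R) (K : set V) (chi : V -> R).
Hypotheses (fa : curl_family al la) (cK : compact K) (KU : K `<=` U).
Hypotheses (tchi : test_function setT chi) (chiK : forall x, ~ K x -> chi x = 0).
Hypothesis chi1 : forall x, `|chi x| <= 1.

Let mK := compact_rV_measurable cK.
Let ga j c : V -> R := fun x => al j c x - la c x.
(** Subtracting the weak limit and cutting off gives a weakly null sequence supported in a fixed
    cube, as [div_curl] requires. *)
Definition localized j c : V -> R := fun x => chi x * (ga j c \_ K) x.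

Let gaE j c x : (ga j c \_ K) x = (al j c \_ K) x - (la c \_ K) x.
Proof. by rewrite !patchE; case: (x \in K) => //; rewrite subrr. Qed.

Let Lga j c : Lp_on p K (ga j c).
Proof. by have [LK L0K] := family_Lp fa cK KU; exact: Lp_on_B. Qed.

Let bga : exists2 C : R, 0 <= C & forall j c, \int[leb]_x (`|(ga j c \_ K) x| `^ p) <= C.
Proof.
have [C C0 [hC hC0]] := family_bound fa cK KU.
exists (2 `^ p * (C + C)); first by rewrite mulr_ge0 ?powR_ge0 ?addr_ge0.
move=> j c; have [LK L0K] := family_Lp fa cK KU.
have [_ i1] := (Lp_onP _ mK p0).1 (LK j c); have [_ i2] := (Lp_onP _ mK p0).1 (L0K c).
have [_ i3] := (Lp_onP _ mK p0).1 (Lga j c).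
apply: (@le_trans _ _ (\int[leb]_x (2 `^ p * (`|(al j c \_ K) x| `^ p + `|(la c \_ K) x| `^ p)))).
  apply: le_int => //; first by apply: igZ; exact: igD.
  by move=> x; rewrite gaE; apply: le_trans (powR_D_le _ _ p0) _; rewrite normrN.
rewrite intZ; last exact: igD.
by rewrite intD// ler_wpM2l ?powR_ge0// lerD.
Qed.

Let mchi : measurable_fun setT chi. Proof. exact: test_function_measurable. Qed.
Let L2ga j c : L2 leb (ga j c \_ K). Proof. by have [] := Lp_on_L2 cK p2 (Lga j c). Qed.

Lemma localized_L2 j c : L2 leb (localized j c).
Proof.
rewrite /localized (_ : (fun x => _) = fun x => (ga j c \_ K) x * chi x); last first.
  by apply/funext => x; rewrite mulrC.
exact: L2Mb (L2ga j c) mchi chi1.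
Qed.

Lemma localized_le j c x : `|localized j c x| <= `|(ga j c \_ K) x|.
Proof. by rewrite /localized normrM ler_piMl. Qed.

Let N2ga : exists2 C : R, 0 <= C & forall j c, N2 leb (ga j c \_ K) <= C.
Proof.
have [C C0 hC] := bga.
exists (Num.sqrt (\int[leb]_x \1_K x + C)); first exact: sqrtr_ge0.
move=> j c; rewrite /N2; apply: ler_wsqrtr.
have [_ h] := Lp_on_L2 cK p2 (Lga j c); apply: le_trans h _.
by rewrite lerD2l.
Qed.

Lemma localized_N2 : exists2 C : R, 0 <= C & forall j c, N2 leb (localized j c) <= C.
Proof.
have [C C0 hC] := N2ga; exists C => // j c; apply: le_trans (hC j c).
by apply: le_N2; [case: (localized_L2 j c)|exact: localized_le|exact: L2ga].
Qed.

Lemma localized_cube : exists2 M : R, 0 <= M & forall j c x, ~ cube M x -> localized j c x = 0.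
Proof.
have [M M0 hM] := test_function_cube tchi; exists M; first exact: ltW.
by move=> j c x nx; rewrite /localized hM// mul0r.
Qed.

Lemma localized_equi : equi2 localized.
Proof.
move=> e e0; have [C C0 hC] := bga.
have [eta eta0 H] := equi_Lp cK p2 (fun t : nat * 'I_n => Lga t.1 t.2) (fun t => hC t.1 t.2) e0.
exists eta => // j c psi mpsi Lpsi psi2 psie; apply: le_trans (H (j, c) psi mpsi Lpsi psi2 psie).
have b x : localized j c x ^+ 2 <= (ga j c \_ K) x ^+ 2.
  rewrite -real_normK ?num_real// -[leRHS]real_normK ?num_real//.
  by rewrite lerXn2r ?nnegrE//; exact: localized_le.
have mnp : measurable_fun setT (fun x => `|psi x|) by exact: measurableT_comp.
have np2 x : `| `|psi x| | <= 2 by rewrite normr_id.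
apply: le_int.
- by apply: (igMb _ mnp np2); case: (localized_L2 j c).
- by apply: (igMb _ mnp np2); case: (L2ga j c).
- by move=> x; rewrite ler_wpM2r.
Qed.

Lemma localized_weak c z h : 0 <= h ->
  (fun j => \int[leb]_x (localized j c x * \1_(cube h) (z - x))) @ \oo --> (0 : R).
Proof.
move=> h0; pose psi x : R := chi x * \1_(cube h) (z - x).
have mi : measurable_fun setT (\1_(cube h) : V -> R).
  by apply: measurable_indic; exact: cube_measurable.
have mpsi : measurable_fun setT psi.
  apply: measurable_funM => //; apply: measurableT_comp mi _; apply: measurable_fun_rVR => i.
  under eq_fun do rewrite !mxE.
  by apply: measurable_funB; [exact: measurable_cst|exact: measurable_coordR].
have psi1 x : `|psi x| <= 1.
  rewrite /psi normrM -[leRHS]mulr1 ler_pM// indicE.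
  by case: (_ \in _); rewrite ?normr1 ?normr0.
have w := weak_bounded (c := c) fa cK KU mpsi psi1.
have [LK L0K] := family_Lp fa cK KU.
have Lj j := proj1 (Lp_on_L2 cK p2 (LK j c)); have L0 := proj1 (Lp_on_L2 cK p2 (L0K c)).
have Lpsi : L2 leb psi.
  have Lc := test_function_L2 tchi; apply: (L2_le mpsi _ Lc) => x.
  rewrite /psi normrM ler_piMr// indicE.
  by case: (_ \in _); rewrite ?normr1 ?normr0.
rewrite (_ : (fun j => _) = fun j => \int[leb]_x ((al j c \_ K) x * psi x) -
    \int[leb]_x ((la c \_ K) x * psi x)).
  by rewrite -[X in _ --> X](subrr (\int[leb]_x ((la c \_ K) x * psi x))); apply: cvgB w _; exact: cvg_cst.
apply/funext => j; rewrite -intB; [|exact: L2M|exact: L2M].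
by apply: eq_Rintegral => x _; rewrite /localized gaE /psi; ring.
Qed.

(** By the product rule, chi dpsi = d(chi psi) - psi dchi. The first part tests the curl of [al] and
    of its limit with chi psi; the second is small because psi is small in L2 and dchi is
    bounded. *)
Lemma localized_curl : small_curl localized.
Proof.
move=> e e0; have [C C0 hC] := N2ga.
have e4 : 0 < e / 4 by rewrite divr_gt0.
have [_ _ _ _ /(_ K cK KU _ e4)[eta1 h1 H1]] := fa.
have /choice[B hB] d : exists B : R, 0 <= B /\ forall x, `|pd d chi x| <= B.
  by have [B B0 hB] := test_function_bounded (test_function_pd d tchi); exists B.
pose Bs := \sum_d B d.
have hBs d x : `|pd d chi x| <= Bs.
  apply: le_trans (proj2 (hB d) x) _; rewrite /Bs (bigD1 d)//= lerDl.
  by apply: sumr_ge0 => d' _; case: (hB d').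
have Bs0 : 0 <= Bs by apply: sumr_ge0 => d _; case: (hB d).
have D0 : 0 < C * Bs + 1 by rewrite ltr_wpDl// mulr_ge0.
exists (Num.min eta1 (e / 4 / (C * Bs + 1))); first by rewrite lt_min h1 divr_gt0.
move=> j c d psi tpsi psi1; rewrite le_min => /andP[psie1 psie2].
have [spsi _] := tpsi; have [schi _] := tchi.
pose phi x := chi x * psi x.
have tphi : test_function setT phi by exact: test_functionM.
have Lpsi := test_function_L2 tpsi; have Lphi := test_function_L2 tphi.
have phiK x : ~ K x -> phi x = 0 by move=> nx; rewrite /phi chiK// mul0r.
have phi1 x : `|phi x| <= 1 by rewrite /phi normrM -[leRHS]mulr1 ler_pM.
have phiN : N2 leb phi <= eta1.
  apply: le_trans psie1; apply: le_N2 => //; first exact: test_function_measurable.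
  by move=> x; rewrite /phi normrM ler_piMl.
have [LK L0K] := family_Lp fa cK KU.
have Lj c' j' := proj1 (Lp_on_L2 cK p2 (LK j' c')); have L0 c' := proj1 (Lp_on_L2 cK p2 (L0K c')).
have Lpphi d' := test_function_L2 (test_function_pd d' tphi).
have A j' : `|\int[leb]_x ((al j' c \_ K) x * pd d phi x) -
     \int[leb]_x ((al j' d \_ K) x * pd c phi x)| <= e / 4.
  by rewrite -intB; [exact: H1|exact: (L2M (Lj _ _) (Lpphi d))|exact: (L2M (Lj _ _) (Lpphi c))].
(* The limit inherits the bound: the curl at a fixed test function is linear, hence a weak limit. *)
have A0 : `|\int[leb]_x ((la c \_ K) x * pd d phi x) -
     \int[leb]_x ((la d \_ K) x * pd c phi x)| <= e / 4.
  have [Bd _ hBd] := test_function_bounded (test_function_pd d tphi).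
  have [Bc _ hBc] := test_function_bounded (test_function_pd c tphi).
  have wd := weak_bounded (c := c) fa cK KU (test_function_measurable (test_function_pd d tphi)) hBd.
  have wc := weak_bounded (c := d) fa cK KU (test_function_measurable (test_function_pd c tphi)) hBc.
  by apply: lim_norm_le (cvgB wd wc) _ => j'; exact: A.
have Lpc d' : L2 leb (fun x => psi x * pd d' chi x).
  exact: L2Mb Lpsi (test_function_measurable (test_function_pd d' tchi)) (hBs d').
have Npc d' : N2 leb (fun x => psi x * pd d' chi x) <= Bs * (e / 4 / (C * Bs + 1)).
  apply: (@le_trans _ _ (Bs * N2 leb psi)); last by rewrite ler_wpM2l.
  rewrite -[X in X * N2 _ _](ger0_norm Bs0) -N2Z//; apply: le_N2; [by case: (Lpc d')| |exact: L2Z].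
  by move=> x; rewrite !normrM (ger0_norm Bs0) mulrC ler_wpM2r.
have Er c' d' : `|ip (ga j c' \_ K) (fun x => psi x * pd d' chi x)| <= e / 4.
  apply: le_trans (ip_cs (L2ga j c') (Lpc d') (hC j c') (Npc d')) _.
  have -> : C * (Bs * (e / 4 / (C * Bs + 1))) = e / 4 * (C * Bs) / (C * Bs + 1) by rewrite !mulrA; congr (_ / _); ring.
  by rewrite ler_pdivrMr// ler_wpM2l ?lerDl// ltW.
have ES c' d' : ip (localized j c') (pd d' psi) = \int[leb]_x ((al j c' \_ K) x * pd d' phi x) -
    \int[leb]_x ((la c' \_ K) x * pd d' phi x) - ip (ga j c' \_ K) (fun x => psi x * pd d' chi x).
  rewrite -intB; [|exact: (L2M (Lj _ _) (Lpphi d'))|exact: (L2M (L0 _) (Lpphi d'))].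
  rewrite ip_def ip_def -intB; last 2 first.
  - by apply: igB; [exact: (L2M (Lj _ _) (Lpphi d'))|exact: (L2M (L0 _) (Lpphi d'))].
  - exact: (L2M (L2ga j c') (Lpc d')).
  apply: eq_Rintegral => x _; rewrite (pdM d' x schi spsi) /localized gaE.
  by move: (pd d' psi x) (pd d' chi x) => t1 t2; ring.
have arith (t1 t2 t3 t4 t5 t6 f : R) : `|t3 - t4| <= f -> `|t1 - t2| <= f -> `|t5| <= f -> `|t6| <= f ->
    `|t1 - t3 - t5 - (t2 - t4 - t6)| <= f * 4 by rewrite !ler_norml; lra.
rewrite (ES c d) (ES d c); have -> : e = e / 4 * 4 by rewrite divfK.
exact: arith A0 (A j) (Er c d) (Er d c).
Qed.

End localized.

Section test_weight.
Variables (al be : nat -> 'I_n -> V -> R) (la lb : 'I_n -> V -> R) (K : set V).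
Hypotheses (fa : curl_family al la) (fb : curl_family be lb) (cK : compact K) (KU : K `<=` U).

Let mK := compact_rV_measurable cK.
Let LaK := proj1 (family_Lp fa cK KU).
Let LlaK := proj2 (family_Lp fa cK KU).
Let LbK := proj1 (family_Lp fb cK KU).
Let LlbK := proj2 (family_Lp fb cK KU).
Let La j c := proj1 (Lp_on_L2 cK p2 (LaK j c)).
Let Lla c := proj1 (Lp_on_L2 cK p2 (LlaK c)).
Let Lb j c := proj1 (Lp_on_L2 cK p2 (LbK j c)).
Let Llb c := proj1 (Lp_on_L2 cK p2 (LlbK c)).

Lemma weak_Lp_weight c (f : V -> R) (m : V -> R) : Lp_on p K f -> measurable_fun setT m -> (forall x, `|m x| <= 1) ->
  (fun j => \int[leb]_x ((al j c \_ K) x * (m x * (f \_ K) x))) @ \oo -->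
  \int[leb]_x ((la c \_ K) x * (m x * (f \_ K) x)).
Proof.
move=> hf mm m1; have [_ _ _ w _] := fa.
have mm' : measurable_fun setT (m \_ K) by apply/(meas_restrictP m mK); exact: measurable_funTS.
have hq : Lp_on q K (fun x => f x * m x).
  exact: Lp_on_M cK q0 (Lp_on_exp cK q0 qp hf) mm' (fun x _ => m1 x).
have := w c K q _ cK KU q0 pq hq; rewrite int_restrict; under eq_fun do rewrite int_restrict.
have E (g : V -> R) : \int[leb]_x ((g \_ K) x * (f x * m x)) = \int[leb]_x ((g \_ K) x * (m x * (f \_ K) x)).
  apply: eq_Rintegral => x _; rewrite !patchE; case: (x \in K); last by rewrite !mul0r.
  by rewrite (mulrC (f x)).
by rewrite E; under eq_fun do rewrite E.
Qed.

End test_weight.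

(** The weight m is itself the cutoff of the first family; the second one uses a cutoff equal to 1
    on K, so the product of the localizations is m times the product of the fluctuations. The cross
    terms contain a single weakly convergent factor. *)
Lemma wedge_test al be la lb K (m : V -> R) : curl_family al la -> curl_family be lb ->
  compact K -> K `<=` U -> test_function setT m -> (forall x, ~ K x -> m x = 0) ->
  (forall x, `|m x| <= 1) -> forall c d,
  (fun j => \int[leb]_x (m x * ((al j c \_ K) x * (be j d \_ K) x - (al j d \_ K) x * (be j c \_ K) x)))
   @ \oo --> \int[leb]_x (m x * ((la c \_ K) x * (lb d \_ K) x - (la d \_ K) x * (lb c \_ K) x)).
Proof.
move=> fa fb cK KU tm mK0 m1 c d; have mK := compact_rV_measurable cK.
have [chi [tchi chi01 chiK]] := smooth_cutoff oU cK KU.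
have [schi [K' [cK' K'U chiK']]] := tchi.
have chi1 x : `|chi x| <= 1 by have /andP[h0 h1] := chi01 x; rewrite ger0_norm.
have tchiT : test_function setT chi := test_functionT tchi.
pose a := localized al la K m; pose b := localized be lb K' chi.
have [Ca Ca0 hCa] := localized_N2 fa cK KU tm m1.
have [Cb Cb0 hCb] := localized_N2 fb cK' K'U tchiT chi1.
have [M M0 hM] := localized_cube al la K tm.
have D : (fun j => ip (a j c) (b j d) - ip (a j d) (b j c)) @ \oo --> (0 : R).
  apply: (@div_curl _ _ a b M (Num.max Ca Cb)) => //.
  - by rewrite le_max Ca0.
  - exact: localized_L2.
  - exact: localized_L2.
  - by move=> j c'; rewrite le_max hCa.
  - by move=> j c'; rewrite le_max hCb orbT.
  - exact: localized_equi.
  - exact: localized_curl.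
  - exact: localized_equi.
  - exact: localized_curl.
  - by move=> c' z h h0; exact: localized_weak.
have KK' : forall x, K x -> K' x.
  move=> x Kx; apply: contrapT => /chiK' h; have := chiK x Kx.
  by rewrite h => /esym/eqP; rewrite oner_eq0.
have [LaK LlaK] := family_Lp fa cK KU; have [LbK LlbK] := family_Lp fb cK KU.
have La j c' := proj1 (Lp_on_L2 cK p2 (LaK j c')); have Lla c' := proj1 (Lp_on_L2 cK p2 (LlaK c')).
have Lb j c' := proj1 (Lp_on_L2 cK p2 (LbK j c')); have Llb c' := proj1 (Lp_on_L2 cK p2 (LlbK c')).
have mm := test_function_measurable tm.
have Lm f : L2 leb f -> L2 leb (fun x => m x * f x).
  by move=> Lf; have := L2Mb Lf mm m1; under eq_fun do rewrite mulrC.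
(* Cross terms of al be = (al - la)(be - lb) + la be + al lb - la lb, each weighted by m. *)
pose X j c' d' := \int[leb]_x ((be j d' \_ K) x * (m x * (la c' \_ K) x)).
pose Y j c' d' := \int[leb]_x ((al j c' \_ K) x * (m x * (lb d' \_ K) x)).
pose Z c' d' := \int[leb]_x ((la c' \_ K) x * (m x * (lb d' \_ K) x)).
have cX c' d' : (fun j => X j c' d') @ \oo --> Z c' d'.
  rewrite (_ : Z c' d' = \int[leb]_x ((lb d' \_ K) x * (m x * (la c' \_ K) x))).
    exact: weak_Lp_weight.
  by apply: eq_Rintegral => x _; ring.
have cY c' d' : (fun j => Y j c' d') @ \oo --> Z c' d' by exact: weak_Lp_weight.
have E j c' d' : \int[leb]_x (m x * ((al j c' \_ K) x * (be j d' \_ K) x)) =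
    ip (a j c') (b j d') + X j c' d' + Y j c' d' - Z c' d'.
  have LaX := localized_L2 fa cK KU tm m1 j c'; have LbX := localized_L2 fb cK' K'U tchiT chi1 j d'.
  rewrite ip_def -intD; [|exact: L2M|exact: (L2M (Lb j d') (Lm _ (Lla c')))].
  rewrite -intD; last 2 first.
  - by apply: igD; [exact: L2M|exact: (L2M (Lb j d') (Lm _ (Lla c')))].
  - exact: (L2M (La j c') (Lm _ (Llb d'))).
  rewrite -intB; last 2 first.
  - apply: igD; last exact: (L2M (La j c') (Lm _ (Llb d'))).
    by apply: igD; [exact: L2M|exact: (L2M (Lb j d') (Lm _ (Lla c')))].
  - exact: (L2M (Lla c') (Lm _ (Llb d'))).
  apply: eq_Rintegral => x _; rewrite /a /b /localized.
  have [Kx|nKx] := pselect (K x); last by rewrite (mK0 x nKx) !(restrict_eq0 _ nKx); ring.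
  by rewrite !restrictT_eq ?chiK//; [ring|exact: KK'].
have igM j c' d' : ig leb (fun x => m x * ((al j c' \_ K) x * (be j d' \_ K) x)).
  have := L2M (La j c') (Lm _ (Lb j d')); congr (ig _ _); apply/funext => x; ring.
rewrite (_ : (fun j => _) = fun j => (ip (a j c) (b j d) - ip (a j d) (b j c)) +
   ((X j c d + Y j c d - Z c d) - (X j d c + Y j d c - Z d c))); last first.
  apply/funext => j; rewrite (_ : \int[leb]_x _ = \int[leb]_x (m x * ((al j c \_ K) x * (be j d \_ K) x)) -
     \int[leb]_x (m x * ((al j d \_ K) x * (be j c \_ K) x))); last first.
    by rewrite -intB//; apply: eq_Rintegral => x _; rewrite mulrBr.
  rewrite !E; move: (ip _ _) (ip _ _) (X j c d) (X j d c) (Y j c d) (Y j d c) => t1 t2 t3 t4 t5 t6; ring.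
have -> : \int[leb]_x (m x * ((la c \_ K) x * (lb d \_ K) x - (la d \_ K) x * (lb c \_ K) x)) =
   0 + ((Z c d + Z c d - Z c d) - (Z d c + Z d c - Z d c)).
  rewrite add0r !addrK /Z -intB; [|exact: (L2M (Lla c) (Lm _ (Llb d)))|exact: (L2M (Lla d) (Lm _ (Llb c)))].
  by apply: eq_Rintegral => x _; ring.
apply: cvgD D _; apply: cvgB; (apply: cvgB; last exact: cvg_cst); apply: cvgD; [exact: cX|exact: cY|exact: cX|exact: cY].
Qed.

(** Weights that are only bounded and measurable occur because of the inverse metric. Approximate m
    in L2 by test functions with a common sup bound; as the squares of both families are
    equi-integrable, the error is uniform in j. *)
Lemma wedge_bounded al be la lb K (m : V -> R) N : curl_family al la -> curl_family be lb ->
  compact K -> K `<=` U -> measurable_fun setT m -> (forall x, ~ K x -> m x = 0) ->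
  (forall x, `|m x| <= N) -> forall c d,
  (fun j => \int[leb]_x (m x * (al j c x * be j d x - al j d x * be j c x)))
   @ \oo --> \int[leb]_x (m x * (la c x * lb d x - la d x * lb c x)).
Proof.
move=> fa fb cK KU mm mK0 mN0 c d; have mK := compact_rV_measurable cK.
pose N1 := `|N| + 1; have N0 : 0 < N1 by rewrite ltr_wpDl.
have mN x : `|m x| <= N1.
  by apply: le_trans (mN0 x) _; apply: le_trans (ler_norm _) _; rewrite lerDl.
have [chi [tchi chi01 chiK]] := smooth_cutoff oU cK KU.
have [schi [K' [cK' K'U chiK']]] := tchi.
have mK' := compact_rV_measurable cK'.
have chi1 x : `|chi x| <= 1 by have /andP[h0 h1] := chi01 x; rewrite ger0_norm.
have tchiT : test_function setT chi := test_functionT tchi.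
have KK' : forall x, K x -> K' x.
  move=> x Kx; apply: contrapT => /chiK' h; have := chiK x Kx.
  by rewrite h => /esym/eqP; rewrite oner_eq0.
have [LaK LlaK] := family_Lp fa cK' K'U; have [LbK LlbK] := family_Lp fb cK' K'U.
have [Ca Ca0 [hCa hCla]] := family_bound fa cK' K'U.
have [Cb Cb0 [hCb hClb]] := family_bound fb cK' K'U.
(* [None] stands for the limit, so that one modulus of equi-integrability serves the sequence and
   its limit. *)
pose A (o : option nat) c' := if o is Some j then al j c' else la c'.
pose B (o : option nat) c' := if o is Some j then be j c' else lb c'.
have LA (t : option nat * 'I_n) : Lp_on p K' (A t.1 t.2) by case: t => -[j|] c' /=.
have LB (t : option nat * 'I_n) : Lp_on p K' (B t.1 t.2) by case: t => -[j|] c' /=.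
have hA (t : option nat * 'I_n) : \int[leb]_x (`|(A t.1 t.2 \_ K') x| `^ p) <= Ca by case: t => -[j|] c' /=.
have hB (t : option nat * 'I_n) : \int[leb]_x (`|(B t.1 t.2 \_ K') x| `^ p) <= Cb by case: t => -[j|] c' /=.
have LA2 o c' := proj1 (Lp_on_L2 cK' p2 (LA (o, c'))).
have LB2 o c' := proj1 (Lp_on_L2 cK' p2 (LB (o, c'))).
pose w o x := (A o c \_ K') x * (B o d \_ K') x - (A o d \_ K') x * (B o c \_ K') x.
have igw o : ig leb (w o) by apply: igB; apply: L2M; [exact: LA2|exact: LB2|exact: LA2|exact: LB2].
have wE o : \int[leb]_x (m x * (A o c x * B o d x - A o d x * B o c x)) = \int[leb]_x (m x * w o x).
  apply: eq_Rintegral => x _; have [Kx|nKx] := pselect (K x); last by rewrite mK0// !mul0r.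
  by rewrite /w !restrictT_eq//; exact: KK'.
suff H : (fun j => \int[leb]_x (m x * w (Some j) x)) @ \oo --> \int[leb]_x (m x * w None x).
  have Ew : (fun j => \int[leb]_x (m x * (al j c x * be j d x - al j d x * be j c x))) =
      fun j => \int[leb]_x (m x * w (Some j) x) by apply/funext => j; exact: (wE (Some j)).
  by rewrite Ew; have /= -> := wE None; exact: H.
apply/cvgrPdist_le => e e0.
(* Four error terms, rescaled by 2 N1, then contribute 2 N1 * 4 e1 = e / 3, once for the sequence
   and once for the limit. *)
pose e1 := e / 3 / (8 * N1); have e10 : 0 < e1 by rewrite !divr_gt0// mulr_gt0.
have [ea ea0 Hea] := equi_Lp cK' p2 LA hA e10.
have [eb eb0 Heb] := equi_Lp cK' p2 LB hB e10.
pose eta := 2 * N1 * Num.min ea eb.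
have eta0 : 0 < eta by rewrite !mulr_gt0// lt_min ea0.
have [M M0 KM] := compact_sub_cube cK.
have [psi [tpsi psiN hpsi]] := test_function_dense_bounded N0 eta0 mN mm (fun x nx => mK0 x (contra_not (KM x) nx)).
pose N2p := 2 * N1; have N2p0 : 0 < N2p by rewrite mulr_gt0.
pose mu x := N2p^-1 * (chi x * psi x).
have tmu : test_function setT mu by apply: test_functionZ; apply: test_functionM => //; case: tchiT.
have mu1 x : `|mu x| <= 1.
  rewrite /mu normrM gtr0_norm ?invr_gt0// ler_pdivrMl// mulr1 normrM.
  by rewrite -[leRHS]mul1r ler_pM.
have muK x : ~ K' x -> mu x = 0 by move=> /chiK' h; rewrite /mu h mul0r mulr0.
have W := @wedge_test al be la lb K' mu fa fb cK' K'U tmu muK mu1 c d.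
have mmu := test_function_measurable tmu.
(* the error made by replacing [m] with the test function [N2p * mu], rescaled *)
pose r x := N2p^-1 * m x - mu x.
have mr : measurable_fun setT r by apply: measurable_funB => //; exact: measurable_funM.
have rE x : r x = chi x * (N2p^-1 * (m x - psi x)).
  have [Kx|nKx] := pselect (K x); first by rewrite /r /mu chiK// !mul1r mulrBr.
  by rewrite /r /mu (mK0 x nKx); ring.
have Lmpsi : L2 leb (fun x => m x - psi x).
  apply: L2B; last exact: test_function_L2.
  apply: (L2_le mm _ (L2Z N1 (compact_indic_L2 cK))) => x.
  rewrite indicE; have [Kx|nKx] := pselect (K x); last by rewrite mK0// normr0.
  by rewrite mem_set// mulr1 (ger0_norm (ltW N0)).
have rle x : `|r x| <= `|N2p^-1 * (m x - psi x)| by rewrite rE normrM ler_piMl.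
have Lr : L2 leb r by exact: L2_le mr rle (L2Z _ Lmpsi).
have r2 x : `|r x| <= 2.
  apply: le_trans (rle x) _; rewrite normrM gtr0_norm ?invr_gt0// ler_pdivrMl//.
  apply: le_trans (ler_normB _ _) _; apply: le_trans (lerD (mN x) (psiN x)) _.
  by rewrite /N2p; have := ltW N0; lra.
have rN : N2 leb r <= Num.min ea eb.
  apply: le_trans (le_N2 mr rle (L2Z _ Lmpsi)) _; rewrite N2Z// gtr0_norm ?invr_gt0//.
  by rewrite ler_pdivrMl.
have mnr : measurable_fun setT (fun x => `|r x|) by exact: measurableT_comp.
have nr2 x : `| `|r x| | <= 2 by rewrite normr_id.
have err o : `|\int[leb]_x (r x * w o x)| <= 4 * e1.
  have igrw : ig leb (fun x => r x * w o x).
    by have := igMb (igw o) mr r2; congr (ig _ _); apply/funext => x; rewrite mulrC.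
  have q1 c' : ig leb (fun x => (A o c' \_ K') x ^+ 2 * `|r x|).
    by apply: (igMb _ mnr nr2); case: (LA2 o c').
  have q2 c' : ig leb (fun x => (B o c' \_ K') x ^+ 2 * `|r x|).
    by apply: (igMb _ mnr nr2); case: (LB2 o c').
  apply: le_trans (le_norm_int igrw) _.
  apply: (@le_trans _ _ (\int[leb]_x (((A o c \_ K') x ^+ 2 * `|r x| + (B o d \_ K') x ^+ 2 * `|r x|) +
     ((A o d \_ K') x ^+ 2 * `|r x| + (B o c \_ K') x ^+ 2 * `|r x|)))).
    apply: le_int; [exact: ig_norm|by apply: igD; exact: igD|].
    move=> x; rewrite normrM -!mulrDl mulrC ler_wpM2r// /w.
    exact: abs_wedge_le.
  rewrite intD; [|exact: igD|exact: igD]; rewrite intD// intD//.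
  have ha c' := Hea (o, c') r mr Lr r2 (le_trans rN (ltac:(by rewrite ge_min lexx) : Num.min ea eb <= ea)).
  have hb c' := Heb (o, c') r mr Lr r2 (le_trans rN (ltac:(by rewrite ge_min lexx orbT) : Num.min ea eb <= eb)).
  have := ha c; have := ha d; have := hb c; have := hb d; rewrite /=.
  by move: (Rintegral _ _ _) (Rintegral _ _ _) (Rintegral _ _ _) (Rintegral _ _ _) => t1 t2 t3 t4; lra.
have S o : \int[leb]_x (m x * w o x) = N2p * (\int[leb]_x (mu x * w o x) + \int[leb]_x (r x * w o x)).
  have i1 : ig leb (fun x => mu x * w o x).
    by have := igMb (igw o) mmu mu1; congr (ig _ _); apply/funext => x; rewrite mulrC.
  have i2 : ig leb (fun x => r x * w o x).
    by have := igMb (igw o) mr r2; congr (ig _ _); apply/funext => x; rewrite mulrC.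
  rewrite -intD// -intZ; last exact: igD.
  apply: eq_Rintegral => x _; rewrite /r -mulrDl subrKC !mulrA divff ?mul1r//.
  by rewrite gt_eqF.
have e20 : 0 < e / 3 / N2p by rewrite !divr_gt0.
have /cvgrPdist_le /(_ _ e20) := W; apply: filterS => j hj.
have {}hj : `|\int[leb]_x (mu x * w None x) - \int[leb]_x (mu x * w (Some j) x)| <= e / 3 / N2p by [].
rewrite !S -mulrBr normrM gtr0_norm// -ler_pdivlMl//.
have E1 : N2p^-1 * e = e / 3 / N2p + (4 * e1 + 4 * e1).
  by rewrite /e1 /N2p; field; rewrite gt_eqF.
rewrite E1; move: hj (err None) (err (Some j)); move: (4 * e1) (e / 3 / N2p).
move: (Rintegral _ _ _) (Rintegral _ _ _) (Rintegral _ _ _) (Rintegral _ _ _) => t1 t2 t3 t4 t5 t6.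
by rewrite !ler_norml; lra.
Qed.

End wedge.

Lemma cvg_dist_le {R : realType} (u v : nat -> R) (l : R) :
  (forall k, `|l - u k| <= v k) -> v @ \oo --> (0 : R) -> u @ \oo --> l.
Proof.
move=> uv v0; apply/cvgrPdist_le => e e0.
have /cvgrPdist_le /(_ _ e0) := v0; apply: filterS => k; rewrite sub0r normrN => h.
by apply: le_trans (uv k) _; apply: le_trans (ler_norm _) h.
Qed.

Lemma cvg_approx {R : realType} (u : nat -> R) (l : R) :
  (forall e : R, 0 < e -> exists v l', [/\ v @ \oo --> l', forall j, `|u j - v j| <= e & `|l - l'| <= e]) ->
  u @ \oo --> l.
Proof.
move=> h; apply/cvgrPdist_le => e e0; have e3 : 0 < e / 3 by rewrite divr_gt0.
have [v [l' [vl uv ll]]] := h _ e3.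
have /cvgrPdist_le /(_ _ e3) := vl; apply: filterS => j hj.
have := uv j; move: ll hj; rewrite !ler_norml; lra.
Qed.

Lemma cvgn_approx {R : realType} (u : nat -> R) :
  (forall e : R, 0 < e -> exists2 v, cvgn v & forall j, `|u j - v j| <= e) -> cvgn u.
Proof.
move=> h; apply/cauchy_cvgP/cauchy_exP => e e0; have e4 : 0 < e / 4 by rewrite divr_gt0.
have [v /cvg_ex[l vl] uv] := h _ e4; exists l.
have /cvgrPdist_le /(_ _ e4) hv := vl.
rewrite /nbhs /=; apply: filterS hv => j hj; rewrite /= /ball /=.
have := uv j; move: hj e0; clear; rewrite !ler_norml ltr_norml; lra.
Qed.

(** * Riesz representation of functionals on L2 *)

Section riesz.
Context {R : realType} {n : nat}.
Local Notation V := 'rV[R]_n.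
Local Notation leb := (lebesgue_rV R n).
Implicit Types (f g : V -> R) (A : set V).

Lemma monotone_ig (u : nat -> V -> R) g C : (forall k, ig leb (u k)) -> (forall k x, 0 <= u k x) ->
  (forall k k' x, (k <= k')%N -> u k x <= u k' x) -> (forall x, u ^~ x @ \oo --> g x) ->
  measurable_fun setT g -> (forall k, \int[leb]_x u k x <= C) ->
  ig leb g /\ \int[leb]_x g x <= C.
Proof.
move=> iu u0 ndu cu mg uC.
have g0 x : 0 <= g x.
  rewrite -(cvg_lim _ (cu x))//; apply: limr_ge; first by apply/cvg_ex; exists (g x); exact: cu.
  by apply: nearW => k; exact: u0.
have E k : (\int[leb]_x (u k x)%:E = (\int[leb]_x u k x)%:E)%E.
  by rewrite fineK//; exact: integrable_fin_num (iu k).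
have F : (\int[leb]_x (g x)%:E <= C%:E)%E.
  have mu k : measurable_fun setT (fun x => (u k x)%:E) by apply/measurable_EFinP; exact: ig_meas (iu k).
  have := @cvg_monotone_convergence _ _ _ leb _ measurableT _ mu.
  rewrite (_ : (\int[leb]_x limn _)%E = (\int[leb]_x (g x)%:E)%E); last first.
    apply: eq_integral => x _; apply/cvg_lim => //.
    by apply: cvg_EFin; [exact: nearW|exact: cu].
  move=> h; have {}h := h (fun k x _ => ltac:(by rewrite lee_fin) : (0 <= (u k x)%:E)%E)
     (fun x _ k k' kk => ltac:(by rewrite lee_fin; exact: ndu) : ((u k x)%:E <= (u k' x)%:E)%E).
  rewrite -(cvg_lim _ h)//; apply: lime_le; first by apply/cvg_ex; eexists; exact: h.
  by apply: nearW => k; rewrite E lee_fin.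
have ig_g : ig leb g by apply/ig_ge0P => //; apply: le_lt_trans F _; exact: ltry.
split => //; have := F; rewrite -[X in (X <= _)%E]fineK ?lee_fin//.
exact: integrable_fin_num ig_g.
Qed.

Variables (K : set V) (l : (V -> R) -> R) (C : R).
Hypotheses (cK : compact K) (C0 : 0 <= C).
Hypothesis lD : forall f g, L2 leb f -> L2 leb g -> l (fun x => f x + g x) = l f + l g.
Hypothesis lZ : forall c f, L2 leb f -> l (fun x => c * f x) = c * l f.
Hypothesis lC : forall f, L2 leb f -> `|l f| <= C * N2 leb f.

Let mK := compact_rV_measurable cK.
Let LK A : measurable A -> L2 leb (\1_(A `&` K)).
Proof.
move=> mA; apply: L2_indic; first exact: measurableI.
apply: le_lt_trans (compact_lebesgue_fin cK).
by apply: le_measure; rewrite ?inE//; exact: measurableI.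
Qed.

Let l0 : l (fun=> 0) = 0.
Proof.
apply: etrans (_ : _ = 0 * l (fun=> 0)) _; last by rewrite mul0r.
rewrite -lZ; last exact: L2_0.
by congr l; apply/funext => x; rewrite mul0r.
Qed.

Let lB f g : L2 leb f -> L2 leb g -> l (fun x => f x - g x) = l f - l g.
Proof.
move=> Lf Lg; have := lD Lf (L2Z (-1) Lg); rewrite lZ// mulN1r => <-.
by congr l; apply/funext => x; rewrite mulN1r.
Qed.

Let ldist f g : L2 leb f -> L2 leb g -> `|l f - l g| <= C * N2 leb (fun x => f x - g x).
Proof. by move=> Lf Lg; rewrite -lB//; apply: lC; exact: L2B. Qed.

(** On indicators the functional is a signed measure, finite because of the cut to K and absolutely
    continuous because of the L2 bound. Its Radon-Nikodym density is the candidate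
    representative. *)
Definition riesz_charge A : \bar R := (l (\1_(A `&` K)))%:E.
Local Notation nu := riesz_charge.

Let nu0 : nu set0 = 0%E.
Proof.
rewrite /nu set0I (_ : \1_set0 = fun=> 0) ?l0//.
by apply/funext => x; rewrite indic0.
Qed.

Let nu_fin A : measurable A -> nu A \is a fin_num. Proof. by []. Qed.

Let nu_sigma : semi_sigma_additive nu.
Proof.
move=> F mF tF mU; pose G k x : R := \sum_(i < k) \1_(F i `&` K) x.
have GE k : G k = \1_(\big[setU/set0]_(i < k) F i `&` K).
  elim: k => [|k IH].
    by apply/funext => x; rewrite /G !big_ord0 set0I indic0.
  apply/funext => x; rewrite /G big_ord_recr /= -/(G k x) IH big_ord_recr /= !indicE.
  rewrite setIUl in_setU; case: (boolP (x \in F k `&` K)) => [/set_mem[xF xB]|_].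
    rewrite orbT (_ : (x \in _) = false) ?add0r//; apply/negbTE; rewrite notin_setE.
    rewrite -bigcup_mkord => -[[i /= ik xi] _].
    move/trivIsetP: tF => /(_ i k I I).
    by rewrite neq_ltn ik => /(_ isT) /seteqP[+ _] => /(_ x); apply.
  by rewrite orbF addr0.
have mUk k : measurable (\big[setU/set0]_(i < k) F i) by exact: bigsetU_measurable.
have LG k : L2 leb (G k) by rewrite GE; exact: LK.
have [|||| Lf cv] := @dct_N2 _ _ _ leb G (\1_(\bigcup_k F k `&` K)) (\1_K).
- by move=> k; case: (LG k).
- move=> x; rewrite indicE; case: (boolP (x \in _)) => [/set_mem[[j _ xF] xB]|].
    apply: cvg_near_cst; exists j.+1 => // k /= jk; rewrite GE indicE mem_set//.
    by split => //; rewrite -bigcup_mkord; exists j.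
  rewrite notin_setE => nx; rewrite (_ : G ^~ x = fun=> 0); first exact: cvg_cst.
  apply/funext => k; rewrite GE indicE memNset// => -[].
  rewrite -bigcup_mkord => -[i _ xi] xB; apply: nx; split => //; by exists i.
- move=> k x; rewrite GE !indicE in_setI ger0_norm//.
  by case: (_ \in _); case: (_ \in _).
- exact: compact_indic_L2.
have EG k : (\sum_(0 <= i < k) nu (F i))%E = (l (G k))%:E.
  rewrite big_mkord; elim: k => [|k IH].
    rewrite big_ord0 (_ : G 0%N = fun=> 0) ?l0//.
    by apply/funext => x; rewrite /G big_ord0.
  rewrite big_ord_recr /= IH (_ : G k.+1 = fun x => G k x + \1_(F k `&` K) x); last first.
    by apply/funext => x; rewrite /G big_ord_recr.
  by rewrite lD//; exact: LK.
rewrite (_ : (fun k => _) = fun k => (l (G k))%:E); last by apply/funext => k; exact: EG.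
apply: cvg_EFin; first exact: nearW.
apply: (@cvg_dist_le _ _ (fun k => C * N2 leb (fun x => \1_(\bigcup_k F k `&` K) x - G k x))).
  by move=> k; exact: ldist.
by rewrite -[X in _ --> X](mulr0 C); apply: cvgM; [exact: cvg_cst|exact: cv].
Qed.

HB.instance Definition _ := isCharge.Build _ _ _ nu nu0 nu_fin nu_sigma.

Let nu_dom : nu `<< leb.
Proof.
apply/null_content_dominatesP => A mA A0; rewrite /nu; congr EFin.
apply/eqP; rewrite -normr_le0; apply: le_trans (lC (LK mA)) _.
rewrite (_ : N2 leb _ = 0) ?mulr0// /N2 (_ : \int[leb]_x _ = 0) ?sqrtr0//.
have -> : (fun x => \1_(A `&` K) x ^+ 2) = \1_(A `&` K) :> (V -> R).
  by apply/funext => x; rewrite indicE; case: (_ \in _); rewrite ?expr1n ?expr0n.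
rewrite int_indic; last exact: measurableI.
apply: (etrans (y := fine 0%E)) => //; congr fine.
apply/eqP; rewrite eq_le measure_ge0 andbT -A0.
by apply: le_measure; rewrite ?inE//; exact: measurableI.
Qed.

Let f x : R := fine (Radon_Nikodym nu leb x).
Let fE x : Radon_Nikodym nu leb x = (f x)%:E.
Proof. by rewrite fineK//; exact: Radon_Nikodym_fin_num nu_dom. Qed.
Let igf : ig leb f.
Proof.
have := Radon_Nikodym_integrable nu_dom; congr (_.-integrable _ _).
by apply/funext => x; rewrite fE.
Qed.
Let int_f A : measurable A -> l (\1_(A `&` K)) = \int[leb]_x (f x * \1_A x).
Proof.
move=> mA; have := Radon_Nikodym_integral nu_dom mA; rewrite /nu.
have -> : (\int[leb]_(x in A) Radon_Nikodym nu leb x)%E = (\int[leb]_x (f x * \1_A x)%:E)%E.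
  rewrite integral_mkcond; apply: eq_integral => x _; rewrite patchE indicE.
  by case: (x \in A); rewrite ?fE ?mulr1 ?mulr0.
by move=> /(congr1 fine).
Qed.

(** The density is only known to be in L1; on these sets it is bounded, so its truncation can be
    paired with any L2 function. *)
Let E (N : nat) : set V := [set x | `|f x| <= N%:R] `&` K.
Let mE N : measurable (E N).
Proof.
apply: measurableI => //; have mf : measurable_fun setT (fun x => `|f x|).
  by apply: measurableT_comp => //; exact: ig_meas igf.
have := mf measurableT `]-oo, N%:R]%classic (measurable_itv _).
rewrite setTI; congr measurable; apply/seteqP; split => x /=; rewrite in_itv //=.
Qed.
Let fN N x : R := f x * \1_(E N) x.
Let LE N : L2 leb (\1_(E N) : V -> R).
Proof. by rewrite (_ : E N = E N `&` K); [exact: LK|apply/seteqP; split => x [] //; case]. Qed.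
Let fN_le N x : `|fN N x| <= N%:R * \1_(E N) x.
Proof.
rewrite /fN indicE; case: (boolP (x \in E N)) => [/set_mem[h _]|_]; first by rewrite !mulr1.
by rewrite !mulr0 normr0.
Qed.
Let LfN N : L2 leb (fN N).
Proof.
apply: (L2_le _ _ (L2Z N%:R (LE N))).
  by apply: measurable_funM; [exact: ig_meas igf|exact: measurable_indic].
by move=> x; apply: le_trans (fN_le N x) _; exact: ler_norm.
Qed.
Let LgE N g : L2 leb g -> L2 leb (fun x => g x * \1_(E N) x).
Proof.
move=> Lg; apply: (L2Mb (C := 1) Lg); first exact: measurable_indic.
by move=> x; rewrite indicE; case: (_ \in _); rewrite ?normr1 ?normr0.
Qed.

Let rep_N N g : L2 leb g -> l (fun x => g x * \1_(E N) x) = \int[leb]_x (fN N x * g x).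
Proof.
move: g; apply: (@L2_ind _ _ leb (fun g => l (fun x => g x * \1_(E N) x) = \int[leb]_x (fN N x * g x))).
- exact: rbox_fin.
- move=> g h Lg Lh Eg Eh; rewrite (_ : (fun x => _) = fun x => g x * \1_(E N) x + h x * \1_(E N) x); last first.
    by apply/funext => x; rewrite mulrDl.
  rewrite lD; [|exact: LgE|exact: LgE]; rewrite Eg Eh -intD; [|exact: L2M|exact: L2M].
  by apply: eq_Rintegral => x _; rewrite mulrDr.
- move=> c g Lg Eg; rewrite (_ : (fun x => _) = fun x => c * (g x * \1_(E N) x)); last first.
    by apply/funext => x; rewrite mulrA.
  rewrite lZ; last exact: LgE.
  rewrite Eg -intZ; last exact: L2M.
  by apply: eq_Rintegral => x _; rewrite mulrCA.
- move=> g h Lg Lh Eh cv.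
  pose u k := l (fun x => h k x * \1_(E N) x).
  have cu : u @ \oo --> l (fun x => g x * \1_(E N) x).
    apply: (@cvg_dist_le _ _ (fun k => C * N2 leb (fun x => g x - h k x))).
      move=> k; apply: le_trans (ldist (LgE N Lg) (LgE N (Lh k))) _; rewrite ler_wpM2l//.
      apply: le_N2; [by case: (L2B (LgE N Lg) (LgE N (Lh k)))| |exact: L2B].
      move=> x; rewrite -mulrBl normrM ler_piMr// indicE.
      by case: (_ \in _); rewrite ?normr1 ?normr0.
    by rewrite -[X in _ --> X](mulr0 C); apply: cvgM; [exact: cvg_cst|exact: cv].
  have cu' : u @ \oo --> \int[leb]_x (fN N x * g x).
    apply: (@cvg_dist_le _ _ (fun k => N2 leb (fN N) * N2 leb (fun x => g x - h k x))).
      move=> k; rewrite /u Eh -intB; [|exact: L2M|exact: L2M].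
      under eq_Rintegral do rewrite -mulrBr.
      by apply: cauchy_schwarz => //; exact: L2B.
    by rewrite -[X in _ --> X](mulr0 (N2 leb (fN N))); apply: cvgM; [exact: cvg_cst|exact: cv].
  exact: (@cvg_unique _ (@Rhausdorff R) (u @ \oo)).
- move=> a b; have mr : measurable (rbox a b `&` E N) by apply: measurableI => //; exact: rbox_measurable.
  rewrite (_ : (fun x => _) = \1_((rbox a b `&` E N) `&` K)).
    rewrite int_f//; apply: eq_Rintegral => x _; rewrite /fN !indicE in_setI.
    by case: (_ \in _); case: (_ \in _); rewrite ?mulr1 ?mulr0 ?mul0r.
  apply/funext => x; rewrite !indicE !in_setI.
  by case: (x \in rbox a b); case: (x \in [set _ | _]); case: (x \in K); rewrite ?mulr1 ?mulr0.
Qed.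

(** Apply the functional to the truncated density itself: the square of its norm is then at most C
    times its norm. *)
Let NfN N : N2 leb (fN N) <= C.
Proof.
have [->//|Nn0] := eqVneq (N2 leb (fN N)) 0.
have Np : 0 < N2 leb (fN N) by rewrite lt_neqAle eq_sym Nn0 N2_ge0.
rewrite -(ler_pM2r Np) -expr2 N2_sqr.
have -> : \int[leb]_x (fN N x ^+ 2) = l (fun x => fN N x * \1_(E N) x).
  by rewrite rep_N//; apply: eq_Rintegral => x _; rewrite expr2.
apply: le_trans (ler_norm _) _; apply: le_trans (lC (LgE N (LfN N))) _.
rewrite ler_wpM2l//; apply: le_N2 => //; first by case: (LgE N (LfN N)).
move=> x; rewrite normrM ler_piMr// indicE.
by case: (_ \in _); rewrite ?normr1 ?normr0.
Qed.

Let f1 x : R := f x * \1_K x.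

Let fN_E N x : K x -> `|f x| <= N%:R -> fN N x = f1 x.
Proof. by move=> Kx h; rewrite /fN /f1 !indicE !mem_set. Qed.

Let fN_cvg x : (fN ^~ x) @ \oo --> f1 x.
Proof.
have [Kx|nK] := pselect (K x).
  apply: cvg_near_cst; exists (Num.truncn `|f x|).+1 => // k /= hk.
  rewrite fN_E//; apply: le_trans (ltW (truncnS_gt _)) _.
  by rewrite ler_nat.
rewrite (_ : fN ^~ x = fun=> f1 x); first exact: cvg_cst.
by apply/funext => N; rewrite /fN /f1 !indicE !memNset// => -[].
Qed.

Let fN_abs N x : `|fN N x| <= `|f1 x|.
Proof.
rewrite /fN /f1 !normrM ler_wpM2l// !indicE.
case: (boolP (x \in E N)) => [/set_mem[_ Kx]|_]; first by rewrite mem_set// normr1.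
by rewrite normr0.
Qed.

Let Lf1 : L2 leb f1.
Proof.
have mf1 : measurable_fun setT f1.
  by apply: measurable_funM; [exact: ig_meas igf|exact: measurable_indic].
split => //.
apply: (proj1 (@monotone_ig (fun N x => fN N x ^+ 2) _ (C ^+ 2) _ _ _ _ _ _)) => //.
- by move=> N; case: (LfN N).
- by move=> N x; exact: sqr_ge0.
- move=> k k' x kk; rewrite -real_normK ?num_real// -[leRHS]real_normK ?num_real//.
  rewrite lerXn2r ?nnegrE// /fN !normrM ler_wpM2l// !indicE.
  case: (boolP (x \in E k)) => [/set_mem[h Kx]|_]; last by rewrite normr0.
  by rewrite mem_set//; split => //; apply: le_trans h _; rewrite ler_nat.
- by move=> x; apply: (@cvgM _ _ _ _ (fN ^~ x) (fN ^~ x)); exact: fN_cvg.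
- exact: measurable_funX.
- by move=> N; rewrite -N2_sqr lerXn2r ?nnegrE ?N2_ge0.
Qed.

Lemma riesz_L2 : exists f0, [/\ L2 leb f0, forall x, ~ K x -> f0 x = 0 &
  forall g, L2 leb g -> l (fun x => g x * \1_K x) = \int[leb]_x (f0 x * g x)].
Proof.
exists f1; split => //; first by move=> x nK; rewrite /f1 indicE memNset// mulr0.
move=> g Lg; pose u N := l (fun x => g x * \1_(E N) x).
have LgK : L2 leb (fun x => g x * \1_K x).
  apply: (L2Mb (C := 1) Lg); first exact: measurable_indic.
  by move=> x; rewrite indicE; case: (_ \in _); rewrite ?normr1 ?normr0.
have cu : u @ \oo --> l (fun x => g x * \1_K x).
  have [|||| _ cv] := @dct_N2 _ _ _ leb (fun N x => g x * \1_(E N) x) (fun x => g x * \1_K x) (fun x => `|g x|).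
  - by move=> N; case: (LgE N Lg).
  - move=> x; have [Kx|nK] := pselect (K x).
      apply: cvg_near_cst; exists (Num.truncn `|f x|).+1 => // k /= hk.
      rewrite !indicE !mem_set//; split => //=; apply: le_trans (ltW (truncnS_gt _)) _.
      by rewrite ler_nat.
    rewrite (_ : (fun N => _) = fun=> g x * \1_K x); first exact: cvg_cst.
    by apply/funext => N; rewrite !indicE !memNset// => -[].
  - move=> N x; rewrite normrM ler_piMr// indicE.
    by case: (_ \in _); rewrite ?normr1 ?normr0.
  - apply: (L2_le _ _ Lg); first by apply: measurableT_comp => //; case: Lg.
    by move=> x; rewrite normr_id.
  apply: (@cvg_dist_le _ _ (fun N => C * N2 leb (fun x => g x * \1_K x - g x * \1_(E N) x))).
    by move=> N; apply: ldist => //; exact: LgE.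
  by rewrite -[X in _ --> X](mulr0 C); apply: cvgM; [exact: cvg_cst|exact: cv].
have cu' : u @ \oo --> \int[leb]_x (f1 x * g x).
  rewrite (_ : u = fun N => \int[leb]_x (fN N x * g x)); last by apply/funext => N; exact: rep_N.
  apply: (@dct_int _ _ _ leb _ _ (fun x => `|f1 x * g x|)).
  - by move=> N; apply: measurable_funM; [case: (LfN N)|case: Lg].
  - by move=> x; apply: cvgM; [exact: fN_cvg|exact: cvg_cst].
  - by move=> N x; rewrite (normrM (fN N x)) (normrM (f1 x)) ler_wpM2r// fN_abs.
  - by apply: ig_norm; exact: L2M.
exact: (@cvg_unique _ (@Rhausdorff R) (u @ \oo)).
Qed.

End riesz.

(** * Weak limits in L^p on a compact set *)

Section weak_limit.
Context {R : realType} {n : nat}.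
Local Notation V := 'rV[R]_n.
Local Notation leb := (lebesgue_rV R n).
Variables (p C : R) (K : set V) (G : nat -> V -> R).
Hypotheses (p2 : 2 < p) (cK : compact K) (LG : forall j, Lp_on p K (G j)).
Hypothesis GC : forall j, \int[leb]_x (`|(G j \_ K) x| `^ p) <= C.

Let p0 : 0 < p. Proof. exact: lt_trans p2. Qed.
Let mK := compact_rV_measurable cK.
Let L2G j : L2 leb (G j \_ K). Proof. by have [] := Lp_on_L2 cK p2 (LG j). Qed.
Let igG j : ig leb (fun x => `|(G j \_ K) x| `^ p).
Proof. by have [] := (Lp_onP _ mK p0).1 (LG j). Qed.

Let C0 : 0 <= C.
Proof. by apply: le_trans (GC 0%N); apply: int_ge0 => x; exact: powR_ge0. Qed.

Let D := Num.sqrt (\int[leb]_x \1_K x + C).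
Let N2G j : N2 leb (G j \_ K) <= D.
Proof.
rewrite /N2; apply: ler_wsqrtr; have [_ h] := Lp_on_L2 cK p2 (LG j).
by apply: le_trans h _; rewrite lerD2l.
Qed.

Let u (g : V -> R) j := ip (G j \_ K) g.

(** Convergence against boxes spreads to all of L2 by [L2_ind], because the sequence is bounded; the
    limit functional is then bounded and is represented by a function supported in K. *)
Lemma weak_limit_L2 : (forall a b, cvgn (fun j => \int[leb]_x ((G j \_ K) x * \1_(rbox a b) x))) ->
  exists f0, [/\ L2 leb f0, forall x, ~ K x -> f0 x = 0 &
    forall g, L2 leb g -> (fun j => ip (G j \_ K) g) @ \oo --> ip f0 g].
Proof.
move=> hb.
have udist f g j : L2 leb f -> L2 leb g -> `|u f j - u g j| <= D * N2 leb (fun x => f x - g x).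
  move=> Lf Lg; rewrite /u (ipC _ f) (ipC _ g) -ipBl// ipC.
  by apply: ip_cs => //; exact: L2B.
have cu g : L2 leb g -> cvgn (u g).
  move: g; apply: (@L2_ind _ _ leb (fun g => cvgn (u g))).
  - exact: rbox_fin.
  - move=> f g Lf Lg cf cg; suff -> : u (fun x => f x + g x) = fun j => u f j + u g j by exact: is_cvgD.
    by apply/funext => j; rewrite /u ipC ipDl// !(ipC (G j \_ K)).
  - move=> c f Lf cf; rewrite (_ : u _ = fun j => c * u f j); first exact: is_cvgMl_tmp.
    by apply/funext => j; rewrite /u ipC ipZl// ipC.
  - move=> f g Lf Lg cg cv; apply: cvgn_approx => e e0.
    have D1 : 0 < D + 1 by rewrite ltr_wpDl// sqrtr_ge0.
    have /cvgrPdist_le /(_ _ (divr_gt0 e0 D1)) [k _ hk] := cv.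
    exists (u (g k)) => // j; apply: le_trans (udist _ _ j Lf (Lg k)) _.
    have := hk k (leqnn k); rewrite /= sub0r normrN ger0_norm ?N2_ge0// => h.
    apply: (@le_trans _ _ ((D + 1) * N2 leb (fun x => f x - g k x))).
      by rewrite ler_wpM2r ?N2_ge0// lerDl.
    by rewrite mulrC -ler_pdivlMr.
  - exact: hb.
pose l g : R := limn (u g).
have ul g : L2 leb g -> u g @ \oo --> l g by move=> /cu.
have [f0 [Lf0 f00 hf]] : exists f0, [/\ L2 leb f0, forall x, ~ K x -> f0 x = 0 &
    forall g, L2 leb g -> l (fun x => g x * \1_K x) = \int[leb]_x (f0 x * g x)].
  apply: (@riesz_L2 _ _ K l D cK).
  - exact: sqrtr_ge0.
  - move=> f g Lf Lg; apply/cvg_lim => //.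
    rewrite (_ : u _ = fun j => u f j + u g j); first by apply: cvgD; exact: ul.
    by apply/funext => j; rewrite /u ipC ipDl// !(ipC (G j \_ K)).
  - move=> c f Lf; apply/cvg_lim => //.
    rewrite (_ : u _ = fun j => c * u f j); first by apply: cvgMl_tmp; exact: ul.
    by apply/funext => j; rewrite /u ipC ipZl// ipC.
  - move=> f Lf; apply: lim_norm_le (ul f Lf) _ => j.
    by apply: ip_cs.
exists f0; split => // g Lg.
have Lg1 : L2 leb (fun x => g x * \1_K x).
  apply: (L2Mb (C := 1) Lg); first exact: measurable_indic.
  by move=> x; rewrite indicE; case: (_ \in _); rewrite ?normr1 ?normr0.
have := ul _ Lg1; rewrite hf// (_ : u _ = u g)//; apply/funext => j.
apply: eq_Rintegral => x _; rewrite indicE; have [Kx|nK] := pselect (K x).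
  by rewrite mem_set// mulr1.
by rewrite restrict_eq0// !mul0r.
Qed.

(** Integrated Young inequality. It takes the place of the Hölder inequality; where sharpness
    matters, the two functions are rescaled beforehand. *)
Let dual_bound (q Cf I : R) (f g : V -> R) : 0 < q -> p^-1 + q^-1 = 1 ->
  measurable_fun setT f -> ig leb (fun x => `|f x| `^ p) -> \int[leb]_x (`|f x| `^ p) <= Cf ->
  measurable_fun setT g -> ig leb (fun x => `|g x| `^ q) -> \int[leb]_x (`|g x| `^ q) <= I ->
  `|ip f g| <= Cf / p + I / q.
Proof.
move=> q0 pq mf fi fC mg gi gI.
have igb : ig leb (fun x => p^-1 * (`|f x| `^ p) + q^-1 * (`|g x| `^ q)) by apply: igD; exact: igZ.
have b x : `|f x * g x| <= p^-1 * (`|f x| `^ p) + q^-1 * (`|g x| `^ q).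
  rewrite normrM; apply: le_trans (conjugate_powR _ _ p0 q0 pq) _ => //.
  by rewrite mulrC (mulrC (_ `^ q)).
have ifg : ig leb (fun x => f x * g x) by apply: (ig_le _ b igb); exact: measurable_funM.
apply: le_trans (le_norm_int ifg) _; apply: le_trans (le_int (ig_norm ifg) igb b) _.
rewrite intD; [|exact: igZ|exact: igZ]; rewrite !intZ// mulrC (mulrC q^-1).
by apply: lerD; rewrite ler_pM2r// invr_gt0.
Qed.

(** The L2 limit is shown to be in L^p by testing with truncations of f0 |f0|^(p-2). Convergence
    then extends from L2 to L^q test functions by truncating these, with an error uniform over the
    L^p ball. *)
Lemma weak_limit_Lp : (forall a b, cvgn (fun j => \int[leb]_x ((G j \_ K) x * \1_(rbox a b) x))) ->
  exists f0, [/\ Lp_on p K f0, forall x, ~ K x -> f0 x = 0 &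
    forall q psi, 0 < q -> p^-1 + q^-1 = 1 -> Lp_on q K psi ->
      (fun j => \int[leb]_(x in K) (G j x * psi x)) @ \oo --> \int[leb]_(x in K) (f0 x * psi x)].
Proof.
move=> /weak_limit_L2[f0 [Lf0 f00 wf0]]; have mf0 : measurable_fun setT f0 by case: Lf0.
have f0K : f0 \_ K = f0.
  by apply/funext => x; rewrite patchE; case: (boolP (x \in K)) => //; rewrite notin_setE => /f00 ->.
pose q : R := (1 - p^-1)^-1.
have p1 : 0 < 1 - p^-1 by rewrite subr_gt0 invf_lt1// (lt_trans _ p2)// ltr1n.
have q0 : 0 < q by rewrite invr_gt0.
have pq : p^-1 + q^-1 = 1 by rewrite invrK subrKC.
pose E (N : nat) : set V := [set x | `|f0 x| <= N%:R].
have mE N : measurable (E N).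
  have mf : measurable_fun setT (fun x => `|f0 x|) by exact: measurableT_comp.
  have := mf measurableT `]-oo, N%:R]%classic (measurable_itv _).
  by rewrite setTI; congr measurable; apply/seteqP; split => x /=; rewrite in_itv.
pose g N x := f0 x * `|f0 x| `^ (p - 2) * \1_(E N) x.
pose h N x := `|f0 x| `^ p * \1_(E N) x.
have ind01 N x : `|\1_(E N) x : R| <= 1.
  by rewrite indicE; case: (_ \in _); rewrite ?normr1 ?normr0.
have pw t : 0 <= t -> t * t `^ (p - 2) = t `^ (p - 1) :> R.
  rewrite le_eqVlt => /predU1P[<-|t0].
    by rewrite mul0r powR0// subr_eq0 gt_eqF// (lt_trans _ p2)// ltr1n.
  have -> : t * t `^ (p - 2) = t `^ 1 * t `^ (p - 2) by rewrite powRr1 ?ltW.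
  rewrite -powRD; last by rewrite (gt_eqF t0) implybT.
  by congr (_ `^ _); lra.
have gabs N x : `|g N x| = `|f0 x| `^ (p - 1) * \1_(E N) x.
  rewrite /g !normrM (ger0_norm (powR_ge0 _ _)) pw//; congr (_ * _).
  by rewrite indicE; case: (_ \in _); rewrite ?normr1 ?normr0.
have qp1 : (p - 1) * q = p.
  have pn0 : p != 0 by rewrite gt_eqF.
  have pn1 : p - 1 != 0 by rewrite gt_eqF// subr_gt0 (lt_trans _ p2)// ltr1n.
  rewrite /q; field.
  by rewrite pn1 pn0.
have gq N x : `|g N x| `^ q = h N x.
  rewrite gabs /h indicE; case: (x \in E N); last by rewrite !mulr0 powR0// gt_eqF.
  by rewrite !mulr1 -powRrM qp1.
have fg N x : f0 x * g N x = h N x.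
  rewrite /g /h !mulrA; congr (_ * _); rewrite -expr2 -real_normK ?num_real// expr2 -mulrA pw// .
  have [->|n0] := eqVneq `|f0 x| 0; first by rewrite mul0r powR0// gt_eqF.
  have -> : `|f0 x| * `|f0 x| `^ (p - 1) = `|f0 x| `^ 1 * `|f0 x| `^ (p - 1) by rewrite powRr1.
  by rewrite -powRD ?n0 ?implybT//; congr (_ `^ _); lra.
have mg N : measurable_fun setT (g N).
  apply: measurable_funM; last exact: measurable_indic.
  apply: measurable_funM => //; apply: (measurableT_comp (f := fun t => t `^ (p - 2))) => //.
  exact: measurableT_comp.
have Lg N : L2 leb (g N).
  apply: (L2_le (mg N) _ (L2Z (N%:R `^ (p - 1)) (compact_indic_L2 cK))) => x.
  rewrite gabs normrM ger0_norm ?mulr_ge0 ?powR_ge0// indicE.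
  case: (boolP (x \in E N)) => [/set_mem h1|_]; last by rewrite mulr0.
  rewrite mulr1; have [Kx|nK] := pselect (K x).
    rewrite indicE mem_set// normr1 mulr1 ge0_ler_powR// ?nnegrE//.
    by rewrite subr_ge0 (le_trans _ (ltW p2))// ler1n.
  by rewrite f00// normr0 powR0// gt_eqF// subr_gt0 (lt_trans _ p2)// ltr1n.
have igh N : ig leb (h N) by have := L2M Lf0 (Lg N); congr (ig _ _); apply/funext => x; rewrite fg.
have hC N : \int[leb]_x h N x <= C.
  (* Young gives I <= C / p + I / q; since 1/p + 1/q = 1 this absorbs to I <= C. The truncation
     guarantees that I is finite. *)
  pose I := \int[leb]_x h N x.
  have b : I <= C / p + I / q.
    have E1 : ip f0 (g N) = I by apply: eq_Rintegral => x _; exact: fg.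
    apply: (@le_trans _ _ `|I|); first exact: ler_norm.
    rewrite -{1}E1; apply: lim_norm_le (wf0 _ (Lg N)) _ => j.
    apply: dual_bound => //.
    - by case: (L2G j).
    - by under eq_fun do rewrite gq.
    - by under eq_Rintegral do rewrite gq.
  move: b; rewrite -/I.
  have -> : I / q = I - I / p by rewrite /q invrK; ring.
  by rewrite addrCA lerDl subr_ge0 ler_pM2r// invr_gt0.
have [fi fC] : ig leb (fun x => `|f0 x| `^ p) /\ \int[leb]_x (`|f0 x| `^ p) <= C.
  apply: (@monotone_ig _ _ h) => //.
  - by move=> k x; rewrite mulr_ge0 ?powR_ge0.
  - move=> k k' x kk; rewrite ler_wpM2l ?powR_ge0// !indicE.
    case: (boolP (x \in E k)) => [/set_mem h1|_]; last by [].
    by rewrite mem_set//; apply: le_trans h1 _; rewrite ler_nat.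
  - move=> x; apply: cvg_near_cst; exists (Num.truncn `|f0 x|).+1 => // k /= hk.
    rewrite /h indicE mem_set ?mulr1//; apply: le_trans (ltW (truncnS_gt _)) _.
    by rewrite ler_nat.
  - apply: (measurableT_comp (f := fun t => t `^ p)) => //; exact: measurableT_comp.
exists f0; split => //; first by apply/(Lp_onP _ mK p0); rewrite f0K.
move=> q' psi q'0 pq' hpsi.
have {q'0 pq'} qq : q' = q by rewrite /q -pq' addrAC subrr add0r invrK.
rewrite {}qq in hpsi *.
have [mpsi ipsi] := (Lp_onP _ mK q0).1 hpsi.
pose P := psi \_ K; have PE : P = psi \_ K by [].
rewrite -PE in mpsi ipsi.
have conv f : \int[leb]_(x in K) (f x * psi x) = ip (f \_ K) P.
  by rewrite Rintegral_mkcond restrictMM.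
under eq_fun do rewrite conv; rewrite conv f0K.
apply: cvg_approx => e e0.
(* Young is applied to d f and d^-1 r. The choice d^p = t makes the first term at most e / 2 for
   every f in the ball; the level N is chosen afterwards for the second. *)
pose t := e / 2 / (C / p + 1).
have Cp : 0 <= C / p by rewrite divr_ge0// ltW.
have D0 : 0 < C / p + 1 by rewrite ltr_wpDl.
have t0 : 0 < t by rewrite !divr_gt0.
pose d := t `^ p^-1; have d0 : 0 < d by rewrite powR_gt0.
have dp : d `^ p = t by rewrite /d -powRrM mulVf ?powRr1 ?(ltW t0)// gt_eqF.
pose PN (N : nat) x := P x * \1_([set x | `|P x| <= N%:R]) x.
have mset N : measurable [set x | `|P x| <= N%:R].
  have mf : measurable_fun setT (fun x => `|P x|) by exact: measurableT_comp.
  have := mf measurableT `]-oo, N%:R]%classic (measurable_itv _).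
  by rewrite setTI; congr measurable; apply/seteqP; split => x /=; rewrite in_itv.
have mPN N : measurable_fun setT (PN N).
  by apply: measurable_funM => //; exact: measurable_indic.
have LPN N : L2 leb (PN N).
  apply: (L2_le (mPN N) _ (L2Z N%:R (compact_indic_L2 cK))) => x.
  have [Kx|nK] := pselect (K x); last by rewrite /PN /P restrict_eq0// mul0r normr0.
  rewrite /PN !indicE (mem_set Kx) mulr1.
  case: (boolP (x \in _)) => [/set_mem h1|_]; last by rewrite mulr0 normr0.
  by rewrite mulr1 [leRHS]ger0_norm.
pose r N x := P x - PN N x.
have mr N : measurable_fun setT (r N) by exact: measurable_funB.
have mrq N : measurable_fun setT (fun x => `|r N x| `^ q).
  by apply: (measurableT_comp (f := fun t => t `^ q)) => //; exact: measurableT_comp.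
have rle N x : `|r N x| `^ q <= `|P x| `^ q.
  rewrite ge0_ler_powR ?nnegrE ?(ltW q0)// /r /PN indicE.
  by case: (_ \in _); rewrite ?mulr1 ?mulr0 ?subrr ?subr0 ?normr0.
have ir N : ig leb (fun x => `|r N x| `^ q).
  by apply: (ig_le (mrq N) _ ipsi) => x; rewrite ger0_norm ?powR_ge0.
have cr : (fun N => \int[leb]_x (`|r N x| `^ q)) @ \oo --> (0 : R).
  rewrite -[X in _ --> X](int0 leb); apply: (dct_int mrq (g := fun x => `|P x| `^ q)) => //.
    move=> x; apply: cvg_near_cst; exists (Num.truncn `|P x|).+1 => // k /= hk.
    rewrite /r /PN indicE mem_set ?mulr1 ?subrr ?normr0 ?powR0 ?gt_eqF//=.
    by apply: le_trans (ltW (truncnS_gt _)) _; rewrite ler_nat.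
  by move=> k x; rewrite ger0_norm ?powR_ge0.
have s0 : 0 < e / 2 * q * d `^ q by rewrite !mulr_gt0 ?divr_gt0 ?powR_gt0.
have /cvgrPdist_le /(_ _ s0) [N _ hN] := cr.
have {}hN : \int[leb]_x (`|r N x| `^ q) <= e / 2 * q * d `^ q.
  by have := hN N (leqnn N); rewrite /= sub0r normrN; apply: le_trans; exact: ler_norm.
exists (fun j => ip (G j \_ K) (PN N)), (ip f0 (PN N)).
have key f : L2 leb f -> ig leb (fun x => `|f x| `^ p) -> \int[leb]_x (`|f x| `^ p) <= C ->
    `|ip f P - ip f (PN N)| <= e.
  move=> Lf ifp fCC; have mf : measurable_fun setT f by case: Lf.
  have ifP : ig leb (fun x => f x * P x).
    apply: (@ig_le _ _ _ leb _ (fun x => p^-1 * (`|f x| `^ p) + q^-1 * (`|P x| `^ q))).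
    - exact: measurable_funM.
    - move=> x; rewrite normrM; apply: le_trans (conjugate_powR _ _ p0 q0 pq) _ => //.
      by rewrite mulrC (mulrC (_ `^ q)).
    - by apply: igD; exact: igZ.
  have -> : ip f P - ip f (PN N) = ip (fun x => d * f x) (fun x => d^-1 * r N x).
    rewrite /ip -intB//; last exact: L2M.
    apply: eq_Rintegral => x _; rewrite /r -mulrBr; field.
    by rewrite gt_eqF.
  have iE c s' (F : V -> R) : 0 < c -> (fun x => `|c * F x| `^ s') = fun x => c `^ s' * `|F x| `^ s'.
    by move=> c0; apply/funext => x; rewrite normrM powRM// gtr0_norm.
  have di0 : 0 < d^-1 by rewrite invr_gt0.
  apply: (@le_trans _ _ (t * C / p + e / 2 * q / q)).
    apply: dual_bound => //.
    - exact: measurable_funM.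
    - by rewrite iE//; exact: igZ.
    - by rewrite iE// intZ// dp ler_wpM2l// ltW.
    - exact: measurable_funM.
    - by rewrite iE//; exact: igZ.
    - rewrite iE// intZ//; apply: (@le_trans _ _ (d^-1 `^ q * (e / 2 * q * d `^ q))).
        by rewrite ler_wpM2l// powR_ge0.
      rewrite mulrCA -powRM ?(ltW di0) ?(ltW d0)// mulVf ?powR1 ?mulr1//.
      by rewrite gt_eqF.
  rewrite mulfK ?gt_eqF// [leRHS](splitr e) lerD2r -mulrA.
  apply: (@le_trans _ _ (t * (C / p + 1))); first by rewrite ler_wpM2l ?lerDl// ltW.
  by rewrite /t divfK// gt_eqF.
split; [exact: wf0| |exact: key].
move=> j; exact: key (L2G j) (igG j) (GC j).
Qed.

End weak_limit.

Lemma cvg_bigsum {R : realType} (I : Type) (s : seq I) (u : I -> nat -> R) (l : I -> R) :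
  (forall i, u i @ \oo --> l i) -> (fun j => \sum_(i <- s) u i j) @ \oo --> \sum_(i <- s) l i.
Proof.
move=> h; elim: s => [|i s IH].
  by rewrite big_nil; under eq_fun do rewrite big_nil; exact: cvg_cst.
by rewrite big_cons; under eq_fun do rewrite big_cons; exact: cvgD.
Qed.

(** * Gluing weak limits over an open set *)

Section glue.
Context {R : realType} {n : nat}.
Local Notation V := 'rV[R]_n.
Local Notation leb := (lebesgue_rV R n).
Local Notation boxes := ('rV[rat]_n * 'rV[rat]_n)%type.
Variables (p : R) (U : set V) (F : nat -> V -> R) (good : boxes -> Prop).
Hypotheses (oU : open U) (p2 : 2 < p) (LF : forall j, Lp_loc p U (F j)) (bF : bounded_Lp_loc p U F).
Hypothesis goodU : forall ab, good ab -> cbox ab.1 ab.2 `<=` U.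
Hypothesis good_cover : forall x, U x -> exists2 ab, good ab & rbox ab.1 ab.2 x.
Hypothesis good_cvg : forall ab, good ab -> forall a b,
  cvgn (fun j => \int[leb]_x ((F j \_ (cbox ab.1 ab.2)) x * \1_(rbox a b) x)).

Let p0 : 0 < p. Proof. exact: lt_trans p2. Qed.

(** The good closed boxes listed by their codes; numbers that code no good box give the empty set,
    so the family is indexed by all integers. *)
Let Q (m : nat) : set V :=
  if unpickle m is Some ab then if `[< good ab >] then cbox (ab : boxes).1 ab.2 else set0 else set0.

Let cQ m : compact (Q m).
Proof.
rewrite /Q; case: unpickle => [ab|]; last exact: compact0.
by case: asboolP => _; [exact: cbox_compact|exact: compact0].
Qed.

Let QU m : Q m `<=` U.
Proof. by move=> x; rewrite /Q; case: unpickle => [ab|//]; case: asboolP => // gab; exact: goodU. Qed.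

Let mQ m : measurable (Q m). Proof. exact: compact_rV_measurable (@cQ m). Qed.

Let Q_cover K : compact K -> K `<=` U -> exists N, K `<=` \big[setU/set0]_(m < N) Q m.
Proof.
move=> cK KU.
have [|x Kx|s [sg sK]] := @compact_cover_seq V K boxes good (fun ab => rbox ab.1 ab.2) cK.
- by move=> ab _; exact: rbox_open.
- by have [ab gab xab] := good_cover (KU x Kx); exists ab.
exists (\max_(ab <- s) pickle ab).+1 => x Kx; rewrite -bigcup_mkord.
have [ab abs xab] := sK x Kx; exists (pickle ab) => /=.
  by rewrite ltnS; apply: (leq_bigmax_seq (F := fun ab => pickle ab)).
by rewrite /Q pickleK asboolT; [exact: rbox_sub_cbox|exact: sg].
Qed.

Let D := seqDU Q.
Let mD m : measurable (D m).
Proof. by apply: measurableD => //; exact: bigsetU_measurable. Qed.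
Let DQ m : D m `<=` Q m. Proof. exact: subDsetl. Qed.

Let fm_ex m : exists f, [/\ Lp_on p (Q m) f, forall x, ~ Q m x -> f x = 0 &
  forall q psi, 0 < q -> p^-1 + q^-1 = 1 -> Lp_on q (Q m) psi ->
    (fun j => \int[leb]_(x in Q m) (F j x * psi x)) @ \oo --> \int[leb]_(x in Q m) (f x * psi x)].
Proof.
have LFQ j : Lp_on p (Q m) (F j) by have [_ h] := LF j; apply: h => //; exact: QU.
have [C hC] := bF (@cQ m) (@QU m).
apply: (@weak_limit_Lp _ _ p C (Q m) F) => //.
- by move=> j; have := hC j; rewrite (Lp_on_intE (mQ m) p0 (LFQ j)) lee_fin.
- move=> a b; move: (LFQ 0%N); rewrite /Q; case: unpickle => [ab|] _.
    case: asboolP => [gab|_]; first exact: good_cvg.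
    by under eq_fun do under eq_Rintegral do rewrite patch_set0 mul0r; apply: is_cvg_cst.
  by under eq_fun do under eq_Rintegral do rewrite patch_set0 mul0r; apply: is_cvg_cst.
Qed.

Let fm m := sval (cid (fm_ex m)).
Let fmP m := svalP (cid (fm_ex m)).

Let f x : R := if pselect (exists m, D m x) is left h then fm (sval (cid h)) x else 0.

Let fE m x : D m x -> f x = fm m x.
Proof.
move=> Dx; rewrite /f; case: pselect => [h|]; last by case; exists m.
case: cid => /= m' Dm'; congr (fm _ x).
apply: (@trivIset_seqDU _ Q m' m I I); by exists x.
Qed.

Let restrict_sum K N (g : V -> R) : K `<=` \big[setU/set0]_(m < N) Q m ->
  g \_ K = fun x => \sum_(m < N) g x * \1_(D m `&` K) x.
Proof.
move=> KN; apply/funext => x; have [Kx|nK] := pselect (K x); last first.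
  rewrite restrict_eq0// big1// => m _; rewrite indicE memNset ?mulr0// => -[] //.
have : (\big[setU/set0]_(m < N) D m) x by rewrite -bigsetU_seqDU; exact: KN.
rewrite -bigcup_mkord => -[m /= mN Dx]; rewrite restrictT_eq// (bigD1 (Ordinal mN))//=.
rewrite indicE mem_set// mulr1 big1 ?addr0// => m' mm; rewrite indicE memNset ?mulr0// => -[Dm' _].
move/eqP: mm; apply; apply: val_inj => /=.
by apply: (@trivIset_seqDU _ Q m' m I I); exists x.
Qed.

Let piece m K q (g : V -> R) : measurable K -> 0 < q -> Lp_on q K g ->
  Lp_on q (Q m) (fun x => g x * \1_(D m `&` K) x).
Proof.
move=> mK q0 hg; have [mg gi] := (Lp_onP _ mK q0).1 hg.
have E : (fun x => g x * \1_(D m `&` K) x) \_ (Q m) = fun x => (g \_ K) x * \1_(D m) x.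
  apply/funext => x; have [Qx|nQ] := pselect (Q m x).
    rewrite restrictT_eq// indicI /= mulrCA mulrC; congr (_ * _).
    rewrite indicE; have [Kx|nK] := pselect (K x); first by rewrite restrictT_eq// mem_set// mulr1.
    by rewrite restrict_eq0// memNset ?mulr0.
  by rewrite restrict_eq0// indicE memNset ?mulr0// => /DQ.
apply: (Lp_on_bound (mQ m) q0 (g := fun x => `|(g \_ K) x| `^ q)) => //.
- by rewrite E; apply: measurable_funM => //; exact: measurable_indic.
- move=> x Qx; have := congr1 (fun h => h x) E; rewrite /= restrictT_eq// => ->.
  rewrite ge0_ler_powR ?nnegrE ?(ltW q0)// normrM ler_piMr// indicE.
  by case: (_ \in _); rewrite ?normr1 ?normr0.
Qed.

Let f_Lp K : compact K -> K `<=` U -> Lp_on p K f.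
Proof.
move=> cK KU; have mK := compact_rV_measurable cK; have [N KN] := Q_cover cK KU.
have E : f \_ K = fun x => \sum_(m < N) (fm m \_ (Q m)) x * \1_(D m `&` K) x.
  rewrite (restrict_sum f KN); apply/funext => x; apply: eq_bigr => m _.
  rewrite indicE; case: (boolP (x \in _)) => [/set_mem[Dx Kx]|_]; last by rewrite !mulr0.
  by rewrite (fE Dx) restrictT_eq//; exact: DQ.
have mf : measurable_fun setT (f \_ K).
  rewrite E; apply: measurable_sum => m; apply: measurable_funM.
    by have [h _ _] := fmP m; have [] := (Lp_onP _ (mQ m) p0).1 h.
  by apply: measurable_indic; exact: measurableI.
apply: (Lp_on_bound mK p0 mf (g := fun x => \sum_(m < N) `|(fm m \_ (Q m)) x| `^ p)).
- move=> x Kx; have : (\big[setU/set0]_(m < N) D m) x by rewrite -bigsetU_seqDU; exact: KN.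
  rewrite -bigcup_mkord => -[m /= mN Dx]; rewrite (fE Dx) (bigD1 (Ordinal mN))//=.
  rewrite restrictT_eq; last exact: DQ.
  by rewrite lerDl; apply: sumr_ge0 => i _; exact: powR_ge0.
- by move=> x; apply: sumr_ge0 => i _; exact: powR_ge0.
- by apply: ig_sum => m _; have [h _ _] := fmP m; have [] := (Lp_onP _ (mQ m) p0).1 h.
Qed.

(** The boxes are made disjoint and the limits of the pieces put side by side. A compact subset of U
    is covered by finitely many boxes, so convergence against a test function on it is a finite sum
    of convergences on boxes. *)
Lemma weak_limit_loc : exists f0, Lp_loc p U f0 /\ weak_cvg_Lp_loc p U F f0.
Proof.
exists f; split.
  split; last by move=> K cK KU; exact: f_Lp.
  have UE : U = \bigcup_m Q m.
    apply/seteqP; split => [x Ux|x [m _ /QU]//].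
    have [ab gab xab] := good_cover Ux; exists (pickle ab) => //.
    by rewrite /Q pickleK asboolT//; exact: rbox_sub_cbox.
  rewrite UE; apply/measurable_fun_typeR/measurable_fun_bigcup => // m.
  by have [h _] := f_Lp (@cQ m) (@QU m); apply/measurable_fun_typeR.
move=> K q psi cK KU q0 pq hpsi; have mK := compact_rV_measurable cK.
have [N KN] := Q_cover cK KU.
pose psim (m : nat) x := psi x * \1_(D m `&` K) x.
have hm m : Lp_on q (Q m) (psim m) by exact: piece.
have conv (g : V -> R) : (forall K', compact K' -> K' `<=` U -> Lp_on p K' g) ->
    \int[leb]_(x in K) (g x * psi x) = \sum_(m < N) \int[leb]_(x in Q m) (g x * psim m x).
  move=> hg; rewrite Rintegral_mkcond (restrict_sum _ KN).
  have igm m : ig leb (fun x => (g \_ (Q m)) x * (psim m \_ (Q m)) x).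
    exact: (Lp_on_dual_ig (mQ m) p0 q0 pq (hg _ (@cQ m) (@QU m)) (hm m)).
  transitivity (\int[leb]_x (\sum_(m < N) (g \_ (Q m)) x * (psim m \_ (Q m)) x)).
    apply: eq_Rintegral => x _; apply: eq_bigr => m _; rewrite -mulrA.
    have [Qx|nQ] := pselect (Q m x); first by rewrite !restrictT_eq.
    by rewrite !restrict_eq0// mul0r indicE memNset ?mulr0// => -[/DQ].
  rewrite int_sum//; apply: eq_bigr => m _.
  rewrite [RHS]Rintegral_mkcond; apply: eq_Rintegral => x _.
  by rewrite !patchE; case: (x \in Q m) => //; exact: mul0r.
have convF j := conv (F j) (proj2 (LF j)).
under eq_fun do rewrite convF; rewrite (conv f f_Lp).
apply: cvg_bigsum => m; have [_ _ w] := fmP m.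
rewrite (_ : \int[leb]_(x in Q m) (f x * psim m x) = \int[leb]_(x in Q m) (fm m x * psim m x)).
  exact: w q _ q0 pq (hm m).
apply: eq_Rintegral => x _; rewrite /psim indicE.
by case: (boolP (x \in _)) => [/set_mem[Dx _]|_]; [rewrite (fE Dx)|rewrite !mulr0].
Qed.

End glue.

(** * Composition in L2 with maps whose inverse is Lipschitz *)

Section push.
Context {R : realType} {n : nat}.
Local Notation V := 'rV[R]_n.
Local Notation leb := (lebesgue_rV R n).
Implicit Types (f g phi psi : V -> R).

Lemma test_function_lipschitz psi : test_function setT psi -> exists2 B : R, 0 <= B &
  forall x y, `|psi (x + y) - psi x| <= (\sum_b `|y 0 b|) * B.
Proof.
move=> tpsi; have [spsi _] := tpsi.
have /choice[B hB] b : exists B : R, 0 <= B /\ forall x, `|pd b psi x| <= B.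
  by have [B B0 hB] := test_function_bounded (test_function_pd b tpsi); exists B.
pose Bs := \sum_d B d.
have hBs d x : `|pd d psi x| <= Bs.
  apply: le_trans (proj2 (hB d) x) _; rewrite /Bs (bigD1 d)//= lerDl.
  by apply: sumr_ge0 => d' _; case: (hB d').
exists Bs; first by apply: sumr_ge0 => d _; case: (hB d).
move=> x y; rewrite {1}[y]row_sum_delta mulr_suml; elim: (index_enum _) => [|b s IH].
  by rewrite !big_nil addr0 subrr normr0.
rewrite !big_cons; set Y := \sum_(j <- s) _ in IH *.
have -> : psi (x + (y 0 b *: delta_mx 0 b + Y)) - psi x =
    (psi (x + Y + y 0 b *: delta_mx 0 b) - psi (x + Y)) + (psi (x + Y) - psi x).
  by rewrite [RHS]addrA subrK (addrC (y 0 b *: _)) addrA.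
apply: le_trans (ler_normD _ _) _; apply: lerD => //.
by rewrite mulrC; exact: slice_lipschitz (hBs b).
Qed.

Variables (L : set V) (T : V -> V) (Lam : R).
Hypotheses (cL : compact L) (mT : measurable_fun L T) (Lam0 : 0 <= Lam).
Hypothesis lipT : forall r x x', L x -> L x' -> cube r (T x - T x') -> cube (Lam * r) (x - x').

Let mL := compact_rV_measurable cL.
(** The identity outside L gives a measurable map of the whole space whose pushforward of Lebesgue
    measure is finite on boxes. *)
Let T' x : V := if x \in L then T x else x.

Let mT' : measurable_fun setT T'.
Proof.
rewrite -(setUv L); apply/measurable_funU => //; first exact: measurableC.
split.
  by apply: eq_measurable_fun mT => x; rewrite inE => Lx; rewrite /T' mem_set.
apply: (eq_measurable_fun id); last exact: measurable_id.
by move=> x; rewrite inE => Lx; rewrite /T' memNset.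
Qed.

Let T'E x : L x -> T' x = T x. Proof. by move=> Lx; rewrite /T' mem_set. Qed.

Let mcl h z : measurable_fun setT (fun x => \1_(cube h) (z - T' x) : R).
Proof.
have mi : measurable_fun setT (\1_(cube h) : V -> R) by apply: measurable_indic; exact: cube_measurable.
apply: measurableT_comp mi _; apply: measurable_fun_rVR => i; under eq_fun do rewrite !mxE.
apply: measurable_funB; first exact: measurable_cst.
exact: measurableT_comp (measurable_coordR i) mT'.
Qed.

Let ind1 (A : set V) x : `|\1_A x : R| <= 1.
Proof. by rewrite indicE; case: (_ \in _); rewrite ?normr1 ?normr0. Qed.

Let ig_cl h z : ig leb (fun x => \1_L x * \1_(cube h) (z - T' x)).
Proof. exact: (igMb (compact_indic_ig cL) (mcl h z) (fun x => ind1 _ _)). Qed.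

(* for fixed [z], the points [x] of [L] with [T x] close to [z] lie in a small cube *)
Let close_points h z : 0 <= h ->
  \int[leb]_x (\1_L x * \1_(cube h) (z - T' x)) <= (2 * Lam) ^+ n * (h *+ 2) ^+ n.
Proof.
move=> h0; have r0 : 0 <= Lam * (h *+ 2) by rewrite mulr_ge0// mulrn_wge0.
have [[x0 [Lx0 hx0]]|nS] := pselect (exists x, L x /\ cube h (z - T' x)); last first.
  rewrite (_ : (fun x => _) = fun=> 0).
    by rewrite int0 -exprMn exprn_ge0// !mulr_ge0// mulrn_wge0.
  apply/funext => x; have [Lx|nL] := pselect (L x); last by rewrite indicE (memNset nL) mul0r.
  rewrite [X in _ * X]indicE memNset ?mulr0// => hx.
  exact: nS (ex_intro _ x (conj Lx hx)).
pose W : V -> R := fun x => \1_(cube (Lam * (h *+ 2))) (x - x0).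
have igc : ig leb (\1_(cube (Lam * (h *+ 2))) : V -> R).
  by apply: ig_indic; [exact: cube_measurable|exact: compact_lebesgue_fin (@cube_compact _ _ _)].
have igW : ig leb W by exact: (ig_translate (- x0) igc).
have iW : \int[leb]_x W x = (2 * Lam) ^+ n * (h *+ 2) ^+ n.
  apply: (etrans (int_translate (- x0) igc)).
  transitivity (fine (leb (cube (Lam * (h *+ 2)) : set V))); first by apply: int_indic; exact: cube_measurable.
  rewrite (lebesgue_cube r0) -exprMn /=; congr (_ ^+ _).
  by rewrite -[LHS]mulr_natl mulrA.
rewrite -iW; apply: (le_int (ig_cl h z) igW) => x; rewrite /W.
have [Lx|nL] := pselect (L x); last by rewrite indicE (memNset nL) mul0r.
have [hx|nx] := pselect (cube h (z - T' x)); last by rewrite [X in _ * X]indicE (memNset nx) mulr0.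
rewrite [leRHS]indicE mem_set; first by rewrite !indicE; do 2 case: (_ \in _); rewrite ?mulr1 ?mulr0 ?mul0r.
apply: lipT => //; rewrite -!T'E// => i.
have := hx i; have := hx0 i; rewrite !mxE => a1 a2.
have -> : T' x 0 i - T' x0 0 i = (z 0 i - T' x0 0 i) - (z 0 i - T' x 0 i) by ring.
by apply: le_trans (ler_normB _ _) _; rewrite mulr2n; exact: lerD.
Qed.

(** Up to the Lipschitz error n B h, f (T x) is the mean of f over the cube of half-side h around T
    x. Exchanging integrals, each z is weighted by the volume of the points x with T x within h of
    z, at most (2 Lam)^n times the volume of the cube. Let h tend to 0. *)
Let push_test f : test_function setT f -> (forall x, 0 <= f x) ->
  \int[leb]_x (\1_L x * f (T' x)) <= (2 * Lam) ^+ n * \int[leb]_x f x.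
Proof.
move=> tf f_ge0; have f0 : unit * (forall x, 0 <= f x) by []; clear f_ge0.
have [B B0 hB] := test_function_lipschitz tf.
have igL : ig leb (\1_L : V -> R) by exact: compact_indic_ig.
have mf := test_function_measurable tf.
have [Cf Cf0 hCf] := test_function_bounded tf.
have igf := test_function_ig tf.
have mfT : measurable_fun setT (fun x => f (T' x)) by exact: measurableT_comp.
have igLf : ig leb (fun x => \1_L x * f (T' x)) by apply: (igMb igL mfT (C := Cf)) => x.
rewrite -subr_le0; apply: (@le0_small _ _ ((n%:R * B) * \int[leb]_x \1_L x)) => h h0 h1.
rewrite lerBlDr.
have [Q QE] : exists Q : R, Q = (h *+ 2) ^+ n by eexists.
have Q0 : 0 < Q by rewrite QE exprn_gt0// mulrn_wgt0.
have mcube : measurable (cube h : set V) by exact: cube_measurable.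
have mi : measurable_fun setT (\1_(cube h) : V -> R) by exact: measurable_indic.
have igi : ig leb (\1_(cube h)) by apply: ig_indic => //; exact: compact_lebesgue_fin (@cube_compact _ _ h).
have iQ : \int[leb]_y \1_(cube h) y = Q.
  transitivity (fine (leb (cube h : set V))); last by rewrite lebesgue_cube ?(ltW h0)// QE.
  exact: int_indic.
pose G (xz : V * V) := \1_L xz.1 * (f xz.2 * \1_(cube h) (xz.2 - T' xz.1)).
have msub : measurable_fun setT (fun xy : V * V => xy.2 - T' xy.1).
  apply: measurable_fun_rVR => i; under eq_fun do rewrite !mxE.
  apply: measurable_funB; first exact: measurableT_comp (measurable_coordR i) _.
  exact: (measurableT_comp (measurable_coordR i) (measurableT_comp mT' measurable_fst)).
have m1L : measurable_fun setT (\1_L : V -> R) by exact: measurable_indic.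
have mG : measurable_fun setT G.
  apply: measurable_funM; first exact: measurableT_comp m1L measurable_fst.
  apply: measurable_funM; first exact: measurableT_comp mf measurable_snd.
  exact: measurableT_comp mi msub.
have GB x z : `|G (x, z)| <= \1_L x * f z.
  rewrite /G /= !normrM (ger0_norm (f0.2 _)) (@ger0_norm _ (\1_L x))//.
  apply: ler_wpM2l => //; apply: ler_piMr; [exact: f0.2|]; rewrite indicE.
  by case: (_ \in _); rewrite ?normr1 ?normr0.
have [igG SG] := fubini_bound mG igL igf GB.
(* [G] integrates to an average of [f] over cubes of size [h] around [T x] *)
have lower x : \1_L x * (f (T' x) * Q) <= \int[leb]_z G (x, z) + (n%:R * B * h * Q) * \1_L x.
  rewrite /G /= intZ; last first.
    apply: (igMb igf (C := 1)).
      apply: measurableT_comp mi _; apply: measurable_fun_rVR => i; under eq_fun do rewrite !mxE.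
      by apply: measurable_funB; [exact: measurable_coordR|exact: measurable_cst].
    by move=> z; rewrite indicE; case: (_ \in _); rewrite ?normr1 ?normr0.
  rewrite [X in _ + X]mulrC -mulrDr; apply: ler_wpM2l; first by [].
  have igy : ig leb (fun y => f (T' x + y) * \1_(cube h) y).
    have mfy : measurable_fun setT (fun y => f (T' x + y)).
      by under eq_fun do rewrite addrC; exact: measurableT_comp mf (measurable_addrV (T' x)).
    have := igMb igi mfy (fun y => hCf (T' x + y)).
    by congr (ig _ _); apply/funext => y; rewrite mulrC.
  rewrite (_ : \int[leb]_z _ = \int[leb]_y (f (T' x + y) * \1_(cube h) y)); last first.
    rewrite -(int_translate (- T' x) igy); apply: eq_Rintegral => z _.
    by rewrite [T' x + _]addrC subrK.
  rewrite -lerBlDr -mulrBl; set c := f (T' x) - _.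
  have Ec : c * Q = \int[leb]_y (c * \1_(cube h) y) by rewrite -iQ; exact: esym (intZ c igi).
  rewrite Ec; apply: (le_int (igZ c igi) igy).
  move=> y; rewrite indicE; have [hy|hy] := pselect (cube h y); last first.
    by rewrite (memNset hy) 2!mulr0.
  rewrite (mem_set hy) 2!mulr1 /c lerBlDr -lerBlDl; apply: le_trans (_ : `|f (T' x + y) - f (T' x)| <= _).
    by rewrite distrC ler_norm.
  apply: le_trans (hB _ _) _; rewrite mulrAC; apply: ler_wpM2r; first by [].
  apply: (@le_trans _ _ (\sum_(b < n) h)); first by apply: ler_sum => b _; exact: hy.
  by rewrite sumr_const card_ord mulr_natl.
have mGx x : ig leb (fun z => G (x, z)).
  apply: (ig_le _ (GB x)); last exact: igZ.
  exact: (measurableT_comp mG (pair1_measurable x)).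
have upper z : \int[leb]_x G (x, z) <= (2 * Lam) ^+ n * Q * f z.
  rewrite (_ : \int[leb]_x G (x, z) = f z * \int[leb]_x (\1_L x * \1_(cube h) (z - T' x))).
    rewrite mulrC QE; apply: ler_wpM2r; [exact: f0.2|].
    exact: close_points (ltW h0).
  apply: esym; apply: (etrans (esym (intZ (f z) (ig_cl h z)))).
  by apply: eq_Rintegral => x _; rewrite /G /= mulrCA.
have msw : measurable_fun setT (fun zx : V * V => (zx.2, zx.1)).
  by apply/measurable_fun_pairP; split; [exact: measurable_snd|exact: measurable_fst].
pose G' (zx : V * V) := G (zx.2, zx.1).
have mG' : measurable_fun setT G' by exact: measurableT_comp mG msw.
have GB' z x : `|G' (z, x)| <= f z * \1_L x by rewrite mulrC; exact: GB.
have [igG' _] := fubini_bound mG' igf igL GB'.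
have I1 : Q * \int[leb]_x (\1_L x * f (T' x)) <=
    Q * (n%:R * B * (\int[leb]_x \1_L x) * h + (2 * Lam) ^+ n * \int[leb]_x f x).
  rewrite -(intZ Q igLf); apply: (@le_trans _ _ (\int[leb]_x (\int[leb]_z G (x, z) + (n%:R * B * h * Q) * \1_L x))).
    apply: le_int; [exact: igZ|by apply: igD; [exact: igG'|exact: igZ]|].
    move=> x; apply: le_trans (lower x); rewrite [leRHS]mulrA [leRHS]mulrC; exact: lexx.
  rewrite intD; [|exact: igG'|exact: igZ]; rewrite (intZ _ igL) SG mulrDr addrC; apply: lerD.
    rewrite le_eqVlt; apply/orP; left; apply/eqP.
    by move: (\int[leb]_x \1_L x) => t; ring.
  rewrite mulrA -(intZ _ igf); apply: (le_int igG (igZ _ igf)).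
  move=> z; rewrite [Q * _]mulrC; exact: upper.
by rewrite ler_pM2l in I1.
Qed.

Let nuT : {measure set V -> \bar R}.
Proof. by unshelve refine (pushforward leb T' : {measure set V -> \bar R}). Defined.

(** An approximation of f in L2 of this sum of measures is an approximation both of f and of f o T
    in L2, which carries the estimate from test functions to other functions. *)
Let mu : {measure set V -> \bar R} := measure_add leb nuT.

Let mu_int g : (forall x, 0 <= g x) -> measurable_fun setT g ->
  (\int[mu]_x (g x)%:E = \int[leb]_x (g x)%:E + \int[leb]_x (g (T' x))%:E)%E.
Proof.
move=> g0 mg; have mge : measurable_fun setT (EFin \o g) by exact/measurable_EFinP.
rewrite /mu ge0_integral_measure_add//; last by move=> x _; rewrite lee_fin.
congr (_ + _)%E; rewrite /nuT.
by rewrite (ge0_integral_pushforward mT' leb measurableT mge)//= => x _; rewrite lee_fin.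
Qed.

Let mu_fin a b : (mu (rbox a b : set V) < +oo)%E.
Proof.
have mr : measurable (rbox a b : set V) by exact: rbox_measurable.
have mi : measurable_fun setT (\1_(rbox a b) : V -> R) by exact: measurable_indic.
have i0 (x : V) : 0 <= (\1_(rbox a b) : V -> R) x by [].
have := mu_int i0 mi.
rewrite integral_indic// setIT => ->; rewrite integral_indic// setIT lte_add_pinfty//; first exact: rbox_fin.
have E : (fun x => (\1_(rbox a b) (T' x))%:E) = EFin \o \1_(T' @^-1` rbox a b) :> (V -> \bar R).
  by apply/funext => x.
have mp : measurable (T' @^-1` rbox a b) by rewrite -[X in measurable X]setTI; exact: mT'.
rewrite (_ : (\int[leb]_x _)%E = leb (T' @^-1` rbox a b)); last first.
  transitivity (\int[leb]_x (\1_(T' @^-1` rbox a b) x)%:E)%E; first by apply: eq_integral.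
  by rewrite integral_indic// setIT.
apply: (@le_lt_trans _ _ (leb (L `|` rbox a b))).
  apply: le_measure; rewrite ?inE//; first exact: measurableU.
  move=> x /=; rewrite /T'; case: (boolP (x \in L)) => [/set_mem Lx _|_ ?]; by [left|right].
apply: le_lt_trans (measureU2 _ _ _) _ => //.
by rewrite lte_add_pinfty//; [exact: compact_lebesgue_fin|exact: rbox_fin].
Qed.

Let ig_mu g : (forall x, 0 <= g x) -> measurable_fun setT g -> ig leb g -> ig leb (g \o T') ->
  ig mu g.
Proof.
move=> g0 mg ig1 ig2; apply/integrableP; split; first exact/measurable_EFinP.
rewrite (eq_integral (fun x => (g x)%:E)); last by move=> x _ /=; rewrite ger0_norm.
rewrite mu_int// lte_add_pinfty//; apply/ig_ge0P => //.
exact: measurableT_comp.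
Qed.

Let mu_split g : (forall x, 0 <= g x) -> ig mu g ->
  [/\ ig leb g, ig leb (g \o T') & \int[mu]_x g x = \int[leb]_x g x + \int[leb]_x g (T' x)].
Proof.
move=> g0 /[dup] ig_g /integrableP[/measurable_EFinP mg].
rewrite (eq_integral (fun x => (g x)%:E)); last by move=> x _ /=; rewrite ger0_norm.
have E := mu_int g0 mg; rewrite E => fin.
have p1 : (0 <= \int[leb]_x (g x)%:E)%E by apply: integral_ge0 => x _; rewrite lee_fin.
have p2 : (0 <= \int[leb]_x (g (T' x))%:E)%E by apply: integral_ge0 => x _; rewrite lee_fin.
have i1 : ig leb g.
  by apply/ig_ge0P => //; apply: le_lt_trans fin; rewrite leeDl.
have i2 : ig leb (g \o T').
  have mgT : measurable_fun setT (g \o T') := measurableT_comp mg mT'.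
  have gT0 x : 0 <= (g \o T') x by exact: g0.
  by apply/(ig_ge0P gT0 mgT); apply: le_lt_trans fin; rewrite leeDr.
split => //; rewrite /Rintegral E fineD//.
- exact: integrable_fin_num i1.
- exact: integrable_fin_num i2.
Qed.

Let D := Num.sqrt ((2 * Lam) ^+ n).
Let X f x := \1_L x * f (T' x).

Let X_meas f : measurable_fun setT f -> measurable_fun setT (X f).
Proof. by move=> mf; apply: measurable_funM; [exact: measurable_indic|exact: measurableT_comp]. Qed.

Let X_sqr f x : X f x ^+ 2 = \1_L x * f (T' x) ^+ 2.
Proof. by rewrite /X exprMn; congr (_ * _); rewrite indicE; case: (_ \in _); rewrite ?expr1n ?expr0n. Qed.

Let X_mu f : L2 mu f -> [/\ L2 leb f, L2 leb (X f), N2 leb f <= N2 mu f & N2 leb (X f) <= N2 mu f].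
Proof.
move=> [mf if2]; have sq0 x : 0 <= f x ^+ 2 by exact: sqr_ge0.
have [i1 i2 E] := mu_split sq0 if2.
have Xle x : X f x ^+ 2 <= f (T' x) ^+ 2.
  by rewrite X_sqr ler_piMl ?sqr_ge0// (le_trans (ler_norm _))// ind1.
have iX : ig leb (fun x => X f x ^+ 2).
  apply: (ig_le _ _ i2); first by apply: measurable_funX; exact: X_meas.
  by move=> x; rewrite ger0_norm ?sqr_ge0//; exact: Xle.
split => //; first by split => //; exact: X_meas.
- by apply: ler_wsqrtr; rewrite E lerDl; apply: int_ge0 => x; exact: sqr_ge0.
- apply: ler_wsqrtr; rewrite E; apply: ler_wpDl; first by apply: int_ge0 => x; exact: sqr_ge0.
  exact: le_int.
Qed.

Let X_test psi : test_function setT psi -> N2 leb (X psi) <= D * N2 leb psi.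
Proof.
move=> tpsi.
have tf : test_function setT (fun x => psi x ^+ 2).
  by have := test_functionM (proj1 tpsi) tpsi; congr (test_function _ _); apply/funext => x; rewrite expr2.
have := push_test tf (fun x => sqr_ge0 (psi x)).
rewrite (_ : \int[leb]_x _ = \int[leb]_x (X psi x ^+ 2)); last by apply: eq_Rintegral => x _; rewrite X_sqr.
by move=> h; rewrite /N2 /D -sqrtrM ?exprn_ge0 ?mulr_ge0//; exact: ler_wsqrtr.
Qed.

Let X_L2mu f : L2 mu f -> N2 leb (X f) <= D * N2 leb f.
Proof.
move=> Lf; have [L1 LX _ _] := X_mu Lf; rewrite -subr_le0.
apply: (@le0_small _ _ (D + 1)) => e e0 _.
have [psi tpsi hpsi] := test_function_dense_measure mu_fin Lf e0.
have Lpsi := test_function_L2_measure mu_fin tpsi.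
have [Lp1 LXp _ _] := X_mu Lpsi; have [Ld LXd d1 d2] := X_mu (L2B Lf Lpsi).
have h1 : N2 leb (X f) <= N2 leb (X psi) + e.
  rewrite (_ : X f = fun x => X psi x + X (fun x => f x - psi x) x); last first.
    by apply/funext => x; rewrite /X -mulrDr subrKC.
  by apply: le_trans (N2D LXp LXd) _; rewrite lerD2l (le_trans d2).
have h2 : N2 leb psi <= N2 leb f + e.
  rewrite (_ : psi = fun x => f x - (f x - psi x)); last by apply/funext => x; rewrite subKr.
  by apply: le_trans (N2B L1 Ld) _; rewrite lerD2l (le_trans d1).
have D0 : 0 <= D by exact: sqrtr_ge0.
have h3 := X_test tpsi; have h4 := ler_wpM2l D0 h2.
rewrite mulrDr in h4; rewrite mulrDl mul1r lerBlDr; apply: le_trans h1 _.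
by rewrite addrAC lerD2r addrC; exact: le_trans h3 h4.
Qed.

(** f need not be in L2 of [mu] at once. Its truncations, bounded by N and supported in a box, are;
    the estimate for them is uniform and monotone convergence removes the truncation. *)
Lemma push_L2 f : L2 leb f -> L2 leb ((f \o T) \_ L) /\ N2 leb ((f \o T) \_ L) <= D * N2 leb f.
Proof.
move=> Lf; have mf : measurable_fun setT f by case: Lf.
have XE g : (g \o T) \_ L = X g.
  apply/funext => x; rewrite /X indicE; have [Lx|nL] := pselect (L x).
    by rewrite restrictT_eq// (mem_set Lx) mul1r T'E.
  by rewrite restrict_eq0// (memNset nL) mul0r.
pose A (N : nat) : set V := [set x | `|f x| <= N%:R] `&` nbox N.
have mA N : measurable (A N).
  apply: measurableI; last exact: rbox_measurable.
  have ma : measurable_fun setT (fun x => `|f x|) by exact: measurableT_comp.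
  have := ma measurableT `]-oo, N%:R]%classic (measurable_itv _).
  by rewrite setTI; congr measurable; apply/seteqP; split => x /=; rewrite in_itv.
pose g N x := f x * \1_(A N) x.
have mg N : measurable_fun setT (g N) by apply: measurable_funM => //; exact: measurable_indic.
have gle N x : `|g N x| <= `|N%:R * \1_(nbox N) x|.
  rewrite /g indicE; case: (boolP (x \in A N)) => [/set_mem[h1 h2]|_]; last by rewrite mulr0 normr0.
  by rewrite mulr1 indicE mem_set// mulr1 [leRHS]ger0_norm.
have Lmu N : L2 mu (g N).
  apply: (L2_le (mg N) (gle N)); apply: L2Z; apply: L2_indic; [exact: rbox_measurable|exact: mu_fin].
have glef N x : `|g N x| <= `|f x| by rewrite /g normrM ler_piMr// ind1.
have gN N : N2 leb (X (g N)) <= D * N2 leb f.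
  apply: le_trans (X_L2mu (Lmu N)) _; apply: ler_wpM2l; first exact: sqrtr_ge0.
  exact: le_N2.
have mX := X_meas mf.
have gcv x : (fun N => g N x) @ \oo --> f x.
  apply: cvg_near_cst; exists (Num.truncn (Num.max `|f x| `|x|)).+1 => // k /= hk.
  have hk' : Num.max `|f x| `|x| < k%:R.
    by apply: lt_le_trans (truncnS_gt _) _; rewrite ler_nat.
  rewrite /g indicE mem_set ?mulr1//; split => /=.
    by apply: le_trans (ltW hk'); rewrite le_max lexx.
  apply/nboxP => i; apply: le_lt_trans (norm_coord_le x i) _; apply: le_lt_trans hk'.
  by rewrite le_max lexx orbT.
have D0 : 0 <= D * N2 leb f by rewrite mulr_ge0 ?sqrtr_ge0 ?N2_ge0.
have [iX bX] : ig leb (fun x => X f x ^+ 2) /\ \int[leb]_x (X f x ^+ 2) <= (D * N2 leb f) ^+ 2.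
  apply: (@monotone_ig _ _ (fun N x => X (g N) x ^+ 2)).
  - by move=> N; have [_ [_ h] _ _] := X_mu (Lmu N).
  - by move=> N x; exact: sqr_ge0.
  - move=> k k' x kk; rewrite -real_normK ?num_real// -[leRHS]real_normK ?num_real//.
    rewrite lerXn2r ?nnegrE// /X !normrM ler_wpM2l// ler_wpM2l// !indicE.
    case: (boolP (_ \in A k)) => [/set_mem[h1 /nboxP h2]|_]; last by rewrite normr0.
    rewrite mem_set//; split; first by apply: le_trans h1 _; rewrite ler_nat.
    by apply/nboxP => i; apply: lt_le_trans (h2 i) _; rewrite ler_nat.
  - move=> x; have h : (fun N => X (g N) x) @ \oo --> X f x.
      by apply: cvgM; [exact: cvg_cst|exact: gcv].
    exact: (cvgM h h).
  - exact: measurable_funX.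
  - by move=> N; rewrite -N2_sqr lerXn2r ?nnegrE ?N2_ge0.
rewrite XE; split; first by split.
by rewrite -ler_sqr ?nnegrE ?N2_ge0// N2_sqr.
Qed.

End push.

(** * Weak convergence under composition with a map *)

Section transport.
Context {R : realType} {n : nat}.
Local Notation V := 'rV[R]_n.
Local Notation leb := (lebesgue_rV R n).
Variables (p : R) (U K L : set V) (T : V -> V) (Lam : R).
Hypotheses (p2 : 2 < p) (cL : compact L) (mT : measurable_fun L T) (Lam0 : 0 <= Lam).
Hypothesis lipT : forall r x x', L x -> L x' -> cube r (T x - T x') -> cube (Lam * r) (x - x').
Hypotheses (cK : compact K) (KU : K `<=` U) (TK : forall x, L x -> K (T x)).

Let mK := compact_rV_measurable cK.

Let restrictK (f : V -> R) : (f \o T) \_ L = ((f \_ K) \o T) \_ L.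
Proof.
apply/funext => x; have [Lx|nL] := pselect (L x); last by rewrite !restrict_eq0.
by rewrite !restrictT_eq//= restrictT_eq//; exact: TK.
Qed.

Lemma transport_L2 (f : V -> R) : Lp_on p K f -> L2 leb ((f \o T) \_ L).
Proof.
move=> hf; rewrite restrictK.
by have [] := push_L2 cL mT Lam0 lipT (proj1 (Lp_on_L2 cK p2 hf)).
Qed.

(** The functional g -> int_L (g o T) m is bounded on L2, hence represented by some rho supported in
    K. Testing F j o T with m is therefore testing F j with rho, a fixed function in L^q since q <=
    2. *)
Lemma transport_weak (F : nat -> V -> R) (f m : V -> R) : (forall j, Lp_on p K (F j)) -> Lp_on p K f ->
  weak_cvg_Lp_loc p U F f -> L2 leb m ->
  (fun j => \int[leb]_x (((F j \o T) \_ L) x * m x)) @ \oo --> \int[leb]_x (((f \o T) \_ L) x * m x).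
Proof.
move=> LF Lf w Lm.
have push g (Lg : L2 leb g) := push_L2 cL mT Lam0 lipT Lg.
pose l (g : V -> R) := ip ((g \o T) \_ L) m.
have [rho [Lrho rho0 hrho]] : exists f0, [/\ L2 leb f0, forall x, ~ K x -> f0 x = 0 &
    forall g, L2 leb g -> l (fun x => g x * \1_K x) = \int[leb]_x (f0 x * g x)].
  apply: (@riesz_L2 _ _ K l (Num.sqrt ((2 * Lam) ^+ n) * N2 leb m) cK).
  - by rewrite mulr_ge0 ?sqrtr_ge0 ?N2_ge0.
  - move=> g h Lg Lh; rewrite /l -ipDl//; [|exact: (proj1 (push _ Lg))|exact: (proj1 (push _ Lh))].
    congr (ip _ m); apply/funext => x; have [Lx|nL] := pselect (L x).
      by rewrite !restrictT_eq.
    by rewrite !restrict_eq0// addr0.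
  - move=> c g Lg; rewrite /l -ipZl//; last exact: (proj1 (push _ Lg)).
    congr (ip _ m); apply/funext => x; have [Lx|nL] := pselect (L x).
      by rewrite !restrictT_eq.
    by rewrite !restrict_eq0// mulr0.
  - move=> g Lg; have [L1 L2] := push _ Lg; apply: le_trans (cauchy_schwarz L1 Lm) _.
    by rewrite mulrAC ler_wpM2r ?N2_ge0.
have E g : Lp_on p K g -> \int[leb]_x (((g \o T) \_ L) x * m x) = \int[leb]_(x in K) (g x * rho x).
  move=> hg; have LgK := proj1 (Lp_on_L2 cK p2 hg).
  transitivity (l (fun x => (g \_ K) x * \1_K x)).
    have gE : (fun x => (g \_ K) x * \1_K x) = g \_ K; last first.
      by apply: etrans (congr1 l (esym gE)); rewrite /l /ip -restrictK.
    apply/funext => y; rewrite indicE; have [Ky|nK] := pselect (K y).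
      by rewrite mem_set// mulr1.
    by rewrite restrict_eq0// mul0r.
  rewrite hrho//; rewrite [RHS]Rintegral_mkcond restrictM.
  by apply: eq_Rintegral => x _; rewrite mulrC.
rewrite (E _ Lf) (_ : (fun j => _) = fun j => \int[leb]_(x in K) (F j x * rho x)); last first.
  by apply/funext => j; exact: (E _ (LF j)).
pose q : R := (1 - p^-1)^-1.
have p1 : 0 < 1 - p^-1 by rewrite subr_gt0 invf_lt1 ?(lt_trans _ p2)// ltr1n.
have q0 : 0 < q by rewrite invr_gt0.
have pq : p^-1 + q^-1 = 1 by rewrite invrK subrKC.
apply: (w K q rho cK KU q0 pq); apply: (@Lp_on_exp _ _ 2); [exact: cK|exact: q0| |].
  rewrite -[2]invrK /q lef_pV2 ?posrE ?invr_gt0//.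
  have : p^-1 <= 2^-1 by rewrite lef_pV2 ?posrE ?(lt_trans _ p2)// ltW.
  by move: (p^-1) => t; lra.
have rK : rho \_ K = rho.
  apply/funext => x; have [Kx|nK] := pselect (K x); first by rewrite restrictT_eq.
  by rewrite restrict_eq0// rho0.
apply/(Lp_onP _ mK) => //; rewrite rK; split; first by case: Lrho.
case: Lrho => _; congr (ig _ _); apply/funext => x.
by rewrite powR_mulrn// real_normK ?num_real.
Qed.

End transport.

(** * Boxes on which a diffeomorphism has a Lipschitz inverse *)

Section diffeo.
Context {R : realType} {n : nat}.
Local Notation V := 'rV[R]_n.

Lemma test_function_mul_on (W : set V) (f chi : V -> R) : open W -> smooth_on W f ->
  test_function W chi -> test_function W (fun x => chi x * f x).
Proof.
move=> oW sf [schi [K [cK KW chiK]]]; split; last first.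
  by exists K; split => // x nK; rewrite chiK// mul0r.
apply: smooth_on_local => x _; have [Kx|nK] := pselect (K x).
  exists W; split; first exact: KW.
  by apply: smooth_onM => //; exact: smooth_on_sub schi.
have oK : open (~` K) by apply: closed_openC; apply: compact_closed cK; exact: rV_hausdorff.
exists (~` K); split => //; apply: (@smooth_on_eq _ _ _ (fun=> 0)) => //.
  by move=> y nKy; rewrite chiK// mul0r.
exact: smooth_on_cst.
Qed.

Lemma open_preimage_on (W W' : set V) (T : V -> V) : open W -> open W' ->
  (forall x, W x -> {for x, continuous T}) -> open (W `&` T @^-1` W').
Proof.
move=> oW oW' cT; rewrite openE => x [Wx Tx]; apply: filterI.
  exact: open_nbhs_nbhs.
by apply: (cT x Wx); exact: open_nbhs_nbhs.
Qed.

Variables (W W' : set V) (T S : V -> V).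
Hypotheses (oW : open W) (oW' : open W').
Hypotheses (sT : forall c, smooth_on W (fun x => T x 0 c)) (sS : forall c, smooth_on W' (fun x => S x 0 c)).
Hypotheses (TW : forall x, W x -> W' (T x)) (ST : forall x, W x -> S (T x) = x).

Lemma diffeo_continuous x : W x -> {for x, continuous T}.
Proof. by move=> Wx; apply: continuous_rV => c; exact: smooth_on_continuous (sT c) Wx. Qed.

Definition lip_box (a b : 'rV[rat]_n) := cbox a b `<=` W /\ exists2 Lam : R, 0 <= Lam &
  forall r x x', cbox a b x -> cbox a b x' -> cube r (T x - T x') -> cube (Lam * r) (x - x').

(** Around T x, cut the inverse S off to a test function, which is globally Lipschitz and agrees
    with S on a box; then take a box around x that T maps into that box. *)
Lemma lip_box_exists x : W x -> exists a b, lip_box a b /\ rbox a b x.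
Proof.
move=> Wx; have [a' [b' [xa' aW']]] := open_cbox_nbhs oW' (TW Wx).
have [chi [tchi _ chi1]] := smooth_cutoff oW' (@cbox_compact R n a' b') aW'.
have /choice[B hB] c : exists B : R, 0 <= B /\ forall x y,
    `|chi (x + y) * S (x + y) 0 c - chi x * S x 0 c| <= (\sum_b `|y 0 b|) * B.
  have [B B0 h] := test_function_lipschitz (test_functionT (test_function_mul_on oW' (sS c) tchi)).
  by exists B.
have [a [b [xab abW]]] := open_cbox_nbhs (open_preimage_on oW (@rbox_open _ _ a' b') diffeo_continuous) (conj Wx xa').
exists a, b; split => //; split; first by move=> y /abW[].
pose Bs := \sum_c B c; have B0 : 0 <= Bs by apply: sumr_ge0 => c _; case: (hB c).
exists (n%:R * Bs); first by rewrite mulr_ge0.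
move=> r y y' yab y'ab hr c.
have [Wy Ty] := abW _ yab; have [Wy' Ty'] := abW _ y'ab.
have := (hB c).2 (T y') (T y - T y'); rewrite [T y' + _]addrC subrK.
rewrite !chi1 ?mul1r; [|exact: rbox_sub_cbox|exact: rbox_sub_cbox].
rewrite !ST// !mxE => h; apply: le_trans h _; rewrite mulrAC.
apply: ler_pM => //; first exact: sumr_ge0.
- by case: (hB c).
- apply: (@le_trans _ _ (\sum_(b < n) r)); first by apply: ler_sum => d _; exact: hr.
  by rewrite sumr_const card_ord mulr_natl.
- by rewrite /Bs (bigD1 c)//= lerDl sumr_ge0// => d _; case: (hB d).
Qed.

End diffeo.

(** * Diagonal extraction and countable subatlases *)

Section extraction.
Context {R : realType}.

Lemma bounded_ultralimit (F : set_system nat) (u : nat -> R) (C : R) : UltraFilter F ->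
  (forall j, `|u j| <= C) -> exists l : R, u @ F --> l.
Proof.
move=> uF uC.
have := @segment_compact R (- C) C; rewrite compact_ultra => /(_ (u @ F)).
have cF : (u @ F) `[- C, C]%classic.
  rewrite /fmap /= (_ : _ @^-1` _ = setT); first exact: filterT.
  by apply/seteqP; split => j //= _; rewrite in_itv /= -ler_norml.
have uu : UltraFilter (u @ F).
  split; first exact: fmap_proper_filter.
  move=> G pG FG; apply/seteqP; split => A; last exact: FG.
  move=> GA; have [//|nA] := in_ultra_setVsetC (u @^-1` A) uF.
  have GnA : G (~` A) by exact: FG.
  by have [x []] := filter_ex (filterI GA GnA).
by move=> /(_ uu cF)[l [_ h]]; exists l.
Qed.

(** One ultrafilter finer than the cofinite filter provides limits of all the sequences at once.
    Indices are then picked recursively, the m-th one within 1/(m+1) of the first m+1 limits. *)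
Lemma diagonal_extraction (u : nat -> nat -> R) : (forall i, exists C, forall j, `|u i j| <= C) ->
  exists2 phi : nat -> nat, (forall m, (phi m < phi m.+1)%N) & forall i, cvgn (u i \o phi).
Proof.
move=> bu; have [F [uF Foo]] := ultraFilterLemma (eventually_filter : ProperFilter eventually).
have /choice[l hl] i : exists l : R, u i @ F --> l.
  by have [C hC] := bu i; exact: bounded_ultralimit uF hC.
have near_l (m N : nat) : exists j, (N < j)%N /\ forall i : 'I_m.+1, `|l i - u i j| <= m.+1%:R^-1.
  have h : F (fun j => forall i : 'I_m.+1, `|l i - u i j| <= m.+1%:R^-1).
    apply: filter_forall => i; have /cvgrPdist_le := hl i; apply.
    by rewrite invr_gt0.
  have hN : F (fun j => (N < j)%N) by apply: Foo; exists N.+1.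
  by have [j [? ?]] := filter_ex (filterI hN h); exists j.
have /choice[f hf] (mN : nat * nat) := near_l mN.1 mN.2.
pose phi := fix phi m := if m is m'.+1 then f (m, phi m') else f (0%N, 0%N).
exists phi => [m|i]; first exact: (hf (m.+1, phi m)).1.
apply/cvg_ex; exists (l i); apply/cvgrPdist_le => e e0.
have [N _ hN] := near_infty_natSinv_lt (PosNum e0).
exists (maxn N i) => // m /=; rewrite geq_max => /andP[Nm im].
have {}hN := ltW (hN m Nm); apply: le_trans hN.
have := (hf (m, phi m.-1)).2; case: m Nm im => [|m] Nm im.
  have := (hf (0%N, 0%N)).2 (Ordinal (im : (i < 1)%N)); exact.
by move=> /= /(_ (Ordinal (im : (i < m.+2)%N))); exact.
Qed.

End extraction.

(** To each set of a countable base lying in some chart domain assign one such chart. Every point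
    has a base neighbourhood inside a chart domain, so the assigned charts cover. *)
Lemma countable_subatlas {R : realType} {n : nat} (M : smooth_manifold R n) : chart M ->
  exists q : nat -> chart M, forall m, exists s, chart_dom (q s) m.
Proof.
move=> i0; have [B cB [oB bB]] := @carrier_second_countable R n M.
have /choice[c hc] (b : set M) : exists i : chart M, (exists i', b `<=` chart_dom i') -> b `<=` chart_dom i.
  by have [[i hi]|h] := pselect (exists i', b `<=` chart_dom (i' : chart M)); [exists i|exists i0].
have [[e he]|/eqP B0] : (exists e : nat -> set M, B `<=` range e) \/ B == set0.
- have [->|B0] := eqVneq B set0; first by right.
  left; have /(countable_injP _)[f injf] := cB; have /set0P[b0 Bb0] := B0.
  exists (fun s => if pselect (exists2 b, B b & f b = s) is left h then s2val (cid2 h) else b0).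
  move=> b Bb; exists (f b) => //; case: pselect => [h|]; last by case; exists b.
  case: (cid2 h) => b' Bb' /= e; apply: injf => //; exact: mem_set.
- exists (fun s => c (e s)) => m; have [i im] := chart_dom_cover m.
  have : nbhs m (chart_dom i) by apply: open_nbhs_nbhs; split => //; exact: chart_dom_open.
  move=> /(bB m)[b [Bb bm] bi]; have [s _ es] := he b Bb.
  by exists s; rewrite es; apply: (hc b) => //; exists i.
- exists (fun=> i0) => m; have [b [Bb _] _] := bB m setT filterT.
  by move: Bb; rewrite B0.
Qed.

(** * Almost-everywhere statements and local bounds *)

Section ae_lemmas.
Context {R : realType} {n : nat}.
Local Notation V := 'rV[R]_n.
Local Notation leb := (lebesgue_rV R n).
Implicit Types (f g m : V -> R).

Lemma int_ae_eq f g : measurable_fun setT f -> measurable_fun setT g ->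
  {ae leb, forall x, f x = g x} -> \int[leb]_x f x = \int[leb]_x g x.
Proof.
move=> mf mg fg; rewrite /Rintegral; congr fine; apply: ae_eq_integral => //.
- exact/measurable_EFinP.
- exact/measurable_EFinP.
- by apply: filterS fg => x /= -> _.
Qed.

Lemma int_sqr_eq0 f : L2 leb f -> \int[leb]_x (f x ^+ 2) = 0 -> {ae leb, forall x, f x = 0}.
Proof.
move=> [mf fi] f0; have mf2 : measurable_fun setT (fun x => (f x ^+ 2)%:E).
  by apply/measurable_EFinP; exact: measurable_funX.
have h : (\int[leb]_x `|(f x ^+ 2)%:E| = 0)%E.
  rewrite (eq_integral (fun x => (f x ^+ 2)%:E)); last by move=> x _ /=; rewrite ger0_norm ?sqr_ge0.
  by rewrite -(fineK (integrable_fin_num measurableT fi)); congr EFin.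
have := (ae_eq_integral_abs leb measurableT mf2).1 h.
by apply: filterS => x /(_ I) [] /eqP; rewrite sqrf_eq0 => /eqP.
Qed.

Lemma ae_cover (I : countType) (Q : I -> V -> Prop) (U : set V) (P : V -> Prop) :
  (forall x, U x -> exists i, Q i x) ->
  (forall i, {ae leb, forall x, Q i x -> P x}) -> {ae leb, forall x, U x -> P x}.
Proof.
move=> cov h; have h' : {ae leb, forall x, forall s : nat, if unpickle s is Some i then Q i x -> P x else True}.
  by apply: ae_foralln => s; case: unpickle => [i|]; [exact: h|exact: aeW].
apply: filterS h' => x hx /cov[i Qi]; have := hx (pickle i).
by rewrite pickleK; exact.
Qed.

(** On a compact set L2 functions belong to the conjugate space L^q, as q <= 2 <= p. *)
Lemma weak_cvg_L2 p U K (F : nat -> V -> R) f m : 2 < p -> compact K -> K `<=` U ->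
  weak_cvg_Lp_loc p U F f -> L2 leb m ->
  (fun j => \int[leb]_x ((F j \_ K) x * m x)) @ \oo --> \int[leb]_x ((f \_ K) x * m x).
Proof.
move=> p2 cK KU w Lm; have mK := compact_rV_measurable cK.
pose q : R := (1 - p^-1)^-1.
have p1 : 0 < 1 - p^-1 by rewrite subr_gt0 invf_lt1 ?(lt_trans _ p2)// ltr1n.
have q0 : 0 < q by rewrite invr_gt0.
have pq : p^-1 + q^-1 = 1 by rewrite invrK subrKC.
have Lq : Lp_on q K m.
  apply: (@Lp_on_exp _ _ 2); [exact: cK|exact: q0| |].
    rewrite -[2]invrK /q lef_pV2 ?posrE ?invr_gt0//.
    have : p^-1 <= 2^-1 by rewrite lef_pV2 ?posrE ?(lt_trans _ p2)// ltW.
    by move: (p^-1) => t; lra.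
  apply: (Lp_on_bound (g := fun x => m x ^+ 2)) => //.
  - by apply/(meas_restrictP _ mK); apply: measurable_funTS; case: Lm.
  - by move=> x _; rewrite powR_mulrn// real_normK ?num_real.
  - by move=> x; exact: sqr_ge0.
  - by case: Lm.
rewrite -int_restrict (_ : (fun j => _) = fun j => \int[leb]_(x in K) (F j x * m x)); last first.
  by apply/funext => j; rewrite -int_restrict.
exact: w cK KU q0 pq Lq.
Qed.

Lemma continuous_bounded (K : set V) f : compact K -> (forall x, K x -> {for x, continuous f}) ->
  exists2 C : R, 0 <= C & forall x, K x -> `|f x| <= C.
Proof.
move=> cK cf; have [K0|/set0P Kn0] := eqVneq K set0; first by exists 0 => // x; rewrite K0.
have [x /set_mem Kx hx] : exists2 c : V, c \in K & forall t, t \in K -> `|f t| <= `|f c|.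
  apply: (@EVT_max_rV _ _ (fun x => `|f x|)) => //.
  apply: continuous_in_subspaceT => x /set_mem Kx; apply: continuous_comp; first exact: cf.
  exact: norm_continuous.
by exists `|f x| => // y Ky; apply: hx; exact: mem_set.
Qed.

Lemma smooth_restrict_meas (U K : set V) f : open U -> compact K -> K `<=` U -> smooth_on U f ->
  measurable_fun setT (f \_ K).
Proof.
move=> oU cK KU sf; apply/(meas_restrictP _ (compact_rV_measurable cK)).
apply: measurable_funS KU _; first exact: open_rV_measurable.
exact: smooth_on_measurable.
Qed.

Lemma smooth_restrict_bounded (U K : set V) f : open U -> compact K -> K `<=` U -> smooth_on U f ->
  exists2 C : R, 0 <= C & forall x, `|(f \_ K) x| <= C.
Proof.
move=> oU cK KU sf; have [x Kx|C C0 hC] := continuous_bounded (f := f) cK.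
  by apply: smooth_on_continuous sf _ => //; exact: KU.
exists C => // x; have [Kx|nK] := pselect (K x); first by rewrite restrictT_eq//; exact: hC.
by rewrite restrict_eq0// normr0.
Qed.

End ae_lemmas.

(** * Transition maps between charts *)

Section charts.
Context {R : realType} {n : nat} {M : smooth_manifold R n}.
Local Notation V := 'rV[R]_n.
Implicit Types (i k : chart M).

Lemma overlap_open i k : open (overlap i k).
Proof.
rewrite openE => x [m [mi mk] <-].
have h1 : nbhs (chart_fun i m) (chart_image i).
  by apply: open_nbhs_nbhs; split; [exact: chart_image_open|exists m].
have h2 : nbhs (chart_fun i m) (chart_inv i @^-1` chart_dom k).
  apply: (@chart_inv_continuous _ _ M i); first by exists m.
  by apply: open_nbhs_nbhs; rewrite chart_funK//; split => //; exact: chart_dom_open.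
apply: filterS (filterI h1 h2) => y [[m' mi' <-]] /=; rewrite chart_funK// => mk'.
by exists m'.
Qed.

Lemma overlap_image i k : overlap i k `<=` chart_image i.
Proof. by move=> x [m [mi _] <-]; exists m. Qed.

Lemma overlap_id i : overlap i i = chart_image i.
Proof. by rewrite /overlap setIid. Qed.

Lemma transition_overlap i k x : overlap i k x -> overlap k i (transition i k x).
Proof. by move=> [m [mi mk] <-]; exists m => //; rewrite /transition /= chart_funK. Qed.

Lemma transition_image i k x : overlap i k x -> chart_image k (transition i k x).
Proof. by move=> /transition_overlap/overlap_image. Qed.

Lemma transitionK i k x : overlap i k x -> transition k i (transition i k x) = x.
Proof. by move=> [m [mi mk] <-]; rewrite /transition /= !chart_funK. Qed.

Lemma transition_id i x : chart_image i x -> transition i i x = x.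
Proof. by move=> [m mi <-]; rewrite /transition /= chart_funK. Qed.

Lemma transition_coord_smooth i k c : smooth_on (overlap i k) (fun x => transition i k x 0 c).
Proof. exact: transition_smooth. Qed.

Lemma transition_continuous i k x : overlap i k x -> {for x, continuous (transition i k)}.
Proof. exact: diffeo_continuous (@transition_coord_smooth i k) _. Qed.

Lemma transition_lip_box i k x : overlap i k x ->
  exists a b, lip_box (overlap i k) (transition i k) a b /\ rbox a b x.
Proof.
apply: (@lip_box_exists _ _ (overlap i k) (overlap k i) (transition i k) (transition k i)).
- exact: overlap_open.
- exact: overlap_open.
- exact: transition_coord_smooth.
- exact: (@transition_coord_smooth k i).
- exact: transition_overlap.
- exact: transitionK.
Qed.

Lemma transition_compact i k L : compact L -> L `<=` overlap i k -> compact (transition i k @` L).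
Proof.
move=> cL LU; apply: continuous_compact cL.
by apply: continuous_in_subspaceT => x /set_mem /LU; exact: transition_continuous.
Qed.

Lemma transition_measurable i k L : compact L -> L `<=` overlap i k -> measurable_fun L (transition i k).
Proof.
move=> cL LU; pose T (x : V) : V := if x \in L then transition i k x else 0.
apply: (@eq_measurable_fun _ _ _ _ L T); first by move=> x; rewrite /T => ->.
apply: measurable_funTS; apply: measurable_fun_rVR => c.
rewrite (_ : (fun x => _) = (fun x => transition i k x 0 c) \_ L); last first.
  by apply/funext => x; rewrite patchE /T; case: (x \in L) => //; rewrite mxE.
exact: smooth_restrict_meas (@overlap_open i k) cL LU (@transition_coord_smooth i k c).
Qed.

End charts.

(** * Weak limits and affine changes of chart *)

Section atlas_limit.
Context {R : realType} {n : nat} (M : smooth_manifold R n) (C : finType).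
Local Notation V := 'rV[R]_n.
Local Notation leb := (lebesgue_rV R n).
Local Notation boxes := ('rV[rat]_n * 'rV[rat]_n)%type.
Implicit Types (i k : chart M) (al be : C).
Variables (p : R) (F : nat -> chart M -> C -> V -> R).
Variables (c0 : chart M -> chart M -> C -> V -> R) (c1 : chart M -> chart M -> C -> C -> V -> R).
Hypotheses (p2 : 2 < p) (LF : forall j i al, Lp_loc p (chart_image i) (F j i al)).
Hypothesis sc0 : forall i k al, smooth_on (overlap i k) (c0 i k al).
Hypothesis sc1 : forall i k al be, smooth_on (overlap i k) (c1 i k al be).

(** An affine law covers both kinds of data: tensors have [c0] = 0, while connections have the
    inhomogeneous term [c0]. *)
Definition pulled i k (f : C -> V -> R) al : V -> R := fun x =>
  c0 i k al x + \sum_be c1 i k al be x * f be (transition i k x).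

Hypothesis changeF : forall j i k, {ae leb, forall x, overlap i k x ->
  forall al, F j i al x = pulled i k (F j k) al x}.

Lemma pulled_restrict i k L (f : C -> V -> R) al x :
  (pulled i k f al \_ L) x = (c0 i k al \_ L) x +
    \sum_be (c1 i k al be \_ L) x * ((f be \o transition i k) \_ L) x.
Proof.
have [Lx|nL] := pselect (L x).
  by rewrite !restrictT_eq//; congr (_ + _); apply: eq_bigr => be _; rewrite !restrictT_eq.
by rewrite !restrict_eq0// big1 ?addr0// => be _; rewrite restrict_eq0// mul0r.
Qed.

Section box.
Variables (i k : chart M) (a b : 'rV[rat]_n).
Hypothesis lab : lip_box (overlap i k) (transition i k) a b.
Let L : set V := cbox a b.
Let K : set V := transition i k @` L.
Let LU : L `<=` overlap i k. Proof. by case: lab. Qed.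
Let cL : compact L. Proof. exact: cbox_compact. Qed.
Let cK : compact K. Proof. exact: transition_compact. Qed.
Let KU : K `<=` chart_image k.
Proof. by move=> y [x Lx <-]; exact: transition_image (LU Lx). Qed.
Let TK x : L x -> K (transition i k x). Proof. by move=> Lx; exists x. Qed.

Lemma transport_L2_box f : Lp_loc p (chart_image k) f -> L2 leb ((f \o transition i k) \_ L).
Proof.
move=> [_ hf]; have [_ [Lam Lam0 lip]] := lab.
exact: (transport_L2 p2 cL (transition_measurable cL LU) Lam0 lip cK TK (hf _ cK KU)).
Qed.

Let c0m al := smooth_restrict_meas (@overlap_open _ _ M i k) cL LU (@sc0 i k al).
Let c1m al be := smooth_restrict_meas (@overlap_open _ _ M i k) cL LU (@sc1 i k al be).
Let c1b al be := smooth_restrict_bounded (@overlap_open _ _ M i k) cL LU (@sc1 i k al be).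

Let c0L2 al : L2 leb (c0 i k al \_ L).
Proof.
have [C0 _ hC] := smooth_restrict_bounded (@overlap_open _ _ M i k) cL LU (@sc0 i k al).
apply: (L2_le (c0m al) (g := fun x => C0 * \1_L x)); last by apply: L2Z; exact: compact_indic_L2.
move=> x; rewrite indicE; have [Lx|nL] := pselect (L x).
  by rewrite mem_set// mulr1; apply: le_trans (hC x) (ler_norm _).
by rewrite restrict_eq0// normr0.
Qed.

Lemma pulled_L2 f al : (forall be, Lp_loc p (chart_image k) (f be)) -> L2 leb (pulled i k f al \_ L).
Proof.
move=> hf; rewrite (_ : _ \_ L = fun x => (c0 i k al \_ L) x +
    \sum_be (c1 i k al be \_ L) x * ((f be \o transition i k) \_ L) x); last first.
  by apply/funext => x; exact: pulled_restrict.
apply: L2D; first exact: c0L2.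
apply: L2_sum => be _; have [C1 _ hC] := c1b al be.
have := L2Mb (transport_L2_box (hf be)) (c1m al be) hC.
by congr (L2 _ _); apply/funext => x; rewrite mulrC.
Qed.

(** The smooth coefficients are absorbed in the test function, and the composition with the
    transition map is handled by [transport_weak]. Weak convergence in chart k thus yields
    convergence in chart i on the box. *)
Lemma pulled_cvg f al m : (forall be, Lp_loc p (chart_image k) (f be)) ->
  (forall be, weak_cvg_Lp_loc p (chart_image k) (fun j => F j k be) (f be)) -> L2 leb m ->
  (fun j => \int[leb]_x ((F j i al \_ L) x * m x)) @ \oo --> \int[leb]_x ((pulled i k f al \_ L) x * m x).
Proof.
move=> hf wf Lm; have mm : measurable_fun setT m by case: Lm.
have E (h : C -> V -> R) : (forall be, Lp_loc p (chart_image k) (h be)) ->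
    \int[leb]_x ((pulled i k h al \_ L) x * m x) = \int[leb]_x ((c0 i k al \_ L) x * m x) +
    \sum_be \int[leb]_x (((h be \o transition i k) \_ L) x * ((c1 i k al be \_ L) x * m x)).
  move=> hh; have L1 be := transport_L2_box (hh be).
  have L3 be : L2 leb (fun x => (c1 i k al be \_ L) x * m x).
    have [C1 _ hC] := c1b al be; have := L2Mb Lm (c1m al be) hC.
    by congr (L2 _ _); apply/funext => x; rewrite mulrC.
  rewrite -int_sum; last by move=> be _; exact: L2M.
  rewrite -intD; [|exact: L2M (c0L2 al) Lm|by apply: ig_sum => be _; exact: L2M].
  apply: eq_Rintegral => x _; rewrite pulled_restrict mulrDl; congr (_ + _).
  by rewrite mulr_suml; apply: eq_bigr => be _; rewrite mulrAC mulrC.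
have EF j : \int[leb]_x ((F j i al \_ L) x * m x) = \int[leb]_x ((pulled i k (F j k) al \_ L) x * m x).
  apply: int_ae_eq.
  - apply: measurable_funM mm; have [_ hF] := LF j i al.
    by have [[]] := Lp_on_L2 cL p2 (hF _ cL (subset_trans LU (@overlap_image _ _ M i k))).
  - by apply: measurable_funM mm; have [] := pulled_L2 al (LF j k).
  - apply: filterS (changeF j i k) => x hx; congr (_ * _); have [Lx|nL] := pselect (L x).
      by rewrite !restrictT_eq//; apply: hx; exact: LU.
    by rewrite !restrict_eq0.
rewrite E// (_ : (fun j => _) = fun j => \int[leb]_x ((c0 i k al \_ L) x * m x) +
    \sum_be \int[leb]_x (((F j k be \o transition i k) \_ L) x * ((c1 i k al be \_ L) x * m x))); last first.
  by apply/funext => j; rewrite EF; apply: E => be; exact: LF.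
apply: cvgD; first exact: cvg_cst.
apply: (cvg_bigsum (u := fun be j => \int[leb]_x (((F j k be \o transition i k) \_ L) x * ((c1 i k al be \_ L) x * m x)))) => be.
have [_ [Lam Lam0 lip]] := lab.
apply: (transport_weak p2 cL (transition_measurable cL LU) Lam0 lip cK KU TK).
- by move=> j; have [_ h] := LF j k be; exact: h.
- by have [_ h] := hf be; exact: h.
- exact: wf.
- have [C1 _ hC] := c1b al be; have := L2Mb Lm (c1m al be) hC.
  by congr (L2 _ _); apply/funext => x; rewrite mulrC.
Qed.

End box.

(** On a box both sides are weak limits of the same sequence. Tested with their difference, they
    show that the integral of its square is 0. *)
Lemma pulled_limit (f : chart M -> C -> V -> R) i k : (forall i be, Lp_loc p (chart_image i) (f i be)) ->
  (forall i be, weak_cvg_Lp_loc p (chart_image i) (fun j => F j i be) (f i be)) ->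
  {ae leb, forall x, overlap i k x -> forall al, f i al x = pulled i k (f k) al x}.
Proof.
move=> hf wf.
pose Q (ab : boxes) (x : V) := lip_box (overlap i k) (transition i k) ab.1 ab.2 /\ cbox ab.1 ab.2 x.
apply: (@ae_cover _ _ _ Q).
  by move=> x /transition_lip_box[a [b [lab xab]]]; exists (a, b); split => //; exact: rbox_sub_cbox.
move=> ab; have [lab|nl] := pselect (lip_box (overlap i k) (transition i k) ab.1 ab.2); last first.
  by apply: aeW => x [].
have h al : {ae leb, forall x, cbox ab.1 ab.2 x -> f i al x = pulled i k (f k) al x}.
  set L := cbox ab.1 ab.2 : set V; have cL : compact L by exact: cbox_compact.
  have LU : L `<=` chart_image i by apply: subset_trans (@overlap_image _ _ M i k); case: lab.
  have L1 : L2 leb (f i al \_ L).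
    by have [_ h] := hf i al; have [] := Lp_on_L2 cL p2 (h _ cL LU).
  have L2' := pulled_L2 lab al (hf k).
  pose d x := (f i al \_ L) x - (pulled i k (f k) al \_ L) x.
  have Ld : L2 leb d by exact: L2B.
  have := int_sqr_eq0 Ld.
  have e : \int[leb]_x ((f i al \_ L) x * d x) = \int[leb]_x ((pulled i k (f k) al \_ L) x * d x).
    have w1 := weak_cvg_L2 p2 cL LU (wf i al) Ld.
    have w2 := pulled_cvg lab (al := al) (hf k) (wf k) Ld.
    exact: cvg_unique w1 w2.
  have -> : \int[leb]_x (d x ^+ 2) = 0.
    transitivity (\int[leb]_x ((f i al \_ L) x * d x) - \int[leb]_x ((pulled i k (f k) al \_ L) x * d x)).
      rewrite -intB; [|exact: L2M|exact: L2M]; apply: eq_Rintegral => x _.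
      by rewrite -mulrBl expr2.
    by rewrite e subrr.
  move=> /(_ erefl); apply: filterS => x + Lx; rewrite /d !restrictT_eq// => /eqP.
  by rewrite subr_eq0 => /eqP.
have h' : {ae leb, forall x, forall al, cbox ab.1 ab.2 x -> f i al x = pulled i k (f k) al x}.
  exact: filter_forall.
by apply: filterS h' => x hx [_ xab] al; exact: hx.
Qed.

End atlas_limit.

Lemma Lp_on_test_bounded {R : realType} {n : nat} (p : R) (K : set 'rV[R]_n) (F : nat -> 'rV[R]_n -> R) (B : R) a b :
  2 < p -> compact K -> (forall j, Lp_on p K (F j)) ->
  (forall j, (\int[lebesgue_rV R n]_(x in K) (`|F j x| `^ p)%:E <= B%:E)%E) ->
  exists C : R, forall j, `|\int[lebesgue_rV R n]_x ((F j \_ K) x * \1_(rbox a b) x)| <= C.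
Proof.
move=> p2 cK LF hB; set leb := lebesgue_rV R n; have mK := compact_rV_measurable cK.
have p0 : 0 < p by exact: lt_trans p2.
exists (\int[leb]_x \1_K x + B) => j.
have [mF iF] := (Lp_onP _ mK p0).1 (LF j).
have mi : measurable_fun setT (\1_(rbox a b) : 'rV[R]_n -> R).
  by apply: measurable_indic; exact: rbox_measurable.
have i1 := compact_indic_ig cK.
have bd x : `|(F j \_ K) x * \1_(rbox a b) x| <= \1_K x + `|(F j \_ K) x| `^ p.
  rewrite normrM; apply: (@le_trans _ _ `|(F j \_ K) x|).
    by rewrite ler_piMr// indicE; case: (_ \in _); rewrite ?normr1 ?normr0.
  have [Kx|nK] := pselect (K x); last by rewrite restrict_eq0// normr0 addr_ge0 ?powR_ge0.
  rewrite indicE mem_set//; have := @powR_le_1D _ p 1 `|(F j \_ K) x| ltr01.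
  by rewrite powRr1//; apply => //; rewrite ltW// (lt_trans _ p2)// ltr1n.
have ig1 : ig leb (fun x => (F j \_ K) x * \1_(rbox a b) x).
  apply: (ig_le _ bd); first exact: measurable_funM.
  exact: igD.
apply: le_trans (le_norm_int ig1) _.
apply: (@le_trans _ _ (\int[leb]_x (\1_K x + `|(F j \_ K) x| `^ p))).
  by apply: (le_int (ig_norm ig1) (igD i1 iF)) => x; exact: bd.
rewrite intD// lerD2l; have := hB j; rewrite (Lp_on_intE mK p0 (LF j)) lee_fin; exact.
Qed.

(** * Weak compactness over the whole atlas *)

Section atlas_compactness.
Context {R : realType} {n : nat} (M : smooth_manifold R n) (C : finType).
Local Notation V := 'rV[R]_n.
Local Notation leb := (lebesgue_rV R n).
Local Notation boxes := ('rV[rat]_n * 'rV[rat]_n)%type.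
Implicit Types (i k : chart M) (al be : C).
Variables (p : R) (F : nat -> chart M -> C -> V -> R).
Variables (c0 : chart M -> chart M -> C -> V -> R) (c1 : chart M -> chart M -> C -> C -> V -> R).
Hypotheses (p2 : 2 < p) (LF : forall j i al, Lp_loc p (chart_image i) (F j i al)).
Hypothesis bF : forall i al, bounded_Lp_loc p (chart_image i) (fun j => F j i al).
Hypothesis sc0 : forall i k al, smooth_on (overlap i k) (c0 i k al).
Hypothesis sc1 : forall i k al be, smooth_on (overlap i k) (c1 i k al be).
Hypothesis changeF : forall j i k, {ae leb, forall x, overlap i k x ->
  forall al, F j i al x = pulled c0 c1 i k (F j k) al x}.

Let box_bounded i al (ab cd : boxes) : exists B : R, forall j,
  cbox ab.1 ab.2 `<=` chart_image i ->
  `|\int[leb]_x ((F j i al \_ (cbox ab.1 ab.2)) x * \1_(rbox cd.1 cd.2) x)| <= B.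
Proof.
have [h|h] := pselect (cbox ab.1 ab.2 `<=` chart_image i); last by exists 0 => j /h.
have cL := @cbox_compact R n ab.1 ab.2; have [B hB] := @bF i al _ cL h.
have LL j : Lp_on p (cbox ab.1 ab.2) (F j i al) by have [_ hL] := LF j i al; exact: hL.
by have [B' hB'] := Lp_on_test_bounded cd.1 cd.2 p2 cL LL hB; exists B' => j _.
Qed.

(** Charts of the subatlas, components, restricting boxes and test boxes form a countable index set,
    so a single diagonal extraction treats them all. *)
Let subatlas_cvg (q : nat -> chart M) : exists2 phi : nat -> nat, (forall m, (phi m < phi m.+1)%N) &
  forall s al (ab cd : boxes), cbox ab.1 ab.2 `<=` chart_image (q s) ->
    cvgn (fun j => \int[leb]_x ((F (phi j) (q s) al \_ (cbox ab.1 ab.2)) x * \1_(rbox cd.1 cd.2) x)).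
Proof.
pose I := (nat * C * boxes * boxes)%type.
pose v (t : I) j : R := if `[< cbox t.1.2.1 t.1.2.2 `<=` chart_image (q t.1.1.1) >] then
  \int[leb]_x ((F j (q t.1.1.1) t.1.1.2 \_ (cbox t.1.2.1 t.1.2.2)) x * \1_(rbox t.2.1 t.2.2) x) else 0.
pose u s j := if unpickle s is Some t then v t j else 0.
have bu s : exists B, forall j, `|u s j| <= B.
  rewrite /u; case: unpickle => [[[[s' al] ab] cd]|]; last by exists 0 => j; rewrite normr0.
  rewrite /v /=; case: asboolP => h; last by exists 0 => j; rewrite normr0.
  by have [B hB] := box_bounded (q s') al ab cd; exists B => j; exact: hB.
have [phi phim hphi] := diagonal_extraction bu; exists phi => // s al ab cd h.
rewrite (_ : (fun j => _) = u (pickle (s, al, ab, cd)) \o phi); first exact: hphi.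
by apply/funext => j; rewrite /u /= pickleK /v /= asboolT.
Qed.

(** Limits are first built on the countable subatlas. In any other chart, every point has a box on
    which some chart of the subatlas determines the limit through the change law, so the subsequence
    already extracted converges there as well. *)
Lemma atlas_weak_compactness : exists2 phi : nat -> nat, (forall m, (phi m < phi m.+1)%N) &
  exists f : chart M -> C -> V -> R, forall i al, Lp_loc p (chart_image i) (f i al) /\
    weak_cvg_Lp_loc p (chart_image i) (fun j => F (phi j) i al) (f i al).
Proof.
have [[i0 _]|nM] := pselect (exists i : chart M, True); last first.
  by exists id => //; exists (fun _ _ _ => 0) => i; case: nM; exists i.
have [q hq] := countable_subatlas i0; have [phi phim hphi] := subatlas_cvg q.
exists phi => //.
have bphi i al : bounded_Lp_loc p (chart_image i) (fun j => F (phi j) i al).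
  by move=> K cK KU; have [B hB] := @bF i al _ cK KU; exists B => j.
have /choice[g hg] s : exists g : C -> V -> R, forall al, Lp_loc p (chart_image (q s)) (g al) /\
    weak_cvg_Lp_loc p (chart_image (q s)) (fun j => F (phi j) (q s) al) (g al).
  have h al : exists g : V -> R, Lp_loc p (chart_image (q s)) g /\
      weak_cvg_Lp_loc p (chart_image (q s)) (fun j => F (phi j) (q s) al) g.
    apply: (@weak_limit_loc _ _ p _ _ (fun ab => cbox ab.1 ab.2 `<=` chart_image (q s))) => //.
    - by move=> x Ux; have [a [b [xab abU]]] := open_cbox_nbhs (@chart_image_open _ _ M (q s)) Ux; exists (a, b).
    - by move=> [a' b'] abU a b; exact: (hphi s al (a', b') (a, b)).
  by have /choice[g hg] := h; exists g.
pose good i (ab : boxes) := exists s, lip_box (overlap i (q s)) (transition i (q s)) ab.1 ab.2.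
have h i : exists f : C -> V -> R, forall al, Lp_loc p (chart_image i) (f al) /\
    weak_cvg_Lp_loc p (chart_image i) (fun j => F (phi j) i al) (f al).
  have h al : exists f : V -> R, Lp_loc p (chart_image i) f /\
      weak_cvg_Lp_loc p (chart_image i) (fun j => F (phi j) i al) f.
    apply: (@weak_limit_loc _ _ p _ _ (good i)) => //.
    - by move=> ab [s [LU _]]; apply: subset_trans LU _; exact: overlap_image.
    - move=> x [m mi mx]; have [s ms] := hq m.
      have : overlap i (q s) x by exists m.
      by move=> /transition_lip_box[a [b [lab xab]]]; exists (a, b) => //; exists s.
    - move=> ab [s lab] a b; apply/cvg_ex; exists (\int[leb]_x ((pulled c0 c1 i (q s) (g s) al \_ (cbox ab.1 ab.2)) x * \1_(rbox a b) x)).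
      apply: (pulled_cvg (F := fun j => F (phi j)) p2 _ sc0 sc1 _ lab).
      + by move=> j i' al'; exact: LF.
      + by move=> j i' k'; exact: changeF.
      + by move=> be; have [] := hg s be.
      + by move=> be; have [] := hg s be.
      + by apply: L2_indic; [exact: rbox_measurable|exact: rbox_fin].
  by have /choice[f hf] := h; exists f.
by have /choice[f hf] := h; exists f.
Qed.

End atlas_compactness.

Lemma pd_comp {R : realType} {n : nat} (T : 'rV[R]_n -> 'rV[R]_n) (f : 'rV[R]_n -> R) b x :
  (forall c, differentiable (fun y => T y 0 c) x) -> differentiable f (T x) ->
  pd b (f \o T) x = \sum_c pd b (fun y => T y 0 c) x * pd c f (T x).
Proof.
move=> /differentiable_rV dT df.
rewrite /pd deriveE; last exact: differentiable_comp.
rewrite diff_comp//= -!deriveE// derive_sum_pd//; apply: eq_bigr => c _; congr (_ * _).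
by rewrite derive_mx ?mxE//; apply: diff_derivable.
Qed.

Lemma smooth_mx_derive {R : realType} {n : nat} (U : set 'rV[R]_n) r s (F : 'rV[R]_n -> 'M[R]_(r, s)) x u :
  open U -> smooth_mx_on U F -> U x ->
  'D_u F x = \sum_b u 0 b *: \matrix_(i, j) pd b (fun y => F y i j) x.
Proof.
move=> oU sF Ux; have d i j : differentiable (fun y => F y i j) x by exact: smooth_on_differentiable (sF i j) Ux.
rewrite derive_mx; last by apply/derivable_mxP => i j; apply: diff_derivable.
apply/matrixP => i j; rewrite mxE derive_sum_pd// summxE; apply: eq_bigr => b _.
by rewrite !mxE.
Qed.

(** * Cocycles of the tangent and normal bundles *)

Section tangent_cocycle.
Context {R : realType} {n : nat} {M : smooth_manifold R n}.
Local Notation V := 'rV[R]_n.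
Implicit Types (i j k l : chart M).

(** The common structure of the tangent bundle and of E, so that extensions of local sections and
    frames are built once for both. *)
Definition smooth_cocycle r (A : @cocycle R n M r) :=
  [/\ forall i j, smooth_mx_on (overlap i j) (A i j),
      forall i x, chart_image i x -> A i i x = 1%:M &
      forall i j l m, chart_dom i m -> chart_dom j m -> chart_dom l m ->
        A i l (chart_fun i m) = A i j (chart_fun i m) *m A j l (chart_fun j m)].

Lemma transition_diff i k x c : overlap i k x -> differentiable (fun y => transition i k y 0 c) x.
Proof. exact: smooth_on_differentiable (@transition_coord_smooth _ _ M i k c). Qed.

Lemma tangentE i k x a c : overlap i k x -> tangent i k x a c = pd a (fun y => transition i k y 0 c) x.
Proof.
move=> Ux; have dT : differentiable (transition i k) x.
  by apply: differentiable_rV => c'; exact: transition_diff.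
by rewrite /tangent /jacobian mxE -deriveE// derive_mx ?mxE//; apply: diff_derivable.
Qed.

Lemma tangent_smooth_cocycle : smooth_cocycle (tangent (M := M)).
Proof.
split.
- move=> i j a c; apply: (@smooth_on_eq _ _ _ (pd a (fun y => transition i j y 0 c))).
  + exact: overlap_open.
  + by move=> x /tangentE ->.
  + by apply: smooth_on_pd; exact: transition_coord_smooth.
- move=> i x ix; have Ux : overlap i i x by rewrite overlap_id.
  apply/matrixP => a c; rewrite tangentE// (_ : pd _ _ x = pd a (fun y : V => y 0 c) x); last first.
    apply: near_eq_derive; have : nbhs x (overlap i i).
      by apply: open_nbhs_nbhs; split => //; exact: overlap_open.
    by apply: filterS => y; rewrite overlap_id => iy; rewrite transition_id.
  by rewrite /pd derive_coord !mxE eqxx eq_sym.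
- move=> i j l m mi mj ml; apply/matrixP => a c.
  have Uil : overlap i l (chart_fun i m) by exists m.
  have Uij : overlap i j (chart_fun i m) by exists m.
  have Tm : transition i j (chart_fun i m) = chart_fun j m by rewrite /transition /= chart_funK.
  have Ujl : overlap j l (transition i j (chart_fun i m)) by rewrite Tm; exists m.
  rewrite tangentE// mxE.
  rewrite (_ : pd _ _ _ = pd a ((fun y => transition j l y 0 c) \o transition i j) (chart_fun i m)).
    rewrite pd_comp; [|by move=> d; exact: transition_diff|exact: transition_diff].
    apply: eq_bigr => d _.
    exact: (congr2 *%R (esym (tangentE a d Uij))
      (etrans (esym (tangentE d c Ujl)) (congr1 (fun y => tangent j l y d c) Tm))).
  apply: near_eq_derive.
  have : nbhs (chart_fun i m) (overlap i l `&` overlap i j).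
    apply: filterI; apply: open_nbhs_nbhs; split => //; exact: overlap_open.
  apply: filterS => y [[m1 [m1i m1l] <-]] [m2 [m2i m2j]] e.
  have m12 : m2 = m1 by rewrite -(chart_funK m2i) e chart_funK.
  by rewrite m12 in m2j; rewrite /transition /= !chart_funK.
Qed.

Lemma bundle_smooth_cocycle (r tau : nat) (E : metric_bundle M r tau) : smooth_cocycle (bundle_cocycle E).
Proof.
split; [exact: bundle_cocycle_smooth|exact: bundle_cocycle_id|exact: bundle_cocycle_comp].
Qed.

Lemma cocycleK r (A : @cocycle R n M r) i k x : smooth_cocycle A -> overlap i k x ->
  A i k x *m A k i (transition i k x) = 1%:M.
Proof.
move=> [_ id comp] [m [mi mk] <-].
have -> : transition i k (chart_fun i m) = chart_fun k m by rewrite /transition /= chart_funK.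
by rewrite -comp// id//; exists m.
Qed.

End tangent_cocycle.

(** * Scalar components of a tensor and a connection under a change of chart *)

Section components.
Context {R : realType} {n r : nat} {M : smooth_manifold R n}.
Local Notation V := 'rV[R]_n.
Local Notation leb := (lebesgue_rV R n).
Variable A : @cocycle R n M r.
Hypothesis cA : smooth_cocycle A.
Implicit Types (i k : chart M) (B : tensor2 M r) (w : connection M r).

Lemma tensor_at_delta (b : 'I_n -> 'I_n -> 'rV[R]_r) c d : tensor_at b (delta_mx 0 c) (delta_mx 0 d) = b c d.
Proof.
rewrite /tensor_at (bigD1 c)//= (bigD1 d)//= !mxE !eqxx mulr1 scale1r big1 ?addr0; last first.
  by move=> e /negbTE ne; rewrite mxE ne andbF mulr0 scale0r.
rewrite big1 ?addr0// => e /negbTE ne; apply: big1 => f _.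
by rewrite mxE ne andbF mul0r scale0r.
Qed.

Lemma tensor_at_lin (b : 'I_n -> 'I_n -> 'rV[R]_r) (u v : V) (J : 'M[R]_n) :
  tensor_at b (u *m J) (v *m J) = \sum_c \sum_d (u 0 c * v 0 d) *: tensor_at b (row c J) (row d J).
Proof.
pose P c d e f := (u 0 c * v 0 d * (J c e * J d f)) *: b e f.
transitivity (\sum_e \sum_f \sum_c \sum_d P c d e f).
  rewrite /tensor_at; apply: eq_bigr => e _; apply: eq_bigr => f _.
  rewrite !mxE mulr_suml scaler_suml; apply: eq_bigr => c _.
  rewrite mulr_sumr scaler_suml; apply: eq_bigr => d _.
  by rewrite /P mulrACA.
transitivity (\sum_c \sum_d \sum_e \sum_f P c d e f); last first.
  apply: eq_bigr => c _; apply: eq_bigr => d _; rewrite /tensor_at scaler_sumr.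
  apply: eq_bigr => e _; rewrite scaler_sumr; apply: eq_bigr => f _.
  by rewrite !mxE scalerA.
under eq_bigr do rewrite exchange_big; rewrite exchange_big; apply: eq_bigr => c _.
rewrite [RHS]exchange_big; apply: eq_bigr => e _ /=; exact: exchange_big.
Qed.

Lemma conn_at_lin (W : 'I_n -> 'M[R]_r) (u : V) (J : 'M[R]_n) :
  conn_at W (u *m J) = \sum_b u 0 b *: conn_at W (row b J).
Proof.
rewrite /conn_at; under [RHS]eq_bigr do rewrite scaler_sumr.
rewrite [RHS]exchange_big; apply: eq_bigr => e _ /=.
by rewrite mxE scaler_suml; apply: eq_bigr => b _; rewrite mxE scalerA.
Qed.

Lemma conn_at_delta (W : 'I_n -> 'M[R]_r) b : conn_at W (delta_mx 0 b) = W b.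
Proof.
rewrite /conn_at (bigD1 b)//= mxE !eqxx scale1r big1 ?addr0// => e /negbTE ne.
by rewrite mxE ne andbF scale0r.
Qed.

Local Notation J := (@tangent R n M).
Let A' i k x := A k i (transition i k x).

Lemma tensor_change_components (tau : nat) (E : metric_bundle M r tau) B i k x :
  bundle_cocycle E = A -> overlap i k x ->
  tensor_change E B i k x <->
  forall a b, B i x a b = tensor_at (B k (transition i k x)) (row a (J i k x)) (row b (J i k x)) *m A' i k x.
Proof.
move=> EA Ux; rewrite /tensor_change EA; have K1 := cocycleK cA Ux.
have K2 : A' i k x *m A i k x = 1%:M by apply: mulmx1C.
split => h.
  by move=> a b; rewrite -[LHS]mulmx1 -K1 mulmxA -{1}(tensor_at_delta (B i x)) h -!rowE.
move=> u v; rewrite tensor_at_lin /tensor_at mulmx_suml; apply: eq_bigr => a _.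
rewrite mulmx_suml; apply: eq_bigr => b _.
by rewrite h -scalemxAl -mulmxA K2 mulmx1.
Qed.

Lemma connection_change_components w i k x : overlap i k x ->
  connection_change A w i k x <->
  forall b, w i x b = ('D_(delta_mx 0 b) (A i k) x + A i k x *m
    conn_at (w k (transition i k x)) (row b (J i k x))) *m A' i k x.
Proof.
move=> Ux; have K1 := cocycleK cA Ux.
have K2 : A' i k x *m A i k x = 1%:M by apply: mulmx1C.
have [sA _ _] := cA.
split => h.
  by move=> b; rewrite -[LHS]mulmx1 -K1 mulmxA -{1}(conn_at_delta (w i x)) h -!rowE.
move=> u; have dA v := @smooth_mx_derive _ _ _ _ _ (A i k) x v (@overlap_open _ _ M i k) (sA i k) Ux.
rewrite conn_at_lin {1}/conn_at mulmx_suml mulmx_sumr (dA u) -big_split /=; apply: eq_bigr => b _.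
rewrite h -!scalemxAl -mulmxA K2 mulmx1 -scalemxAr -scalerDr; congr (_ *: (_ + _)).
rewrite (dA (delta_mx 0 b)) (bigD1 b)//= mxE !eqxx scale1r big1 ?addr0// => e /negbTE ne.
by rewrite mxE ne andbF scale0r.
Qed.

(** A single finite index set for the components of II and of the normal connection, so that both
    converge along one subsequence. *)
Definition comp_index := (('I_n * 'I_n * 'I_r) + ('I_n * 'I_r * 'I_r))%type.

Definition components B w i (c : comp_index) : V -> R := match c with
  | inl t => fun x => B i x t.1.1 t.1.2 0 t.2
  | inr t => fun x => w i x t.1.1 t.1.2 t.2
  end.

(** The inhomogeneous term of a connection, the derivative of the cocycle times its inverse; tensors
    have none. *)
Definition change_shift i k (c : comp_index) : V -> R := match c with
  | inl _ => fun=> 0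
  | inr t => fun x => \sum_q pd t.1.1 (fun y => A i k y t.1.2 q) x * A' i k x q t.2
  end.

Definition change_coef i k (c d : comp_index) : V -> R := match c, d with
  | inl t, inl s => fun x => J i k x t.1.1 s.1.1 * J i k x t.1.2 s.1.2 * A' i k x s.2 t.2
  | inr t, inr s => fun x => J i k x t.1.1 s.1.1 * A i k x t.1.2 s.1.2 * A' i k x s.2 t.2
  | _, _ => fun=> 0
  end.

Let smooth_A' i k s t : smooth_on (overlap i k) (fun x => A' i k x s t).
Proof.
have [sA _ _] := cA.
apply: (@smooth_on_comp _ _ _ (@overlap_open _ _ M i k) (overlap k i) (transition i k) (fun y => A k i y s t)).
- exact: overlap_open.
- exact: transition_overlap.
- exact: transition_coord_smooth.
- exact: sA.
Qed.

Lemma change_shift_smooth i k c : smooth_on (overlap i k) (change_shift i k c).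
Proof.
have oU := @overlap_open _ _ M i k; have [sA _ _] := cA.
case: c => [t|t] /=; first exact: smooth_on_cst.
apply: (smooth_on_sum oU) => q _; apply: (smooth_onM oU); last exact: smooth_A'.
by apply: smooth_on_pd; exact: sA.
Qed.

Lemma change_coef_smooth i k c d : smooth_on (overlap i k) (change_coef i k c d).
Proof.
have oU := @overlap_open _ _ M i k; have [sA _ _] := cA.
have [sJ _ _] := @tangent_smooth_cocycle R n M.
case: c => [t|t]; case: d => [s|s] /=; try exact: smooth_on_cst.
- by apply: (smooth_onM oU); [apply: (smooth_onM oU); exact: sJ|exact: smooth_A'].
- by apply: (smooth_onM oU); [apply: (smooth_onM oU); [exact: sJ|exact: sA]|exact: smooth_A'].
Qed.

Lemma components_change (tau : nat) (E : metric_bundle M r tau) B w i k x : bundle_cocycle E = A -> overlap i k x ->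
  (tensor_change E B i k x /\ connection_change A w i k x) <->
  forall c, components B w i c x = pulled change_shift change_coef i k (components B w k) c x.
Proof.
move=> EA Ux; have [sA _ _] := cA.
have E1 (a b : 'I_n) (c : 'I_r) : (tensor_at (B k (transition i k x)) (row a (J i k x)) (row b (J i k x)) *m A' i k x) 0 c =
    pulled change_shift change_coef i k (components B w k) (inl (a, b, c)) x.
  rewrite /pulled /= add0r big_sumType /= [X in _ = _ + X]big1 ?addr0; last by move=> ? _; rewrite mul0r.
  rewrite (eq_bigr (fun s : 'I_n * 'I_n * 'I_r => (fun de f => J i k x a de.1 * J i k x b de.2 * A' i k x f c * B k (transition i k x) de.1 de.2 0 f) s.1 s.2))//.
  rewrite -(pair_big predT predT (fun (de : 'I_n * 'I_n) f => J i k x a de.1 * J i k x b de.2 * A' i k x f c * B k (transition i k x) de.1 de.2 0 f)) /=.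
  rewrite -(pair_big predT predT (fun d e => \sum_f J i k x a d * J i k x b e * A' i k x f c * B k (transition i k x) d e 0 f)) /=.
  rewrite /tensor_at mulmx_suml summxE; apply: eq_bigr => d _; rewrite mulmx_suml summxE.
  apply: eq_bigr => e _; rewrite -scalemxAl mxE [(_ *m _) _ _]mxE mulr_sumr; apply: eq_bigr => f _.
  by rewrite !mxE -!mulrA; congr (_ * (_ * _)); exact: mulrC.
have E2 b s t : (('D_(delta_mx 0 b) (A i k) x + A i k x *m conn_at (w k (transition i k x)) (row b (J i k x))) *m A' i k x) s t =
    pulled change_shift change_coef i k (components B w k) (inr (b, s, t)) x.
  rewrite /pulled /= big_sumType /= [X in _ = _ + (X + _)]big1 ?add0r; last by move=> ? _; rewrite mul0r.
  rewrite mulmxDl mxE; congr (_ + _).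
    rewrite mxE; apply: eq_bigr => q _; congr (_ * _).
    rewrite (smooth_mx_derive _ (@overlap_open _ _ M i k) (sA i k) Ux) (bigD1 b)//= mxE.
    rewrite summxE big1 ?addr0; first by rewrite !mxE !eqxx mul1r.
    by move=> e /negbTE ne; rewrite !mxE ne andbF mul0r.
  rewrite (eq_bigr (fun z : 'I_n * 'I_r * 'I_r => (fun de f => J i k x b de.1 * A i k x s de.2 * A' i k x f t * w k (transition i k x) de.1 de.2 f) z.1 z.2))//.
  rewrite -(pair_big predT predT (fun (de : 'I_n * 'I_r) f => J i k x b de.1 * A i k x s de.2 * A' i k x f t * w k (transition i k x) de.1 de.2 f)) /=.
  rewrite -(pair_big predT predT (fun d e => \sum_f J i k x b d * A i k x s e * A' i k x f t * w k (transition i k x) d e f)) /=.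
  rewrite /conn_at mulmx_sumr mulmx_suml summxE; apply: eq_bigr => d _.
  rewrite -scalemxAr -scalemxAl mxE -mulmxA [(_ *m _) s t]mxE mulr_sumr; apply: eq_bigr => e _.
  rewrite [(_ *m _) e t]mxE !mulr_sumr; apply: eq_bigr => f _.
  by rewrite !mxE -!mulrA; congr (_ * (_ * _)); exact: mulrC.
split => [[h1 h2] c|h].
  case: c => [[[a b] c]|[[b s] t]].
    rewrite -E1; have h := (tensor_change_components _ EA Ux).1 h1.
    by rewrite -h.
  rewrite -E2; have h := (connection_change_components _ Ux).1 h2.
  by rewrite -h.
split.
  apply/(tensor_change_components _ EA Ux) => a b; apply/rowP => c.
  by rewrite E1; exact: (h (inl (a, b, c))).
apply/(connection_change_components _ Ux) => b; apply/matrixP => s t.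
by rewrite E2; exact: (h (inr (b, s, t))).
Qed.

End components.

(** * Extraction of a limit second fundamental form and connection *)

Section family_limit.
Context {R : realType} {n : nat}.
Local Notation V := 'rV[R]_n.
Local Notation leb := (lebesgue_rV R n).
Local Notation boxes := ('rV[rat]_n * 'rV[rat]_n)%type.

(** Used for the symmetry of the limit tensor, whose transposed components are weak limits of
    sequences that agree almost everywhere. *)
Lemma weak_limit_ae_eq p (U : set V) (F G : nat -> V -> R) f g : 2 < p -> open U ->
  (forall j, Lp_loc p U (F j)) -> (forall j, Lp_loc p U (G j)) ->
  Lp_loc p U f -> Lp_loc p U g -> weak_cvg_Lp_loc p U F f -> weak_cvg_Lp_loc p U G g ->
  (forall j, {ae leb, forall x, U x -> F j x = G j x}) -> {ae leb, forall x, U x -> f x = g x}.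
Proof.
move=> p2 oU LF LG Lf Lg wf wg FG.
pose Q (ab : boxes) (x : V) := cbox ab.1 ab.2 `<=` U /\ cbox ab.1 ab.2 x.
apply: (@ae_cover _ _ _ Q).
  by move=> x /(open_cbox_nbhs oU)[a [b [xab abU]]]; exists (a, b); split => //; exact: rbox_sub_cbox.
move=> ab; have [LU|nl] := pselect (cbox ab.1 ab.2 `<=` U); last by apply: aeW => x [].
set L := cbox ab.1 ab.2 : set V; have cL : compact L by exact: cbox_compact.
have L2l (h : V -> R) : Lp_loc p U h -> L2 leb (h \_ L).
  by move=> [_ hh]; have [] := Lp_on_L2 cL p2 (hh _ cL LU).
pose d x := (f \_ L) x - (g \_ L) x.
have Ld : L2 leb d by apply: L2B; exact: L2l.
have e : \int[leb]_x ((f \_ L) x * d x) = \int[leb]_x ((g \_ L) x * d x).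
  have w1 := weak_cvg_L2 p2 cL LU wf Ld; have w2 := weak_cvg_L2 p2 cL LU wg Ld.
  suff FGe : (fun j => \int[leb]_x ((F j \_ L) x * d x)) = fun j => \int[leb]_x ((G j \_ L) x * d x).
    by rewrite FGe in w1; exact: cvg_unique w1 w2.
  apply/funext => j; have md : measurable_fun setT d by case: Ld.
  have [mF _] := L2l _ (LF j); have [mG _] := L2l _ (LG j).
  apply: int_ae_eq; [exact: measurable_funM|exact: measurable_funM|].
  apply: filterS (FG j) => x hx; congr (_ * _); have [Lx|nL] := pselect (L x).
    by rewrite !restrictT_eq//; apply: hx; exact: LU.
  by rewrite !restrict_eq0.
have d0 : \int[leb]_x (d x ^+ 2) = 0.
  transitivity (\int[leb]_x ((f \_ L) x * d x) - \int[leb]_x ((g \_ L) x * d x)).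
    rewrite -intB; [|exact: L2M (L2l _ Lf) Ld|exact: L2M (L2l _ Lg) Ld].
    by apply: eq_Rintegral => x _; rewrite -mulrBl expr2.
  by rewrite e subrr.
have := int_sqr_eq0 Ld d0; apply: filterS => x + [_ Lx].
by rewrite /d !restrictT_eq// => /eqP; rewrite subr_eq0 => /eqP.
Qed.

Context {M : smooth_manifold R n} {k tau : nat} (E : metric_bundle M k tau).

Lemma family_limit p (B : nat -> tensor2 M k) (w : nat -> connection M k) : 2 < p ->
  (forall j, second_fundamental_form E p (B j)) ->
  (forall j, Lp_connection p (bundle_cocycle E) (w j)) ->
  bounded_family p B w ->
  exists2 phi : nat -> nat, (forall m, (phi m < phi m.+1)%N) &
  exists B0 w0, [/\ second_fundamental_form E p B0, Lp_connection p (bundle_cocycle E) w0 &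
    weak_cvg p (B \o phi) (w \o phi) B0 w0].
Proof.
move=> p2 hB hw [bB bw]; have cA := bundle_smooth_cocycle E.
pose A := bundle_cocycle E.
pose F j i (c : @comp_index n k) := components (B j) (w j) i c.
have LF j i c : Lp_loc p (chart_image i) (F j i c).
  case: c => [[[a b] c]|[[b s] t]]; first by have [h _ _] := hB j; exact: h.
  by have [h _] := hw j; exact: h.
have bF i c : bounded_Lp_loc p (chart_image i) (fun j => F j i c).
  by case: c => [[[a b] c]|[[b s] t]]; [exact: bB|exact: bw].
have changeF j i l : {ae leb, forall x, overlap i l x ->
    forall c, F j i c x = pulled (change_shift A) (change_coef A) i l (F j l) c x}.
  have [_ _ h1] := hB j; have [_ h2] := hw j.
  apply: filterS2 (h1 i l) (h2 i l) => x e1 e2 Ux.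
  by apply/(components_change cA (B j) (w j) (E := E) erefl Ux); split; [exact: e1|exact: e2].
have [phi phim [f hf]] := atlas_weak_compactness p2 LF bF (change_shift_smooth cA) (change_coef_smooth cA) changeF.
exists phi => //.
pose B0 : tensor2 M k := fun i x a b => \row_c f i (inl (a, b, c)) x.
pose w0 : connection M k := fun i x b => \matrix_(s, t) f i (inr (b, s, t)) x.
have fE i c : components B0 w0 i c = f i c.
  by apply/funext => x; case: c => [[[a b] c]|[[b s] t]] /=; rewrite mxE.
have ch i l : {ae leb, forall x, overlap i l x ->
    forall c, f i c x = pulled (change_shift A) (change_coef A) i l (f l) c x}.
  apply: (pulled_limit (F := F \o phi) p2 _ (change_shift_smooth cA) (change_coef_smooth cA)).
  - by move=> j i' c; exact: LF.
  - by move=> j i' l'; exact: changeF.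
  - by move=> i' c; have [] := hf i' c.
  - by move=> i' c; have [] := hf i' c.
have B0E i a b c : (fun x => B0 i x a b 0 c) = f i (inl (a, b, c)) by rewrite -fE.
have w0E i b s t : (fun x => w0 i x b s t) = f i (inr (b, s, t)) by rewrite -fE.
have ch' i l : {ae leb, forall x, overlap i l x -> tensor_change E B0 i l x /\ connection_change A w0 i l x}.
  apply: filterS (ch i l) => x hx Ux; apply/(components_change cA B0 w0 (E := E) erefl Ux) => c.
  by rewrite fE hx//; congr (pulled _ _ _ _ _ _ _); apply/funext => c'; rewrite fE.
exists B0, w0; split.
- split.
  + by move=> i a b c; rewrite B0E; have [] := hf i (inl (a, b, c)).
  + move=> i; have h a b c : {ae leb, forall x, chart_image i x -> f i (inl (a, b, c)) x = f i (inl (b, a, c)) x}.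
      have [L1 w1] := hf i (inl (a, b, c)); have [L2 w2] := hf i (inl (b, a, c)).
      apply: (weak_limit_ae_eq p2 _ _ _ L1 L2 w1 w2).
      * exact: chart_image_open.
      * by move=> j; exact: LF.
      * by move=> j; exact: LF.
      * move=> j; have [_ h _] := hB (phi j); apply: filterS (h i) => x hx Ux /=.
        by rewrite hx.
    have h' : {ae leb, forall x, forall abc : 'I_n * 'I_n * 'I_k, chart_image i x ->
        f i (inl abc) x = f i (inl (abc.1.2, abc.1.1, abc.2)) x}.
      by apply: filter_forall => -[[a b] c]; exact: h.
    apply: filterS h' => x hx Ux a b; apply/rowP => c.
    by rewrite !mxE; exact: (hx (a, b, c) Ux).
  + by move=> i l; apply: filterS (ch' i l) => x hx /hx[].
- split; first by move=> i b s t; rewrite w0E; have [] := hf i (inr (b, s, t)).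
  by move=> i l; apply: filterS (ch' i l) => x hx /hx[].
- split.
  + by move=> i a b c; rewrite B0E; have [_] := hf i (inl (a, b, c)).
  + by move=> i b s t; rewrite w0E; have [_] := hf i (inr (b, s, t)).
Qed.

End family_limit.

(** * Global sections with prescribed local values *)

Section global_sections.
Context {R : realType} {n r : nat} {M : smooth_manifold R n}.
Local Notation V := 'rV[R]_n.
Implicit Types (i j l : chart M).

(** To be equal to 1 near K, and not only on it, the second cutoff is taken relative to the compact
    set where a first cutoff is at least 1/2, a neighbourhood of K. *)
Lemma smooth_cutoff_near (U K : set V) : open U -> compact K -> K `<=` U ->
  exists chi : V -> R, test_function U chi /\ forall x, K x -> \forall y \near x, chi y = 1.
Proof.
move=> oU cK KU; have [chi0 [tchi0 _ chi01]] := smooth_cutoff oU cK KU.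
have cchi0 x : {for x, continuous chi0} by exact: smooth_on_continuous (proj1 tchi0) _.
have [schi0 [K0 [cK0 K0U chiK0]]] := tchi0.
pose K' := [set x | 2^-1 <= chi0 x].
have K'0 : K' `<=` K0.
  by move=> x hx; apply: contrapT => /chiK0 e; move: hx; rewrite /K' /= e invr_le0 leNgt ltr0n.
have cK' : compact K'.
  apply: (subclosed_compact _ cK0 K'0).
  rewrite (_ : K' = chi0 @^-1` [set y | 2^-1 <= y])//.
  by apply: closed_comp => [x _|]; [exact: cchi0|exact: closed_ge].
have [chi [tchi _ chi1]] := smooth_cutoff oU cK' (subset_trans K'0 K0U).
exists chi; split => // x Kx.
have : \forall y \near x, 2^-1 < chi0 y.
  apply: (cchi0 x [set y | 2^-1 < y]); rewrite (chi01 _ Kx).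
  by apply: open_nbhs_nbhs; split; [exact: open_gt|rewrite /= invf_lt1// ltr1n].
by apply: filterS => y hy; apply: chi1; exact: ltW.
Qed.

Variable A : @cocycle R n M r.
Hypothesis cA : smooth_cocycle A.

(** The local section chi v is carried to the other charts by the cocycle and extended by zero.
    Smoothness at points outside the overlap uses that the support is compact, hence closed in the
    Hausdorff manifold. *)
Lemma global_section i (chi : V -> R) (v : 'rV[R]_r) : test_function (chart_image i) chi ->
  exists2 s, smooth_section A s & forall x, chart_image i x -> s i x = chi x *: v.
Proof.
move=> [schi [K [cK KU chiK]]]; have [sA idA compA] := cA.
pose s j y := if `[< overlap j i y >] then
  chi (transition j i y) *: (v *m A i j (transition j i y)) else 0.
have sE j m : chart_dom j m -> chart_dom i m ->
    s j (chart_fun j m) = chi (chart_fun i m) *: (v *m A i j (chart_fun i m)).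
  move=> mj mi; rewrite /s asboolT; last by exists m.
  by rewrite /transition /= chart_funK.
have s0 j m : chart_dom j m -> ~ chart_dom i m -> s j (chart_fun j m) = 0.
  move=> mj nmi; rewrite /s asboolF// => -[m' [m'j m'i] e].
  by case: nmi; rewrite -(chart_funK mj) -e chart_funK.
exists s; last first.
  by move=> x [m mi <-]; rewrite sE// idA ?mulmx1//; exists m.
split; last first.
  move=> j l x [m [mj ml] <-]; rewrite {1}/transition /= chart_funK//.
  have [mi|nmi] := pselect (chart_dom i m); last by rewrite !s0// mul0mx.
  by rewrite !sE// (compA i j l m)// mulmxA scalemxAl.
move=> j a c; rewrite ord1 {a}; apply: smooth_on_local => y Uy.
have oU := @chart_image_open _ _ M j.
have [Oy|nO] := pselect (overlap j i y).
  exists (overlap j i); split => //.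
  have oO := @overlap_open _ _ M j i.
  have co (f : V -> R) : smooth_on (overlap i j) f -> smooth_on (overlap j i) (f \o transition j i).
    apply: smooth_on_comp => //; [exact: overlap_open|exact: transition_overlap|exact: transition_coord_smooth].
  apply: (@smooth_on_eq _ _ _ ((fun z => chi z * \sum_d v 0 d * A i j z d c) \o transition j i)) => //.
    by move=> z Oz; rewrite /s asboolT// !mxE.
  apply: co; have oO' := @overlap_open _ _ M i j; apply: smooth_onM => //; first exact: smooth_on_sub schi.
  by apply: smooth_on_sum => // d _; apply: smooth_onZ => //; exact: sA.
(* The support of chi as a subset of the manifold; in the chart j the section vanishes on the open
   set of points outside it. *)
pose Km := chart_inv i @` K.
have cKm : compact Km.
  apply: continuous_compact cK; apply: continuous_in_subspaceT => x /set_mem /KU.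
  exact: chart_inv_continuous.
have clKm : closed Km by apply: compact_closed cKm; exact: carrier_hausdorff.
pose W := chart_image j `&` chart_inv j @^-1` (~` Km).
have oW : open W.
  rewrite openE => z [Uz nz]; apply: filterI; first exact: open_nbhs_nbhs.
  by apply: (chart_inv_continuous Uz); apply: open_nbhs_nbhs; split => //; exact: closed_openC.
exists W; split.
  split => // -[x Kx e]; apply: nO; have [m mj my] := Uy; exists m => //; split => //.
  have [m' m'i m'x] := KU _ Kx.
  by rewrite -(chart_funK mj) my -e -m'x chart_funK.
apply: (@smooth_on_eq _ _ _ (fun=> 0)) => //; last exact: smooth_on_cst.
move=> z [[m mj <-] nz]; have [mi|nmi] := pselect (chart_dom i m); last by rewrite s0// mxE.
rewrite sE// chiK ?scale0r ?mxE// => Kx; apply: nz; rewrite chart_funK//.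
by exists (chart_fun i m) => //; rewrite chart_funK.
Qed.

End global_sections.

(** * Convergence of integrals against compactly supported weights *)

Section multipliers.
Context {R : realType} {n : nat}.
Local Notation V := 'rV[R]_n.
Local Notation leb := (lebesgue_rV R n).
Variables (p : R) (U K : set V).
Hypotheses (p2 : 2 < p) (oU : open U) (cK : compact K) (KU : K `<=` U).
Implicit Types (f g m : V -> R) (X Y : V -> V).

Let mK := compact_rV_measurable cK.
Let p0 : 0 < p. Proof. exact: lt_trans p2. Qed.

Definition multiplier m := [/\ measurable_fun setT m, exists C, forall x, `|m x| <= C &
  forall x, ~ K x -> m x = 0].

(** The weaker class for terms linear in the unknowns: it admits products of test functions with the
    L^p coefficients of the tangent connection, which are not bounded. *)
Definition sq_multiplier m := L2 leb m /\ forall x, ~ K x -> m x = 0.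

Lemma multiplier_L2 m : multiplier m -> sq_multiplier m.
Proof.
move=> [mm [C hC] m0]; split => //; apply: (L2_le mm (g := fun x => C * \1_K x)).
  move=> x; have [Kx|nK] := pselect (K x); last by rewrite m0// normr0.
  by rewrite indicE mem_set// mulr1; apply: le_trans (hC x) (ler_norm _).
by apply: L2Z; exact: compact_indic_L2.
Qed.

Lemma sq_multiplier_ig m : sq_multiplier m -> ig leb m.
Proof.
move=> [Lm m0]; have := L2M (compact_indic_L2 cK) Lm; congr (ig _ _).
apply/funext => x; have [Kx|nK] := pselect (K x); last by rewrite m0// mulr0.
by rewrite indicE mem_set// mul1r.
Qed.

Lemma test_multiplier phi : test_function setT phi -> (forall x, ~ K x -> phi x = 0) -> multiplier phi.
Proof.
move=> tphi phi0; split => //; first exact: test_function_measurable.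
by have [C _ hC] := test_function_bounded tphi; exists C.
Qed.

Lemma multiplier_bounded f m C : measurable_fun setT (f \_ K) -> (forall x, `|(f \_ K) x| <= C) ->
  multiplier m -> multiplier (fun x => f x * m x).
Proof.
move=> mf fC [mm [D hD] m0].
have E : (fun x => f x * m x) = fun x => (f \_ K) x * m x.
  apply/funext => x; have [Kx|nK] := pselect (K x); first by rewrite restrictT_eq.
  by rewrite m0// !mulr0.
rewrite E; split; first exact: measurable_funM.
- exists (C * D) => x; rewrite normrM; apply: ler_pM => //.
- by move=> x nK; rewrite m0// mulr0.
Qed.

Lemma multiplier_continuous f m : (forall x, U x -> {for x, continuous f}) -> multiplier m ->
  multiplier (fun x => f x * m x).
Proof.
move=> cf; have [C C0 hC] := continuous_bounded cK (fun x Kx => cf x (KU Kx)).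
apply: (@multiplier_bounded _ _ C).
  apply/(meas_restrictP _ mK); apply: measurable_funS KU _; first exact: open_rV_measurable.
  exact: continuous_rV_measurable.
move=> x; have [Kx|nK] := pselect (K x); first by rewrite restrictT_eq//; exact: hC.
by rewrite restrict_eq0// normr0.
Qed.

Lemma multiplier_smooth f m : smooth_on U f -> multiplier m -> multiplier (fun x => f x * m x).
Proof. by move=> sf; apply: multiplier_continuous => x Ux; exact: smooth_on_continuous sf Ux. Qed.

Lemma sq_multiplierD m m' : sq_multiplier m -> sq_multiplier m' -> sq_multiplier (fun x => m x + m' x).
Proof. by move=> [Lm m0] [Lm' m0']; split; [exact: L2D|move=> x nK; rewrite m0// m0'// addr0]. Qed.

Lemma sq_multiplier_sum (I : finType) (P : pred I) (m : I -> V -> R) : (forall i, P i -> sq_multiplier (m i)) ->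
  sq_multiplier (fun x => \sum_(i | P i) m i x).
Proof.
move=> h; split; first by apply: L2_sum => i /h[].
by move=> x nK; apply: big1 => i /h[_]; exact.
Qed.

Lemma Lp_multiplier f m : Lp_loc p U f -> multiplier m -> sq_multiplier (fun x => f x * m x).
Proof.
move=> [_ hf] [mm [C hC] m0]; split; last by move=> x nK; rewrite m0// mulr0.
have [Lf _] := Lp_on_L2 cK p2 (hf _ cK KU).
have := L2Mb Lf mm hC; congr (L2 _ _); apply/funext => x.
have [Kx|nK] := pselect (K x); first by rewrite restrictT_eq.
by rewrite m0// !mulr0.
Qed.

(** Integrability is part of the notion so that sums can be integrated term by term, which makes it
    stable under finite sums. *)
Definition int_cvg (G : nat -> V -> R) (G0 : V -> R) :=
  [/\ forall j, ig leb (G j), ig leb G0 & (fun j => \int[leb]_x G j x) @ \oo --> \int[leb]_x G0 x].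

Lemma int_cvg_cst f : ig leb f -> int_cvg (fun=> f) f.
Proof. by move=> hf; split => //; exact: cvg_cst. Qed.

Lemma int_cvgD G G0 H H0 : int_cvg G G0 -> int_cvg H H0 ->
  int_cvg (fun j x => G j x + H j x) (fun x => G0 x + H0 x).
Proof.
move=> [iG iG0 cG] [iH iH0 cH]; split; [by move=> j; exact: igD|exact: igD|].
rewrite intD// (_ : (fun j => _) = fun j => \int[leb]_x G j x + \int[leb]_x H j x).
  exact: cvgD.
by apply/funext => j; rewrite intD.
Qed.

Lemma int_cvg_sum (I : finType) (G : I -> nat -> V -> R) (G0 : I -> V -> R) :
  (forall i, int_cvg (G i) (G0 i)) ->
  int_cvg (fun j x => \sum_i G i j x) (fun x => \sum_i G0 i x).
Proof.
move=> h; split.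
- by move=> j; apply: ig_sum => i _; have [] := h i.
- by apply: ig_sum => i _; have [] := h i.
- rewrite int_sum; last by move=> i _; have [] := h i.
  rewrite (_ : (fun j => _) = fun j => \sum_i \int[leb]_x G i j x).
    by apply: (cvg_bigsum (u := fun i j => \int[leb]_x G i j x)) => i; have [] := h i.
  by apply/funext => j; rewrite int_sum// => i _; have [] := h i.
Qed.

Lemma int_cvg_eq G G0 H H0 : (forall j x, H j x = G j x) -> (forall x, H0 x = G0 x) ->
  int_cvg G G0 -> int_cvg H H0.
Proof.
move=> e e0 h; rewrite (_ : H = G); last by apply/funext => j; apply/funext => x.
by rewrite (_ : H0 = G0)//; apply/funext.
Qed.

Definition weak_family (F : nat -> V -> R) f :=
  [/\ forall j, Lp_loc p U (F j), Lp_loc p U f, bounded_Lp_loc p U F & weak_cvg_Lp_loc p U F f].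

Lemma int_cvg_linear F f m : weak_family F f -> sq_multiplier m ->
  int_cvg (fun j x => F j x * m x) (fun x => f x * m x).
Proof.
move=> [LF Lf _ wF] [Lm m0].
have E (h : V -> R) : (fun x => h x * m x) = fun x => (h \_ K) x * m x.
  apply/funext => x; have [Kx|nK] := pselect (K x); first by rewrite restrictT_eq.
  by rewrite m0// !mulr0.
have igh h : Lp_loc p U h -> ig leb (fun x => h x * m x).
  by move=> [_ hh]; rewrite E; apply: L2M Lm; have [] := Lp_on_L2 cK p2 (hh _ cK KU).
split; [move=> j; exact: igh (LF j)|exact: igh Lf|].
rewrite (_ : (fun j => _) = fun j => \int[leb]_x ((F j \_ K) x * m x)); last first.
  by apply/funext => j; rewrite E.
by rewrite E; exact: weak_cvg_L2 p2 cK KU wF Lm.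
Qed.

Definition curl_bounded_family al la := (forall c, weak_family (al ^~ c) (la c)) /\ curl_bound U al.

Lemma curl_bounded_familyP al la : curl_bounded_family al la -> curl_family U p al la.
Proof.
move=> [h cb]; split => //.
- move=> j c; have [h1 _ _ _] := h c; exact: h1.
- move=> c; have [_ h1 _ _] := h c; exact: h1.
- move=> c; have [_ _ h1 _] := h c; exact: h1.
- move=> c; have [_ _ _ h1] := h c; exact: h1.
Qed.

Lemma int_cvg_wedge al la be lb m c d : curl_bounded_family al la -> curl_bounded_family be lb ->
  multiplier m ->
  int_cvg (fun j x => m x * (al j c x * be j d x - al j d x * be j c x))
          (fun x => m x * (la c x * lb d x - la d x * lb c x)).
Proof.
move=> ha hb hm; have [mm [C hC] m0] := hm.
have igm f g : Lp_loc p U f -> Lp_loc p U g -> ig leb (fun x => m x * (f x * g x)).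
  move=> Lf Lg; have [L1 _] := Lp_multiplier Lf hm; have [_ hg] := Lg.
  have [L2 _] := Lp_on_L2 cK p2 (hg _ cK KU).
  have := L2M L1 L2; congr (ig _ _); apply/funext => x.
  have [Kx|nK] := pselect (K x); first by rewrite restrictT_eq// mulrA (mulrC (m x)).
  by rewrite m0// mul0r mulr0 mul0r.
have igw f f' g g' : Lp_loc p U f -> Lp_loc p U f' -> Lp_loc p U g -> Lp_loc p U g' ->
    ig leb (fun x => m x * (f x * g x - f' x * g' x)).
  move=> h1 h2 h3 h4; have := igB (igm f g h1 h3) (igm f' g' h2 h4).
  by congr (ig _ _); apply/funext => x; rewrite mulrBr.
have [ha1 ha2 _ _ _] := curl_bounded_familyP ha; have [hb1 hb2 _ _ _] := curl_bounded_familyP hb.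
split; [move=> j; exact: igw (ha1 j c) (ha1 j d) (hb1 j d) (hb1 j c)|exact: igw (ha2 c) (ha2 d) (hb2 d) (hb2 c)|].
exact: (wedge_bounded oU p2 (curl_bounded_familyP ha) (curl_bounded_familyP hb) cK KU mm m0 hC (c := c) (d := d)).
Qed.

Definition apply_form (al : 'I_n -> V -> R) X : V -> R := fun x => \sum_c X x 0 c * al c x.

Lemma int_cvg_form al la be lb m X Y : curl_bounded_family al la -> curl_bounded_family be lb ->
  multiplier m -> smooth_mx_on U X -> smooth_mx_on U Y ->
  int_cvg (fun j x => m x * (apply_form (al j) X x * apply_form (be j) Y x - apply_form (al j) Y x * apply_form (be j) X x))
          (fun x => m x * (apply_form la X x * apply_form lb Y x - apply_form la Y x * apply_form lb X x)).
Proof.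
move=> ha hb hm sX sY.
have E (a b : 'I_n -> V -> R) x : m x * (apply_form a X x * apply_form b Y x - apply_form a Y x * apply_form b X x) =
    \sum_c \sum_d (X x 0 c * (Y x 0 d * m x)) * (a c x * b d x - a d x * b c x).
  rewrite /apply_form (mulr_suml _ _ _ (\sum_d _ * b d x)) [X in _ - X]mulrC mulr_suml -sumrB mulr_sumr.
  apply: eq_bigr => c _; rewrite !mulr_sumr -sumrB mulr_sumr; apply: eq_bigr => d _.
  by ring.
apply: (@int_cvg_eq (fun j x => \sum_c \sum_d (X x 0 c * (Y x 0 d * m x)) * (al j c x * be j d x - al j d x * be j c x))
  (fun x => \sum_c \sum_d (X x 0 c * (Y x 0 d * m x)) * (la c x * lb d x - la d x * lb c x))) => //.
apply: (@int_cvg_sum _ (fun c j x => \sum_d (X x 0 c * (Y x 0 d * m x)) * (al j c x * be j d x - al j d x * be j c x))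
  (fun c x => \sum_d (X x 0 c * (Y x 0 d * m x)) * (la c x * lb d x - la d x * lb c x))) => c.
apply: (@int_cvg_sum _ (fun d j x => (X x 0 c * (Y x 0 d * m x)) * (al j c x * be j d x - al j d x * be j c x))
  (fun d x => (X x 0 c * (Y x 0 d * m x)) * (la c x * lb d x - la d x * lb c x))) => d.
apply: int_cvg_wedge => //; apply: multiplier_smooth; first exact: sX.
by apply: multiplier_smooth; first exact: sY.
Qed.

End multipliers.

(** * Equi-integrability of quadratic expressions *)

Section equi_integrable.
Context {R : realType} {n : nat}.
Local Notation V := 'rV[R]_n.
Local Notation leb := (lebesgue_rV R n).
Variables (p : R) (U K : set V) (T : Type).
Hypotheses (p2 : 2 < p) (oU : open U) (cK : compact K) (KU : K `<=` U).
Implicit Types (F G Q : T -> V -> R).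

Let mK := compact_rV_measurable cK.
Let p0 : 0 < p. Proof. exact: lt_trans p2. Qed.

(** The L1 counterpart of [equi2]: the multipliers are bounded by 1 and small in L2, exactly like
    the test functions of [curl_bound]. *)
Definition equi_integrable Q := (forall t, ig leb (Q t \_ K)) /\
  forall e : R, 0 < e -> exists2 eta : R, 0 < eta & forall t psi, measurable_fun setT psi ->
    L2 leb psi -> (forall x, `|psi x| <= 1) -> N2 leb psi <= eta ->
    \int[leb]_x `|(Q t \_ K) x * psi x| <= e.

Let ig_psi (q psi : V -> R) : ig leb (q \_ K) -> measurable_fun setT psi -> (forall x, `|psi x| <= 1) ->
  ig leb (fun x => `|(q \_ K) x * psi x|).
Proof. by move=> h1 h2 h3; apply: ig_norm; exact: igMb h1 h2 h3. Qed.

Lemma equi_integrableD Q Q' : equi_integrable Q -> equi_integrable Q' ->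
  equi_integrable (fun t x => Q t x + Q' t x).
Proof.
move=> [iQ hQ] [iQ' hQ']; have iE t : ig leb ((fun x => Q t x + Q' t x) \_ K) by rewrite restrictD; exact: igD.
split => // e e0; have e2 : 0 < e / 2 by rewrite divr_gt0.
have [n1 n10 h1] := hQ _ e2; have [n2 n20 h2] := hQ' _ e2.
exists (Num.min n1 n2); first by rewrite lt_min n10.
move=> t psi mpsi Lpsi psi1; rewrite le_min => /andP[l1 l2].
rewrite [e]splitr; apply: le_trans (lerD (h1 t psi mpsi Lpsi psi1 l1) (h2 t psi mpsi Lpsi psi1 l2)).
have i1 := ig_psi (iQ t) mpsi psi1; have i2 := ig_psi (iQ' t) mpsi psi1.
rewrite -intD//; apply: (le_int (ig_psi (iE t) mpsi psi1) (igD i1 i2)).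
by move=> x; rewrite restrictD mulrDl; exact: ler_normD.
Qed.

Lemma equi_integrable_bounded Q (f : V -> R) C : measurable_fun setT (f \_ K) -> 0 <= C ->
  (forall x, `|(f \_ K) x| <= C) -> equi_integrable Q -> equi_integrable (fun t x => f x * Q t x).
Proof.
move=> mf C0 hC [iQ hQ].
have E t : (fun x => f x * Q t x) \_ K = fun x => (Q t \_ K) x * (f \_ K) x.
  by rewrite restrictMM; apply/funext => x; rewrite mulrC.
have iE t : ig leb ((fun x => f x * Q t x) \_ K) by rewrite E; exact: igMb (iQ t) mf hC.
split => // e e0; have C1 : 0 < C + 1 by rewrite ltr_wpDl.
have [eta eta0 h] := hQ (e / (C + 1)) (divr_gt0 e0 C1); exists eta => // t psi mpsi Lpsi psi1 l.
have := h t psi mpsi Lpsi psi1 l; rewrite ler_pdivlMr// mulrC; apply: le_trans.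
have i1 := ig_psi (iQ t) mpsi psi1.
rewrite -intZ//; apply: (le_int (ig_psi (iE t) mpsi psi1) (igZ _ i1)).
move=> x; rewrite E mulrAC normrM [leRHS]mulrC; apply: ler_wpM2l => //.
by apply: le_trans (hC x) _; rewrite lerDl.
Qed.

Lemma equi_integrableM Q (f : V -> R) : smooth_on U f -> equi_integrable Q ->
  equi_integrable (fun t x => f x * Q t x).
Proof.
move=> sf; have [C C0 hC] := smooth_restrict_bounded oU cK KU sf.
exact: equi_integrable_bounded (smooth_restrict_meas oU cK KU sf) C0 hC.
Qed.

Lemma equi_integrableN Q : equi_integrable Q -> equi_integrable (fun t x => - Q t x).
Proof.
move=> h; have := equi_integrableM (@smooth_on_cst _ _ U (-1)) h.
by congr equi_integrable; apply/funext => t; apply/funext => x; rewrite mulN1r.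
Qed.

Lemma equi_integrable0 : equi_integrable (fun _ _ => 0).
Proof.
have E : (fun=> 0) \_ K = fun=> 0 :> R.
  by apply/funext => x; rewrite patchE; case: (x \in K).
split; first by move=> t; rewrite E; exact: ig0.
move=> e e0; exists 1 => // t psi _ _ _ _; rewrite E.
under eq_Rintegral do rewrite mul0r normr0.
by rewrite int0 ltW.
Qed.

Lemma equi_integrable_sum (I : Type) (s : seq I) (Q : I -> T -> V -> R) : (forall i, equi_integrable (Q i)) ->
  equi_integrable (fun t x => \sum_(i <- s) Q i t x).
Proof.
move=> h; elim: s => [|i s IH].
  have := equi_integrable0; congr equi_integrable.
  by apply/funext => t; apply/funext => x; rewrite big_nil.
have := equi_integrableD (h i) IH; congr equi_integrable.
by apply/funext => t; apply/funext => x; rewrite big_cons.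
Qed.

Definition Lp_family F := (forall t, Lp_on p K (F t)) /\
  exists C, forall t, \int[leb]_x (`|(F t \_ K) x| `^ p) <= C.

Lemma Lp_family_loc F : (forall t, Lp_loc p U (F t)) -> bounded_Lp_loc p U F -> Lp_family F.
Proof.
move=> LF bF; have h t : Lp_on p K (F t) by have [_ h] := LF t; exact: h.
split => //; have [C hC] := bF _ cK KU; exists C => t.
by have := hC t; rewrite (Lp_on_intE mK p0 (h t)) lee_fin.
Qed.

Lemma Lp_family_cst (f : V -> R) : Lp_loc p U f -> Lp_family (fun=> f).
Proof.
move=> [_ h]; split; first by move=> _; exact: h.
by exists (\int[leb]_x (`|(f \_ K) x| `^ p)).
Qed.

(** Since |F G| <= F^2 + G^2, this is where p > 2 makes products of two L^p families
    equi-integrable. *)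
Lemma equi_integrable_prod F G : Lp_family F -> Lp_family G -> equi_integrable (fun t x => F t x * G t x).
Proof.
move=> [LF [C hC]] [LG [D hD]].
have L1 t := proj1 (Lp_on_L2 cK p2 (LF t)); have L2' t := proj1 (Lp_on_L2 cK p2 (LG t)).
have iE t : ig leb ((fun x => F t x * G t x) \_ K) by rewrite restrictMM; exact: L2M.
split => // e e0; have e2 : 0 < e / 2 by rewrite divr_gt0.
have [n1 n10 h1] := equi_Lp cK p2 LF hC e2; have [n2 n20 h2] := equi_Lp cK p2 LG hD e2.
exists (Num.min n1 n2); first by rewrite lt_min n10.
move=> t psi mpsi Lpsi psi1; rewrite le_min => /andP[l1 l2].
have psi2 x : `|psi x| <= 2 by apply: le_trans (psi1 x) _; rewrite ler1n.
rewrite [e]splitr; apply: le_trans (lerD (h1 t psi mpsi Lpsi psi2 l1) (h2 t psi mpsi Lpsi psi2 l2)).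
have np : measurable_fun setT (fun x => `|psi x|) by exact: measurableT_comp.
have np1 x : `| `|psi x| | <= 1 by rewrite normr_id.
have i1 := igMb (proj2 (L1 t)) np np1; have i2 := igMb (proj2 (L2' t)) np np1.
rewrite -intD//; apply: (le_int (ig_psi (iE t) mpsi psi1) (igD i1 i2)).
move=> x; rewrite restrictMM -mulrDl normrM; apply: ler_wpM2r => //.
move: ((F t \_ K) x) ((G t \_ K) x) => a b; rewrite normrM -(real_normK (num_real a)) -(real_normK (num_real b)).
by move: `|a| `|b| => {a b}a b; have := sqr_ge0 (a - b); have := sqr_ge0 a; have := sqr_ge0 b; nra.
Qed.

Lemma equi_integrable_form (al be : T -> 'I_n -> V -> R) X Y : (forall c, Lp_family (al ^~ c)) ->
  (forall c, Lp_family (be ^~ c)) -> smooth_mx_on U X -> smooth_mx_on U Y ->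
  equi_integrable (fun t x => apply_form (al t) X x * apply_form (be t) Y x).
Proof.
move=> ha hb sX sY.
have -> : (fun t x => apply_form (al t) X x * apply_form (be t) Y x) =
    fun t x => \sum_c \sum_d X x 0 c * (Y x 0 d * (al t c x * be t d x)).
  apply/funext => t; apply/funext => x; rewrite /apply_form mulr_suml; apply: eq_bigr => c _.
  by rewrite mulr_sumr; apply: eq_bigr => d _; ring.
apply: (@equi_integrable_sum _ _ (fun c t x => \sum_d X x 0 c * (Y x 0 d * (al t c x * be t d x)))) => c.
apply: (@equi_integrable_sum _ _ (fun d t x => X x 0 c * (Y x 0 d * (al t c x * be t d x)))) => d.
apply: equi_integrableM; first exact: sX.
apply: equi_integrableM; first exact: sY.
exact: equi_integrable_prod (ha c) (hb d).
Qed.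

Lemma equi_integrable_pairing Q : equi_integrable Q -> forall e : R, 0 < e ->
  exists2 eta : R, 0 < eta & forall t psi, test_function setT psi ->
    (forall x, ~ K x -> psi x = 0) -> (forall x, `|psi x| <= 1) -> N2 leb psi <= eta ->
    `|pairing U (Q t) psi| <= e.
Proof.
move=> [iQ hQ] e e0; have [eta eta0 h] := hQ _ e0; exists eta => // t psi tpsi psi0 psi1 l.
have mpsi := test_function_measurable tpsi.
have -> : pairing U (Q t) psi = \int[leb]_x ((Q t \_ K) x * psi x).
  rewrite /pairing Rintegral_mkcond; apply: eq_Rintegral => x _.
  have [Kx|nK] := pselect (K x); first by rewrite !restrictT_eq//; exact: KU.
  rewrite restrict_eq0// mul0r patchE; case: (x \in U) => //; by rewrite psi0// mulr0.
have igQ := igMb (iQ t) mpsi psi1.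
apply: le_trans (le_norm_int igQ) _; exact: h (test_function_L2 tpsi) _ _.
Qed.

End equi_integrable.

(** * Smooth linear combinations of weakly convergent families *)

Section weak_families.
Context {R : realType} {n : nat}.
Local Notation V := 'rV[R]_n.
Local Notation leb := (lebesgue_rV R n).
Variables (p : R) (U : set V).
Hypotheses (p2 : 2 < p) (oU : open U).
Implicit Types (F G : nat -> V -> R) (f g : V -> R).

Let p0 : 0 < p. Proof. exact: lt_trans p2. Qed.

Let Lp_locM f g : smooth_on U f -> Lp_loc p U g -> Lp_loc p U (fun x => g x * f x).
Proof.
move=> sf [mg hg]; split.
  by apply: measurable_funM => //; apply/measurable_fun_typeR; exact: smooth_on_measurable.
move=> K cK KU; have [C _ hC] := smooth_restrict_bounded oU cK KU sf.
apply: (Lp_on_M (C := C) cK p0 (hg K cK KU)); first exact: smooth_restrict_meas oU cK KU sf.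
by move=> x Kx; have := hC x; rewrite restrictT_eq.
Qed.

Let Lp_locD f g : Lp_loc p U f -> Lp_loc p U g -> Lp_loc p U (fun x => f x + g x).
Proof.
move=> [mf hf] [mg hg]; split; first exact: measurable_funD.
by move=> K cK KU; apply: Lp_on_D => //; [exact: compact_rV_measurable|exact: hf|exact: hg].
Qed.

Lemma weak_familyM F f g : smooth_on U g -> weak_family p U F f ->
  weak_family p U (fun j x => F j x * g x) (fun x => f x * g x).
Proof.
move=> sg [LF Lf bF wF]; split.
- move=> j; exact: Lp_locM sg (LF j).
- exact: Lp_locM sg Lf.
- move=> K cK KU; have mK := compact_rV_measurable cK; have [C hC] := bF K cK KU.
  have [D D0 hD] := smooth_restrict_bounded oU cK KU sg.
  exists (D `^ p * C) => j; have LFK : Lp_on p K (F j) by have [_ h] := LF j; exact: h.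
  have LFg : Lp_on p K (fun x => F j x * g x) by have [_ h] := Lp_locM sg (LF j); exact: h.
  move: (hC j); rewrite (Lp_on_intE mK p0 LFK) lee_fin => hCj; rewrite (Lp_on_intE mK p0 LFg) lee_fin.
  have [_ i1] := (Lp_onP _ mK p0).1 LFK; have [_ i2] := (Lp_onP _ mK p0).1 LFg.
  apply: le_trans (_ : D `^ p * \int[leb]_x (`|(F j \_ K) x| `^ p) <= _); last first.
    by apply: ler_wpM2l => //; exact: powR_ge0.
  rewrite -intZ//; apply: (le_int i2 (igZ _ i1)) => x.
  rewrite restrictMM normrM powRM// mulrC; apply: ler_wpM2r; first exact: powR_ge0.
  by apply: ge0_ler_powR; rewrite ?nnegrE// ltW.
- move=> K q psi cK KU q0 pq hpsi.
  have [D D0 hD] := smooth_restrict_bounded oU cK KU sg.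
  have hg : Lp_on q K (fun x => psi x * g x).
    apply: (Lp_on_M (C := D) cK q0 hpsi); first exact: smooth_restrict_meas oU cK KU sg.
    by move=> x Kx; have := hD x; rewrite restrictT_eq.
  have := wF K q _ cK KU q0 pq hg.
  rewrite (_ : (fun j => _) = fun j => \int[leb]_(x in K) (F j x * g x * psi x)); last first.
    by apply/funext => j; apply: eq_Rintegral => x _; rewrite mulrAC mulrA.
  rewrite (_ : \int[leb]_(x in K) (f x * g x * psi x) = \int[leb]_(x in K) (f x * (psi x * g x)))//.
  by apply: eq_Rintegral => x _; rewrite mulrAC mulrA.
Qed.

Lemma weak_familyD F f G g : weak_family p U F f -> weak_family p U G g ->
  weak_family p U (fun j x => F j x + G j x) (fun x => f x + g x).
Proof.
move=> [LF Lf bF wF] [LG Lg bG wG]; split.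
- move=> j; exact: Lp_locD (LF j) (LG j).
- exact: Lp_locD Lf Lg.
- move=> K cK KU; have mK := compact_rV_measurable cK; have [C hC] := bF K cK KU; have [D hD] := bG K cK KU.
  exists (2 `^ p * (C + D)) => j; have L1 : Lp_on p K (F j) by have [_ h] := LF j; exact: h.
  have L2 : Lp_on p K (G j) by have [_ h] := LG j; exact: h.
  have L3 := Lp_on_D mK p0 L1 L2.
  move: (hC j); rewrite (Lp_on_intE mK p0 L1) lee_fin => h1; move: (hD j); rewrite (Lp_on_intE mK p0 L2) lee_fin => h2.
  rewrite (Lp_on_intE mK p0 L3) lee_fin.
  have [_ i1] := (Lp_onP _ mK p0).1 L1; have [_ i2] := (Lp_onP _ mK p0).1 L2.
  have [_ i3] := (Lp_onP _ mK p0).1 L3.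
  apply: le_trans (_ : 2 `^ p * (\int[leb]_x (`|(F j \_ K) x| `^ p) + \int[leb]_x (`|(G j \_ K) x| `^ p)) <= _); last first.
    by apply: ler_wpM2l; [exact: powR_ge0|exact: lerD].
  rewrite -intD// -intZ; last exact: igD.
  apply: (le_int i3 (igZ _ (igD i1 i2))) => x.
  by rewrite restrictD; exact: powR_D_le.
- move=> K q psi cK KU q0 pq hpsi; have mK := compact_rV_measurable cK.
  have E (u v : V -> R) : Lp_loc p U u -> Lp_loc p U v -> \int[leb]_(x in K) ((u x + v x) * psi x) =
      \int[leb]_(x in K) (u x * psi x) + \int[leb]_(x in K) (v x * psi x).
    move=> [_ hu] [_ hv].
    rewrite (int_restrict K (fun x => u x + v x) psi) (int_restrict K u psi) (int_restrict K v psi) restrictD.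
    have i1 := Lp_on_dual_ig mK p0 q0 pq (hu K cK KU) hpsi.
    have i2 := Lp_on_dual_ig mK p0 q0 pq (hv K cK KU) hpsi.
    rewrite -restrictMM restrictM in i1; rewrite -restrictMM restrictM in i2.
    by rewrite -intD//; apply: eq_Rintegral => x _; rewrite mulrDl.
  rewrite (E f g)// (_ : (fun j => _) = fun j => \int[leb]_(x in K) (F j x * psi x) + \int[leb]_(x in K) (G j x * psi x)).
    by apply: cvgD; [exact: (wF K q psi cK KU q0 pq hpsi)|exact: (wG K q psi cK KU q0 pq hpsi)].
  by apply/funext => j; exact: E (LF j) (LG j).
Qed.

Lemma weak_family0 : weak_family p U (fun _ _ => 0) (fun=> 0).
Proof.
have z : Lp_loc p U (fun=> 0 : R).
  split; first exact: measurable_cst.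
  move=> K cK KU; apply: (@Lp_on_bounded _ _ p K _ 0) => //; last by move=> x _; rewrite normr0.
  by apply/(meas_restrictP _ (compact_rV_measurable cK)); exact: measurable_cst.
split => //.
- move=> K cK KU; exists 0 => _; rewrite (Lp_on_intE (compact_rV_measurable cK) p0 (z.2 K cK KU)) lee_fin.
  rewrite (_ : (fun x => _) = fun=> 0); first by rewrite int0.
  by apply/funext => x; rewrite patchE; case: (x \in K); rewrite normr0 powR0// gt_eqF.
- by move=> K q psi _ _ _ _ _; exact: cvg_cst.
Qed.

Lemma weak_family_sum (I : Type) (s : seq I) (F : I -> nat -> V -> R) (f : I -> V -> R) :
  (forall i, weak_family p U (F i) (f i)) ->
  weak_family p U (fun j x => \sum_(i <- s) F i j x) (fun x => \sum_(i <- s) f i x).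
Proof.
move=> h; elim: s => [|i s IH].
  rewrite (_ : (fun j x => _) = fun _ _ => 0); last by apply/funext => j; apply/funext => x; rewrite big_nil.
  by rewrite (_ : (fun x => _) = fun=> 0); [exact: weak_family0|apply/funext => x; rewrite big_nil].
have -> : (fun j x => \sum_(l <- i :: s) F l j x) = fun j x => F i j x + \sum_(l <- s) F l j x.
  by apply/funext => j; apply/funext => x; rewrite big_cons.
have -> : (fun x => \sum_(l <- i :: s) f l x) = fun x => f i x + \sum_(l <- s) f l x.
  by apply/funext => x; rewrite big_cons.
exact: weak_familyD (h i) IH.
Qed.

End weak_families.

(** * Measurability, smoothness and inversion of matrix-valued functions *)

Section matrix_functions.
Context {R : realType} {n : nat}.
Local Notation V := 'rV[R]_n.
Variable U : set V.
Hypothesis oU : open U.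

Definition measurable_mx_on r s (F : V -> 'M[R]_(r, s)) := forall a b, measurable_fun U (fun x => F x a b).

Let mU : measurable U. Proof. exact: open_rV_measurable. Qed.

Lemma measurable_mxM r s t (F : V -> 'M[R]_(r, s)) (G : V -> 'M[R]_(s, t)) :
  measurable_mx_on F -> measurable_mx_on G -> measurable_mx_on (fun x => F x *m G x).
Proof.
move=> mF mG a b; under eq_fun do rewrite mxE.
by apply: measurable_sum => c; apply: measurable_funM; [exact: mF|exact: mG].
Qed.

Lemma measurable_mxB r s (F G : V -> 'M[R]_(r, s)) :
  measurable_mx_on F -> measurable_mx_on G -> measurable_mx_on (fun x => F x - G x).
Proof.
move=> mF mG a b; under eq_fun do rewrite !mxE.
by apply: measurable_funB; [exact: mF|exact: mG].
Qed.

Lemma measurable_innerf r (m : V -> 'M[R]_r) (s t : V -> 'rV[R]_r) :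
  measurable_mx_on m -> measurable_mx_on s -> measurable_mx_on t -> measurable_fun U (innerf m s t).
Proof.
move=> mm ms mt; apply: (measurable_mxM (measurable_mxM ms mm) (G := fun x => (t x)^T)) => a b.
by under eq_fun do rewrite mxE; exact: mt.
Qed.

Lemma smooth_mx_measurable r s (F : V -> 'M[R]_(r, s)) : smooth_mx_on U F -> measurable_mx_on F.
Proof. by move=> sF a b; apply: smooth_on_measurable; [exact: oU|exact: sF]. Qed.

Lemma measurable_tensor_app r (B : V -> 'I_n -> 'I_n -> 'rV[R]_r) (X Y : V -> V) :
  (forall a b, measurable_mx_on (fun x => B x a b)) -> measurable_mx_on X -> measurable_mx_on Y ->
  measurable_mx_on (tensor_app B X Y).
Proof.
move=> mB mX mY a b; rewrite /tensor_app /tensor_at.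
rewrite (_ : (fun x => _) = fun x => \sum_c \sum_d (X x 0 c * Y x 0 d) * B x c d a b); last first.
  apply/funext => x; rewrite summxE; apply: eq_bigr => c _; rewrite summxE; apply: eq_bigr => d _.
  by rewrite mxE.
apply: measurable_sum => c; apply: measurable_sum => d; apply: measurable_funM; last exact: mB.
by apply: measurable_funM; [exact: mX|exact: mY].
Qed.

Lemma measurable_shape r (G : V -> 'M[R]_n) (H : V -> 'M[R]_r) (B : V -> 'I_n -> 'I_n -> 'rV[R]_r) (xi : V -> 'rV[R]_r) (X : V -> V) :
  measurable_mx_on (fun x => invmx (G x)) -> measurable_mx_on H -> (forall a b, measurable_mx_on (fun x => B x a b)) ->
  measurable_mx_on xi -> measurable_mx_on X -> measurable_mx_on (Defs.shape G H B xi X).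
Proof.
move=> mG mH mB mxi mX; rewrite /Defs.shape /shape_at.
apply: (measurable_mxM (F := fun x => \row_a inner (H x) (tensor_at (B x) (X x) (delta_mx 0 a)) (xi x))) => // a b.
under eq_fun do rewrite mxE.
apply: (measurable_innerf (s := tensor_app B X (fun=> delta_mx 0 b))) => //.
by apply: measurable_tensor_app => // c d; exact: measurable_cst.
Qed.

Lemma smooth_det r (F : V -> 'M[R]_r) : smooth_mx_on U F -> smooth_on U (fun x => \det (F x)).
Proof.
move=> sF; rewrite /determinant; apply: smooth_on_sum => // s _; apply: smooth_onZ => //.
by apply: smooth_on_prod => // a _; exact: sF.
Qed.

Lemma invmx_continuous r (F : V -> 'M[R]_r) a b x : smooth_mx_on U F ->
  (forall y, U y -> F y \in unitmx) -> U x -> {for x, continuous (fun y => invmx (F y) a b)}.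
Proof.
move=> sF uF Ux.
have E y : U y -> (\det (F y))^-1 * \adj (F y) a b = invmx (F y) a b.
  by move=> Uy; rewrite /invmx uF// [RHS]mxE.
apply: (@near_eq_continuous _ _ _ (fun y => (\det (F y))^-1 * \adj (F y) a b)).
  have : nbhs x U by exact: open_nbhs_nbhs.
  by apply: filterS => y; exact: E.
have cdet : {for x, continuous (fun y => \det (F y))} by exact: smooth_on_continuous (smooth_det sF) Ux.
have cadj : {for x, continuous (fun y => \adj (F y) a b)}.
  apply: (smooth_on_continuous (U := U)) Ux.
  apply: (@smooth_on_eq _ _ _ (fun y => (-1) ^+ (b + a) * \det (row' b (col' a (F y))))) => //.
    by move=> y _; rewrite mxE.
  apply: smooth_onZ => //; apply: smooth_det => c d.
  by rewrite (_ : (fun y => _) = fun y => F y (lift b c) (lift a d)); [exact: sF|apply/funext => y; rewrite !mxE].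
apply: continuousM cadj; apply: continuousV cdet.
by have := uF x Ux; rewrite unitmxE unitfE.
Qed.

End matrix_functions.

(** * Pointwise algebra of shape operators *)

Section pointwise.
Context {R : realType} {n r : nat}.
Local Notation V := 'rV[R]_n.

Lemma tensor_at_coord (b : 'I_n -> 'I_n -> 'rV[R]_r) (u v : V) s :
  tensor_at b u v 0 s = \sum_c v 0 c * \sum_a u 0 a * b a c 0 s.
Proof.
rewrite /tensor_at summxE; under eq_bigr do rewrite summxE.
rewrite exchange_big; apply: eq_bigr => c _ /=; rewrite mulr_sumr; apply: eq_bigr => a _.
by rewrite mxE; ring.
Qed.

Lemma tensor_at_deltar (b : 'I_n -> 'I_n -> 'rV[R]_r) (v : V) a s :
  tensor_at b v (delta_mx 0 a) 0 s = \sum_c v 0 c * b c a 0 s.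
Proof.
rewrite tensor_at_coord (bigD1 a)//= mxE !eqxx mul1r [X in _ + X]big1 ?addr0// => c /negbTE ca.
by rewrite mxE ca andbF mul0r.
Qed.

Lemma tensor_at_deltal (b : 'I_n -> 'I_n -> 'rV[R]_r) (v : V) a s :
  tensor_at b (delta_mx 0 a) v 0 s = \sum_c v 0 c * b a c 0 s.
Proof.
rewrite tensor_at_coord; apply: eq_bigr => c _; congr (_ * _).
rewrite (bigD1 a)//= mxE !eqxx mul1r big1 ?addr0// => d /negbTE da.
by rewrite mxE da andbF mul0r.
Qed.

Lemma inner_sum d (H : 'M[R]_d) (u v : 'rV[R]_d) : inner H u v = \sum_s \sum_t u 0 s * H s t * v 0 t.
Proof.
rewrite /inner mxE exchange_big; apply: eq_bigr => t _ /=.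
by rewrite mxE [v^T _ _]mxE mulr_suml.
Qed.

Lemma innerC d (H : 'M[R]_d) (u v : 'rV[R]_d) : H^T = H -> inner H u v = inner H v u.
Proof.
move=> HT; rewrite !inner_sum exchange_big; apply: eq_bigr => s _; apply: eq_bigr => t _ /=.
by rewrite -{1}HT mxE; ring.
Qed.

Lemma innerBl d (H : 'M[R]_d) (u v w : 'rV[R]_d) : inner H (u - v) w = inner H u w - inner H v w.
Proof. by rewrite /inner !mulmxBl !mxE. Qed.

(* the coefficients of the bilinear form [<II(., .), xi>] *)
Definition shape_coef (H : 'M[R]_r) (b : 'I_n -> 'I_n -> 'rV[R]_r) (xi : 'rV[R]_r) (v : V) a : R :=
  \sum_s (H *m xi^T) s 0 * \sum_c v 0 c * b c a 0 s.

Lemma inner_shape_coef H b xi v a : inner H (tensor_at b v (delta_mx 0 a)) xi = shape_coef H b xi v a.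
Proof.
rewrite /inner -mulmxA mxE; apply: eq_bigr => s _; rewrite mulrC; congr (_ * _).
exact: tensor_at_deltar.
Qed.

Lemma inner_shape_shape (G : 'M[R]_n) H b xi eta u v : G \in unitmx -> (forall a c, b a c = b c a) ->
  inner G (shape_at G H b xi (shape_at G H b eta u)) v =
  \sum_a \sum_c invmx G c a * (shape_coef H b xi v a * shape_coef H b eta u c).
Proof.
move=> uG sb; rewrite shape_atP//; set S := shape_at G H b eta u.
have -> : tensor_at b S v = \sum_a S 0 a *: tensor_at b v (delta_mx 0 a).
  apply/rowP => s; rewrite tensor_at_coord [RHS]summxE; under [LHS]eq_bigr do rewrite mulr_sumr.
  rewrite [LHS]exchange_big; apply: eq_bigr => a _ /=; rewrite [RHS]mxE tensor_at_deltar.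
  by rewrite mulr_sumr; apply: eq_bigr => c _; rewrite (sb a c); ring.
rewrite {1}/inner !mulmx_suml summxE; apply: eq_bigr => a _.
rewrite -!scalemxAl mxE -/(inner _ _ _) inner_shape_coef /S /shape_at mxE mulr_suml.
by apply: eq_bigr => c _; rewrite mxE inner_shape_coef; ring.
Qed.

(** Exchanging the summation indices in the second product, allowed by the symmetry of the inverse
    metric, makes the commutator antisymmetric in u and v: a contraction of wedge products. *)
Lemma inner_shape_bracket (G : 'M[R]_n) H b xi eta u v : G \in unitmx -> G^T = G -> (forall a c, b a c = b c a) ->
  inner G (shape_at G H b xi (shape_at G H b eta u) - shape_at G H b eta (shape_at G H b xi u)) v =
  \sum_a \sum_c invmx G c a * (shape_coef H b xi v a * shape_coef H b eta u c -
    shape_coef H b xi u a * shape_coef H b eta v c).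
Proof.
move=> uG GT sb; rewrite innerBl !inner_shape_shape//.
have iT : (invmx G)^T = invmx G by rewrite trmx_inv GT.
rewrite [X in _ - X]exchange_big -sumrB; apply: eq_bigr => a _; rewrite -sumrB; apply: eq_bigr => c _ /=.
by rewrite -{2}iT [_^T _ _]mxE; ring.
Qed.

End pointwise.

(** The value 1 / (1 + sum of the 1 / f i) lies below every f i and is also positive when the index
    type is empty. *)
Lemma common_lower_bound {R : realType} (I : finType) (f : I -> R) : (forall i, 0 < f i) ->
  exists2 eta : R, 0 < eta & forall i, eta <= f i.
Proof.
move=> f0; have s0 (P : pred I) : 0 <= \sum_(j | P j) (f j)^-1 by apply: sumr_ge0 => j _; rewrite invr_ge0 ltW.
exists (1 + \sum_j (f j)^-1)^-1; first by rewrite invr_gt0 ltr_pwDl.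
move=> i; rewrite -[leRHS]invrK lef_pV2 ?posrE ?invr_gt0//; last by rewrite ltr_pwDl.
by rewrite (bigD1 i)//= addrCA lerDl addr_ge0.
Qed.

Lemma sum_prod_sub {R : comRingType} (I J : finType) (x P P' : I -> R) (y Q Q' : J -> R) :
  (\sum_s x s * P s) * (\sum_t y t * Q t) - (\sum_s x s * P' s) * (\sum_t y t * Q' t) =
  \sum_s \sum_t x s * (y t * (P s * Q t - P' s * Q' t)).
Proof.
rewrite !mulr_suml -sumrB; apply: eq_bigr => s _; rewrite !mulr_sumr -sumrB; apply: eq_bigr => t _.
by ring.
Qed.

Lemma sub_of_addN {R : realType} (a b x y : R) : - a + x = - b + y -> b - a = y - x.
Proof. by lra. Qed.

Lemma sub_of_curvature {R : realType} (a b t x y : R) :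
  t = - ((- b - x) - (- a - y) + 0) -> b - a = t - x + y.
Proof. by lra. Qed.

(** * Testing with fields that are constant near a compact set *)

Section frames.
Context {R : realType} {n : nat}.
Local Notation V := 'rV[R]_n.
Local Notation leb := (lebesgue_rV R n).
Variables (U K : set V).
Hypotheses (oU : open U) (cK : compact K) (KU : K `<=` U).
Implicit Types (f psi : V -> R) (X Y : V -> V).

Lemma pairing_restrict f psi : (forall x, ~ K x -> psi x = 0) ->
  pairing U f psi = \int[leb]_x ((f \_ K) x * psi x).
Proof.
move=> psi0; rewrite /pairing Rintegral_mkcond; apply: eq_Rintegral => x _.
have [Kx|nK] := pselect (K x); first by rewrite !restrictT_eq//; exact: KU.
by rewrite [in RHS]restrict_eq0// mul0r patchE; case: (x \in U) => //; rewrite psi0// mulr0.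
Qed.

Lemma restrict_eq f f' : (forall x, K x -> f x = f' x) -> f \_ K = f' \_ K.
Proof.
move=> ff; apply/funext => x; have [Kx|nK] := pselect (K x); first by rewrite !restrictT_eq//; exact: ff.
by rewrite !restrict_eq0.
Qed.

Lemma pairing_eq_on f f' psi : (forall x, ~ K x -> psi x = 0) -> (forall x, K x -> f x = f' x) ->
  pairing U f psi = pairing U f' psi.
Proof. by move=> psi0 ff; rewrite !pairing_restrict// (restrict_eq ff). Qed.

(** Constancy near K, not merely on K, makes all derivatives vanish on K, so brackets vanish and
    covariant derivatives reduce to connection coefficients there. *)
Definition frame_on r (s : V -> 'rV[R]_r) v := forall x, K x -> \forall y \near x, s y = v.

Lemma frame_onE r (s : V -> 'rV[R]_r) v x : frame_on s v -> K x -> s x = v.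
Proof. by move=> h /h /nbhs_singleton. Qed.

Lemma frame_on_derive r (s : V -> 'rV[R]_r) v u x : frame_on s v -> K x -> 'D_u s x = 0.
Proof.
move=> h Kx; transitivity ('D_u (fun=> v) x); last by rewrite derive_cst.
apply: near_eq_derive; exact: h.
Qed.

Lemma covd_frame r (W : V -> 'I_n -> 'M[R]_r) X s a e x : frame_on X (delta_mx 0 a) -> frame_on s e ->
  K x -> covd W X s x = e *m W x a.
Proof.
move=> hX hs Kx; rewrite /covd (frame_onE hX Kx) (frame_onE hs Kx) (frame_on_derive _ hs Kx) add0r.
by rewrite conn_at_delta.
Qed.

Lemma lie_bracket_frame X Y u v x : frame_on X u -> frame_on Y v -> K x -> lie_bracket X Y x = 0.
Proof.
by move=> hX hY Kx; rewrite /lie_bracket (frame_on_derive _ hX Kx) (frame_on_derive _ hY Kx) subr0.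
Qed.

Lemma dist_deriv_frame X f psi a : frame_on X (delta_mx 0 a) -> test_function setT psi ->
  (forall x, ~ K x -> psi x = 0) -> dist_deriv U X f psi = - \int[leb]_x ((f \_ K) x * pd a psi x).
Proof.
move=> hX tpsi psi0; rewrite /dist_deriv; congr (- _).
have pd0 x : ~ K x -> pd a psi x = 0 by move=> nK; exact: pd_eq0 cK psi0 nK.
have E x : \sum_b 'D_(delta_mx 0 b) (fun y => psi y * X y 0 b) x = pd a psi x.
  have [Kx|nK] := pselect (K x).
    have near_b b : 'D_(delta_mx 0 b) (fun y => psi y * X y 0 b) x = (a == b)%:R * pd b psi x.
      transitivity (pd b (fun y => (a == b)%:R * psi y) x).
        apply: near_eq_derive; apply: filterS (hX x Kx) => y ->.
        by rewrite mxE eqxx eq_sym mulrC.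
      exact: pdZ (proj1 tpsi).
    rewrite (bigD1 a)//= near_b eqxx mul1r big1 ?addr0// => b /negbTE ba.
    by rewrite near_b eq_sym ba mul0r.
  rewrite pd0// big1// => b _.
  have z y : ~ K y -> psi y * X y 0 b = 0 by move=> nKy; rewrite psi0// mul0r.
  exact: (pd_eq0 b cK z nK).
rewrite -pairing_restrict//; rewrite /pairing; apply: eq_Rintegral => x _.
by rewrite E.
Qed.

End frames.

Lemma frame_exists {R : realType} {n r : nat} {M : smooth_manifold R n} (A : @cocycle R n M r) i
    (K : set 'rV[R]_n) : smooth_cocycle A -> compact K -> K `<=` chart_image i ->
  forall v, exists s, smooth_section A s /\ frame_on K (s i) v.
Proof.
move=> cA cK KU v; have [chi [tchi chi1]] := smooth_cutoff_near (@chart_image_open _ _ M i) cK KU.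
have [s ss hs] := global_section cA v tchi; exists s; split => // x Kx.
have : nbhs x (chart_image i) by apply: open_nbhs_nbhs; split; [exact: chart_image_open|exact: KU].
by apply: filterS2 (chi1 x Kx) => y chiy Uy; rewrite hs// chiy scale1r.
Qed.

(** * The Ricci commutator as a combination of wedge products *)

Section ricci_form.
Context {R : realType} {n k nu tau : nat} {M : smooth_manifold R n}.
Local Notation V := 'rV[R]_n.
Local Notation leb := (lebesgue_rV R n).
Variables (p : R) (g : field M 'M[R]_n) (E : metric_bundle M k tau) (i : chart M) (K : set V).
Hypotheses (p2 : 2 < p) (hg : semi_riemannian_metric nu g) (cK : compact K) (KU : K `<=` chart_image i).
Local Notation U := (chart_image i).
Local Notation h := (bundle_metric E i).

Let oU : open U := @chart_image_open _ _ M i.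
Let mK := compact_rV_measurable cK.

(** The inverse metric is bounded on K only almost everywhere; clamping its entries to [-D, D] gives
    measurable functions bounded everywhere that agree with it almost everywhere on K. *)
Lemma metric_inverse_bounded : exists2 C : R, 0 <= C & exists gi : 'I_n -> 'I_n -> V -> R,
  [/\ forall a b, measurable_fun setT (gi a b), forall a b x, `|gi a b x| <= C &
      {ae leb, forall x, K x -> forall a b, invmx (g i x) a b = gi a b x}].
Proof.
have [_ hi _ _] := hg.
have /choice[C hC] (ab : 'I_n * 'I_n) : exists C : R, {ae leb, forall x, K x -> `|invmx (g i x) ab.1 ab.2| <= C}.
  by have [_ h] := hi i ab.1 ab.2; exact: h.
pose D := \sum_ab `|C ab|.
have CD ab : C ab <= D.
  apply: le_trans (ler_norm _) _; rewrite /D (bigD1 ab)//= lerDl.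
  by apply: sumr_ge0.
have D0 : 0 <= D by exact: sumr_ge0.
pose v a b := (fun x => invmx (g i x) a b) \_ K.
have mv a b : measurable_fun setT (v a b).
  apply/(meas_restrictP _ mK); apply: measurable_funS KU _; first exact: open_rV_measurable.
  by have [h _] := hi i a b; apply/measurable_fun_typeR.
exists D => //; exists (fun a b x => Num.max (- D) (Num.min D (v a b x))); split.
- move=> a b; apply: measurable_maxr; first exact: measurable_cst.
  by apply: measurable_minr; first exact: measurable_cst.
- move=> a b x; rewrite ler_norml le_max lexx ge_max ge_min lexx andbT /=.
  by rewrite -subr_ge0 opprK addr_ge0.
- have h : {ae leb, forall x, forall ab : 'I_n * 'I_n, K x -> `|invmx (g i x) ab.1 ab.2| <= C ab}.
    exact: filter_forall.
  apply: filterS h => x hx Kx a b; rewrite /v restrictT_eq//.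
  have := le_trans (hx (a, b) Kx) (CD (a, b)); rewrite ler_norml /= => /andP[h1 h2].
  by rewrite (min_idPr h2) (max_idPr h1).
Qed.

(** The scalar 1-form II(., e_a)^s; its form index is the first argument of II, so the
    antisymmetrised derivative in Codazzi is its curl. *)
Definition theta (B : tensor2 M k) a s : 'I_n -> V -> R := fun c x => B i x c a 0 s.

(** By [inner_shape_bracket] this is <[S_xi, S_eta] X, Y> wherever [gi] is the inverse metric.
    Unlike the shape operators, it shows wedge products of the forms [theta]. *)
Definition ricci_form (gi : 'I_n -> 'I_n -> V -> R) (B : tensor2 M k) (X Y : V -> V) (xi eta : V -> 'rV[R]_k) : V -> R :=
  fun x => \sum_a \sum_c gi c a x * \sum_s \sum_t (h x *m (xi x)^T) s 0 * ((h x *m (eta x)^T) t 0 *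
    (apply_form (theta B a s) Y x * apply_form (theta B c t) X x - apply_form (theta B a s) X x * apply_form (theta B c t) Y x)).

Lemma smooth_lower (xi : V -> 'rV[R]_k) s : smooth_mx_on U xi -> smooth_on U (fun x => (h x *m (xi x)^T) s 0).
Proof.
move=> sxi; apply: (@smooth_on_eq _ _ _ (fun x => \sum_u h x s u * xi x 0 u)) => //.
  by move=> x _; rewrite mxE; apply: eq_bigr => u _; rewrite [_^T _ _]mxE.
apply: (smooth_on_sum oU) => u _; apply: (smooth_onM oU); last exact: sxi.
exact: bundle_metric_smooth.
Qed.

Lemma ricci_lhs (B : tensor2 M k) gi X Y xi eta psi : second_fundamental_form E p B ->
  (forall a b, measurable_fun setT (gi a b)) ->
  {ae leb, forall x, K x -> forall a b, invmx (g i x) a b = gi a b x} ->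
  smooth_mx_on U X -> smooth_mx_on U Y -> smooth_mx_on U xi -> smooth_mx_on U eta ->
  test_function setT psi -> (forall x, ~ K x -> psi x = 0) ->
  let S := Defs.shape (g i) h (B i) in
  pairing U (innerf (g i) (fun x => S xi (S eta X) x - S eta (S xi X) x) Y) psi =
  pairing U (ricci_form gi B X Y xi eta) psi.
Proof.
move=> [LB symB _] mgi giE sX sY sxi seta tpsi psi0 S.
have [Lg Li sg _] := hg; have mpsi := test_function_measurable tpsi.
have mB a b : measurable_mx_on U (fun x => B i x a b).
  by move=> z c; rewrite ord1; have [h' _] := LB i a b c; apply/measurable_fun_typeR.
have mh : measurable_mx_on U h by apply: smooth_mx_measurable => //; exact: bundle_metric_smooth.
have mX := smooth_mx_measurable oU sX; have mY := smooth_mx_measurable oU sY.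
have mxi := smooth_mx_measurable oU sxi; have meta := smooth_mx_measurable oU seta.
have mg : measurable_mx_on U (g i) by move=> a b; have [h' _] := Lg i a b; apply/measurable_fun_typeR.
have mi : measurable_mx_on U (fun x => invmx (g i x)).
  by move=> a b; have [h' _] := Li i a b; apply/measurable_fun_typeR.
have mS (x1 : V -> 'rV[R]_k) (Z : V -> V) : measurable_mx_on U x1 -> measurable_mx_on U Z -> measurable_mx_on U (S x1 Z).
  by move=> m1 mZ; exact: measurable_shape.
rewrite !(pairing_restrict KU)//; apply: int_ae_eq.
- apply: measurable_funM mpsi; apply/(meas_restrictP _ mK); apply: measurable_funS KU _.
    exact: open_rV_measurable.
  apply: measurable_innerf => //; apply: measurable_mxB.
    by apply: (mS xi) => //; exact: mS.
  by apply: (mS eta) => //; exact: mS.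
- apply: measurable_funM mpsi; apply/(meas_restrictP _ mK).
  have mth a s (Z : V -> V) : smooth_mx_on U Z -> measurable_fun K (apply_form (theta B a s) Z).
    move=> sZ; apply: measurable_funS KU _; first exact: open_rV_measurable.
    apply: measurable_sum => c; apply: measurable_funM; last by rewrite /theta; exact: mB.
    by apply: smooth_on_measurable => //; exact: sZ.
  have ml (x1 : V -> 'rV[R]_k) s : smooth_mx_on U x1 -> measurable_fun K (fun x => (h x *m (x1 x)^T) s 0).
    move=> s1; apply: measurable_funS KU _; first exact: open_rV_measurable.
    by apply: smooth_on_measurable => //; exact: smooth_lower.
  apply: measurable_sum => a; apply: measurable_sum => c; apply: measurable_funM.
    by apply: measurable_funTS; exact: mgi.
  apply: measurable_sum => s; apply: measurable_sum => t; apply: measurable_funM; first exact: ml.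
  apply: measurable_funM; first exact: ml.
  by apply: measurable_funB; apply: measurable_funM; exact: mth.
- have sB := symB i; apply: filterS3 giE (sg i) sB => x gix sgx sBx; congr (_ * _).
  have [Kx|nK] := pselect (K x); last by rewrite !restrict_eq0.
  rewrite !restrictT_eq//; have Ux := KU Kx; have [gT ug _] := sgx Ux.
  rewrite /innerf /S /Defs.shape inner_shape_bracket//; last by move=> a c; exact: sBx.
  rewrite /ricci_form; apply: eq_bigr => a _; apply: eq_bigr => c _; rewrite gix//; congr (_ * _).
  rewrite /shape_coef /apply_form /theta.
  exact: sum_prod_sub.
Qed.

End ricci_form.

(** * Curl bounds from the Codazzi and Ricci equations *)

Section curl_bounds.
Context {R : realType} {n k nu tau : nat} {M : smooth_manifold R n}.
Local Notation V := 'rV[R]_n.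
Local Notation leb := (lebesgue_rV R n).
Variables (p : R) (g : field M 'M[R]_n) (Gamma : connection M n) (E : metric_bundle M k tau).
Variables (B : nat -> tensor2 M k) (w : nat -> connection M k).
Hypotheses (p2 : 2 < p) (hg : semi_riemannian_metric nu g) (hGamma : Lp_connection p tangent Gamma).
Hypothesis hB : forall j, second_fundamental_form E p (B j).
Hypothesis hw : forall j, Lp_connection p (bundle_cocycle E) (w j).
Hypothesis bBw : bounded_family p B w.
Variable i : chart M.
Local Notation U := (chart_image i).
Local Notation h := (bundle_metric E i).
Local Notation A := (bundle_cocycle E).

Let oU : open U := @chart_image_open _ _ M i.
Let cA := bundle_smooth_cocycle E.

Section compact.
Variable K : set V.
Hypotheses (cK : compact K) (KU : K `<=` U).

Lemma family_B a b c : Lp_family p K (fun j x => B j i x a b 0 c).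
Proof.
apply: (Lp_family_loc p2 cK KU) => [j|]; last exact: (proj1 bBw).
by have [h1 _ _] := hB j; exact: h1.
Qed.

Lemma family_w b s t : Lp_family p K (fun j x => w j i x b s t).
Proof.
apply: (Lp_family_loc p2 cK KU) => [j|]; last exact: (proj2 bBw).
by have [h1 _] := hw j; exact: h1.
Qed.

Lemma family_Gamma b s t : Lp_family p K (fun (_ : nat) x => Gamma i x b s t).
Proof. by apply: (Lp_family_cst (U := U)) => //; have [h1 _] := hGamma; exact: h1. Qed.

Lemma equi_tensor_conn (b : 'I_n) d c s :
  equi_integrable K (fun j x => (B j i x d b *m w j i x c) 0 s).
Proof.
rewrite (_ : (fun j x => _) = fun j x => \sum_t B j i x d b 0 t * w j i x c t s); last first.
  by apply/funext => j; apply/funext => x; rewrite mxE.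
apply: (@equi_integrable_sum _ _ _ _ _ _ (fun t j x => B j i x d b 0 t * w j i x c t s)) => t.
exact: (equi_integrable_prod p2 cK (family_B d b t) (family_w c t s)).
Qed.

Lemma equi_tensor_Gammal (b c d : 'I_n) s :
  equi_integrable K (fun j x => tensor_at (B j i x) (delta_mx 0 d *m Gamma i x c) (delta_mx 0 b) 0 s).
Proof.
rewrite (_ : (fun j x => _) = fun j x => \sum_a Gamma i x c d a * B j i x a b 0 s); last first.
  by apply/funext => j; apply/funext => x; rewrite tensor_at_deltar -rowE; apply: eq_bigr => a _; rewrite mxE.
apply: (@equi_integrable_sum _ _ _ _ _ _ (fun a j x => Gamma i x c d a * B j i x a b 0 s)) => a.
exact: (equi_integrable_prod p2 cK (family_Gamma c d a) (family_B a b s)).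
Qed.

Lemma equi_tensor_Gammar (b c d : 'I_n) s :
  equi_integrable K (fun j x => tensor_at (B j i x) (delta_mx 0 d) (delta_mx 0 b *m Gamma i x c) 0 s).
Proof.
rewrite (_ : (fun j x => _) = fun j x => \sum_a Gamma i x c b a * B j i x d a 0 s); last first.
  by apply/funext => j; apply/funext => x; rewrite tensor_at_deltal -rowE; apply: eq_bigr => a _; rewrite mxE.
apply: (@equi_integrable_sum _ _ _ _ _ _ (fun a j x => Gamma i x c b a * B j i x d a 0 s)) => a.
exact: (equi_integrable_prod p2 cK (family_Gamma c b a) (family_B d a s)).
Qed.

Lemma equi_conn_conn (c d : 'I_n) s t :
  equi_integrable K (fun j x => inner (h x) (delta_mx 0 s *m w j i x c) (delta_mx 0 t *m w j i x d)).
Proof.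
rewrite (_ : (fun j x => _) = fun j x => \sum_u \sum_v h x u v * (w j i x c s u * w j i x d t v)); last first.
  apply/funext => j; apply/funext => x; rewrite inner_sum; apply: eq_bigr => u _; apply: eq_bigr => v _.
  by rewrite -!rowE !mxE; ring.
apply: (@equi_integrable_sum _ _ _ _ _ _ (fun u j x => \sum_v h x u v * (w j i x c s u * w j i x d t v))) => u.
apply: (@equi_integrable_sum _ _ _ _ _ _ (fun v j x => h x u v * (w j i x c s u * w j i x d t v))) => v.
apply: (equi_integrableM oU cK KU); first exact: bundle_metric_smooth.
exact: (equi_integrable_prod p2 cK (family_w c s u) (family_w d t v)).
Qed.

Lemma equi_ricci_form (gi : 'I_n -> 'I_n -> V -> R) (C : R) (X Y : V -> V) (xi eta : V -> 'rV[R]_k) : (forall a b, measurable_fun setT (gi a b)) -> 0 <= C ->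
  (forall a b x, `|gi a b x| <= C) -> smooth_mx_on U X -> smooth_mx_on U Y ->
  smooth_mx_on U xi -> smooth_mx_on U eta ->
  equi_integrable K (fun j => ricci_form E i gi (B j) X Y xi eta).
Proof.
move=> mgi C0 giC sX sY sxi seta.
pose I4 s t a c j x := apply_form (theta i (B j) a s) Y x * apply_form (theta i (B j) c t) X x -
  apply_form (theta i (B j) a s) X x * apply_form (theta i (B j) c t) Y x.
pose L (z : V -> 'rV[R]_k) s x := (h x *m (z x)^T) s 0.
apply: (@equi_integrable_sum _ _ _ _ _ _ (fun a j x => \sum_c gi c a x * \sum_s \sum_t L xi s x * (L eta t x * I4 s t a c j x))) => a.
apply: (@equi_integrable_sum _ _ _ _ _ _ (fun c j x => gi c a x * \sum_s \sum_t L xi s x * (L eta t x * I4 s t a c j x))) => c.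
apply: (@equi_integrable_bounded _ _ _ _ _ _ C) => //.
- by apply/(meas_restrictP _ (compact_rV_measurable cK)); exact: measurable_funTS.
- move=> x; have [Kx|nK] := pselect (K x); first by rewrite restrictT_eq.
  by rewrite restrict_eq0// normr0.
apply: (@equi_integrable_sum _ _ _ _ _ _ (fun s j x => \sum_t L xi s x * (L eta t x * I4 s t a c j x))) => s.
apply: (@equi_integrable_sum _ _ _ _ _ _ (fun t j x => L xi s x * (L eta t x * I4 s t a c j x))) => t.
apply: (equi_integrableM oU cK KU); first exact: smooth_lower.
apply: (equi_integrableM oU cK KU); first exact: smooth_lower.
have hth a' s' (c' : 'I_n) : Lp_family p K ((fun j => theta i (B j) a' s') ^~ c') by exact: family_B.
apply: equi_integrableD.
  exact: (equi_integrable_form p2 oU cK KU (hth a s) (hth c t) sY sX).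
apply: (equi_integrableN oU cK KU).
exact: (equi_integrable_form p2 oU cK KU (hth a s) (hth c t) sX sY).
Qed.

End compact.

Definition small_functional (K : set V) (L : nat -> (V -> R) -> R) := forall e : R, 0 < e ->
  exists2 eta : R, 0 < eta & forall j psi, test_function setT psi ->
    (forall x, ~ K x -> psi x = 0) -> (forall x, `|psi x| <= 1) -> N2 leb psi <= eta -> `|L j psi| <= e.

Lemma small_functionalD K L L' : small_functional K L -> small_functional K L' ->
  small_functional K (fun j psi => L j psi + L' j psi).
Proof.
move=> h1 h2 e e0; have e2 : 0 < e / 2 by rewrite divr_gt0.
have [n1 n10 hn1] := h1 _ e2; have [n2 n20 hn2] := h2 _ e2.
exists (Num.min n1 n2); first by rewrite lt_min n10.
move=> j psi t0 t1 t2; rewrite le_min => /andP[l1 l2]; rewrite [e]splitr.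
apply: le_trans (ler_normD _ _) _; apply: lerD; [exact: hn1|exact: hn2].
Qed.

Lemma small_functionalN K L : small_functional K L -> small_functional K (fun j psi => - L j psi).
Proof. by move=> hL e /hL[eta eta0 he]; exists eta => // *; rewrite normrN; exact: he. Qed.

(** The pairs of form indices are finite in number, so their thresholds have a common positive lower
    bound. *)
Lemma curl_of_small (al : nat -> 'I_n -> V -> R) : (forall j c, Lp_loc p U (al j c)) ->
  (forall K, compact K -> K `<=` U -> forall c d, exists2 L, small_functional K L &
     forall j psi, test_function setT psi -> (forall x, ~ K x -> psi x = 0) ->
       \int[leb]_x ((al j c \_ K) x * pd d psi x) - \int[leb]_x ((al j d \_ K) x * pd c psi x) = L j psi) ->
  curl_bound U al.
Proof.
move=> Lal hL K cK KU e e0.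
have /choice[eta heta] (cd : 'I_n * 'I_n) : exists eta : R, 0 < eta /\ forall j psi, test_function setT psi ->
    (forall x, ~ K x -> psi x = 0) -> (forall x, `|psi x| <= 1) -> N2 leb psi <= eta ->
    `|\int[leb]_x ((al j cd.1 \_ K) x * pd cd.2 psi x) - \int[leb]_x ((al j cd.2 \_ K) x * pd cd.1 psi x)| <= e.
  have [L sL EL] := hL K cK KU cd.1 cd.2; have [eta eta0 he] := sL e e0.
  by exists eta; split => // j psi t0 t1 t2 t3; rewrite EL//; exact: he.
have [et et0 het] := common_lower_bound (fun cd => (heta cd).1).
exists et => // j c d psi tpsi psi0 psi1 l.
have L2al c' : L2 leb (al j c' \_ K).
  by have [_ hal] := Lal j c'; have [] := Lp_on_L2 cK p2 (hal K cK KU).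
have L2pd d' : L2 leb (pd d' psi) by apply: test_function_L2; exact: test_function_pd.
rewrite intB; [|exact: L2M|exact: L2M].
by apply: (heta (c, d)).2 => //; apply: le_trans l (het (c, d)).
Qed.

(** With coordinate frames constant near K, the derivative terms of Codazzi form the curl of II(.,
    e_b)^s. All other terms are products of two L^p factors, one being II and the other a connection
    coefficient. *)
Lemma codazzi_curl b s : (forall j, codazzi_equation Gamma (B j) (w j)) ->
  curl_bound U (fun j => theta i (B j) b s).
Proof.
move=> cod; apply: curl_of_small => [j c|K cK KU c d]; first by have [h1 _ _] := hB j; exact: h1.
have fr := frame_exists (@tangent_smooth_cocycle R n M) cK KU.
have [X [sX fX]] := fr (delta_mx 0 c); have [Y [sY fY]] := fr (delta_mx 0 d).
have [Z [sZ fZ]] := fr (delta_mx 0 b).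
pose T1 c' d' j x := (B j i x d' b *m w j i x c') 0 s.
pose T2 c' d' j x := tensor_at (B j i x) (delta_mx 0 d' *m Gamma i x c') (delta_mx 0 b) 0 s.
pose T3 c' d' j x := tensor_at (B j i x) (delta_mx 0 d') (delta_mx 0 b *m Gamma i x c') 0 s.
pose P (T : nat -> V -> R) j psi := pairing U (T j) psi.
have sT1 c' d' : small_functional K (P (T1 c' d')).
  exact: (equi_integrable_pairing KU (equi_tensor_conn cK KU b d' c' s)).
have sT2 c' d' : small_functional K (P (T2 c' d')).
  exact: (equi_integrable_pairing KU (equi_tensor_Gammal cK KU b c' d' s)).
have sT3 c' d' : small_functional K (P (T3 c' d')).
  exact: (equi_integrable_pairing KU (equi_tensor_Gammar cK KU b c' d' s)).
pose L c' d' j psi := P (T1 c' d') j psi - P (T2 c' d') j psi - P (T3 c' d') j psi.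
have sL c' d' : small_functional K (L c' d').
  by apply: small_functionalD; [apply: small_functionalD|]; [|exact: small_functionalN|exact: small_functionalN].
exists (fun j psi => L d c j psi - L c d j psi); first by apply: small_functionalD => //; exact: small_functionalN.
move=> j psi tpsi psi0.
have tpsiU : test_function U psi by split; [case: tpsi|exists K].
have cov c' d' (X' Y' : V -> V) : frame_on K X' (delta_mx 0 c') -> frame_on K Y' (delta_mx 0 d') ->
    covd_tensor (Gamma i) (w j i) (B j i) U X' Y' (Z i) s psi =
    (- \int[leb]_x ((theta i (B j) b s d' \_ K) x * pd c' psi x)) + L c' d' j psi.
  move=> fX' fY'; rewrite /covd_tensor (dist_deriv_frame cK KU _ fX' tpsi psi0) /L !addrA.
  have II x : K x -> tensor_app (B j i) Y' (Z i) x = B j i x d' b.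
    by move=> Kx; rewrite /tensor_app (frame_onE fY' Kx) (frame_onE fZ Kx) tensor_at_delta.
  rewrite (restrict_eq (f' := theta i (B j) b s d')); last by move=> x Kx; rewrite II.
  congr (_ + _ - _ - _); apply: (pairing_eq_on KU psi0) => x Kx.
  - by rewrite II// (frame_onE fX' Kx) conn_at_delta.
  - by rewrite /tensor_app (frame_onE fZ Kx) (covd_frame _ fX' fY' Kx).
  - by rewrite /tensor_app (frame_onE fY' Kx) (covd_frame _ fX' fZ Kx).
have := cod j X Y Z sX sY sZ i psi tpsiU s.
rewrite (cov c d)// (cov d c)//.
exact: sub_of_addN.
Qed.

(** The connection form <nabla_a e_s, e_t>, with the index lowered by the bundle metric because the
    Ricci equation gives the curvature in this form. *)
Definition rho (w0 : connection M k) s t : 'I_n -> V -> R := fun a x => (w0 i x a *m h x) s t.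

(** With frames constant near K the bracket term vanishes and the derivative terms of the curvature
    form the curl of [rho]. What remains is quadratic: the shape operator commutator and products of
    connection coefficients. *)
Lemma ricci_curl s t : (forall j a, Lp_loc p U (rho (w j) s t a)) ->
  (forall j, ricci_equation E g (B j) (w j)) -> curl_bound U (fun j => rho (w j) s t).
Proof.
move=> Lrho ric; apply: curl_of_small => // K cK KU c d.
have fr := frame_exists (@tangent_smooth_cocycle R n M) cK KU.
have [X [sX fX]] := fr (delta_mx 0 c); have [Y [sY fY]] := fr (delta_mx 0 d).
have [xi [sxi fxi]] := frame_exists cA cK KU (delta_mx 0 s).
have [eta [seta feta]] := frame_exists cA cK KU (delta_mx 0 t).
have [C C0 [gi [mgi giC giE]]] := metric_inverse_bounded hg cK KU.
pose P (T : nat -> V -> R) j psi := pairing U (T j) psi.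
pose T0 j := ricci_form E i gi (B j) (X i) (Y i) (xi i) (eta i).
pose T1 c' d' j x := inner (h x) (delta_mx 0 s *m w j i x c') (delta_mx 0 t *m w j i x d').
have sT0 : small_functional K (P T0).
  by apply: (equi_integrable_pairing KU (equi_ricci_form cK KU mgi C0 giC _ _ _ _)); [have [] := sX|have [] := sY|have [] := sxi|have [] := seta].
have sT1 c' d' : small_functional K (P (T1 c' d')).
  exact: (equi_integrable_pairing KU (equi_conn_conn cK KU c' d' s t)).
exists (fun j psi => P T0 j psi - P (T1 c d) j psi + P (T1 d c) j psi).
  by apply: small_functionalD => //; apply: small_functionalD => //; exact: small_functionalN.
move=> j psi tpsi psi0.
have tpsiU : test_function U psi by split; [case: tpsi|exists K].
have := ric j X Y xi eta sX sY sxi seta i psi tpsiU; cbv zeta.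
rewrite (ricci_lhs hg cK KU (hB j) mgi giE) //; [|by have [] := sX|by have [] := sY|by have [] := sxi|by have [] := seta].
have dd c' d' (X' Y' : V -> V) : frame_on K X' (delta_mx 0 c') -> frame_on K Y' (delta_mx 0 d') ->
    dist_deriv U Y' (innerf h (covd (w j i) X' (xi i)) (eta i)) psi =
    - \int[leb]_x ((rho (w j) s t c' \_ K) x * pd d' psi x).
  move=> fX' fY'; rewrite (dist_deriv_frame cK KU _ fY' tpsi psi0).
  rewrite (restrict_eq (f' := rho (w j) s t c'))// => x Kx.
  rewrite /innerf (covd_frame _ fX' fxi Kx) (frame_onE feta Kx) /inner /rho -!mulmxA (mulmxA (w j i x c')).
  by rewrite -rowE trmx_delta -colE !mxE.
have PP c' d' (X' Y' : V -> V) : frame_on K X' (delta_mx 0 c') -> frame_on K Y' (delta_mx 0 d') ->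
    pairing U (innerf h (covd (w j i) X' (xi i)) (covd (w j i) Y' (eta i))) psi = P (T1 c' d') j psi.
  move=> fX' fY'; apply: (pairing_eq_on KU psi0) => x Kx.
  by rewrite /innerf (covd_frame _ fX' fxi Kx) (covd_frame _ fY' feta Kx).
have P0 : pairing U (innerf h (covd (w j i) (lie_bracket (X i) (Y i)) (xi i)) (eta i)) psi = 0.
  rewrite (pairing_eq_on KU psi0 (f' := fun=> 0)).
    rewrite (pairing_restrict KU _ psi0) (_ : (fun x => _) = fun=> 0); first exact: int0.
    by apply/funext => x; rewrite patchE; case: (x \in K); rewrite mul0r.
  move=> x Kx; rewrite /innerf /covd (lie_bracket_frame fX fY Kx) (frame_on_derive _ fxi Kx) add0r.
  by rewrite /conn_at big1 ?mulmx0 ?/inner ?mul0mx ?mxE// => a _; rewrite mxE scale0r.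
rewrite /curvature P0 (dd _ _ _ _ fX fY) (dd _ _ _ _ fY fX) (PP _ _ _ _ fX fY) (PP _ _ _ _ fY fX).
exact: sub_of_curvature.
Qed.

End curl_bounds.

(** Used with a, b derivatives of the sections and c, d connection terms: the first two products are
    of first order in the connection, the third is free of it, and only the last is quadratic. *)
Lemma inner_split {R : realType} r (H : 'M[R]_r) (a b c d : 'rV[R]_r) : H^T = H ->
  inner H (a + c) (b + d) = inner H (a + c) b + inner H (b + d) a - inner H b a + inner H c d.
Proof.
move=> HT.
have Dl u v z : inner H (u + v) z = inner H u z + inner H v z by rewrite /inner !mulmxDl mxE.
have Dr u v z : inner H z (u + v) = inner H z u + inner H z v by rewrite /inner linearD mulmxDr mxE.
rewrite !(Dl, Dr) (innerC d a HT); move: (inner H) => f; ring.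
Qed.

Lemma cvg_congr {R : realType} (u v : nat -> R) (a b : R) : (forall j, u j = v j) -> a = b ->
  v @ \oo --> b -> u @ \oo --> a.
Proof. by move=> /funext -> ->. Qed.

Lemma cvg_subD {R : realType} (u v z : nat -> R) (a b c : R) : u @ \oo --> a -> v @ \oo --> b -> z @ \oo --> c ->
  (fun j => u j - v j + z j) @ \oo --> a - b + c.
Proof. by move=> ua vb zc; apply: cvgD zc; exact: cvgB. Qed.

(** * Convergence of each term of the GCR system in a chart *)

Section limit.
Context {R : realType} {n k tau : nat} {M : smooth_manifold R n}.
Local Notation V := 'rV[R]_n.
Local Notation leb := (lebesgue_rV R n).
Variables (p : R) (E : metric_bundle M k tau) (i : chart M).
Variables (B : nat -> tensor2 M k) (w : nat -> connection M k) (B0 : tensor2 M k) (w0 : connection M k).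
Local Notation U := (chart_image i).
Local Notation h := (bundle_metric E i).
Hypothesis p2 : 2 < p.
Hypothesis wB : forall a b c, weak_family p U (fun j x => B j i x a b 0 c) (fun x => B0 i x a b 0 c).
Hypothesis ww : forall b s t, weak_family p U (fun j x => w j i x b s t) (fun x => w0 i x b s t).

Let oU : open U := @chart_image_open _ _ M i.
Let sh : smooth_mx_on U h. Proof. exact: bundle_metric_smooth. Qed.
Let hT x : U x -> (h x)^T = h x. Proof. by move=> /(@bundle_metric_index _ _ _ _ _ E i)[]. Qed.
Let hu x : U x -> h x \in unitmx. Proof. by move=> /(@bundle_metric_index _ _ _ _ _ E i)[]. Qed.

Lemma weak_rho s t a : weak_family p U (fun j => rho E i (w j) s t a) (rho E i w0 s t a).
Proof.
rewrite (_ : (fun j => _) = fun j x => \sum_u w j i x a s u * h x u t); last first.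
  by apply/funext => j; apply/funext => x; rewrite /rho mxE.
rewrite (_ : rho _ _ w0 s t a = fun x => \sum_u w0 i x a s u * h x u t); last first.
  by apply/funext => x; rewrite /rho mxE.
apply: weak_family_sum => // u; apply: weak_familyM => //; exact: sh.
Qed.

Hypothesis cth : forall b s, curl_bound U (fun j => theta i (B j) b s).
Hypothesis crho : forall s t, curl_bound U (fun j => rho E i (w j) s t).

Let fth b s : curl_bounded_family p U (fun j => theta i (B j) b s) (theta i B0 b s).
Proof. by split => // c; exact: wB. Qed.

Let frho s t : curl_bounded_family p U (fun j => rho E i (w j) s t) (rho E i w0 s t).
Proof. by split => // a; exact: weak_rho. Qed.

Variable K : set V.
Hypotheses (cK : compact K) (KU : K `<=` U).
Implicit Types (X Y Z : V -> V) (m : V -> R).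

Let smoothm f m := @multiplier_smooth _ _ U K oU cK KU f m.

Lemma pairing_int f m : multiplier K m -> pairing U f m = \int[leb]_x (f x * m x).
Proof.
move=> [_ _ m0]; rewrite (pairing_restrict KU _ m0); apply: eq_Rintegral => x _.
by have [Kx|nK] := pselect (K x); [rewrite restrictT_eq|rewrite m0// !mulr0].
Qed.

Lemma pairing_cvg G G0 m : multiplier K m -> int_cvg (fun j x => G j x * m x) (fun x => G0 x * m x) ->
  (fun j => pairing U (G j) m) @ \oo --> pairing U G0 m.
Proof.
move=> hm [_ _]; rewrite pairing_int// (_ : (fun j => pairing U (G j) m) = fun j => \int[leb]_x (G j x * m x))//.
by apply/funext => j; rewrite pairing_int.
Qed.

(* equality of the integrands is only needed on [K], where the weight lives *)
Lemma int_cvg_eq_on G G0 H H0 m : multiplier K m ->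
  (forall j x, U x -> H j x * m x = G j x) -> (forall x, U x -> H0 x * m x = G0 x) ->
  (forall j x, ~ U x -> G j x = 0) -> (forall x, ~ U x -> G0 x = 0) ->
  int_cvg G G0 -> int_cvg (fun j x => H j x * m x) (fun x => H0 x * m x).
Proof.
move=> [_ _ m0] e e0 z z0; apply: int_cvg_eq => [j x|x].
  have [Ux|nU] := pselect (U x); first exact: e.
  by rewrite m0 ?mulr0 ?z// => /KU.
have [Ux|nU] := pselect (U x); first exact: e0.
by rewrite m0 ?mulr0 ?z0// => /KU.
Qed.

Lemma tensor_app_theta (b : tensor2 M k) X Z x s :
  tensor_app (b i) X Z x 0 s = \sum_c Z x 0 c * apply_form (theta i b c s) X x.
Proof. by rewrite /tensor_app tensor_at_coord. Qed.

Section gauss.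
Variables (X Y Z1 Z2 : V -> V) (m : V -> R).
Hypotheses (sX : smooth_mx_on U X) (sY : smooth_mx_on U Y) (sZ1 : smooth_mx_on U Z1) (sZ2 : smooth_mx_on U Z2).
Hypothesis hm : multiplier K m.

Let lhs (b : tensor2 M k) := let II := tensor_app (b i) in
  innerf h (II X Z1) (II Y Z2) \- innerf h (II X Z2) (II Y Z1).

Let wedge (b : tensor2 M k) x := \sum_s \sum_t \sum_c \sum_d (h x s t * (Z1 x 0 c * (Z2 x 0 d * m x))) *
  (apply_form (theta i b c s) X x * apply_form (theta i b d t) Y x -
   apply_form (theta i b c s) Y x * apply_form (theta i b d t) X x).

Let lhsE b x : U x -> lhs b x * m x = wedge b x.
Proof.
(* Swapping the factors of the second product by symmetry of the bundle metric leaves Z1 and Z2 in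
   the same slots, so that the difference is antisymmetric in X and Y. *)
move=> Ux; rewrite /lhs /= /innerf [X in _ - X]innerC; last exact: hT.
rewrite !inner_sum -sumrB mulr_suml; apply: eq_bigr => s _; rewrite -sumrB mulr_suml; apply: eq_bigr => t _.
rewrite !tensor_app_theta !(mulrAC _ (h x s t)) -mulrBl sum_prod_sub !mulr_suml.
apply: eq_bigr => c _; rewrite !mulr_suml; apply: eq_bigr => d _; by ring.
Qed.

Lemma gauss_cvg : (fun j => pairing U (lhs (B j)) m) @ \oo --> pairing U (lhs B0) m.
Proof.
have [_ _ m0] := hm.
have w0' b x : ~ U x -> wedge b x = 0.
  move=> nU; have mx0 : m x = 0 by apply: m0 => /KU.
  by rewrite /wedge mx0; do 4! (apply: big1 => ? _); rewrite !mulr0 mul0r.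
apply: pairing_cvg => //; apply: (int_cvg_eq_on hm (G := fun j => wedge (B j)) (G0 := wedge B0)).
- by move=> j x; exact: lhsE.
- by move=> x; exact: lhsE.
- by move=> j x; exact: w0'.
- by move=> x; exact: w0'.
- apply: int_cvg_sum => s; apply: int_cvg_sum => t; apply: int_cvg_sum => c; apply: int_cvg_sum => d.
  apply: (int_cvg_form p2 oU cK KU (fth c s) (fth d t) _ sX sY).
  by apply: smoothm; [exact: sh|apply: smoothm; [exact: sZ1|apply: smoothm; [exact: sZ2|exact: hm]]].
Qed.

End gauss.

Lemma ig_form (al be : 'I_n -> V -> R) X Y m : (forall c, Lp_loc p U (al c)) -> (forall c, Lp_loc p U (be c)) ->
  smooth_mx_on U X -> smooth_mx_on U Y -> multiplier K m ->
  ig leb (fun x => m x * (apply_form al X x * apply_form be Y x)).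
Proof.
move=> La Lb sX sY hm.
rewrite (_ : (fun x => _) = fun x => \sum_c \sum_d (al c x * (X x 0 c * (Y x 0 d * m x))) * (be d \_ K) x).
  apply: ig_sum => c _; apply: ig_sum => d _; apply: L2M.
    have hm' := smoothm (sX 0 c) (smoothm (sY 0 d) hm).
    by have [] := Lp_multiplier p2 cK KU (La c) hm'.
  by have [_ h'] := Lb d; have [] := Lp_on_L2 cK p2 (h' _ cK KU).
have [_ _ m0] := hm; apply/funext => x; rewrite /apply_form mulr_suml mulr_sumr; apply: eq_bigr => c _.
rewrite !mulr_sumr; apply: eq_bigr => d _; have [Kx|nK] := pselect (K x).
  by rewrite restrictT_eq//; ring.
by rewrite m0// restrict_eq0// !(mulr0, mul0r).
Qed.

Lemma conn_rho (W : connection M k) X x s t :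
  (conn_at (W i x) (X x) *m h x) s t = apply_form (rho E i W s t) X x.
Proof.
rewrite /conn_at mulmx_suml summxE; apply: eq_bigr => a _.
by rewrite -scalemxAl mxE.
Qed.

(** Curl bounds are known for [rho] only, so connection terms are expressed through it. The inverse
    bundle metric that appears is continuous and can be absorbed in the weight. *)
Lemma conn_rho_inv (W : connection M k) X x s t : U x ->
  conn_at (W i x) (X x) s t = \sum_v apply_form (rho E i W s v) X x * invmx (h x) v t.
Proof.
move=> Ux; rewrite -[conn_at _ _](mulmxK (hu Ux)) mxE; apply: eq_bigr => v _.
by rewrite conn_rho.
Qed.

Lemma invm_multiplier s t m : multiplier K m -> multiplier K (fun x => invmx (h x) s t * m x).
Proof. by apply: (multiplier_continuous oU cK KU) => x Ux; exact: (@invmx_continuous _ _ U oU _ h s t x sh hu Ux). Qed.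

Lemma smooth_derive r (s : V -> 'rV[R]_r) X : smooth_mx_on U X -> smooth_mx_on U s ->
  smooth_mx_on U (fun x => 'D_(X x) s x).
Proof.
move=> sX ss a c; apply: (@smooth_on_eq _ _ _ (fun x => \sum_b X x 0 b * pd b (fun y => s y 0 c) x)) => //.
  move=> x Ux; rewrite (smooth_mx_derive _ oU ss Ux) summxE; apply: eq_bigr => b _.
  by rewrite !mxE ord1.
by apply: (smooth_on_sum oU) => b _; apply: (smooth_onM oU); [exact: sX|apply: smooth_on_pd; exact: ss].
Qed.

Lemma smooth_lie_bracket X Y : smooth_mx_on U X -> smooth_mx_on U Y -> smooth_mx_on U (lie_bracket X Y).
Proof.
move=> sX sY a c; rewrite (_ : (fun x => _) = fun x => ('D_(X x) Y x) a c - ('D_(Y x) X x) a c); last first.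
  by apply/funext => x; rewrite /lie_bracket !mxE.
by apply: (smooth_onB oU); exact: smooth_derive.
Qed.

Lemma smooth_innerf (s t : V -> 'rV[R]_k) : smooth_mx_on U s -> smooth_mx_on U t -> smooth_on U (innerf h s t).
Proof.
move=> ss st; apply: (@smooth_on_eq _ _ _ (fun x => \sum_a \sum_b s x 0 a * h x a b * t x 0 b)) => //.
  by move=> x _; rewrite /innerf inner_sum.
apply: (smooth_on_sum oU) => a _; apply: (smooth_on_sum oU) => b _; apply: (smooth_onM oU); last exact: st.
by apply: (smooth_onM oU); [exact: ss|exact: sh].
Qed.

Lemma multiplier_ig m : multiplier K m -> ig leb m.
Proof. by move=> hm; apply: (sq_multiplier_ig cK); exact: multiplier_L2. Qed.

Section first_order.
Variables (X : V -> V) (s t : V -> 'rV[R]_k) (m : V -> R).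
Hypotheses (sX : smooth_mx_on U X) (ss : smooth_mx_on U s) (st : smooth_mx_on U t) (hm : multiplier K m).

Let lin (W : connection M k) x := innerf h (fun x => 'D_(X x) s x) t x * m x +
  \sum_u \sum_v \sum_a rho E i W u v a x * (s x 0 u * (t x 0 v * (X x 0 a * m x))).

Lemma covd_innerE (W : connection M k) x : innerf h (covd (W i) X s) t x * m x = lin W x.
Proof.
rewrite /innerf /covd {1}/inner 2!mulmxDl mxE mulrDl; congr (_ + _).
rewrite -(mulmxA (s x)) -mulmxA mxE mulr_suml; apply: eq_bigr => u _.
rewrite mxE mulr_sumr mulr_suml; apply: eq_bigr => v _.
rewrite conn_rho [_^T _ _]mxE /apply_form mulr_suml mulr_sumr mulr_suml; apply: eq_bigr => a _.
by ring.
Qed.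

Lemma int_cvg_covd : int_cvg (fun j x => innerf h (covd (w j i) X s) t x * m x)
  (fun x => innerf h (covd (w0 i) X s) t x * m x).
Proof.
apply: (@int_cvg_eq _ _ (fun j => lin (w j)) (lin w0)) => [j x|x|]; [exact: covd_innerE|exact: covd_innerE|].
apply: int_cvgD.
  apply: int_cvg_cst; apply: multiplier_ig; apply: smoothm => //.
  by apply: smooth_innerf => //; exact: smooth_derive.
apply: int_cvg_sum => u; apply: int_cvg_sum => v; apply: int_cvg_sum => a.
apply: (int_cvg_linear p2 cK KU (weak_rho u v a)); apply: (multiplier_L2 cK).
by apply: smoothm; [exact: ss|apply: smoothm; [exact: st|apply: smoothm; [exact: sX|exact: hm]]].
Qed.

End first_order.

Section second_order.
Variables (X Y : V -> V) (s t : V -> 'rV[R]_k) (m : V -> R).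
Hypotheses (sX : smooth_mx_on U X) (sY : smooth_mx_on U Y).
Hypotheses (ss : smooth_mx_on U s) (st : smooth_mx_on U t) (hm : multiplier K m).

Let quad (W : connection M k) (X Y : V -> V) x :=
  inner (h x) (s x *m conn_at (W i x) (X x)) (t x *m conn_at (W i x) (Y x)) * m x.

Let quadE (W : connection M k) X' Y' x : U x -> quad W X' Y' x =
  \sum_u \sum_v \sum_a \sum_b (s x 0 a * (t x 0 b * (invmx (h x) u v * m x))) *
    (apply_form (rho E i W a u) X' x * apply_form (rho E i W b v) Y' x).
Proof.
move=> Ux; rewrite /quad.
have -> (a b : 'rV[R]_k) : inner (h x) a b = inner (invmx (h x)) (a *m h x) (b *m h x).
  by rewrite /inner trmx_mul (hT Ux) !mulmxA mulmxK ?hu.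
rewrite inner_sum mulr_suml; apply: eq_bigr => u _; rewrite mulr_suml; apply: eq_bigr => v _.
rewrite -!mulmxA !mxE !mulr_suml; apply: eq_bigr => a _; rewrite !mulr_sumr mulr_suml; apply: eq_bigr => b _.
by rewrite !conn_rho; ring.
Qed.

Let quad_ig (W : connection M k) X' Y' : (forall a b c, Lp_loc p U (rho E i W a b c)) ->
  smooth_mx_on U X' -> smooth_mx_on U Y' -> ig leb (quad W X' Y').
Proof.
move=> LW sX' sY'; have [_ _ m0] := hm.
rewrite (_ : quad W X' Y' = fun x => \sum_u \sum_v \sum_a \sum_b (s x 0 a * (t x 0 b * (invmx (h x) u v * m x))) *
    (apply_form (rho E i W a u) X' x * apply_form (rho E i W b v) Y' x)); last first.
  apply/funext => x; have [Ux|nU] := pselect (U x); first exact: quadE.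
  have mx0 : m x = 0 by apply: m0 => /KU.
  by rewrite /quad mx0 mulr0; apply/esym; do 4! (apply: big1 => ? _); rewrite !mulr0 mul0r.
apply: ig_sum => u _; apply: ig_sum => v _; apply: ig_sum => a _; apply: ig_sum => b _.
apply: ig_form => //.
by apply: smoothm; [exact: ss|apply: smoothm; [exact: st|exact: invm_multiplier]].
Qed.

Let quad_cvg : int_cvg (fun j x => quad (w j) X Y x - quad (w j) Y X x) (fun x => quad w0 X Y x - quad w0 Y X x).
Proof.
have [_ _ m0] := hm.
pose T (W : connection M k) x := \sum_u \sum_v \sum_a \sum_b (s x 0 a * (t x 0 b * (invmx (h x) u v * m x))) *
    (apply_form (rho E i W a u) X x * apply_form (rho E i W b v) Y x -
     apply_form (rho E i W a u) Y x * apply_form (rho E i W b v) X x).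
have QT W x : quad W X Y x - quad W Y X x = T W x.
  have [Ux|nU] := pselect (U x).
    rewrite !quadE// -sumrB; apply: eq_bigr => u _; rewrite -sumrB; apply: eq_bigr => v _.
    rewrite -sumrB; apply: eq_bigr => a _; rewrite -sumrB; apply: eq_bigr => b _.
    by rewrite -mulrBr.
  have mx0 : m x = 0 by apply: m0 => /KU.
  by rewrite /quad mx0 !mulr0 subrr; apply/esym; do 4! (apply: big1 => ? _); rewrite mx0 !mulr0 mul0r.
apply: (@int_cvg_eq _ _ (fun j => T (w j)) (T w0)) => [j x|x|]; [exact: QT|exact: QT|].
apply: int_cvg_sum => u; apply: int_cvg_sum => v; apply: int_cvg_sum => a; apply: int_cvg_sum => b.
apply: (int_cvg_form p2 oU cK KU (frho a u) (frho b v) _ sX sY).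
by apply: smoothm; [exact: ss|apply: smoothm; [exact: st|exact: invm_multiplier]].
Qed.

Let ds (X : V -> V) (s : V -> 'rV[R]_k) : V -> 'rV[R]_k := fun x => 'D_(X x) s x.

(* only the last term is quadratic in the connection *)
Let split (W : connection M k) X' Y' x : U x -> innerf h (covd (W i) X' s) (covd (W i) Y' t) x * m x =
  innerf h (covd (W i) X' s) (ds Y' t) x * m x + innerf h (covd (W i) Y' t) (ds X' s) x * m x -
  innerf h (ds Y' t) (ds X' s) x * m x + quad W X' Y' x.
Proof.
move=> Ux; rewrite /quad /innerf -!mulrDl -mulrBl -mulrDl; congr (_ * _).
rewrite /covd -/(ds X' s x) -/(ds Y' t x); exact: inner_split (hT Ux).
Qed.

(** The two pairings are taken together: only the difference of their quadratic parts is a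
    combination of wedge products, while the other parts are linear in the connection. *)
Lemma pairing_covd2_cvg :
  (fun j => pairing U (innerf h (covd (w j i) X s) (covd (w j i) Y t)) m -
            pairing U (innerf h (covd (w j i) Y s) (covd (w j i) X t)) m) @ \oo -->
  pairing U (innerf h (covd (w0 i) X s) (covd (w0 i) Y t)) m -
  pairing U (innerf h (covd (w0 i) Y s) (covd (w0 i) X t)) m.
Proof.
have [_ _ m0] := hm.
pose lin (W : connection M k) X' Y' x := innerf h (covd (W i) X' s) (ds Y' t) x * m x +
  innerf h (covd (W i) Y' t) (ds X' s) x * m x - innerf h (ds Y' t) (ds X' s) x * m x.
have lin_cvg X' Y' : smooth_mx_on U X' -> smooth_mx_on U Y' -> int_cvg (fun j => lin (w j) X' Y') (lin w0 X' Y').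
  move=> sX' sY'; have sd r := smooth_derive (r := r); apply: int_cvgD.
    by apply: int_cvgD; apply: int_cvg_covd => //; exact: smooth_derive.
  apply: int_cvg_cst; apply: igN; apply: multiplier_ig; apply: smoothm => //.
  by apply: smooth_innerf; exact: smooth_derive.
have splitT W X' Y' : (fun x => innerf h (covd (W i) X' s) (covd (W i) Y' t) x * m x) =
    fun x => lin W X' Y' x + quad W X' Y' x.
  apply/funext => x; have [Ux|nU] := pselect (U x); first exact: split.
  have mx0 : m x = 0 by apply: m0 => /KU.
  have z (a : R) : a * m x = 0 by rewrite mx0 mulr0.
  by rewrite /lin /quad !z !addr0 subr0.
have Lj j a b c : Lp_loc p U (rho E i (w j) a b c) by have [h1 _ _ _] := weak_rho a b c; exact: h1.
have L0 a b c : Lp_loc p U (rho E i w0 a b c) by have [_ h1 _ _] := weak_rho a b c; exact: h1.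
have [i1 i2 c1] := lin_cvg X Y sX sY; have [i3 i4 c2] := lin_cvg Y X sY sX.
have [i5 i6 c3] := quad_cvg.
have EW W : ig leb (lin W X Y) -> ig leb (lin W Y X) -> (forall a b c, Lp_loc p U (rho E i W a b c)) ->
    pairing U (innerf h (covd (W i) X s) (covd (W i) Y t)) m - pairing U (innerf h (covd (W i) Y s) (covd (W i) X t)) m =
    \int[leb]_x lin W X Y x - \int[leb]_x lin W Y X x + \int[leb]_x (quad W X Y x - quad W Y X x).
  move=> l1 l2 LW; rewrite !pairing_int// !splitT.
  rewrite (intD l1 (quad_ig LW sX sY)) (intD l2 (quad_ig LW sY sX)) (intB (quad_ig LW sX sY) (quad_ig LW sY sX)).
  by rewrite opprD; exact: addrACA.
exact: (cvg_congr (fun j => EW (w j) (i1 j) (i3 j) (Lj j)) (EW w0 i2 i4 L0) (cvg_subD c1 c2 c3)).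
Qed.

End second_order.

(** A distributional derivative along X is minus the pairing with this weight, so it passes to the
    limit like a term without derivatives. *)
Definition divergence (phi : V -> R) X : V -> R := fun x => \sum_b pd b (fun y => phi y * X y 0 b) x.

Variable phi : V -> R.
Hypotheses (tphi : test_function U phi) (phi0 : forall x, ~ K x -> phi x = 0).

Let mphi : multiplier K phi. Proof. exact: test_multiplier (test_functionT tphi) phi0. Qed.

Lemma divergence_multiplier X : smooth_mx_on U X -> multiplier K (divergence phi X).
Proof.
move=> sX; apply: test_multiplier.
  apply: (test_functionT (U := U)); apply: test_function_sum => b _; apply: test_function_pd.
  by apply: test_function_mul_on => //; exact: sX.
move=> x nK; apply: big1 => b _; apply: pd_eq0 cK _ nK => y nKy.
by rewrite phi0// mul0r.
Qed.

Lemma metric_cvg X s t : smooth_mx_on U X -> smooth_mx_on U s -> smooth_mx_on U t ->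
  (fun j => pairing U (innerf h (covd (w j i) X s) t \+ innerf h s (covd (w j i) X t)) phi) @ \oo -->
  pairing U (innerf h (covd (w0 i) X s) t \+ innerf h s (covd (w0 i) X t)) phi.
Proof.
move=> sX ss st; apply: pairing_cvg => //.
have [_ _ m0] := mphi.
have EW W x : (innerf h (covd W X s) t \+ innerf h s (covd W X t)) x * phi x =
    innerf h (covd W X s) t x * phi x + innerf h (covd W X t) s x * phi x.
  rewrite /= mulrDl; congr (_ + _); have [Ux|nU] := pselect (U x).
    by congr (_ * _); rewrite /innerf innerC//; exact: hT.
  by rewrite m0 ?mulr0// => /KU.
apply: (@int_cvg_eq _ _ (fun j x => innerf h (covd (w j i) X s) t x * phi x + innerf h (covd (w j i) X t) s x * phi x)
  (fun x => innerf h (covd (w0 i) X s) t x * phi x + innerf h (covd (w0 i) X t) s x * phi x)) => [j x|x|].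
- exact: EW.
- exact: EW.
- by apply: int_cvgD; exact: int_cvg_covd.
Qed.

Lemma curvature_cvg X Y s t : smooth_mx_on U X -> smooth_mx_on U Y -> smooth_mx_on U s -> smooth_mx_on U t ->
  (fun j => curvature h (w j i) U X Y s t phi) @ \oo --> curvature h (w0 i) U X Y s t phi.
Proof.
move=> sX sY ss st.
have cdd Z Z' : smooth_mx_on U Z -> smooth_mx_on U Z' ->
    (fun j => dist_deriv U Z' (innerf h (covd (w j i) Z s) t) phi) @ \oo -->
    dist_deriv U Z' (innerf h (covd (w0 i) Z s) t) phi.
  move=> sZ sZ'; apply: cvgN; apply: (pairing_cvg (m := divergence phi Z')); first exact: divergence_multiplier.
  by apply: int_cvg_covd => //; exact: divergence_multiplier.
have c3 := pairing_covd2_cvg sX sY ss st mphi.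
have c4 : (fun j => pairing U (innerf h (covd (w j i) (lie_bracket X Y) s) t) phi) @ \oo -->
    pairing U (innerf h (covd (w0 i) (lie_bracket X Y) s) t) phi.
  by apply: pairing_cvg => //; apply: int_cvg_covd => //; exact: smooth_lie_bracket.
have EC W : curvature h W U X Y s t phi =
    dist_deriv U Y (innerf h (covd W X s) t) phi - dist_deriv U X (innerf h (covd W Y s) t) phi -
    (pairing U (innerf h (covd W X s) (covd W Y t)) phi - pairing U (innerf h (covd W Y s) (covd W X t)) phi) +
    pairing U (innerf h (covd W (lie_bracket X Y) s) t) phi.
  rewrite /curvature; move: (dist_deriv U Y _ phi) (dist_deriv U X _ phi) => a1 a2.
  move: (pairing _ _ _) (pairing _ _ _) (pairing _ _ _) => a3 a4 a5; ring.
rewrite EC (_ : (fun j => _) = fun j => dist_deriv U Y (innerf h (covd (w j i) X s) t) phi -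
    dist_deriv U X (innerf h (covd (w j i) Y s) t) phi -
    (pairing U (innerf h (covd (w j i) X s) (covd (w j i) Y t)) phi -
     pairing U (innerf h (covd (w j i) Y s) (covd (w j i) X t)) phi) +
    pairing U (innerf h (covd (w j i) (lie_bracket X Y) s) t) phi); last by apply/funext => j; exact: EC.
apply: cvgD c4; apply: cvgB c3; apply: cvgB; [exact: cdd X Y sX sY|exact: cdd Y X sY sX].
Qed.

(** The coefficients [gi] are only bounded and measurable; here convergence of wedge products
    against such weights is indispensable. *)
Lemma ricci_form_cvg (gi : 'I_n -> 'I_n -> V -> R) (C : R) X Y (xi eta : V -> 'rV[R]_k) : (forall a b, measurable_fun setT (gi a b)) ->
  (forall a b (x : V), `|gi a b x| <= C) -> smooth_mx_on U X -> smooth_mx_on U Y ->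
  smooth_mx_on U xi -> smooth_mx_on U eta ->
  (fun j => pairing U (ricci_form E i gi (B j) X Y xi eta) phi) @ \oo --> pairing U (ricci_form E i gi B0 X Y xi eta) phi.
Proof.
move=> mgi giC sX sY sxi seta.
pose L (z : V -> 'rV[R]_k) s x := (h x *m (z x)^T) s 0.
pose T b x := \sum_a \sum_c \sum_s \sum_t (gi c a x * (L xi s x * (L eta t x * phi x))) *
  (apply_form (theta i b a s) Y x * apply_form (theta i b c t) X x - apply_form (theta i b a s) X x * apply_form (theta i b c t) Y x).
have ET b x : ricci_form E i gi b X Y xi eta x * phi x = T b x.
  rewrite /ricci_form mulr_suml; apply: eq_bigr => a _; rewrite mulr_suml; apply: eq_bigr => c _.
  rewrite mulr_sumr mulr_suml; apply: eq_bigr => s _; rewrite mulr_sumr mulr_suml; apply: eq_bigr => t _.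
  by rewrite /L; ring.
apply: pairing_cvg => //; apply: (@int_cvg_eq _ _ (fun j => T (B j)) (T B0)) => [j x|x|]; [exact: ET|exact: ET|].
apply: int_cvg_sum => a; apply: int_cvg_sum => c; apply: int_cvg_sum => s; apply: int_cvg_sum => t.
apply: (int_cvg_form p2 oU cK KU (fth a s) (fth c t) _ sY sX).
apply: (@multiplier_bounded _ _ K _ _ `|C|).
- by apply/(meas_restrictP _ (compact_rV_measurable cK)); exact: measurable_funTS.
- move=> x; have [Kx|nK] := pselect (K x); first by rewrite restrictT_eq//; apply: le_trans (giC c a x) (ler_norm _).
  by rewrite restrict_eq0// normr0.
- apply: smoothm; first exact: smooth_lower.
  by apply: smoothm; first exact: smooth_lower.
Qed.

Section codazzi.
Variables (Gamma : connection M n) (X Y Z : V -> V) (c : 'I_k).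
Hypothesis LG : forall b s t, Lp_loc p U (fun x => Gamma i x b s t).
Hypotheses (sX : smooth_mx_on U X) (sY : smooth_mx_on U Y) (sZ : smooth_mx_on U Z).

Let tensor_cvg (u v : V -> V) m : multiplier K m -> (forall a b, sq_multiplier K (fun x => u x 0 a * (v x 0 b * m x))) ->
  (fun j => pairing U (fun x => tensor_app (B j i) u v x 0 c) m) @ \oo -->
  pairing U (fun x => tensor_app (B0 i) u v x 0 c) m.
Proof.
move=> hm huv.
have ET (b : tensor2 M k) x : tensor_app (b i) u v x 0 c * m x =
    \sum_d \sum_a b i x a d 0 c * (u x 0 a * (v x 0 d * m x)).
  rewrite /tensor_app tensor_at_coord mulr_suml; apply: eq_bigr => d _; rewrite mulr_sumr mulr_suml.
  by apply: eq_bigr => a _; ring.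
apply: pairing_cvg => //.
apply: (@int_cvg_eq _ _ (fun j x => \sum_d \sum_a B j i x a d 0 c * (u x 0 a * (v x 0 d * m x)))
  (fun x => \sum_d \sum_a B0 i x a d 0 c * (u x 0 a * (v x 0 d * m x)))) => [j x|x|]; [exact: ET|exact: ET|].
apply: int_cvg_sum => d; apply: int_cvg_sum => a.
exact: (int_cvg_linear p2 cK KU (wB a d c) (huv a d)).
Qed.

(** The tangent connection is only in L^p, so these weights need not be bounded; they are square
    integrable, which suffices for terms linear in II. *)
Let sq_covd X' Y' a m : smooth_mx_on U X' -> smooth_mx_on U Y' -> multiplier K m ->
  sq_multiplier K (fun x => covd (Gamma i) X' Y' x 0 a * m x).
Proof.
move=> sX' sY' hm.
rewrite (_ : (fun x => _) = fun x => 'D_(X' x) Y' x 0 a * m x +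
    \sum_d \sum_b Gamma i x b d a * (Y' x 0 d * (X' x 0 b * m x))); last first.
  apply/funext => x; rewrite /covd mxE mulrDl; congr (_ + _).
  rewrite mxE mulr_suml; apply: eq_bigr => d _; rewrite /conn_at summxE mulr_sumr mulr_suml.
  by apply: eq_bigr => b _; rewrite mxE; ring.
apply: sq_multiplierD.
  by apply: (multiplier_L2 cK); apply: smoothm => //; exact: smooth_derive.
apply: sq_multiplier_sum => d _; apply: sq_multiplier_sum => b _.
apply: (Lp_multiplier p2 cK KU (LG b d a)).
by apply: smoothm; [exact: sY'|apply: smoothm; [exact: sX'|exact: hm]].
Qed.

Let quad (b : tensor2 M k) (W : connection M k) (X Y : V -> V) x :=
  (tensor_app (b i) Y Z x *m conn_at (W i x) (X x)) 0 c.

Let quadE b W X' Y' x : U x -> quad b W X' Y' x * phi x =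
  \sum_t \sum_d \sum_v (Z x 0 d * (invmx (h x) v c * phi x)) *
    (apply_form (theta i b d t) Y' x * apply_form (rho E i W t v) X' x).
Proof.
move=> Ux; rewrite /quad mxE mulr_suml; apply: eq_bigr => t _.
rewrite tensor_app_theta !mulr_suml; apply: eq_bigr => d _; rewrite conn_rho_inv//.
by rewrite mulr_sumr mulr_suml; apply: eq_bigr => v _; ring.
Qed.

Let quad_ig b W X' Y' : (forall a d s, Lp_loc p U (theta i b a d s)) -> (forall s t a, Lp_loc p U (rho E i W s t a)) ->
  smooth_mx_on U X' -> smooth_mx_on U Y' -> ig leb (fun x => quad b W X' Y' x * phi x).
Proof.
move=> Lb LW sX' sY'.
rewrite (_ : (fun x => _) = fun x => \sum_t \sum_d \sum_v (Z x 0 d * (invmx (h x) v c * phi x)) *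
    (apply_form (theta i b d t) Y' x * apply_form (rho E i W t v) X' x)); last first.
  apply/funext => x; have [Ux|nU] := pselect (U x); first exact: quadE.
  have z : phi x = 0 by apply: phi0 => /KU.
  by rewrite z mulr0; apply/esym; do 3! (apply: big1 => ? _); rewrite !mulr0 mul0r.
apply: ig_sum => t _; apply: ig_sum => d _; apply: ig_sum => v _; apply: ig_form => //.
by apply: smoothm; [exact: sZ|exact: invm_multiplier].
Qed.

(** Convergence is asserted for the difference of the two sides: the product of II with the normal
    connection becomes a combination of wedge products only after antisymmetrising in X and Y. *)
Lemma codazzi_cvg :
  (fun j => covd_tensor (Gamma i) (w j i) (B j i) U X Y Z c phi - covd_tensor (Gamma i) (w j i) (B j i) U Y X Z c phi) @ \oo -->
  covd_tensor (Gamma i) (w0 i) (B0 i) U X Y Z c phi - covd_tensor (Gamma i) (w0 i) (B0 i) U Y X Z c phi.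
Proof.
pose T b W x := \sum_t \sum_d \sum_v (Z x 0 d * (invmx (h x) v c * phi x)) *
    (apply_form (theta i b d t) Y x * apply_form (rho E i W t v) X x -
     apply_form (theta i b d t) X x * apply_form (rho E i W t v) Y x).
have QT b W x : quad b W X Y x * phi x - quad b W Y X x * phi x = T b W x.
  have [Ux|nU] := pselect (U x).
    rewrite !quadE// -sumrB; apply: eq_bigr => t _; rewrite -sumrB; apply: eq_bigr => d _.
    by rewrite -sumrB; apply: eq_bigr => v _; rewrite -mulrBr.
  have z : phi x = 0 by apply: phi0 => /KU.
  by rewrite z !mulr0 subrr; apply/esym; do 3! (apply: big1 => ? _); rewrite z !mulr0 mul0r.
have [_ _ cT] : int_cvg (fun j => T (B j) (w j)) (T B0 w0).
  apply: int_cvg_sum => t; apply: int_cvg_sum => d; apply: int_cvg_sum => v.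
  apply: (int_cvg_form p2 oU cK KU (fth d t) (frho t v) _ sY sX).
  by apply: smoothm; [exact: sZ|exact: invm_multiplier].
have EW b W : (forall a d s, Lp_loc p U (theta i b a d s)) -> (forall s t a, Lp_loc p U (rho E i W s t a)) ->
    pairing U (quad b W X Y) phi - pairing U (quad b W Y X) phi = \int[leb]_x T b W x.
  move=> Lb LW; rewrite !pairing_int// -(intB (quad_ig Lb LW sX sY) (quad_ig Lb LW sY sX)).
  by apply: eq_Rintegral => x _; exact: QT.
have Lth j a d s : Lp_loc p U (theta i (B j) a d s) by have [h1 _ _ _] := wB s a d; exact: h1.
have Lth0 a d s : Lp_loc p U (theta i B0 a d s) by have [_ h1 _ _] := wB s a d; exact: h1.
have Lj j a b d : Lp_loc p U (rho E i (w j) a b d) by have [h1 _ _ _] := weak_rho a b d; exact: h1.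
have L0 a b d : Lp_loc p U (rho E i w0 a b d) by have [_ h1 _ _] := weak_rho a b d; exact: h1.
have cq : (fun j => pairing U (quad (B j) (w j) X Y) phi - pairing U (quad (B j) (w j) Y X) phi) @ \oo -->
    pairing U (quad B0 w0 X Y) phi - pairing U (quad B0 w0 Y X) phi.
  have Ej j := EW (B j) (w j) (Lth j) (Lj j).
  by rewrite (EW B0 w0 Lth0 L0) (funext Ej).
pose lin (b : tensor2 M k) X' Y' := dist_deriv U X' (fun x => tensor_app (b i) Y' Z x 0 c) phi -
  pairing U (fun x => tensor_app (b i) (covd (Gamma i) X' Y') Z x 0 c) phi -
  pairing U (fun x => tensor_app (b i) Y' (covd (Gamma i) X' Z) x 0 c) phi.
have clin X' Y' : smooth_mx_on U X' -> smooth_mx_on U Y' -> (fun j => lin (B j) X' Y') @ \oo --> lin B0 X' Y'.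
  move=> sX' sY'; apply: cvgB; [apply: cvgB|].
  - apply: cvgN; apply: (tensor_cvg (m := divergence phi X')); first exact: divergence_multiplier.
    move=> a b; apply: (multiplier_L2 cK); apply: smoothm; first exact: sY'.
    by apply: smoothm; [exact: sZ|exact: divergence_multiplier].
  - apply: tensor_cvg => // a b; apply: sq_covd => //.
    by apply: smoothm; first exact: sZ.
  - apply: tensor_cvg => // a b.
    rewrite (_ : (fun x => _) = fun x => covd (Gamma i) X' Z x 0 b * (Y' x 0 a * phi x)); last first.
      by apply/funext => x; rewrite mulrCA.
    by apply: sq_covd => //; apply: smoothm; first exact: sY'.
have EE b W : covd_tensor (Gamma i) (W i) (b i) U X Y Z c phi - covd_tensor (Gamma i) (W i) (b i) U Y X Z c phi =
    lin b X Y - lin b Y X + (pairing U (quad b W X Y) phi - pairing U (quad b W Y X) phi).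
  rewrite /covd_tensor /lin /quad.
  move: (dist_deriv U X _ phi) (dist_deriv U Y _ phi) (pairing _ _ _) (pairing _ _ _) (pairing _ _ _) => a1 a2 a3 a4 a5.
  move: (pairing _ _ _) (pairing _ _ _) (pairing _ _ _) => a6 a7 a8; ring.
rewrite EE (_ : (fun j => _) = fun j => lin (B j) X Y - lin (B j) Y X +
   (pairing U (quad (B j) (w j) X Y) phi - pairing U (quad (B j) (w j) Y X) phi)).
  by apply: cvgD cq; apply: cvgB; exact: clin.
by apply/funext => j; exact: EE.
Qed.

End codazzi.
End limit.

Lemma cvg_eq_cst {R : realType} (u : nat -> R) (a b : R) : u @ \oo --> a -> (forall j, u j = b) -> a = b.
Proof.
move=> ua ub; have ub' : u = fun=> b by apply/funext.
by rewrite ub' in ua; exact: cvg_unique ua (cvg_cst b).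
Qed.

(** Each equation holds along the whole sequence and its terms converge, so it holds for the limit;
    the compatibility of the connection with the bundle metric passes in the same way. *)
Lemma gcr_limit {R : realType} {n k nu tau : nat} {p : R} {M : smooth_manifold R n} {g : field M 'M[R]_n}
    {Gamma : connection M n} {E : metric_bundle M k tau} (B : nat -> tensor2 M k) (w : nat -> connection M k) B0 w0 :
  2 < p -> semi_riemannian_metric nu g -> Lp_connection p tangent Gamma ->
  (forall j, second_fundamental_form E p (B j)) -> (forall j, normal_connection E p (w j)) ->
  bounded_family p B w -> (forall j, gcr_system E g Gamma (B j) (w j)) ->
  second_fundamental_form E p B0 -> Lp_connection p (bundle_cocycle E) w0 -> weak_cvg p B w B0 w0 ->
  metric_connection (bundle_cocycle E) (bundle_metric E) w0 /\ gcr_system E g Gamma B0 w0.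
Proof.
move=> p2 hg hGamma hB hw bBw gcr hB0 hw0 [cB cw]; have [bB bw] := bBw.
have hw' j : Lp_connection p (bundle_cocycle E) (w j) by have [] := hw j.
have wB i a b c : weak_family p (chart_image i) (fun j x => B j i x a b 0 c) (fun x => B0 i x a b 0 c).
  split; [move=> j|by have [h _ _] := hB0; exact: h|exact: bB|exact: cB].
  by have [h _ _] := hB j; exact: h.
have ww i b s t : weak_family p (chart_image i) (fun j x => w j i x b s t) (fun x => w0 i x b s t).
  split; [move=> j|by have [h _] := hw0; exact: h|exact: bw|exact: cw].
  by have [h _] := hw' j; exact: h.
have wrho i s t a := weak_rho E p2 (ww i) s t a.
have cth i b s : curl_bound (chart_image i) (fun j => theta i (B j) b s).
  by apply: (codazzi_curl p2 hGamma hB hw' bBw) => j; have [] := gcr j.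
have crho i s t : curl_bound (chart_image i) (fun j => rho E i (w j) s t).
  apply: (ricci_curl p2 hg hB hw' bBw) => j; last by have [] := gcr j.
  by move=> a; have [h _ _ _] := wrho i s t a; exact: h.
split; [|split].
- move=> X s t sX ss st i phi tphi; have [_ [K [cK KU phi0]]] := tphi.
  have := metric_cvg (E := E) p2 (ww i) cK KU tphi phi0 (proj1 sX i) (proj1 ss i) (proj1 st i).
  move=> c; apply/esym; apply: (cvg_eq_cst c) => j; have [_ mc] := hw j.
  exact/esym/mc.
- move=> X Y Z1 Z2 sX sY sZ1 sZ2 i phi tphi; have [_ [K [cK KU phi0]]] := tphi.
  have mphi := test_multiplier (test_functionT tphi) phi0.
  have := gauss_cvg (E := E) p2 (wB i) (cth i) cK KU (proj1 sX i) (proj1 sY i) (proj1 sZ1 i) (proj1 sZ2 i) mphi.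
  move=> c; apply: (cvg_eq_cst c) => j; have [ga _ _] := gcr j.
  exact: ga.
- move=> X Y Z sX sY sZ i phi tphi c; have [_ [K [cK KU phi0]]] := tphi.
  have LG b s t : Lp_loc p (chart_image i) (fun x => Gamma i x b s t) by have [h _] := hGamma; exact: h.
  have := codazzi_cvg (E := E) p2 (wB i) (ww i) (cth i) (crho i) cK KU tphi phi0 LG (proj1 sX i) (proj1 sY i) (proj1 sZ i) (c := c).
  move=> cv; apply/eqP; rewrite -subr_eq0; apply/eqP; apply: (cvg_eq_cst cv) => j.
  by have [_ co _] := gcr j; rewrite (co X Y Z sX sY sZ i phi tphi c) subrr.
- move=> X Y xi eta sX sY sxi seta i phi tphi; have [_ [K [cK KU phi0]]] := tphi.
  have [C C0 [gi [mgi giC giE]]] := metric_inverse_bounded hg cK KU (i := i).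
  have R0 b (hb : second_fundamental_form E p b) := ricci_lhs hg cK KU hb mgi giE (proj1 sX i) (proj1 sY i) (proj1 sxi i) (proj1 seta i) (test_functionT tphi) phi0.
  cbv zeta; rewrite (R0 B0 hB0).
  have c1 := ricci_form_cvg (E := E) p2 (wB i) (cth i) cK KU tphi phi0 mgi giC (proj1 sX i) (proj1 sY i) (proj1 sxi i) (proj1 seta i).
  have c2 := curvature_cvg (E := E) p2 (ww i) (crho i) cK KU tphi phi0 (proj1 sX i) (proj1 sY i) (proj1 sxi i) (proj1 seta i).
  have Ej j : pairing (chart_image i) (ricci_form E i gi (B j) (X i) (Y i) (xi i) (eta i)) phi =
      - curvature (bundle_metric E i) (w j i) (chart_image i) (X i) (Y i) (xi i) (eta i) phi.
    by have [_ _ ri] := gcr j; rewrite -(R0 (B j) (hB j)); exact: ri.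
  by rewrite (funext Ej) in c1; exact: cvg_unique c1 (cvgN c2).
Qed.
Theorem theorem4p2 (R : realType) (n k nu tau : nat) (p : R)
    (M : smooth_manifold R n) (g : field M 'M[R]_n) (Gamma : connection M n)
    (E : metric_bundle M k tau)
    (II : R -> tensor2 M k) (w : R -> connection M k) :
  2 < p ->
  semi_riemannian_metric nu g ->
  Lp_connection p tangent Gamma ->
  levi_civita g Gamma ->
  (forall eps, 0 < eps -> second_fundamental_form E p (II eps)) ->
  (forall eps, 0 < eps -> normal_connection E p (w eps)) ->
  bounded_family p (fun eps : {eps : R | 0 < eps} => II (sval eps))
    (fun eps : {eps : R | 0 < eps} => w (sval eps)) ->
  (forall eps, 0 < eps -> gcr_system E g Gamma (II eps) (w eps)) ->
  exists eps : nat -> R,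
    [/\ forall j, 0 < eps j,
        forall j, eps j.+1 < eps j,
        eps @ \oo --> 0 &
        exists (II0 : tensor2 M k) (w0 : connection M k),
          [/\ second_fundamental_form E p II0,
              normal_connection E p w0,
              weak_cvg p (fun j => II (eps j)) (fun j => w (eps j)) II0 w0 &
              gcr_system E g Gamma II0 w0]].
Proof.
move=> p2 hg hGamma _ hB hw [bB bw] gcr.
(* The reciprocals of j + 1 are positive and strictly decreasing to 0; composing with the strictly
   increasing extraction keeps these properties. *)
pose e0 (j : nat) : R := j.+1%:R^-1.
have e0_gt0 j : 0 < e0 j by rewrite invr_gt0.
pose Bs j := II (e0 j); pose ws j := w (e0 j).
have bBw : bounded_family p Bs ws.
  split => [i a b c|i b s t] K cK KU.
    have [C hC] := bB i a b c K cK KU.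
    by exists C => j; exact: (hC (exist _ (e0 j) (e0_gt0 j))).
  have [C hC] := bw i b s t K cK KU.
  by exists C => j; exact: (hC (exist _ (e0 j) (e0_gt0 j))).
have hBs j : second_fundamental_form E p (Bs j) by exact: hB.
have hws j : normal_connection E p (ws j) by exact: hw.
have hws' j : Lp_connection p (bundle_cocycle E) (ws j) by have [] := hws j.
have [phi phim [B0 [w0 [hB0 hw0 cBw]]]] := family_limit p2 hBs hws' bBw.
have phi_ge j : (j <= phi j)%N by elim: j => // j IH; exact: leq_ltn_trans IH (phim j).
exists (fun j => e0 (phi j)); split => [j|j||].
- exact: e0_gt0.
- by rewrite /e0 ltf_pV2 ?posrE// ltr_nat ltnS.
- apply: (cvg_dist_le (v := e0)) => [j|].
    rewrite sub0r normrN ger0_norm ?(ltW (e0_gt0 _))// /e0 lef_pV2 ?posrE// ler_nat ltnS.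
    exact: phi_ge.
  apply/cvgrPdist_le => d d0; have [N _ hN] := near_infty_natSinv_lt (PosNum d0).
  exists N => // j Nj; rewrite sub0r normrN ger0_norm ?(ltW (e0_gt0 _))//.
  exact: ltW (hN j Nj).
exists B0, w0.
have bBw' : bounded_family p (Bs \o phi) (ws \o phi).
  have [b1 b2] := bBw; split => [i a b c|i b s t] K cK KU.
    by have [C hC] := b1 i a b c K cK KU; exists C => j; exact: hC.
  by have [C hC] := b2 i b s t K cK KU; exists C => j; exact: hC.
have [mc gc] := gcr_limit (B := Bs \o phi) (w := ws \o phi) p2 hg hGamma
  (fun j => hBs (phi j)) (fun j => hws (phi j)) bBw' (fun j => gcr _ (e0_gt0 (phi j))) hB0 hw0 cBw.
by split.
Qed.
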